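(* Let $a,b\in\mathbb{C}$ with $ab\in\mathbb{R}$. Then $H(a,b)$ is a spectral operator if and only if it is self-adjoint.
   Context: For $a,b\in\mathbb{C}$, $H(a,b)$ is the operator generated in $L_2(-\infty,\infty)$ by $l(y)=-y''+q(x)y$ with $q(x)=ae^{-i2\pi x}+be^{i2\pi x}$. For $t\in(-\pi,\pi]$, $H_t(a,b)$ is the operator generated in $L_2[0,1]$ by the same expression and the boundary conditions $y(1)=e^{it}y(0)$, $y'(1)=e^{it}y'(0)$. Its eigenvalues are the roots (counted with multiplicity) of $F(\lambda)=2\cos t$, where $F(\lambda)=\varphi'(1,\lambda)+\theta(1,\lambda)$ and $\varphi,\theta$ are the solutions of $l(y)=\lambda y$ with $\theta(0,\lambda)=\varphi'(0,\lambda)=1$, $\theta'(0,\lambda)=\varphi(0,\lambda)=0$. The eigenvalues (with multiplicity) of $H_t(a,b)$ are numbered by $n\in\mathbb{Z}$ as $\lambda_n(t)$ so that each $\lambda_n(\cdot)$ is continuous on $(-\pi,\pi]$ and $|\lambda_{\pm n}(t)|\to\infty$ as $n\to\infty$. Let $A_n$ be the (at most finite) set of $t\in(-\pi,\pi]$ for which $\lambda_n(t)$ is not a simple eigenvalue. For $t\in(-\pi,\pi]\setminus A_n$ let $\Psi_{n,t}$ be a normalized eigenfunction of $H_t(a,b)$ for $\lambda_n(t)$, $\Psi^*_{n,t}$ a normalized eigenfunction of the adjoint $(H_t(a,b))^*$ for $\overline{\lambda_n(t)}$, and $d_n(t)=(\Psi_{n,t},\Psi^*_{n,t})$ with $(\cdot,\cdot)$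 the inner product of $L_2[0,1]$. $H(a,b)$ is called a spectral operator if there exists $c_1>0$ such that $|d_n(t)|^{-1}<c_1$ for all $n\in\mathbb{Z}$ and all $t\in(-\pi,\pi]\setminus A_n$. *)

(* Defs.v *)
(* Derivatives in a real variable and integrals of functions R -> R[i] are     *)
(* taken on real and imaginary parts; complex derivatives and limits use the   *)
(* numFieldType structure of R[i].                                             *)
From mathcomp Require Import all_boot all_order all_algebra.
From mathcomp Require Import all_classical all_reals all_analysis.
From mathcomp Require Export complex.

Set Implicit Arguments.
Unset Strict Implicit.
Unset Printing Implicit Defensive.

Import Order.TTheory GRing.Theory Num.Theory numFieldNormedType.Exports.

Local Open Scope classical_set_scope.
Local Open Scope ring_scope.
Local Open Scope complex_scope.

(* Re and Im of numfield.v live in the algebraically closed type itself. *)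
Local Notation Re := (@complex.Re _).
Local Notation Im := (@complex.Im _).

Definition cmod (R : realType) (z : R[i]) : R := ComplexField.Normc.normc z.

Definition expi (R : realType) (t : R) : R[i] := cos t +i* sin t.

Definition potential (R : realType) (a b : R[i]) (x : R) : R[i] :=
  a * expi (- (2 * pi * x)) + b * expi (2 * pi * x).

Section Calculus.
Variable R : realType.
Implicit Types (D : set R) (y f g u p : R -> R[i]).

Definition cderivable y : Prop :=
  forall x, derivable (Re \o y) x 1 /\ derivable (Im \o y) x 1.

Definition cderive y : R -> R[i] :=
  fun x => derive1 (Re \o y) x +i* derive1 (Im \o y) x.

Definition cintegrable D f : Prop :=
  lebesgue_measure.-integrable D (EFin \o (Re \o f)) /\
  lebesgue_measure.-integrable D (EFin \o (Im \o f)).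

Definition cintegral D f : R[i] :=
  Rintegral lebesgue_measure D (Re \o f)
  +i* Rintegral lebesgue_measure D (Im \o f).

Definition aeeq D f g : Prop :=
  {ae lebesgue_measure, forall x, D x -> f x = g x}.

Definition L2 D f : Prop :=
  [/\ measurable_fun D (Re \o f), measurable_fun D (Im \o f)
    & (\int[lebesgue_measure]_(x in D) ((cmod (f x)) ^+ 2)%:E < +oo)%E].

Definition inner D f g : R[i] := cintegral D (fun x => f x * (g x)^*%C).

(* For an interval D: y is locally absolutely continuous on D, with y' = g    *)
(* almost everywhere. When g is continuous this says that y is C^1 on D with  *)
(* y' = g, one-sided at the end points contained in D.                        *)
Definition abs_cont D y g : Prop :=
  forall c d, c <= d -> `[c, d] `<=` D ->
    cintegrable `[c, d] g /\ y d - y c = cintegral `[c, d] g.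

End Calculus.

(* An operator in L_2(D) is given by its graph, a relation between square     *)
(* integrable functions that is compatible with almost everywhere equality.   *)
Section Operators.
Variables (R : realType) (D : set R).
Implicit Types (G : (R -> R[i]) -> (R -> R[i]) -> Prop) (y f z h : R -> R[i]).

Definition adjoint G z h : Prop :=
  [/\ L2 D z, L2 D h & forall y f, G y f -> inner D f z = inner D y h].

(* The graph of an operator coincides with its adjoint relation only if the   *)
(* operator is densely defined, since otherwise the latter is multivalued.    *)
Definition self_adjoint G : Prop := forall y f, G y f <-> adjoint G y f.

Definition normalized_eigenfunction G (mu : R[i]) y : Prop :=
  G y (fun x => mu * y x) /\ inner D y y = 1.

(* The operator generated by -y'' + q y on the functions y in L_2(D) such     *)
(* that y and y' are locally absolutely continuous, -y'' + q y is in L_2(D),  *)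
(* and y, y' satisfy bc. Here u is the regular representative of the class of *)
(* y, p is u' and g is u''.                                                   *)
Definition generated (q : R -> R[i])
    (bc : (R -> R[i]) -> (R -> R[i]) -> Prop) y f : Prop :=
  [/\ L2 D y, L2 D f & exists u p g : R -> R[i],
    [/\ aeeq D y u, abs_cont D u p, abs_cont D p g,
        aeeq D f (fun x => - g x + q x * u x) & bc u p]].

End Operators.

Section Hill.
Variables (R : realType) (a b : R[i]).

Definition Hill : (R -> R[i]) -> (R -> R[i]) -> Prop :=
  generated setT (potential a b) (fun _ _ => True).

Definition Hill_t (t : R) : (R -> R[i]) -> (R -> R[i]) -> Prop :=
  generated `[0, 1] (potential a b)
    (fun y y' => y 1 = expi t * y 0 /\ y' 1 = expi t * y' 0).

Definition solution (mu : R[i]) (y : R -> R[i]) : Prop :=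
  [/\ cderivable y, cderivable (cderive y)
    & forall x, - cderive (cderive y) x + potential a b x * y x = mu * y x].

Definition theta (mu : R[i]) : R -> R[i] :=
  xget (fun=> 0) [set y | [/\ solution mu y, y 0 = 1 & cderive y 0 = 0]].

Definition phi (mu : R[i]) : R -> R[i] :=
  xget (fun=> 0) [set y | [/\ solution mu y, y 0 = 0 & cderive y 0 = 1]].

Definition discriminant (mu : R[i]) : R[i] := cderive (phi mu) 1 + theta mu 1.

(* mu is a root of order m of the entire function discriminant - 2 cos t;     *)
(* m = 0 means that mu is not a root.                                         *)
Definition multiplicity (t : R) (mu : R[i]) (m : nat) : Prop :=
  let f : (R[i] : numFieldType) -> (R[i] : numFieldType) :=
    fun z => discriminant z - (2 * cos t)%:C in
  (forall k, (k < m)%N -> derive1n k f mu = 0) /\ derive1n m f mu <> 0.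

Definition eigenvalue_numbering (lam : int -> R -> R[i]) : Prop :=
  [/\ forall t, t \in `]-pi, pi] -> forall mu m,
        multiplicity t mu m <-> ([set n | lam n t = mu] #= `I_m)%card,
      forall n, {within `]-pi, pi],
        continuous (lam n : R -> (R[i] : numFieldType))}
    & forall t, t \in `]-pi, pi] ->
        (fun n : nat => cmod (lam n%:Z t)) @ \oo --> +oo /\
        (fun n : nat => cmod (lam (- n%:Z) t)) @ \oo --> +oo].

Definition exceptional (lam : int -> R -> R[i]) (n : int) : set R :=
  [set t | t \in `]-pi, pi] /\ ~ multiplicity t (lam n t) 1].

(* d <> 0 is stated because 0^-1 = 0 in the library. *)
Definition spectral_operator (lam : int -> R -> R[i]) : Prop :=
  exists2 c1 : R, 0 < c1 &
    forall (n : int) (t : R), t \in `]-pi, pi] -> ~ exceptional lam n t ->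
    forall Psi Psis : R -> R[i],
      normalized_eigenfunction `[0, 1] (Hill_t t) (lam n t) Psi ->
      normalized_eigenfunction `[0, 1] (adjoint `[0, 1] (Hill_t t))
        ((lam n t)^*) Psis ->
      let d := inner `[0, 1] Psi Psis in d <> 0 /\ (cmod d)^-1 < c1.

End Hill.

(* Main.v *)
(* For a real eigenvalue parameter l let F(l) be the discriminant and M(l) the
   monodromy matrix, F = tr M. The derivative of F at l is minus the integral of
   m12 theta^2 + (m22 - m11) theta phi - m21 phi^2, so it vanishes when M is scalar.

   The flow (a, b) -> (e^-t a, e^t b) does not change F: the t-derivative of q is a
   multiple of q', and the integral of q' against products of solutions over a period
   vanishes. So for real ab <> 0 one may assume |a| = |b|, where q is real (ab > 0) or
   satisfies q(x + 1/2) = conj q(x) (ab < 0), and for ab = 0 one may replace q by 0. Thus F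
   is real on the real line, F >= -2 if ab <= 0, and F(w^2) = 2 cos w + O(1/w).

   If b = conj a, the fibre at t has a simple eigenvalue with a nonscalar monodromy
   matrix, so the adjoint eigenfunction is a multiple of the eigenfunction and |d| = 1;
   H is self-adjoint because weak solutions are regular and boundary terms vanish at
   infinity. Conversely, testing a self-adjoint H on bump functions shows that q is
   real, that is, b = conj a.

   Suppose H is spectral and b <> conj a. At a simple eigenvalue inside a band the bound
   on 1/|d| bounds the off-scalar part of M by a multiple of F', so M is scalar at every
   zero l of F' that is a limit of such points. For ab <> 0 the matrix M(l) is never -1
   (Ince): the Casoratian of the Fourier coefficients of theta and phi vanishes. So the
   minima of F between consecutive large maxima have F < -2. Then ab > 0 and |a| <> |b|,
   and the band edge F = -2 carries a simple antiperiodic eigenfunction f, for which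
   d is the integral of f^2 over that of |f|^2. Its Fourier coefficients satisfy
   |c(-j-1)| = s^(2j+1) |c(j)| with s^2 = |a|/|b| <> 1, which forces d = O(1/l). When
   ab = 0 the double point l = pi^2 gives the contradiction directly. *)
Require Import Defs.
From mathcomp Require Import all_boot all_order all_algebra.
From mathcomp Require Import all_classical all_reals all_analysis.
From mathcomp Require Import complex.
From mathcomp Require Import measurable_realfun ring lra.
Local Open Scope classical_set_scope.
Local Open Scope ring_scope.
Set Implicit Arguments.
Unset Strict Implicit.
Unset Printing Implicit Defensive.
Import Order.TTheory GRing.Theory Num.Theory numFieldNormedType.Exports.
Local Notation Re := (@complex.Re _).
Local Notation Im := (@complex.Im _).
Local Notation mu := lebesgue_measure.
Local Open Scope complex_scope.

(** * Calculus of complex functions of a real variable *)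

(** The definition of spectrality is silent at multiple eigenvalues, which is where its failure
    shows, so what is said about a double point is a limit. For Floquet solutions y, z with
    reciprocal multipliers, |d| is the modulus of the integral of y z over the norms. The identity
    linking that integral to F' and the one linking products of Cauchy data to the off-scalar
    entries of M contain the same factor, degenerate at the double point; it cancels in the
    quotient, and the estimate survives up to the limit. At an edge with F' <> 0 this limit yields
    nothing, and only an explicit decay of d at high energy contradicts the bound. Dependence on the
    parameter is handled without holomorphy: an exact formula for the difference of the traces of
    two equations gives first order expansions with quadratic remainder. Analyticity of F is
    replaced by the numbering, which makes the real roots of F = 2 cos t countable, so that F is
    constant on no interval inside a band. Operators are graphs on classes of functions, so elements
    of adjoints are a priori only square integrable; their regularity is a second order du
    Bois-Reymond argument. *)

Section RealCalculus.
Variable R : realType.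
Implicit Types (f g : R -> R) (x y c d : R).

Lemma deriv_continuous f f' : (forall x, is_derive x 1 f (f' x)) -> continuous f.
Proof.
by move=> df x; apply/differentiable_continuous/derivable1_diffP; case: (df x).
Qed.

Lemma is_derive_mulr f g (f' g' x : R) : is_derive x 1 f f' -> is_derive x 1 g g' ->
  is_derive x 1 (fun x => f x * g x) (f' * g x + f x * g').
Proof.
move=> df dg; apply: (is_derive_eq (is_deriveM df dg)).
by rewrite /GRing.scale /= addrC (mulrC (g x)).
Qed.

Lemma is_derive_addr f g (f' g' x : R) : is_derive x 1 f f' -> is_derive x 1 g g' ->
  is_derive x 1 (fun x => f x + g x) (f' + g').
Proof. by move=> df dg; exact: (is_deriveD df dg). Qed.

Lemma is_derive_subr f g (f' g' x : R) : is_derive x 1 f f' -> is_derive x 1 g g' ->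
  is_derive x 1 (fun x => f x - g x) (f' - g').
Proof. by move=> df dg; exact: (is_deriveB df dg). Qed.

Lemma is_derive_oppr f (f' x : R) : is_derive x 1 f f' ->
  is_derive x 1 (fun x => - f x) (- f').
Proof. by move=> df; exact: (is_deriveN df). Qed.

Lemma is_derive_affine_comp f (f' c d x : R) : is_derive (c * x + d) 1 f f' ->
  is_derive x 1 (fun x => f (c * x + d)) (c * f').
Proof.
move=> df.
have da : is_derive x 1 (fun x => c * x + d) c.
  by apply: is_derive_eq; rewrite addr0 /GRing.scale /= mulr1.
have H := @is_derive1_comp _ f (fun x => c * x + d) x _ _ df da; apply: (is_derive_eq H); exact: mulrC.
Qed.

Lemma nondecreasing_of_deriv f f' c d : c <= d ->
    (forall x, is_derive x 1 f (f' x)) ->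
    (forall x, c < x -> x < d -> 0 <= f' x) -> f c <= f d.
Proof.
rewrite le_eqVlt => /predU1P[-> //|cd] df f0; rewrite -subr_ge0.
have [|e] := MVT cd (fun x _ => df x); first exact/continuous_subspaceT/(deriv_continuous df).
by rewrite in_itv /= => /andP[ce ed] ->; rewrite mulr_ge0 ?f0 // subr_ge0 ltW.
Qed.

Lemma le_increment f g f' g' c d : c <= d ->
    (forall x, is_derive x 1 f (f' x)) -> (forall x, is_derive x 1 g (g' x)) ->
    (forall x, c < x -> x < d -> f' x <= g' x) -> f d - f c <= g d - g c.
Proof.
move=> cd df dg fg.
have := @nondecreasing_of_deriv (fun x => g x - f x) (fun x => g' x - f' x) c d cd
  (fun x => is_derive_subr (dg x) (df x)).
move=> H; have /H : forall x, c < x -> x < d -> 0 <= g' x - f' x.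
  by move=> x cx xd; rewrite subr_ge0 fg.
lra.
Qed.

Lemma integrable_continuous f c d : continuous f ->
  (mu : measure _ R).-integrable `[c, d] (EFin \o f).
Proof.
move=> cf; apply: continuous_compact_integrable; first exact: segment_compact.
exact: continuous_subspaceT.
Qed.

Lemma Rintegral_deriv f f' c d : c <= d -> (forall x, is_derive x 1 f (f' x)) ->
  continuous f' -> \int[mu]_(x in `[c, d]) f' x = f d - f c.
Proof.
rewrite le_eqVlt => /predU1P[<-|cd] df cf.
  by rewrite set_itv1 Rintegral_set1 subrr.
have cF := deriv_continuous df.
rewrite /Rintegral (@continuous_FTC2 _ f' f c d cd) //.
- exact: continuous_subspaceT.
- split.
  + by move=> x _; case: (df x).
  + exact/cvg_at_right_filter/cF.
  + exact/cvg_at_left_filter/cF.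
- by move=> x _; rewrite derive1E; exact: (@derive_val _ _ _ _ _ _ _ (df x)).
Qed.

(** The integral from a base point is differentiated to the right of that point. A base moving with
    [x], to the left of both [x] and 0, covers the whole line, and additivity of the integral shows
    that [F] does not depend on it. *)
Lemma primitive_exists f : continuous f ->
  exists F, F 0 = 0 /\ forall x, is_derive x 1 F (f x).
Proof.
move=> cf.
pose G N x := \int[mu]_(t in `[N, x]) f t.
have GP N x : N < x -> is_derive x 1 (G N) (f x).
  move=> Nx; have x1 : x < x + 1 by rewrite ltrDl.
  have [] := @continuous_FTC1_closed R f N x (x + 1) x1 (integrable_continuous _ _ cf) Nx (cf x).
  by move=> dG e; split; [exact: dG|rewrite -derive1E; exact: e].
have Gadd N N' x : N <= N' -> N' <= x -> G N x = G N N' + G N' x.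
  move=> NN N'x; rewrite /G.
  have iN : (mu : measure _ R).-integrable [set` Interval (BLeft N) (BRight x)] (EFin \o f).
    exact: integrable_continuous.
  have := @Rintegral_itvB R f (BLeft N) (BRight x) N' iN.
  rewrite !bnd_simp => /(_ NN N'x) e.
  rewrite Rintegral_itv_obnd_cbnd in e; last first.
    apply: integrableS (integrable_continuous N' x cf) => //.
    exact: subset_itv_oc_cc.
  by rewrite -e; lra.
pose F x := G (Order.min x 0 - 1) x - G (Order.min x 0 - 1) 0.
have FE N x : N < x -> N < 0 -> F x = G N x - G N 0.
  move=> Nx N0; rewrite /F; set m := Order.min x 0 - 1.
  have mx : m < x by rewrite /m; case: (leP x 0); lra.
  have m0 : m < 0 by rewrite /m; case: (leP x 0); lra.
  have [mN|/ltW Nm] := leP m N.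
    by rewrite (Gadd m N x mN (ltW Nx)) (Gadd m N 0 mN (ltW N0)); ring.
  by rewrite (Gadd N m x Nm (ltW mx)) (Gadd N m 0 Nm (ltW m0)); ring.
exists F; split; first by rewrite /F subrr.
move=> x; pose N := Order.min x 0 - 1.
have Nx : N < x by rewrite /N; case: (leP x 0); lra.
have N0 : N < 0 by rewrite /N; case: (leP x 0); lra.
have dG : is_derive x 1 (fun y => G N y - G N 0) (f x).
  by apply: is_derive_eq (is_derive_subr (GP N x Nx) (is_derive_cst _ _ _)) _; rewrite subr0.
apply: (near_eq_is_derive _ dG).
near=> y; rewrite (FE N) //.
by near: y; exact: lt_nbhsr.
Unshelve. all: by end_near. Qed.

End RealCalculus.

Section ComplexModulus.
Variable R : realType.
Implicit Types (z w : R[i]) (x : R).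

Lemma cReD z w : Re (z + w) = Re z + Re w. Proof. by case: z w => [? ?] []. Qed.
Lemma cImD z w : Im (z + w) = Im z + Im w. Proof. by case: z w => [? ?] []. Qed.
Lemma cReN z : Re (- z) = - Re z. Proof. by case: z. Qed.
Lemma cImN z : Im (- z) = - Im z. Proof. by case: z. Qed.
Lemma cReB z w : Re (z - w) = Re z - Re w. Proof. by rewrite cReD cReN. Qed.
Lemma cImB z w : Im (z - w) = Im z - Im w. Proof. by rewrite cImD cImN. Qed.
Lemma cReM z w : Re (z * w) = Re z * Re w - Im z * Im w.
Proof. by case: z w => [? ?] []. Qed.
Lemma cImM z w : Im (z * w) = Re z * Im w + Im z * Re w.
Proof. by case: z w => [? ?] []. Qed.
Lemma cReJ z : Re z^*%C = Re z. Proof. by case: z. Qed.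
Lemma cImJ z : Im z^*%C = - Im z. Proof. by case: z. Qed.
Lemma conjcD z w : (z + w)^*%C = z^*%C + w^*%C.
Proof. exact: rmorphD. Qed.
Lemma conjcN z : (- z)^*%C = - z^*%C.
Proof. exact: rmorphN. Qed.
Lemma conjcB z w : (z - w)^*%C = z^*%C - w^*%C.
Proof. exact: rmorphB. Qed.
Lemma conjcM z w : (z * w)^*%C = z^*%C * w^*%C.
Proof. exact: rmorphM. Qed.
Definition cReImE := (cReD, cImD, cReN, cImN, cReM, cImM, cReJ, cImJ).

Lemma complex_ext z w : Re z = Re w -> Im z = Im w -> z = w.
Proof. by case: z w => [? ?] [? ?] /= -> ->. Qed.

Lemma cmod_sqr z : cmod z ^+ 2 = Re z ^+ 2 + Im z ^+ 2.
Proof. by case: z => u v; rewrite /cmod /= sqr_sqrtr // addr_ge0 ?sqr_ge0. Qed.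

Lemma cmod_ge0 z : 0 <= cmod z. Proof. by case: z => u v; exact: sqrtr_ge0. Qed.
Hint Resolve cmod_ge0 : core.

Lemma cmod0 : cmod (0 : R[i]) = 0.
Proof. exact: ComplexField.Normc.normc0. Qed.
Lemma cmod1 : cmod (1 : R[i]) = 1.
Proof. exact: ComplexField.Normc.normc1. Qed.
Lemma cmodM z w : cmod (z * w) = cmod z * cmod w.
Proof. exact: ComplexField.Normc.normcM. Qed.
Lemma cmodV z : cmod z^-1 = (cmod z)^-1.
Proof. exact: ComplexField.Normc.normcV. Qed.
Lemma cmodD z w : cmod (z + w) <= cmod z + cmod w.
Proof. exact: (@le_normcD R). Qed.
Lemma cmodN z : cmod (- z) = cmod z.
Proof. exact: (@normcN R). Qed.
Lemma cmodB z w : cmod (z - w) <= cmod z + cmod w.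
Proof. by rewrite -(cmodN w) cmodD. Qed.
Lemma cmodBC z w : cmod (z - w) = cmod (w - z).
Proof. by rewrite -cmodN opprB. Qed.
Lemma cmod_eq0 z : (cmod z == 0) = (z == 0).
Proof.
apply/eqP/eqP => [|->]; last exact: cmod0.
exact: ComplexField.Normc.eq0_normc.
Qed.
Lemma cmod_gt0 z : (0 < cmod z) = (z != 0).
Proof. by rewrite lt_def cmod_eq0 cmod_ge0 andbT. Qed.
Lemma cmodX z n : cmod (z ^+ n) = cmod z ^+ n.
Proof. by elim: n => [|n IH]; rewrite ?expr0 ?cmod1 // !exprS cmodM IH. Qed.

Lemma cmodJ z : cmod z^*%C = cmod z.
Proof. by case: z => u v; rewrite /cmod /= sqrrN. Qed.
Lemma cmod_real x : cmod x%:C = `|x|.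
Proof. by rewrite /cmod /= expr0n addr0 sqrtr_sqr. Qed.
Lemma normr_complexE z : `|z| = (cmod z)%:C. Proof. by []. Qed.

Lemma mulcJ z : z * z^*%C = (cmod z ^+ 2)%:C.
Proof. by rewrite cmod_sqr; case: z => u v; apply: complex_ext => /=; ring. Qed.

Lemma ler_Re_cmod z : `|Re z| <= cmod z.
Proof.
by rewrite -(@ler_pXn2r _ 2) ?nnegrE // real_normK ?num_real // cmod_sqr lerDl sqr_ge0.
Qed.
Lemma ler_Im_cmod z : `|Im z| <= cmod z.
Proof.
by rewrite -(@ler_pXn2r _ 2) ?nnegrE // real_normK ?num_real // cmod_sqr lerDr sqr_ge0.
Qed.
Lemma cmod_le_ReIm z : cmod z <= `|Re z| + `|Im z|.
Proof.
rewrite -(@ler_pXn2r _ 2) ?nnegrE ?addr_ge0 // cmod_sqr sqrrD !real_normK ?num_real //.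
by rewrite -addrA lerD2l lerDr mulrn_wge0 // mulr_ge0.
Qed.
Lemma cmod_sub_le z w : cmod z - cmod w <= cmod (z - w).
Proof. by rewrite lerBlDr (le_trans _ (cmodD _ _)) // subrK. Qed.

Lemma ReE_real z : Im z = 0 -> z = (Re z)%:C.
Proof. by case: z => u v /= ->. Qed.
Lemma realCM x y : (x * y)%:C = x%:C * y%:C. Proof. exact: rmorphM. Qed.

Lemma cmod_expi x : cmod (expi x) = 1.
Proof. by rewrite /cmod /= cos2Dsin2 sqrtr1. Qed.
Lemma expi0 : expi (0 : R) = 1.
Proof. by rewrite /expi cos0 sin0. Qed.
Lemma expiD x y : expi (x + y) = expi x * expi y.
Proof. by rewrite /expi cosD sinD; apply: complex_ext => /=; ring. Qed.
Lemma expiN x : expi (- x) = (expi x)^*%C.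
Proof. by rewrite /expi cosN sinN. Qed.
Lemma expiNK x : expi (- x) * expi x = 1.
Proof. by rewrite -expiD addNr expi0. Qed.
Lemma expi_pi : expi (pi : R) = -1.
Proof. by rewrite /expi cospi sinpi; apply: complex_ext => /=; rewrite ?oppr0. Qed.

End ComplexModulus.
#[export] Hint Extern 0 (is_true (_ <= cmod _)) => solve [apply: cmod_ge0] : core.

Section ComplexCalculus.
Variable R : realType.
Implicit Types (f g h : R -> R[i]) (x c d : R) (k : R[i]).

(** A relation with an explicit candidate derivative: the rules below build that candidate by
    composition, and [cder_ext] normalizes it. *)
Definition cder f f' := forall x : R,
  is_derive x 1 (Re \o f) (Re (f' x)) /\ is_derive x 1 (Im \o f) (Im (f' x)).

Definition ccont f := continuous (Re \o f) /\ continuous (Im \o f).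

Lemma cder_ccont f f' : cder f f' -> ccont f.
Proof.
move=> df; split.
- by apply: (@deriv_continuous _ _ (fun x => Re (f' x))) => x; case: (df x).
- by apply: (@deriv_continuous _ _ (fun x => Im (f' x))) => x; case: (df x).
Qed.

Lemma cder_ext f f' g g' : f =1 g -> f' =1 g' -> cder f f' -> cder g g'.
Proof. by move=> /funext -> /funext ->. Qed.

Lemma cder_cst k : cder (fun=> k) (fun=> 0).
Proof. by move=> x; split; exact: is_derive_cst. Qed.

Lemma cderD f f' g g' : cder f f' -> cder g g' ->
  cder (fun x => f x + g x) (fun x => f' x + g' x).
Proof.
move=> df dg x; have [df1 df2] := df x; have [dg1 dg2] := dg x.
rewrite (_ : Re \o _ = fun x => Re (f x) + Re (g x)); last by apply/funext => y; rewrite /= cReD.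
rewrite (_ : Im \o _ = fun x => Im (f x) + Im (g x)); last by apply/funext => y; rewrite /= cImD.
by rewrite cReD cImD; split; exact: is_derive_addr.
Qed.

Lemma cderM f f' g g' : cder f f' -> cder g g' ->
  cder (fun x => f x * g x) (fun x => f' x * g x + f x * g' x).
Proof.
move=> df dg x; have [df1 df2] := df x; have [dg1 dg2] := dg x; split.
- rewrite (_ : Re \o _ = fun x => Re (f x) * Re (g x) - Im (f x) * Im (g x)); last first.
    by apply/funext => y; rewrite /= cReM.
  have H := is_derive_subr (is_derive_mulr df1 dg1) (is_derive_mulr df2 dg2).
  by apply: (is_derive_eq H); rewrite !cReImE /=; ring.
- rewrite (_ : Im \o _ = fun x => Re (f x) * Im (g x) + Im (f x) * Re (g x)); last first.
    by apply/funext => y; rewrite /= cImM.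
  have H := is_derive_addr (is_derive_mulr df1 dg2) (is_derive_mulr df2 dg1).
  by apply: (is_derive_eq H); rewrite !cReImE /=; ring.
Qed.

Lemma cderZ k f f' : cder f f' -> cder (fun x => k * f x) (fun x => k * f' x).
Proof.
by move=> df; apply: cder_ext (cderM (cder_cst k) df) => // x; rewrite mul0r add0r.
Qed.

Lemma cderN f f' : cder f f' -> cder (fun x => - f x) (fun x => - f' x).
Proof. by move=> df; apply: cder_ext (cderZ (-1) df) => x; rewrite mulN1r. Qed.

Lemma cderB f f' g g' : cder f f' -> cder g g' ->
  cder (fun x => f x - g x) (fun x => f' x - g' x).
Proof. by move=> df dg; exact: cderD df (cderN dg). Qed.

Lemma cderJ f f' : cder f f' -> cder (fun x => (f x)^*%C) (fun x => (f' x)^*%C).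
Proof.
move=> df x; have [df1 df2] := df x.
rewrite (_ : Re \o _ = Re \o f); last by apply/funext => y; rewrite /= cReJ.
rewrite (_ : Im \o _ = fun x => - Im (f x)); last by apply/funext => y; rewrite /= cImJ.
by rewrite cReJ cImJ; split => //; exact: is_derive_oppr.
Qed.

Lemma cder_real (f f' : R -> R) : (forall x, is_derive x 1 f (f' x)) ->
  cder (fun x => (f x)%:C) (fun x => (f' x)%:C).
Proof. by move=> df x; split; [exact: df|exact: is_derive_cst]. Qed.

Lemma cder_affine_comp f f' (c d : R) : cder f f' ->
  cder (fun x => f (c * x + d)) (fun x => c%:C * f' (c * x + d)).
Proof.
move=> df x; have [df1 df2] := df (c * x + d); rewrite !cReImE /= !mul0r subr0 addr0.
split; first exact: (is_derive_affine_comp df1).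
exact: (is_derive_affine_comp df2).
Qed.

Lemma cder_shift f f' (d : R) : cder f f' ->
  cder (fun x => f (x + d)) (fun x => f' (x + d)).
Proof.
move=> /(cder_affine_comp 1 d); apply: cder_ext => x; first by rewrite mul1r.
by rewrite !mul1r.
Qed.

Lemma cder_expi (w : R) : cder (fun x => expi (w * x)) (fun x => (0 +i* w) * expi (w * x)).
Proof.
move=> x; rewrite !cReImE /= !mul0r sub0r add0r; split.
- have := @is_derive_affine_comp R cos _ w 0 x (is_derive_cos _).
  under eq_fun do rewrite addr0; rewrite addr0 mulrN; exact.
- have := @is_derive_affine_comp R sin _ w 0 x (is_derive_sin _).
  under eq_fun do rewrite addr0; rewrite addr0; exact.
Qed.

Lemma ccont_cst k : ccont (fun=> k).
Proof. by split; exact: cst_continuous. Qed.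

Lemma ccont_ext f g : f =1 g -> ccont f -> ccont g.
Proof. by move=> /funext ->. Qed.

Lemma ccontD f g : ccont f -> ccont g -> ccont (fun x => f x + g x).
Proof.
move=> [f1 f2] [g1 g2]; split.
- rewrite (_ : Re \o _ = (Re \o f) + (Re \o g)); last by apply/funext => y; rewrite /= cReD.
  by move=> x; apply: continuousD; [exact: f1|exact: g1].
- rewrite (_ : Im \o _ = (Im \o f) + (Im \o g)); last by apply/funext => y; rewrite /= cImD.
  by move=> x; apply: continuousD; [exact: f2|exact: g2].
Qed.

Lemma ccontM f g : ccont f -> ccont g -> ccont (fun x => f x * g x).
Proof.
move=> [f1 f2] [g1 g2]; split.
- rewrite (_ : Re \o _ = (Re \o f) * (Re \o g) - (Im \o f) * (Im \o g)); last first.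
    by apply/funext => y; rewrite /= cReM.
  by move=> x; apply: continuousB; apply: continuousM; [exact: f1|exact: g1|exact: f2|exact: g2].
- rewrite (_ : Im \o _ = (Re \o f) * (Im \o g) + (Im \o f) * (Re \o g)); last first.
    by apply/funext => y; rewrite /= cImM.
  by move=> x; apply: continuousD; apply: continuousM; [exact: f1|exact: g2|exact: f2|exact: g1].
Qed.

Lemma ccontZ k f : ccont f -> ccont (fun x => k * f x).
Proof. exact/ccontM/ccont_cst. Qed.

Lemma ccontN f : ccont f -> ccont (fun x => - f x).
Proof. by move=> cf; apply: ccont_ext (ccontZ (-1) cf) => x; rewrite mulN1r. Qed.

Lemma ccontB f g : ccont f -> ccont g -> ccont (fun x => f x - g x).
Proof. by move=> cf cg; exact: ccontD cf (ccontN cg). Qed.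

Lemma ccontJ f : ccont f -> ccont (fun x => (f x)^*%C).
Proof.
move=> [f1 f2]; split.
- by rewrite (_ : Re \o _ = Re \o f) //; apply/funext => y; rewrite /= cReJ.
- rewrite (_ : Im \o _ = - (Im \o f)); last by apply/funext => y; rewrite /= cImJ.
  by move=> x; apply: continuousN; exact: f2.
Qed.

Lemma cprimitive_exists f : ccont f -> exists F, F 0 = 0 /\ cder F f.
Proof.
move=> [/primitive_exists [F1 [F10 d1]] /primitive_exists [F2 [F20 d2]]].
exists (fun x => F1 x +i* F2 x); rewrite F10 F20; split=> [//|x].
by split; [exact: d1|exact: d2].
Qed.

End ComplexCalculus.

(** * Integrals of complex functions of a real variable *)

Section ComplexIntegral.
Variable R : realType.
Local Notation leb := (@lebesgue_measure R).
Implicit Types (D : set R) (f g h : R -> R[i]) (x c d : R) (k : R[i]).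

Lemma ccont_cintegrable f c d : ccont f -> cintegrable `[c, d] f.
Proof. by move=> [f1 f2]; split; exact: integrable_continuous. Qed.

Lemma eq_cintegral D f g : {in D, f =1 g} -> cintegral D f = cintegral D g.
Proof.
by move=> fg; rewrite /cintegral; congr (_ +i* _); apply: eq_Rintegral => x xD /=; rewrite fg.
Qed.

Lemma cintegrableD D f g : measurable (D : set (measurableTypeR R)) -> cintegrable D f -> cintegrable D g ->
  cintegrable D (fun x => f x + g x).
Proof.
move=> mD [f1 f2] [g1 g2]; split.
- have := integrableD mD f1 g1; congr integrable.
  by apply/funext => y; rewrite /= cReD.
- have := integrableD mD f2 g2; congr integrable.
  by apply/funext => y; rewrite /= cImD.
Qed.

Lemma cintegralD D f g : measurable (D : set (measurableTypeR R)) -> cintegrable D f -> cintegrable D g ->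
  cintegral D (fun x => f x + g x) = cintegral D f + cintegral D g.
Proof.
move=> mD [f1 f2] [g1 g2]; apply: complex_ext; rewrite /= ?cReImE /=.
- by rewrite -(RintegralD mD f1 g1); apply: eq_Rintegral => x _; rewrite /= cReD.
- by rewrite -(RintegralD mD f2 g2); apply: eq_Rintegral => x _; rewrite /= cImD.
Qed.

Lemma integrable_lincomb D (u v : R -> R) (s t : R) : measurable (D : set (measurableTypeR R)) ->
  leb.-integrable D (EFin \o u) -> leb.-integrable D (EFin \o v) ->
  leb.-integrable D (EFin \o (fun x => s * u x + t * v x)) /\
  \int[leb]_(x in D) (s * u x + t * v x) =
    s * \int[leb]_(x in D) u x + t * \int[leb]_(x in D) v x.
Proof.
move=> mD iu iv.
have isu : leb.-integrable D (EFin \o (fun x => s * u x)).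
  by rewrite (_ : EFin \o _ = (fun x => s%:E * (EFin \o u) x)%E) //; exact: integrableZl.
have itv : leb.-integrable D (EFin \o (fun x => t * v x)).
  by rewrite (_ : EFin \o _ = (fun x => t%:E * (EFin \o v) x)%E) //; exact: integrableZl.
split; last by rewrite RintegralD // !RintegralZl.
exact: (integrableD mD isu itv).
Qed.

Lemma cintegrableZ D k f : measurable (D : set (measurableTypeR R)) -> cintegrable D f ->
  cintegrable D (fun x => k * f x).
Proof.
move=> mD [f1 f2]; split.
- have [+ _] := integrable_lincomb (Re k) (- Im k) mD f1 f2; congr integrable.
  by apply/funext => x /=; rewrite cReM mulNr.
- have [+ _] := integrable_lincomb (Re k) (Im k) mD f2 f1; congr integrable.
  by apply/funext => x /=; rewrite cImM.
Qed.

Lemma cintegralZ D k f : measurable (D : set (measurableTypeR R)) -> cintegrable D f ->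
  cintegral D (fun x => k * f x) = k * cintegral D f.
Proof.
move=> mD [f1 f2]; apply: complex_ext; rewrite /= ?cReImE /=.
- have [_] := integrable_lincomb (Re k) (- Im k) mD f1 f2.
  by rewrite mulNr => <-; apply: eq_Rintegral => x _ /=; rewrite cReM mulNr.
- have [_] := integrable_lincomb (Re k) (Im k) mD f2 f1.
  by move=> <-; apply: eq_Rintegral => x _ /=; rewrite cImM.
Qed.

Lemma cintegrableN D f : measurable (D : set (measurableTypeR R)) -> cintegrable D f -> cintegrable D (fun x => - f x).
Proof.
move=> mD /(cintegrableZ (-1) mD); rewrite (_ : (fun x => _ * _) = fun x => - f x) //.
by apply/funext => x; rewrite mulN1r.
Qed.

Lemma cintegralN D f : measurable (D : set (measurableTypeR R)) -> cintegrable D f ->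
  cintegral D (fun x => - f x) = - cintegral D f.
Proof.
move=> mD /(cintegralZ (-1) mD); rewrite mulN1r => <-.
by apply: eq_cintegral => x _; rewrite mulN1r.
Qed.

Lemma cintegrableB D f g : measurable (D : set (measurableTypeR R)) -> cintegrable D f -> cintegrable D g ->
  cintegrable D (fun x => f x - g x).
Proof. by move=> mD cf cg; apply: cintegrableD => //; exact: cintegrableN. Qed.

Lemma cintegralB D f g : measurable (D : set (measurableTypeR R)) -> cintegrable D f -> cintegrable D g ->
  cintegral D (fun x => f x - g x) = cintegral D f - cintegral D g.
Proof. by move=> mD cf cg; rewrite cintegralD ?cintegralN //; exact: cintegrableN. Qed.

Lemma cintegrableJ D f : measurable (D : set (measurableTypeR R)) -> cintegrable D f -> cintegrable D (fun x => (f x)^*%C).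
Proof.
move=> mD [f1 f2]; split.
- by move: f1; congr integrable; apply/funext => x /=; rewrite cReJ.
- have [+ _] := integrable_lincomb (-1) 0 mD f2 f1; congr integrable.
  by apply/funext => x /=; rewrite cImJ; congr (_%:E); ring.
Qed.

Lemma cintegralJ D f : measurable (D : set (measurableTypeR R)) -> cintegrable D f ->
  cintegral D (fun x => (f x)^*%C) = (cintegral D f)^*%C.
Proof.
move=> mD [f1 f2]; apply: complex_ext; rewrite /= ?cReImE /=.
- by apply: eq_Rintegral => x _ /=; rewrite cReJ.
- have [_] := integrable_lincomb (-1) 0 mD f2 f1.
  rewrite mul0r addr0 mulN1r => <-.
  by apply: eq_Rintegral => x _ /=; rewrite cImJ; ring.
Qed.

Lemma cintegral_deriv f f' c d : c <= d -> cder f f' -> ccont f' ->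
  cintegral `[c, d] f' = f d - f c.
Proof.
move=> cd df [f1 f2]; apply: complex_ext; rewrite /= ?cReB ?cImB /=.
- exact: (Rintegral_deriv cd (fun x => proj1 (df x)) f1).
- exact: (Rintegral_deriv cd (fun x => proj2 (df x)) f2).
Qed.

(** Multiplication by the conjugate of the integral [z] turns |z|^2 into the real part of an
    integral; the constant is then 1, whereas separate estimates of the two parts would cost a
    factor. *)
Lemma cmod_cintegral_le D f (u : R -> R) : measurable (D : set (measurableTypeR R)) -> cintegrable D f ->
  leb.-integrable D (EFin \o u) -> (forall x, D x -> cmod (f x) <= u x) ->
  cmod (cintegral D f) <= \int[leb]_(x in D) u x.
Proof.
move=> mD cf iu fu; set z := cintegral D f.
have [z0|z0] := eqVneq z 0.
  by rewrite z0 cmod0; apply: Rintegral_ge0 => x /fu; exact/le_trans/cmod_ge0.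
have zp : 0 < cmod z by rewrite cmod_gt0.
rewrite -(ler_pM2l zp) -RintegralZl //.
have -> : cmod z * cmod z = Re (cintegral D (fun x => z^*%C * f x)).
  by rewrite cintegralZ // -/z (mulrC _ z) mulcJ /= expr2.
have [f1 _] := cintegrableZ (z^*)%C mD cf.
apply: le_Rintegral => //.
  rewrite (_ : EFin \o _ = (fun x => (cmod z)%:E * (EFin \o u) x)%E) //; exact: integrableZl.
move=> x Dx; apply: le_trans (ler_norm _) _; apply: le_trans (ler_Re_cmod _) _.
by rewrite cmodM cmodJ ler_pM2l // fu.
Qed.

Lemma cmod_cintegral_le_cst f c d (B : R) : c <= d -> ccont f ->
  (forall x, c <= x -> x <= d -> cmod (f x) <= B) ->
  cmod (cintegral `[c, d] f) <= B * (d - c).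
Proof.
move=> cd cf fB; have := @cmod_cintegral_le `[c, d] f (fun=> B) _ (ccont_cintegrable _ _ cf).
rewrite Rintegral_cst //= lebesgue_measure_itv /= lte_fin.
have -> : fine (if c < d then (d%:E - c%:E)%E else 0%E) = d - c.
  by case: ifP => //= /negbT; rewrite -leNgt => dc; lra.
apply => //; first exact/integrable_continuous/cst_continuous.
by move=> x /=; rewrite in_itv /= => /andP[]; exact: fB.
Qed.

End ComplexIntegral.

(** * Linear differential equations *)

Section Picard.
Variable R : realType.
Implicit Types (x : R).

(** Many equalities below are proved in this form: the distance of the two sides is shown to be at
    most a constant times 2^-n for all n. *)
Lemma le0_geometric (z c : R) : (forall n, z <= c * 2^-1 ^+ n) -> z <= 0.
Proof.
move=> zc; apply/ler_addgt0Pr => e e0; rewrite add0r.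
have : (c * 2^-1 ^+ n) @[n --> \oo] --> (0 : R).
  rewrite -(mulr0 c); apply: cvgMr; apply: cvg_expr.
  by rewrite ger0_norm ?invr_ge0 ?ler0n // invf_lt1 ?ltr0n // ltr1n.
move=> /cvgr_lt /(_ _ e0) [N _ H]; exact: le_trans (zc N) (ltW (H N (leqnn _))).
Qed.

(** [2 * c * 2^-1 ^+ n] is the tail of the geometric series, so [v] increases, [w] decreases, and
    the supremum of [v] lies between them. *)
Lemma geometric_limit (u : nat -> R) (c : R) :
  (forall n, `|u n.+1 - u n| <= c * 2^-1 ^+ n) ->
  exists l, forall n, `|u n - l| <= 2 * c * 2^-1 ^+ n.
Proof.
move=> uc.
pose v n := u n - 2 * c * 2^-1 ^+ n; pose w n := u n + 2 * c * 2^-1 ^+ n.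
have half n : 2 * c * 2^-1 ^+ n.+1 = c * 2^-1 ^+ n by rewrite exprS; field.
have vS n : v n <= v n.+1.
  rewrite /v half; have := uc n; rewrite ler_norml => /andP[+ _].
  by move: (2^-1 ^+ n) => t; lra.
have wS n : w n.+1 <= w n.
  rewrite /w half; have := uc n; rewrite ler_norml => /andP[_].
  by move: (2^-1 ^+ n) => t; lra.
have vm : {homo v : m n / (m <= n)%N >-> m <= n} by apply: homo_leq le_trans vS.
have wm : {homo w : m n / (m <= n)%N >-> n <= m}.
  by apply: (@homo_leq _ _ (fun a b => b <= a)) => // a b d ab bd; exact: le_trans bd ab.
have c0 n : 0 <= c * 2^-1 ^+ n by apply: le_trans (uc n).
have vw m n : v m <= w n.
  apply: le_trans (vm _ _ (leq_maxl m n)) _; apply: le_trans (wm _ _ (leq_maxr m n)).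
  by rewrite /v /w; have := c0 (maxn m n); move: (2^-1 ^+ _) => t; lra.
have hs : has_sup (range v).
  by split; [exists (v 0%N); exists 0%N | exists (w 0%N) => _ [m _ <-]].
exists (sup (range v)) => n.
have h1 : v n <= sup (range v) by apply: ub_le_sup; [case: hs|exists n].
have h2 : sup (range v) <= w n.
  by apply: ge_sup; [case: hs|move=> _ [m _ <-]].
by rewrite ler_norml; move: h1 h2; rewrite /v /w; move: (2^-1 ^+ n) => t; lra.
Qed.

(** The rate is uniform only up to the continuous weight [V], that is, locally uniform; this is what
    an iteration on the whole line supplies. *)
Lemma continuous_uniform_limit (f : R -> R) (fn : nat -> R -> R) (V : R -> R) :
  (forall n, continuous (fn n)) -> continuous V ->
  (forall n x, `|fn n x - f x| <= 2^-1 ^+ n * V x) -> continuous f.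
Proof.
move=> cfn cV H x; apply/cvgrPdist_lt => e e0.
have e3 : 0 < e / 3 by lra.
have V0 z : 0 <= V z by have := H 0%N z; rewrite expr0 mul1r; exact: le_trans.
have [n Hn] : exists n, 2^-1 ^+ n * (V x + 1) < e / 3.
  have : (2^-1 ^+ n * (V x + 1)) @[n --> \oo] --> (0 : R).
    rewrite -(mul0r (V x + 1)); apply: cvgMl; apply: cvg_expr.
    by rewrite ger0_norm ?invr_ge0 ?ler0n // invf_lt1 ?ltr0n // ltr1n.
  by move=> /cvgr_lt /(_ _ e3) [N _ HN]; exists N; exact: (HN N (leqnn _)).
have near1 : \forall t \near x, `|fn n x - fn n t| < e / 3.
  by have /cvgrPdist_lt /(_ _ e3) := cfn n x.
have near2 : \forall t \near x, V t < V x + 1.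
  have := cV x; move=> /cvgr_lt /(_ (V x + 1)); apply; lra.
near=> t.
have a1 : `|fn n x - fn n t| < e / 3 by near: t.
have a2 : V t < V x + 1 by near: t.
have p0 : 0 <= 2^-1 ^+ n :> R by rewrite exprn_ge0 // invr_ge0.
have b1 := H n x; have b2 := H n t.
have b3 : 2^-1 ^+ n * V x <= 2^-1 ^+ n * (V x + 1) by rewrite ler_wpM2l //; lra.
have b4 : 2^-1 ^+ n * V t <= 2^-1 ^+ n * (V x + 1) by rewrite ler_wpM2l //; lra.
rewrite (_ : f x - f t = (fn n x - fn n t) - (fn n x - f x) + (fn n t - f t)); last by ring.
apply: le_lt_trans (ler_normD _ _) _; apply: le_lt_trans (lerD (ler_normB _ _) (lexx _)) _.
lra.
Unshelve. all: by end_near. Qed.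

(* The Picard iteration contracts in the norm weighted by this function, globally on the line. *)
Definition weight (L x : R) : R := expR (L * x) + expR (- L * x).

Lemma is_derive_expRZ (L x : R) : is_derive x 1 (fun x => expR (L * x)) (L * expR (L * x)).
Proof.
have := @is_derive_affine_comp R expR _ L 0 x (is_derive_expR _).
under eq_fun do rewrite addr0; rewrite addr0; exact.
Qed.

Lemma weight_continuous L : continuous (weight L).
Proof.
apply: (@deriv_continuous _ _ (fun x => L * expR (L * x) + - L * expR (- L * x))) => x.
by apply: is_derive_addr; exact: is_derive_expRZ.
Qed.

Lemma weight_ge1 L x : 1 <= weight L x.
Proof.
have h1 := expR_ge1Dx (L * x); have h2 := expR_ge1Dx (- L * x).
by rewrite /weight; move: h1 h2; rewrite mulNr; lra.
Qed.

(** Comparison with [h], whose derivative is exactly [B * weight L]. The odd combination of the two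
    exponentials vanishes at 0, so one function serves on both half-lines. *)
Lemma primitive_le_weight (g g' : R -> R) (B L : R) : 0 < L -> g 0 = 0 ->
  (forall x, is_derive x 1 g (g' x)) -> (forall x, `|g' x| <= B * weight L x) ->
  forall x, `|g x| <= B / L * weight L x.
Proof.
move=> L0 g0 dg g'B x; have L1 : L != 0 by rewrite gt_eqF.
have BL : 0 <= B / L.
  rewrite divr_ge0 ?(ltW L0) //; have := le_trans (normr_ge0 _) (g'B 0).
  by rewrite pmulr_lge0 // (lt_le_trans ltr01) // weight_ge1.
pose h x := B / L * (expR (L * x) - expR (- L * x)).
have dh (z : R) : is_derive z 1 h (B * weight L z).
  have dc : is_derive z (1 : R) (fun=> B / L) 0 by exact: is_derive_cst.
  have H := is_derive_mulr dc
    (is_derive_subr (is_derive_expRZ L z) (is_derive_expRZ (- L) z)).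
  by apply: (is_derive_eq H); rewrite /weight; field.
have h0 : h 0 = 0 by rewrite /h !mulr0 subrr mulr0.
have hW z : `|h z| <= B / L * weight L z.
  rewrite /h normrM (ger0_norm BL) ler_wpM2l // /weight.
  rewrite ler_norml; have := expR_gt0 (L * z); have := expR_gt0 (- L * z); lra.
have dgN (z : R) : is_derive z 1 (fun z => - g z) (- g' z) by exact: is_derive_oppr.
have up z : g' z <= B * weight L z by apply: le_trans (ler_norm _) (g'B z).
have dn z : - g' z <= B * weight L z by apply: le_trans (g'B z); rewrite -normrN ler_norm.
apply: le_trans (hW x); have [x0|/ltW x0] := leP 0 x.
  have := le_increment x0 dg dh (fun z _ _ => up z).
  have := le_increment x0 dgN dh (fun z _ _ => dn z).
  rewrite g0 h0 => a1 a2; have a3 := ler_norm (h x).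
  by rewrite ler_norml; lra.
have := le_increment x0 dg dh (fun z _ _ => up z).
have := le_increment x0 dgN dh (fun z _ _ => dn z).
rewrite g0 h0 => a1 a2; have := ler_norm (- h x); rewrite normrN => a3.
by rewrite ler_norml; lra.
Qed.

Lemma cprimitive_le_weight (f f' : R -> R[i]) (B L : R) : 0 < L -> f 0 = 0 ->
  cder f f' -> (forall x, cmod (f' x) <= B * weight L x) ->
  forall x, cmod (f x) <= 2 * B / L * weight L x.
Proof.
move=> L0 f0 df fB x.
have h1 := @primitive_le_weight (Re \o f) (fun x => Re (f' x)) B L L0 (f_equal Re f0)
  (fun x => proj1 (df x)) (fun x => le_trans (ler_Re_cmod _) (fB x)) x.
have h2 := @primitive_le_weight (Im \o f) (fun x => Im (f' x)) B L L0 (f_equal Im f0)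
  (fun x => proj2 (df x)) (fun x => le_trans (ler_Im_cmod _) (fB x)) x.
apply: le_trans (cmod_le_ReIm _) _; apply: le_trans (lerD h1 h2) _.
by rewrite (_ : _ + _ = 2 * B / L * weight L x) //; ring.
Qed.

Definition ode (Q y p : R -> R[i]) := cder y p /\ cder p (fun x => Q x * y x).

Definition cprim (f : R -> R[i]) : R -> R[i] :=
  xget (fun=> 0) [set F | F 0 = 0 /\ cder F f].

Lemma cprimP f : ccont f -> cprim f 0 = 0 /\ cder (cprim f) f.
Proof.
move=> /cprimitive_exists cf.
by have := @xgetPex _ (fun=> 0) [set F | F 0 = 0 /\ cder F f] cf.
Qed.

Lemma cgeometric_limit (u : nat -> R[i]) (c : R) :
  (forall n, cmod (u n.+1 - u n) <= c * 2^-1 ^+ n) ->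
  exists l, forall n, cmod (u n - l) <= 4 * c * 2^-1 ^+ n.
Proof.
move=> uc.
have [|r hr] := @geometric_limit (fun n => Re (u n)) c.
  by move=> n; apply: le_trans (uc n); rewrite -cReB ler_Re_cmod.
have [|s hs] := @geometric_limit (fun n => Im (u n)) c.
  by move=> n; apply: le_trans (uc n); rewrite -cImB ler_Im_cmod.
exists (r +i* s) => n; apply: le_trans (cmod_le_ReIm _) _.
rewrite cReB cImB /=; apply: le_trans (lerD (hr n) (hs n)) _.
by rewrite (_ : _ + _ = 4 * c * 2^-1 ^+ n) //; move: (2^-1 ^+ n) => t; ring.
Qed.

Lemma ccont_uniform_limit (f : R -> R[i]) (fn : nat -> R -> R[i]) (V : R -> R) :
  (forall n, ccont (fn n)) -> continuous V ->
  (forall n x, cmod (fn n x - f x) <= 2^-1 ^+ n * V x) -> ccont f.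
Proof.
move=> cfn cV H; split.
- apply: (@continuous_uniform_limit _ (fun n => Re \o fn n) V) => // [n|n x].
    by case: (cfn n).
  by apply: le_trans (H n x); rewrite /= -cReB ler_Re_cmod.
- apply: (@continuous_uniform_limit _ (fun n => Im \o fn n) V) => // [n|n x].
    by case: (cfn n).
  by apply: le_trans (H n x); rewrite /= -cImB ler_Im_cmod.
Qed.

Lemma ode_exists (Q : R -> R[i]) (K : R) (y0 p0 : R[i]) :
  ccont Q -> (forall x, cmod (Q x) <= K) ->
  exists y p, [/\ ode Q y p, y 0 = y0 & p 0 = p0].
Proof.
move=> cQ QK.
pose step (yp : (R -> R[i]) * (R -> R[i])) : (R -> R[i]) * (R -> R[i]) :=
  (fun x => y0 + cprim yp.2 x, fun x => p0 + cprim (fun t => Q t * yp.1 t) x).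
pose it n := iter n step (fun=> y0, fun=> p0).
have itc n : ccont (it n).1 /\ ccont (it n).2.
  elim: n => [|n [IH1 IH2]]; first by split; exact: ccont_cst.
  rewrite /it iterS -/(it n); split; apply: ccontD; try exact: ccont_cst.
    by have [_ /cder_ccont] := cprimP IH2.
  by have [_ /cder_ccont] := cprimP (ccontM cQ IH1).
have K0 : 0 <= K := le_trans (cmod_ge0 _) (QK 0).
(* The integrands p and Q y are Lipschitz in the pair with constants 1 and K, both at most [K1]. A
   primitive gains 1/L in the weighted norm and loses 2 for real and imaginary parts, so L = 4 K1
   makes the contraction factor 1/2. *)
pose K1 := K + 1; pose L := 4 * K1; pose c := cmod p0 + K * cmod y0.
have K10 : 0 < K1 by rewrite /K1; lra.
have L0 : 0 < L by rewrite /L; lra.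
have c0 : 0 <= c by rewrite addr_ge0 ?mulr_ge0 ?cmod_ge0.
have W0 x : 0 <= weight L x by apply: le_trans (weight_ge1 L x).
have contract (f g : R -> R[i]) (B : R) : ccont f -> ccont g ->
    (forall x, cmod (f x - g x) <= K1 * B * weight L x) ->
    forall x, cmod (cprim f x - cprim g x) <= B * 2^-1 * weight L x.
  move=> cf cg fg x; have [f0 df] := cprimP cf; have [g0 dg] := cprimP cg.
  have := @cprimitive_le_weight (fun x => cprim f x - cprim g x) (fun x => f x - g x) _ L L0.
  rewrite f0 g0 subrr => /(_ _ erefl (cderB df dg) fg x).
  congr (_ <= _ * _); rewrite /L; field.
  by rewrite gt_eqF.
have QB (f g : R -> R[i]) (B : R) : 0 <= B ->
    (forall x, cmod (f x - g x) <= B * weight L x) ->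
    forall x, cmod (Q x * f x - Q x * g x) <= K1 * B * weight L x.
  move=> B0 fg x; rewrite -mulrBr cmodM -mulrA; apply: ler_pM => //.
  by apply: le_trans (QK x) _; rewrite /K1; lra.
have idB (f g : R -> R[i]) (B : R) : 0 <= B ->
    (forall x, cmod (f x - g x) <= B * weight L x) ->
    forall x, cmod (f x - g x) <= K1 * B * weight L x.
  move=> B0 fg x; apply: le_trans (fg x) _; rewrite ler_wpM2r // ler_peMl // /K1; lra.
have itd n : (forall x, cmod ((it n.+1).1 x - (it n).1 x) <= c * weight L x * 2^-1 ^+ n) /\
             (forall x, cmod ((it n.+1).2 x - (it n).2 x) <= c * weight L x * 2^-1 ^+ n).
  elim: n => [|n [IH1 IH2]].
    have base (k : R[i]) (f : R -> R[i]) : ccont f -> (forall x, cmod (f x) <= c) ->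
        forall x, cmod (k + cprim f x - k) <= c * weight L x * 2^-1 ^+ 0.
      move=> cf fc x; rewrite addrC addKr expr0 mulr1; have [f0 df] := cprimP cf.
      have := @cprimitive_le_weight _ _ c L L0 f0 df.
      move=> /(_ (fun x => le_trans (fc x) (ler_peMr c0 (weight_ge1 L x))) x).
      move=> /le_trans; apply; rewrite ler_wpM2r // ler_pdivrMr // mulrC ler_wpM2l //.
      by rewrite /L /K1; lra.
    split; apply: base; rewrite /=; try exact: ccont_cst.
    - by move=> x; rewrite /c lerDl mulr_ge0.
    - exact/ccontM/ccont_cst.
    - by move=> x; rewrite /c cmodM (le_trans (ler_wpM2r _ (QK x))) // lerDr.
  have [c1 c2] := itc n; have [c3 c4] := itc n.+1.
  have B0 : 0 <= c * 2^-1 ^+ n by rewrite mulr_ge0 // exprn_ge0 // invr_ge0.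
  have sub (k : R[i]) (f g : R -> R[i]) x : k + f x - (k + g x) = f x - g x by ring.
  split => x.
  - have -> : (it n.+2).1 x - (it n.+1).1 x = cprim (it n.+1).2 x - cprim (it n).2 x.
      exact: sub.
    rewrite exprSr mulrA (mulrAC _ (weight L x)) (mulrAC _ (weight L x)).
    apply: contract => // z; apply: idB => // t; apply: le_trans (IH2 t) _.
    by rewrite mulrAC.
  - have -> : (it n.+2).2 x - (it n.+1).2 x =
        cprim (fun t => Q t * (it n.+1).1 t) x - cprim (fun t => Q t * (it n).1 t) x.
      exact: sub.
    rewrite exprSr mulrA (mulrAC _ (weight L x)) (mulrAC _ (weight L x)).
    apply: contract; [exact: ccontM|exact: ccontM|] => z; apply: QB => // t.
    by apply: le_trans (IH1 t) _; rewrite mulrAC.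
have /choice [y yP] : forall x, exists l, forall n,
    cmod ((it n).1 x - l) <= 4 * (c * weight L x) * 2^-1 ^+ n.
  by move=> x; apply: cgeometric_limit => n; exact: (proj1 (itd n)).
have /choice [p pP] : forall x, exists l, forall n,
    cmod ((it n).2 x - l) <= 4 * (c * weight L x) * 2^-1 ^+ n.
  by move=> x; apply: cgeometric_limit => n; exact: (proj2 (itd n)).
have cV : continuous (fun x => 4 * (c * weight L x)).
  move=> x; apply: cvgMr; apply: cvgMr; exact: weight_continuous.
have cy : ccont y.
  apply: (@ccont_uniform_limit _ (fun n => (it n).1) _ _ cV) => [n|n x].
    by case: (itc n).
  by rewrite mulrC.
have cp : ccont p.
  apply: (@ccont_uniform_limit _ (fun n => (it n).2) _ _ cV) => [n|n x].
    by case: (itc n).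
  by rewrite mulrC.
have B0 n : 0 <= 4 * c * 2^-1 ^+ n by rewrite !mulr_ge0 // exprn_ge0 // invr_ge0.
have lim0 (z w : R[i]) (u : nat -> R[i]) (B : R) :
    (forall n, cmod (u n.+1 - z) <= B * 2^-1 ^+ n) ->
    (forall n, cmod (u n.+1 - w) <= B * 2^-1 ^+ n) -> z = w.
  move=> uz uw; apply/eqP; rewrite -subr_eq0 -cmod_eq0 eq_le cmod_ge0 andbT.
  apply: (@le0_geometric _ (2 * B)) => n.
  rewrite (_ : z - w = (u n.+1 - w) - (u n.+1 - z)); last by ring.
  apply: le_trans (cmodB _ _) _; apply: le_trans (lerD (uw n) (uz n)) _.
  by rewrite -mulrDl ler_wpM2r ?exprn_ge0 ?invr_ge0 // -mulr2n mulr_natl.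
have halfS n x : 4 * (c * weight L x) * 2^-1 ^+ n.+1 <= 4 * (c * weight L x) * 2^-1 ^+ n.
  rewrite exprS ler_wpM2l ?mulr_ge0 // ler_piMl ?exprn_ge0 ?invr_ge0 //.
  by rewrite invf_le1 ?ltr0n // ler1n.
have halfW n x : 4 * c * 2^-1 ^+ n * 2^-1 * weight L x <= 4 * (c * weight L x) * 2^-1 ^+ n.
  have : 0 <= c * weight L x * 2^-1 ^+ n by rewrite !mulr_ge0 // exprn_ge0 // invr_ge0.
  by move: (2^-1 ^+ n) => t; lra.
have yE : y = fun x => y0 + cprim p x.
  apply/funext => x; apply: (@lim0 _ _ (fun n => (it n).1 x) (4 * (c * weight L x))) => n.
    exact: le_trans (yP x n.+1) (halfS n x).
  rewrite /it iterS -/(it n) /= (_ : _ - _ = cprim (it n).2 x - cprim p x); last by ring.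
  have [_ c2] := itc n.
  have H z : cmod ((it n).2 z - p z) <= 4 * c * 2^-1 ^+ n * weight L z.
    by apply: le_trans (pP z n) _; rewrite mulrA mulrAC.
  apply: le_trans (contract _ _ _ c2 cp (idB _ _ _ (B0 n) H) x) _.
  exact: halfW.
have pE : p = fun x => p0 + cprim (fun t => Q t * y t) x.
  apply/funext => x; apply: (@lim0 _ _ (fun n => (it n).2 x) (4 * (c * weight L x))) => n.
    exact: le_trans (pP x n.+1) (halfS n x).
  rewrite /it iterS -/(it n) /=.
  rewrite (_ : _ - _ = cprim (fun t => Q t * (it n).1 t) x - cprim (fun t => Q t * y t) x); last by ring.
  have [c1 _] := itc n.
  have H z : cmod ((it n).1 z - y z) <= 4 * c * 2^-1 ^+ n * weight L z.
    by apply: le_trans (yP z n) _; rewrite mulrA mulrAC.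
  apply: le_trans (contract _ _ _ (ccontM cQ c1) (ccontM cQ cy) (QB _ _ _ (B0 n) H) x) _.
  exact: halfW.
have [P0 dP] := cprimP cp; have [Y0 dY] := cprimP (ccontM cQ cy).
exists y, p; split; last 2 first.
- by rewrite yE P0 addr0.
- by rewrite pE Y0 addr0.
split.
- rewrite yE; apply: cder_ext (cderD (cder_cst y0) dP) => // x; exact: add0r.
- rewrite {1}pE; apply: cder_ext (cderD (cder_cst p0) dY) => // x; exact: add0r.
Qed.

End Picard.

Ltac prove_ccont := repeat lazymatch goal with
  | |- ccont ?F => lazymatch F with
    | (fun x => @GRing.add _ (@?f x) (@?g x)) => apply (@ccontD _ f g)
    | (fun x => @GRing.opp _ (@?f x)) => apply (@ccontN _ f)
    | (fun x => @GRing.mul _ (@?f x) (@?g x)) => apply (@ccontM _ f g)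
    | (fun x => conjc (@?f x)) => apply (@ccontJ _ f)
    | _ => first [assumption | exact: ccont_cst]
    end
  end.

(** * Wronskians, fundamental solutions and the Gronwall estimate *)

Section LinearODE.
Variable R : realType.
Implicit Types (Q y p z r : R -> R[i]) (x : R).

Lemma cder_const y : cder y (fun=> 0) -> forall x, y x = y 0.
Proof.
move=> dy.
have cst (f : R -> R) : (forall x, is_derive x 1 f 0) -> forall x, f x = f 0.
  move=> df x; have dc (z : R) : is_derive z (1 : R) (fun=> 0 : R) 0 by exact: is_derive_cst.
  have [x0|/ltW x0] := leP 0 x.
  - have := le_increment x0 df dc (fun _ _ _ => lexx _).
    have := le_increment x0 dc df (fun _ _ _ => lexx _); lra.
  - have := le_increment x0 df dc (fun _ _ _ => lexx _).
    have := le_increment x0 dc df (fun _ _ _ => lexx _); lra.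
move=> x; apply: complex_ext.
- by apply: (cst (Re \o y)) => t; case: (dy t).
- by apply: (cst (Im \o y)) => t; case: (dy t).
Qed.

(** Two different coefficients are allowed so that one identity serves twice: equal coefficients
    give the constancy behind determinant 1 and uniqueness, distinct ones give the trace formula
    [tr_diff]. *)
Lemma wronskian_cder Q1 Q2 y p z r : ode Q1 y p -> ode Q2 z r ->
  cder (fun x => y x * r x - p x * z x) (fun x => (Q2 x - Q1 x) * (y x * z x)).
Proof.
move=> [dy dp] [dz dr]; apply: cder_ext (cderB (cderM dy dr) (cderM dp dz)) => // x.
by rewrite /=; ring.
Qed.

Lemma wronskian_cst Q y p z r : ode Q y p -> ode Q z r -> forall x,
  y x * r x - p x * z x = y 0 * r 0 - p 0 * z 0.
Proof.
move=> oy oz; apply: cder_const; apply: cder_ext (wronskian_cder oy oz) => // x.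
by rewrite subrr mul0r.
Qed.

(** Boundedness on the whole line is what the weighted Picard iteration asks for; periodic
    potentials satisfy it. *)
Definition admissible Q := ccont Q /\ exists K, forall x, cmod (Q x) <= K.

(* A pair (y, y'); fth, fph are theta and phi, and fth', fph' their derivatives. *)
Definition cauchy_sol Q (y0 p0 : R[i]) : (R -> R[i]) * (R -> R[i]) :=
  xget (fun=> 0, fun=> 0) [set yp | [/\ ode Q yp.1 yp.2, yp.1 0 = y0 & yp.2 0 = p0]].

Definition fth Q := (cauchy_sol Q 1 0).1.
Definition fth' Q := (cauchy_sol Q 1 0).2.
Definition fph Q := (cauchy_sol Q 0 1).1.
Definition fph' Q := (cauchy_sol Q 0 1).2.

Lemma cauchy_solP Q (y0 p0 : R[i]) : admissible Q ->
  [/\ ode Q (cauchy_sol Q y0 p0).1 (cauchy_sol Q y0 p0).2,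
      (cauchy_sol Q y0 p0).1 0 = y0 & (cauchy_sol Q y0 p0).2 0 = p0].
Proof.
move=> [cQ [K QK]]; have [y [p H]] := ode_exists y0 p0 cQ QK.
exact: (@xgetPex _ _ [set yp | [/\ ode Q yp.1 yp.2, yp.1 0 = y0 & yp.2 0 = p0]]
  (ex_intro _ (y, p) H)).
Qed.

Section Fundamental.
Variable Q : R -> R[i].
Hypothesis aQ : admissible Q.

Lemma ode_fth : ode Q (fth Q) (fth' Q). Proof. by case: (cauchy_solP 1 0 aQ). Qed.
Lemma ode_fph : ode Q (fph Q) (fph' Q). Proof. by case: (cauchy_solP 0 1 aQ). Qed.
Lemma fth0 : fth Q 0 = 1. Proof. by case: (cauchy_solP 1 0 aQ). Qed.
Lemma fth'0 : fth' Q 0 = 0. Proof. by case: (cauchy_solP 1 0 aQ). Qed.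
Lemma fph0 : fph Q 0 = 0. Proof. by case: (cauchy_solP 0 1 aQ). Qed.
Lemma fph'0 : fph' Q 0 = 1. Proof. by case: (cauchy_solP 0 1 aQ). Qed.

Lemma fundamental_det x : fth Q x * fph' Q x - fth' Q x * fph Q x = 1.
Proof. by rewrite (wronskian_cst ode_fth ode_fph) fth0 fth'0 fph0 fph'0; ring. Qed.

Lemma ode_lincomb y p z r (s t : R[i]) : ode Q y p -> ode Q z r ->
  ode Q (fun x => s * y x + t * z x) (fun x => s * p x + t * r x).
Proof.
move=> [dy dp] [dz dr]; split; first exact: cderD (cderZ s dy) (cderZ t dz).
by apply: cder_ext (cderD (cderZ s dp) (cderZ t dr)) => // x /=; ring.
Qed.

(** The constant Wronskians of [y] with the two fundamental solutions are its Cauchy data, and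
    determinant 1 inverts the relation. This is also the uniqueness theorem for the Cauchy
    problem. *)
Lemma ode_rep y p : ode Q y p -> forall x,
  y x = y 0 * fth Q x + p 0 * fph Q x /\ p x = y 0 * fth' Q x + p 0 * fph' Q x.
Proof.
move=> oy x.
have w1 : y x * fth' Q x - p x * fth Q x = - p 0.
  by rewrite (wronskian_cst oy ode_fth) fth0 fth'0; ring.
have w2 : y x * fph' Q x - p x * fph Q x = y 0.
  by rewrite (wronskian_cst oy ode_fph) fph0 fph'0; ring.
have d := fundamental_det x.
have e1 : p 0 = - (y x * fth' Q x - p x * fth Q x) by rewrite w1 opprK.
rewrite -w2 e1; split.
- by rewrite -[LHS]mulr1 -d; ring.
- by rewrite -[LHS]mulr1 -d; ring.
Qed.

End Fundamental.

Lemma ode_ccont Q y p : ode Q y p -> ccont y /\ ccont p.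
Proof. by move=> [dy dp]; split; [exact: cder_ccont dy|exact: cder_ccont dp]. Qed.

Lemma is_derive_cmod_sqr y p x : cder y p ->
  is_derive x (1 : R) (fun x => cmod (y x) ^+ 2) (2 * Re ((y x)^*%C * p x)).
Proof.
move=> dy; have [d1 d2] := dy x.
rewrite (_ : (fun x => _) = fun x => Re (y x) * Re (y x) + Im (y x) * Im (y x)); last first.
  by apply/funext => t; rewrite cmod_sqr !expr2.
have H := is_derive_addr (is_derive_mulr d1 d1) (is_derive_mulr d2 d2).
by apply: (is_derive_eq H); rewrite !cReImE /=; ring.
Qed.

Lemma Re_le_cmod (u v : R[i]) : Re (u^*%C * v) <= cmod u * cmod v.
Proof. by rewrite -(cmodJ u) -cmodM (le_trans (ler_norm _)) // ler_Re_cmod. Qed.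

(** For E = |y|^2 + |p|^2 one has E' <= 2 (K + 1) |y||p| + 2 r |p| <= (K + 2) E + r^2, and
    multiplication by the exponential integrates this. The inhomogeneity [r] is what the comparison
    of two equations produces. *)
Lemma gronwall y p p' (K r : R) : 0 <= K ->
  cder y p -> cder p p' ->
  (forall x, 0 <= x -> x <= 1 -> cmod (p' x) <= K * cmod (y x) + r) ->
  forall x, 0 <= x -> x <= 1 ->
    cmod (y x) ^+ 2 + cmod (p x) ^+ 2 <=
    expR (K + 2) * (cmod (y 0) ^+ 2 + cmod (p 0) ^+ 2 + r ^+ 2).
Proof.
move=> K0 dy dp H x x0 x1.
pose E (t : R) := cmod (y t) ^+ 2 + cmod (p t) ^+ 2.
pose E' (t : R) := 2 * Re ((y t)^*%C * p t) + 2 * Re ((p t)^*%C * p' t).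
have dE (t : R) : is_derive t (1 : R) E (E' t).
  by apply: is_derive_addr; exact: is_derive_cmod_sqr.
have E'le (t : R) : 0 <= t -> t <= 1 -> E' t <= (K + 2) * E t + r ^+ 2.
  move=> t0 t1; have a1 := Re_le_cmod (y t) (p t); have a2 := Re_le_cmod (p t) (p' t).
  have a3 : cmod (p t) * cmod (p' t) <= cmod (p t) * (K * cmod (y t) + r).
    by rewrite ler_wpM2l // H.
  rewrite /E' /E; move: a1 a2 a3 (cmod_ge0 (y t)) (cmod_ge0 (p t)).
  move: (cmod (y t)) (cmod (p t)) => u v a1 a2 a3 u0 v0.
  have b1 : 0 <= (K + 1) * (u - v) ^+ 2 by rewrite mulr_ge0 ?sqr_ge0 //; lra.
  have b2 := sqr_ge0 (v - r).
  have b3 : 0 <= u ^+ 2 by exact: sqr_ge0.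
  have b4 : 0 <= v ^+ 2 by exact: sqr_ge0.
  rewrite !sqrrB !expr2 in b1 b2 b3 b4 *.
  nra.
pose G (t : R) := expR (- (K + 2) * t) * E t.
have dG (t : R) : is_derive t (1 : R) G (- (K + 2) * expR (- (K + 2) * t) * E t +
    expR (- (K + 2) * t) * E' t).
  exact: is_derive_mulr (is_derive_expRZ _ _) (dE t).
have dr (t : R) : is_derive t (1 : R) (fun t => r ^+ 2 * t) (r ^+ 2).
  by apply: is_derive_eq; rewrite /GRing.scale /= mulr1.
have := @le_increment R _ _ _ _ 0 x x0 dG dr.
have /[swap] /[apply] : forall t : R, 0 < t -> t < x ->
    - (K + 2) * expR (- (K + 2) * t) * E t + expR (- (K + 2) * t) * E' t <= r ^+ 2.
  move=> t t0 tx; have t1 : t <= 1 by lra.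
  have := E'le t (ltW t0) t1.
  have e0 : 0 < expR (- (K + 2) * t) by exact: expR_gt0.
  have e1 : expR (- (K + 2) * t) <= 1.
    rewrite -[leRHS]expR0 ler_expR mulNr oppr_le0; apply: mulr_ge0; last exact: ltW.
    by move: K0; lra.
  have := sqr_ge0 r; move: (expR _) (E t) (E' t) (r ^+ 2) e0 e1 => e u u' rr e0 e1 r0 ub.
  have : e * u' <= e * ((K + 2) * u + rr) by rewrite ler_wpM2l // ltW.
  have : e * rr <= rr by rewrite ler_piMl.
  nra.
rewrite /G !mulr0 expR0 mul1r subr0 => h.
have e0 : 0 < expR (- (K + 2) * x) by exact: expR_gt0.
have h2 : expR (- (K + 2) * x) * E x <= E 0 + r ^+ 2.
  have : r ^+ 2 * x <= r ^+ 2 by rewrite ler_piMr // sqr_ge0.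
  lra.
have E0 (t : R) : 0 <= E t by rewrite addr_ge0 // sqr_ge0.
have inv : expR ((K + 2) * x) * expR (- (K + 2) * x) = 1 by rewrite -expRD mulNr subrr expR0.
rewrite -/(E x) -/(E 0).
have -> : E x = expR ((K + 2) * x) * (expR (- (K + 2) * x) * E x) by rewrite mulrA inv mul1r.
apply: le_trans (ler_wpM2l (ltW (expR_gt0 _)) h2) _.
apply: ler_wpM2r; first by rewrite addr_ge0 ?E0 ?sqr_ge0.
rewrite ler_expR; have : 0 <= (K + 2) * (1 - x) by apply: mulr_ge0; lra.
lra.
Qed.

End LinearODE.

(** * The discriminant *)

Section Trace.
Variable R : realType.
Implicit Types (Q y p z r : R -> R[i]) (x K : R).

(** The Gronwall factor for the sum of squares. Being at least 1 it is below its own square, hence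
    also bounds the solutions themselves. *)
Definition growth (K : R) : R := expR (K + 2).

Lemma growth_ge1 K : 0 <= K -> 1 <= growth K.
Proof. by move=> K0; rewrite -[leLHS]expR0 ler_expR; lra. Qed.

Lemma sqr_sum_le (u v b : R) : 0 <= u -> 0 <= v -> 0 <= b ->
  u ^+ 2 + v ^+ 2 <= b ^+ 2 -> u <= b /\ v <= b.
Proof.
move=> u0 v0 b0 h; have su := sqr_ge0 u; have sv := sqr_ge0 v.
by split; rewrite -(@ler_pXn2r _ 2) ?nnegrE //; lra.
Qed.

Definition bounded01 Q K := forall x, 0 <= x -> x <= 1 -> cmod (Q x) <= K.

Lemma bounded01_ge0 Q K : bounded01 Q K -> 0 <= K.
Proof. by move=> /(_ 0 (lexx _) ler01); exact: le_trans. Qed.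

Lemma sol_bound Q K y p : bounded01 Q K -> ode Q y p ->
  cmod (y 0) ^+ 2 + cmod (p 0) ^+ 2 <= 1 ->
  forall x, 0 <= x -> x <= 1 -> cmod (y x) <= growth K /\ cmod (p x) <= growth K.
Proof.
move=> QK [dy dp] i1 x x0 x1; have K0 := bounded01_ge0 QK; have g1 := growth_ge1 K0.
apply: sqr_sum_le => //; try lra.
have h t : 0 <= t -> t <= 1 -> cmod (Q t * y t) <= K * cmod (y t) + 0.
  by move=> t0 t1; rewrite addr0 cmodM ler_wpM2r // QK.
apply: le_trans (gronwall K0 dy dp h x0 x1) _; rewrite expr0n addr0.
rewrite -/(growth K) expr2; apply: ler_pM => //; try lra.
by rewrite addr_ge0 // sqr_ge0.
Qed.

Lemma sol_lip Q1 Q2 K (d : R) y1 p1 y2 p2 :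
  bounded01 Q1 K -> bounded01 Q2 K -> bounded01 (fun x => Q2 x - Q1 x) d ->
  ode Q1 y1 p1 -> ode Q2 y2 p2 -> y1 0 = y2 0 -> p1 0 = p2 0 ->
  cmod (y1 0) ^+ 2 + cmod (p1 0) ^+ 2 <= 1 ->
  forall x, 0 <= x -> x <= 1 ->
   cmod (y2 x - y1 x) <= growth K ^+ 2 * d /\ cmod (p2 x - p1 x) <= growth K ^+ 2 * d.
Proof.
move=> Q1K Q2K Qd o1 o2 ey ep i1 x x0 x1.
have K0 := bounded01_ge0 Q1K; have g1 := growth_ge1 K0; have d0 := bounded01_ge0 Qd.
have g0 : 0 <= growth K by lra.
apply: sqr_sum_le => //; first by rewrite mulr_ge0 // sqr_ge0.
have [[dy1 dp1] [dy2 dp2]] := (o1, o2).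
have h t : 0 <= t -> t <= 1 ->
    cmod (Q2 t * y2 t - Q1 t * y1 t) <= K * cmod (y2 t - y1 t) + d * growth K.
  move=> t0 t1.
  rewrite (_ : _ - _ = Q2 t * (y2 t - y1 t) + (Q2 t - Q1 t) * y1 t); last by ring.
  apply: le_trans (cmodD _ _) _; rewrite !cmodM; apply: lerD.
    by rewrite ler_wpM2r // Q2K.
  by apply: ler_pM => //; [exact: Qd|case: (sol_bound Q1K o1 i1 t0 t1)].
apply: le_trans (gronwall K0 (cderB dy2 dy1) (cderB dp2 dp1) h x0 x1) _.
rewrite ey ep !subrr cmod0 expr0n !add0r -/(growth K).
rewrite [leRHS](_ : _ = growth K * (growth K * (d * growth K) ^+ 2)); last by ring.
by rewrite ler_wpM2l // ler_peMl // sqr_ge0.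
Qed.

Definition tr Q := fph' Q 1 + fth Q 1.

(** The kernel of variation of constants for the trace: the coefficients are the monodromy entries
    for [Q1], and each product has one solution for [Q1] and one for [Q2], which makes [tr_diff]
    exact rather than first order. On the diagonal it is the quadratic form giving the derivative of
    the trace. *)
Definition kern Q1 Q2 x : R[i] :=
  fph' Q1 1 * (fth Q1 x * fph Q2 x) - fth' Q1 1 * (fph Q1 x * fph Q2 x)
  - fth Q1 1 * (fph Q1 x * fth Q2 x) + fph Q1 1 * (fth Q1 x * fth Q2 x).

Definition qform Q := kern Q Q.

Definition ci (f : R -> R[i]) : R[i] := cintegral `[0, 1] f.

Lemma fund_ccont Q : admissible Q ->
  [/\ ccont (fth Q), ccont (fth' Q), ccont (fph Q) & ccont (fph' Q)].
Proof.
move=> aQ; have [c1 c2] := ode_ccont (ode_fth aQ); have [c3 c4] := ode_ccont (ode_fph aQ).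
by split.
Qed.

Lemma kern_ccont Q1 Q2 : admissible Q1 -> admissible Q2 -> ccont (kern Q1 Q2).
Proof.
by move=> /fund_ccont[? ? ? ?] /fund_ccont[? ? ? ?]; rewrite /kern; prove_ccont.
Qed.

Lemma tr_diff Q1 Q2 : admissible Q1 -> admissible Q2 ->
  tr Q2 - tr Q1 = ci (fun x => (Q2 x - Q1 x) * kern Q1 Q2 x).
Proof.
move=> a1 a2.
pose W y p z r (x : R) : R[i] := y x * r x - p x * z x.
(* [H x] is the trace of M1 times the inverse of the fundamental matrix for [Q1] at x times the one
   for [Q2] at x, so it runs from tr M1 at 0 to tr M2 at 1. *)
pose H x := fph' Q1 1 * W (fth Q1) (fth' Q1) (fph Q2) (fph' Q2) x
  - fth' Q1 1 * W (fph Q1) (fph' Q1) (fph Q2) (fph' Q2) x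
  - fth Q1 1 * W (fph Q1) (fph' Q1) (fth Q2) (fth' Q2) x
  + fph Q1 1 * W (fth Q1) (fth' Q1) (fth Q2) (fth' Q2) x.
have dH : cder H (fun x => (Q2 x - Q1 x) * kern Q1 Q2 x).
  have ot1 := ode_fth a1; have ot2 := ode_fth a2; have op1 := ode_fph a1; have op2 := ode_fph a2.
  apply: cder_ext (cderD (cderB (cderB (cderZ (fph' Q1 1) (wronskian_cder ot1 op2))
    (cderZ (fth' Q1 1) (wronskian_cder op1 op2))) (cderZ (fth Q1 1) (wronskian_cder op1 ot2)))
    (cderZ (fph Q1 1) (wronskian_cder ot1 ot2))) => // x.
  by rewrite /kern; ring.
rewrite /ci (cintegral_deriv ler01 dH); last first.
  by have [[c1 _] [c2 _]] := (a1, a2); have := kern_ccont a1 a2 => ?; prove_ccont.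
rewrite /H /W !(fth0, fth'0, fph0, fph'0) //.
have d := fundamental_det a1 1.
rewrite /tr; set m11 := fth Q1 1 in d *; set m12 := fph Q1 1 in d *.
set m21 := fth' Q1 1 in d *; set m22 := fph' Q1 1 in d *.
have -> : fph' Q2 1 + fth Q2 1 = (m11 * m22 - m21 * m12) * (fph' Q2 1 + fth Q2 1).
  by rewrite d mul1r.
by ring.
Qed.

Lemma cmod_mul3_sub (a1 a2 a3 b1 b2 b3 : R[i]) (B d : R) :
  cmod a1 <= B -> cmod a2 <= B -> cmod a3 <= B ->
  cmod b1 <= B -> cmod b2 <= B -> cmod b3 <= B ->
  cmod (a1 - b1) <= d -> cmod (a2 - b2) <= d -> cmod (a3 - b3) <= d ->
  cmod (a1 * (a2 * a3) - b1 * (b2 * b3)) <= 3 * B ^+ 2 * d.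
Proof.
move=> A1 A2 A3 B1 B2 B3 d1 d2 d3.
have B0 : 0 <= B by apply: le_trans A1.
have d0 : 0 <= d by apply: le_trans d1.
rewrite (_ : _ - _ = (a1 - b1) * (a2 * a3) + b1 * ((a2 - b2) * a3) + b1 * (b2 * (a3 - b3)));
  last by ring.
apply: le_trans (cmodD _ _) _; apply: le_trans (lerD (cmodD _ _) (lexx _)) _.
rewrite !cmodM.
have h1 : cmod (a1 - b1) * (cmod a2 * cmod a3) <= d * (B * B).
  by apply: ler_pM => //; [rewrite mulr_ge0|apply: ler_pM].
have h2 : cmod b1 * (cmod (a2 - b2) * cmod a3) <= B * (d * B).
  by apply: ler_pM => //; [rewrite mulr_ge0|apply: ler_pM].
have h3 : cmod b1 * (cmod b2 * cmod (a3 - b3)) <= B * (B * d).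
  by apply: ler_pM => //; [rewrite mulr_ge0|apply: ler_pM].
rewrite expr2; lra.
Qed.

Lemma fund_bound Q K : admissible Q -> bounded01 Q K -> forall x, 0 <= x -> x <= 1 ->
  [/\ cmod (fth Q x) <= growth K, cmod (fth' Q x) <= growth K,
      cmod (fph Q x) <= growth K & cmod (fph' Q x) <= growth K].
Proof.
move=> aQ QK x x0 x1.
have [|h1 h2] := sol_bound QK (ode_fth aQ) _ x0 x1.
  by rewrite fth0 // fth'0 // cmod0 cmod1 expr1n expr0n addr0.
have [|h3 h4] := sol_bound QK (ode_fph aQ) _ x0 x1.
  by rewrite fph0 // fph'0 // cmod0 cmod1 expr1n expr0n add0r.
by split.
Qed.

Lemma fund_lip Q1 Q2 K d : admissible Q1 -> admissible Q2 ->
  bounded01 Q1 K -> bounded01 Q2 K -> bounded01 (fun x => Q2 x - Q1 x) d ->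
  forall x, 0 <= x -> x <= 1 ->
  [/\ cmod (fth Q2 x - fth Q1 x) <= growth K ^+ 2 * d,
      cmod (fth' Q2 x - fth' Q1 x) <= growth K ^+ 2 * d,
      cmod (fph Q2 x - fph Q1 x) <= growth K ^+ 2 * d &
      cmod (fph' Q2 x - fph' Q1 x) <= growth K ^+ 2 * d].
Proof.
move=> a1 a2 Q1K Q2K Qd x x0 x1.
have [|||h1 h2] := sol_lip Q1K Q2K Qd (ode_fth a1) (ode_fth a2) _ _ _ x0 x1.
- by rewrite !fth0.
- by rewrite !fth'0.
- by rewrite fth0 // fth'0 // cmod0 cmod1 expr1n expr0n addr0.
have [|||h3 h4] := sol_lip Q1K Q2K Qd (ode_fph a1) (ode_fph a2) _ _ _ x0 x1.
- by rewrite !fph0.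
- by rewrite !fph'0.
- by rewrite fph0 // fph'0 // cmod0 cmod1 expr1n expr0n add0r.
by split.
Qed.

Lemma kern_lip Q1 Q2 K d : admissible Q1 -> admissible Q2 ->
  bounded01 Q1 K -> bounded01 Q2 K -> bounded01 (fun x => Q2 x - Q1 x) d ->
  forall x, 0 <= x -> x <= 1 ->
  cmod (kern Q1 Q2 x - qform Q1 x) <= 12 * growth K ^+ 4 * d /\
  cmod (qform Q2 x - qform Q1 x) <= 12 * growth K ^+ 4 * d.
Proof.
move=> a1 a2 Q1K Q2K Qd x x0 x1.
have [A1 A2 A3 A4] := fund_bound a1 Q1K x0 x1.
have [B1 B2 B3 B4] := fund_bound a2 Q2K x0 x1.
have [L1 L2 L3 L4] := fund_lip a1 a2 Q1K Q2K Qd x0 x1.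
have [A1' A2' A3' A4'] := fund_bound a1 Q1K ler01 (lexx 1).
have [B1' B2' B3' B4'] := fund_bound a2 Q2K ler01 (lexx 1).
have [L1' L2' L3' L4'] := fund_lip a1 a2 Q1K Q2K Qd ler01 (lexx 1).
have d0 := bounded01_ge0 Qd.
have g0 : 0 <= growth K ^+ 2 * d by rewrite mulr_ge0 ?sqr_ge0.
have four (u1 u2 u3 u4 v1 v2 v3 v4 : R[i]) (e : R) : cmod (u1 - v1) <= e -> cmod (u2 - v2) <= e ->
    cmod (u3 - v3) <= e -> cmod (u4 - v4) <= e ->
    cmod (u1 - u2 - u3 + u4 - (v1 - v2 - v3 + v4)) <= 4 * e.
  move=> h1 h2 h3 h4.
  rewrite (_ : _ - _ = (u1 - v1) - (u2 - v2) - (u3 - v3) + (u4 - v4)); last by ring.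
  apply: le_trans (cmodD _ _) _; apply: le_trans (lerD (cmodB _ _) (lexx _)) _.
  by apply: le_trans (lerD (lerD (cmodB _ _) (lexx _)) (lexx _)) _; lra.
have -> : 12 * growth K ^+ 4 * d = 4 * (3 * growth K ^+ 2 * (growth K ^+ 2 * d)) by ring.
by split; apply: four; apply: cmod_mul3_sub => //; rewrite subrr cmod0.
Qed.

End Trace.

(** * Differentiation of the discriminant in the spectral parameter *)

Section ComplexDerivative.
Variable R : realType.

Lemma complex_derive1 (F : R[i] -> R[i]) (z D : R[i]) (C : R) :
  (forall w, cmod (w - z) <= 1 -> cmod (F w - F z - (w - z) * D) <= C * cmod (w - z) ^+ 2) ->
  derive1 (F : (R[i] : numFieldType) -> (R[i] : numFieldType)) z = D.
Proof.
move=> H; apply/cvg_lim; first exact: norm_hausdorff.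
apply/cvgrPdist_lt => e e0.
(* Positivity in [R[i]] forces the tolerance to be real, so the limit can be handled with real
   estimates. *)
have er : e = (Re e)%:C.
  by apply: ReE_real; apply: ger0_Im; exact: ltW.
have e1 : 0 < Re e by rewrite -ltcR -er.
pose d := Order.min 1 (Re e / (`|C| + 1)).
have C0 : 0 < `|C| + 1 by rewrite ltr_pwDr.
have d0 : 0 < d by rewrite lt_min ltr01 divr_gt0.
have dC : (0 : R[i]) < d%:C by rewrite ltcR.
near=> h.
have h0 : h != 0 by near: h; exact: nbhs_dnbhs_neq.
have hd : cmod h < d.
  rewrite -ltcR -normr_complexE; near: h.
  apply: dnbhs0_lt; exact: dC.
rewrite normr_complexE er ltcR /GRing.scale /=.
have hz : h + z - z = h by ring.
have := H (h + z); rewrite hz => /(_ _) Hh.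
have {}Hh : cmod (F (h + z) - F z - h * D) <= C * cmod h ^+ 2.
  by apply: Hh; apply: ltW; apply: lt_le_trans hd _; rewrite ge_min lexx.
have hp : 0 < cmod h by rewrite cmod_gt0.
rewrite (_ : D - _ = - (h^-1 * (F (h + z) - F z - h * D))); last first.
  by field.
rewrite cmodN cmodM cmodV mulrC ltr_pdivrMr //.
apply: le_lt_trans Hh _; rewrite expr2 mulrA ltr_pM2r //.
apply: (@le_lt_trans _ _ (`|C| * cmod h)).
  by rewrite ler_wpM2r // ler_norm.
apply: (@lt_trans _ _ ((`|C| + 1) * cmod h)); first by rewrite ltr_pM2r // ltrDl.
rewrite mulrC -ltr_pdivlMr //; apply: lt_le_trans hd _.
by rewrite ge_min lexx orbT.
Unshelve. all: by end_near. Qed.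

End ComplexDerivative.

Section Discriminant.
Variable R : realType.
Implicit Types (a b mu : R[i]) (x : R).

Lemma expi_period x : expi (x + 2 * pi) = expi x :> R[i].
Proof.
rewrite (_ : x + 2 * pi = x + (pi + pi)); last by ring.
by rewrite (expiD x) (expiD pi) expi_pi mulrNN !mulr1.
Qed.

Lemma potential_ccont a b : ccont (potential a b).
Proof.
apply: ccontD; apply: ccontM; try exact: ccont_cst.
- apply: (@cder_ccont _ _ (fun x => (0 +i* - (2 * pi)) * expi (- (2 * pi) * x))).
  by apply: cder_ext (cder_expi (- (2 * pi))) => // x; rewrite mulNr.
- exact: cder_ccont (cder_expi (2 * pi)).
Qed.

Lemma potential_cder a b :
  cder (potential a b) (fun x => (0 +i* (2 * pi)) * potential (- a) b x).
Proof.
have d1 := cderZ a (cder_expi (- (2 * pi) : R)).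
have d2 := cderZ b (cder_expi (2 * pi : R)).
apply: cder_ext (cderD d1 d2) => x; first by rewrite /potential mulNr.
have e : 0 +i* - (2 * pi) = - (0 +i* (2 * pi)) :> R[i].
  by apply: complex_ext => /=; rewrite ?oppr0.
rewrite e /potential (_ : - (2 * pi) * x = - (2 * pi * x)); last by ring.
by ring.
Qed.

Lemma potential_period a b x : potential a b (x + 1) = potential a b x.
Proof.
rewrite /potential; congr (_ * _ + _ * _).
- by rewrite -[LHS]expi_period; congr expi; ring.
- by rewrite -[RHS]expi_period; congr expi; ring.
Qed.

Lemma cmod_potential_le a b x : cmod (potential a b x) <= cmod a + cmod b.
Proof.
by apply: le_trans (cmodD _ _) _; rewrite !cmodM !cmod_expi !mulr1.
Qed.

Definition hill_coef a b mu : R -> R[i] := fun x => potential a b x - mu.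

Lemma hill_coef_admissible a b mu : admissible (hill_coef a b mu).
Proof.
split; first by apply: ccontB; [exact: potential_ccont|exact: ccont_cst].
exists (cmod a + cmod b + cmod mu) => x.
by apply: le_trans (cmodB _ _) _; rewrite lerD2r cmod_potential_le.
Qed.

Lemma hill_coef_bounded a b mu (K : R) : cmod a + cmod b + cmod mu <= K ->
  bounded01 (hill_coef a b mu) K.
Proof.
move=> h x _ _; apply: le_trans h; apply: le_trans (cmodB _ _) _.
by rewrite lerD2r cmod_potential_le.
Qed.

Lemma solution_ode a b mu (y : R -> R[i]) : solution a b mu y ->
  ode (hill_coef a b mu) y (cderive y).
Proof.
have cd (f : R -> R[i]) : cderivable f -> cder f (cderive f).
  move=> df x; have [d1 d2] := df x.
  by split; split; [exact: d1|rewrite /= derive1E|exact: d2|rewrite /= derive1E].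
move=> [/cd d1 /cd d2 e]; split => //.
apply: cder_ext d2 => // x; rewrite /hill_coef mulrBl -e; ring.
Qed.

Lemma ode_solution a b mu (y p : R -> R[i]) : ode (hill_coef a b mu) y p ->
  solution a b mu y /\ cderive y = p.
Proof.
have cd (f f' : R -> R[i]) : cder f f' -> cderivable f /\ cderive f = f'.
  move=> df; split.
    by move=> x; have [[d1 _] [d2 _]] := df x; split; [exact: d1|exact: d2].
  apply/funext => x; have [[_ e1] [_ e2]] := df x.
  by apply: complex_ext; rewrite /= derive1E.
move=> [/cd[d1 e1] /cd[d2 e2]]; split; last exact: e1.
split; [exact: d1|rewrite e1; exact: d2|rewrite e1].
by move=> x; rewrite e2 /hill_coef; ring.
Qed.

(** [theta] is picked by [xget]: the Picard solution shows that there is something to pick,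
    [ode_rep] that there is only one choice. *)
Lemma thetaE a b mu : theta a b mu = fth (hill_coef a b mu).
Proof.
have aQ := hill_coef_admissible a b mu.
have [s e] := ode_solution (ode_fth aQ).
have : exists y, solution a b mu y /\ y 0 = 1 /\ cderive y 0 = 0.
  by exists (fth (hill_coef a b mu)); rewrite e fth0 // fth'0.
have : [set y | [/\ solution a b mu y, y 0 = 1 & cderive y 0 = 0]] (theta a b mu).
  by apply: xgetPex; exists (fth (hill_coef a b mu)); rewrite /= e fth0 // fth'0.
move=> [/solution_ode ot i1 i2] _; apply/funext => x.
by have [-> _] := ode_rep aQ ot x; rewrite i1 i2 mul1r mul0r addr0.
Qed.

Lemma phiE a b mu : phi a b mu = fph (hill_coef a b mu) /\
  cderive (phi a b mu) = fph' (hill_coef a b mu).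
Proof.
have aQ := hill_coef_admissible a b mu.
have [s e] := ode_solution (ode_fph aQ).
have : [set y | [/\ solution a b mu y, y 0 = 0 & cderive y 0 = 1]] (phi a b mu).
  by apply: xgetPex; exists (fph (hill_coef a b mu)); rewrite /= e fph0 // fph'0.
move=> [/solution_ode ot i1 i2].
split; apply/funext => x; have [e1 e2] := ode_rep aQ ot x.
- by rewrite e1 i1 i2 mul1r mul0r add0r.
- by rewrite e2 i1 i2 mul1r mul0r add0r.
Qed.

Lemma discriminantE a b mu : discriminant a b mu = tr (hill_coef a b mu).
Proof. by rewrite /discriminant thetaE (proj2 (phiE _ _ _)). Qed.

Lemma ciZ (k : R[i]) f : ccont f -> ci (fun x => k * f x) = k * ci f.
Proof. by move=> cf; rewrite /ci cintegralZ //; exact: ccont_cintegrable. Qed.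

Lemma ciD (f g : R -> R[i]) : ccont f -> ccont g -> ci (fun x => f x + g x) = ci f + ci g.
Proof. by move=> cf cg; rewrite /ci cintegralD //; exact: ccont_cintegrable. Qed.

Lemma ciB (f g : R -> R[i]) : ccont f -> ccont g -> ci (fun x => f x - g x) = ci f - ci g.
Proof. by move=> cf cg; rewrite /ci cintegralB //; exact: ccont_cintegrable. Qed.

Lemma eq_ci (f g : R -> R[i]) : f =1 g -> ci f = ci g.
Proof. by move=> /funext ->. Qed.

Lemma cmod_ci_le f (B : R) : ccont f ->
  (forall x, 0 <= x -> x <= 1 -> cmod (f x) <= B) -> cmod (ci f) <= B.
Proof.
by move=> cf fB; have := cmod_cintegral_le_cst ler01 cf fB; rewrite subr0 mulr1.
Qed.

(** Replacing [kern Q1 Q2] by its diagonal costs O(d), and the kernel is integrated against a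
    difference that is itself O(d); hence the quadratic remainder. *)
Lemma tr_expand Q1 Q2 (K d : R) : admissible Q1 -> admissible Q2 ->
  bounded01 Q1 K -> bounded01 Q2 K -> bounded01 (fun x => Q2 x - Q1 x) d ->
  cmod (tr Q2 - tr Q1 - ci (fun x => (Q2 x - Q1 x) * qform Q1 x)) <=
    12 * growth K ^+ 4 * d ^+ 2.
Proof.
move=> a1 a2 Q1K Q2K Qd; rewrite tr_diff //.
have [[c1 _] [c2 _]] := (a1, a2).
have ck := kern_ccont a1 a2; have cq := kern_ccont a1 a1.
rewrite -ciB; [|prove_ccont..].
apply: cmod_ci_le => [|x x0 x1]; first by rewrite /qform; prove_ccont.
rewrite -mulrBr cmodM.
have [h _] := kern_lip a1 a2 Q1K Q2K Qd x0 x1.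
rewrite [leRHS](_ : _ = d * (12 * growth K ^+ 4 * d)); last by ring.
by apply: ler_pM => //; exact: Qd.
Qed.

(* The derivative of the discriminant, since hill_coef has derivative -1 in mu. *)
Definition Fdot a b mu : R[i] := - ci (qform (hill_coef a b mu)).

Lemma discriminant_expand a b (K : R) mu nu :
  cmod a + cmod b + cmod mu <= K -> cmod a + cmod b + cmod nu <= K ->
  cmod (discriminant a b nu - discriminant a b mu - (nu - mu) * Fdot a b mu) <=
  12 * growth K ^+ 4 * cmod (nu - mu) ^+ 2.
Proof.
move=> hmu hnu; rewrite !discriminantE.
have amu := hill_coef_admissible a b mu; have anu := hill_coef_admissible a b nu.
have e x : hill_coef a b nu x - hill_coef a b mu x = mu - nu by rewrite /hill_coef; ring.
have := tr_expand amu anu (hill_coef_bounded hmu) (hill_coef_bounded hnu) (d := cmod (nu - mu)).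
under eq_ci do rewrite e.
rewrite ciZ; last exact: kern_ccont.
rewrite (_ : (mu - nu) * _ = (nu - mu) * Fdot a b mu); last by rewrite /Fdot; ring.
by apply => x _ _; rewrite e cmodBC.
Qed.

(** Order 1 means a root at which the first derivative does not vanish, and the quadratic remainder
    identifies that derivative with [Fdot]. *)
Lemma multiplicity1P a b (t : R) mu : multiplicity a b t mu 1 <->
  discriminant a b mu = (2 * cos t)%:C /\ Fdot a b mu <> 0.
Proof.
rewrite /multiplicity; set f := (fun _ => _).
have dF : derive1 (f : (R[i] : numFieldType) -> (R[i] : numFieldType)) mu = Fdot a b mu.
  apply: (@complex_derive1 _ f mu (Fdot a b mu)
    (12 * growth (cmod a + cmod b + cmod mu + 1) ^+ 4)) => w w1.
  rewrite (_ : f w - f mu = discriminant a b w - discriminant a b mu); last first.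
    by rewrite /f; ring.
  apply: discriminant_expand; first by lra.
  have := cmodD (w - mu) mu; rewrite subrK; lra.
split.
- move=> [/(_ 0%N isT) h1 h2]; split; last by rewrite -dF.
  by apply/eqP; rewrite -subr_eq0; apply/eqP; exact: h1.
- move=> [h1 h2]; split; last by rewrite /= dF.
  by case=> // _ /=; rewrite /f h1 subrr.
Qed.

End Discriminant.

(** * Derivatives from quadratic remainders, and the rescaling flow *)

Section QuadraticExpansion.
Variable R : realType.

Lemma is_derive_quadratic (g : R -> R) (x D C e : R) : 0 < e ->
  (forall h, `|h| <= e -> `|g (x + h) - g x - h * D| <= C * h ^+ 2) ->
  is_derive x (1 : R) g D.
Proof.
move=> e0 H.
suff : h^-1 *: (g (h *: (1 : R) + x) - g x) @[h --> (0 : R)^'] --> D.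
  move=> cv; split; first by apply/cvg_ex; exists D.
  by apply/cvg_lim => //; exact: Rhausdorff.
apply/cvgrPdist_lt => d d0.
have C0 : 0 < `|C| + 1 by rewrite ltr_pwDr.
near=> h.
have h0 : h != 0 by near: h; exact: nbhs_dnbhs_neq.
have hn : 0 < `|h| by rewrite normr_gt0.
have hd : `|h| < d / (`|C| + 1).
  by near: h; apply: dnbhs0_lt; rewrite divr_gt0.
have he : `|h| < e by near: h; exact: dnbhs0_lt.
have Hh := H h (ltW he).
rewrite /GRing.scale /= mulr1 (addrC h x).
rewrite (_ : D - _ = - (h^-1 * (g (x + h) - g x - h * D))); last by field.
rewrite normrN normrM normfV mulrC ltr_pdivrMr //.
apply: le_lt_trans Hh _; rewrite -real_normK ?num_real // expr2 mulrA ltr_pM2r //.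
apply: (@le_lt_trans _ _ (`|C| * `|h|)); first by rewrite ler_wpM2r // ler_norm.
apply: (@lt_trans _ _ ((`|C| + 1) * `|h|)); first by rewrite ltr_pM2r // ltrDl.
by rewrite mulrC -ltr_pdivlMr.
Unshelve. all: by end_near. Qed.

Lemma cder_quadratic (g D : R -> R[i]) :
  (forall x, exists e C, 0 < e /\ forall h, `|h| <= e ->
    cmod (g (x + h) - g x - h%:C * D x) <= C * h ^+ 2) -> cder g D.
Proof.
move=> H x; have [e [C [e0 hC]]] := H x; split; apply: (is_derive_quadratic (C := C) e0) => h he.
- apply: le_trans (hC h he); apply: le_trans (ler_Re_cmod _).
  by rewrite !cReB cReM /= mul0r subr0.
- apply: le_trans (hC h he); apply: le_trans (ler_Im_cmod _).
  by rewrite !cImB cImM /= mul0r addr0.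
Qed.

Lemma expR_quadratic (h : R) : `|h| <= 1 / 2 -> `|expR h - 1 - h| <= 2 * h ^+ 2.
Proof.
move=> hh; have h1 := expR_ge1Dx h; have h2 := expR_ge1Dx (- h).
have [hl hu] : - (1 / 2) <= h /\ h <= 1 / 2 by apply/andP; rewrite -ler_norml.
have e : expR h * expR (- h) = 1 by rewrite -expRD subrr expR0.
have ep := expR_gt0 h.
have h3 : expR h * (1 - h) <= 1 by rewrite -[leRHS]e ler_wpM2l // ltW.
rewrite ger0_norm; last by lra.
rewrite expr2; nra.
Qed.

End QuadraticExpansion.

Section Invariance.
Variable R : realType.
Implicit Types (a b : R[i]) (Q : R -> R[i]).

Lemma kern_bound Q1 Q2 (K : R) : admissible Q1 -> admissible Q2 ->
  bounded01 Q1 K -> bounded01 Q2 K -> forall x, 0 <= x -> x <= 1 ->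
  cmod (kern Q1 Q2 x) <= 4 * growth K ^+ 3.
Proof.
move=> a1 a2 Q1K Q2K x x0 x1.
have [A1 A2 A3 A4] := fund_bound a1 Q1K x0 x1.
have [B1 B2 B3 B4] := fund_bound a2 Q2K x0 x1.
have [A1' A2' A3' A4'] := fund_bound a1 Q1K ler01 (lexx 1).
have g0 : 0 <= growth K by apply: le_trans A1.
have m3 (u v w : R[i]) : cmod u <= growth K -> cmod v <= growth K -> cmod w <= growth K ->
    cmod (u * (v * w)) <= growth K ^+ 3.
  move=> hu hv hw; rewrite !cmodM 2!exprS expr1.
  by apply: ler_pM => //; [rewrite mulr_ge0|apply: ler_pM].
apply: le_trans (cmodD _ _) _; apply: le_trans (lerD (cmodB _ _) (lexx _)) _.
apply: le_trans (lerD (lerD (cmodB _ _) (lexx _)) (lexx _)) _.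
rewrite [leRHS](_ : _ = growth K ^+ 3 + growth K ^+ 3 + growth K ^+ 3 + growth K ^+ 3);
  last by ring.
by rewrite !lerD // m3.
Qed.

(** With [P] the same form evaluated on the derivatives of the solutions, P' = Q times the
    derivative of [qform Q], so [Q * qform Q - P] is a primitive of the integrand. The form is
    invariant under the monodromy, so the boundary terms differ by a multiple of det M - 1. *)
Lemma qform_deriv_orthogonal Q Q' : admissible Q -> cder Q Q' -> ccont Q' -> Q 1 = Q 0 ->
  ci (fun x => Q' x * qform Q x) = 0.
Proof.
move=> aQ dQ cQ' Q10.
have [dt dt'] := ode_fth aQ; have [dp dp'] := ode_fph aQ.
pose S' x := fph' Q 1 * (fth' Q x * fph Q x + fth Q x * fph' Q x)
  - fth' Q 1 * (fph' Q x * fph Q x + fph Q x * fph' Q x)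
  - fth Q 1 * (fph' Q x * fth Q x + fph Q x * fth' Q x)
  + fph Q 1 * (fth' Q x * fth Q x + fth Q x * fth' Q x).
have dS : cder (qform Q) S'.
  exact: cderD (cderB (cderB (cderZ _ (cderM dt dp)) (cderZ _ (cderM dp dp)))
    (cderZ _ (cderM dp dt))) (cderZ _ (cderM dt dt)).
pose P x := fph' Q 1 * (fth' Q x * fph' Q x) - fth' Q 1 * (fph' Q x * fph' Q x)
  - fth Q 1 * (fph' Q x * fth' Q x) + fph Q 1 * (fth' Q x * fth' Q x).
have dP : cder P (fun x => Q x * S' x).
  apply: cder_ext (cderD (cderB (cderB (cderZ _ (cderM dt' dp')) (cderZ _ (cderM dp' dp')))
    (cderZ _ (cderM dp' dt'))) (cderZ _ (cderM dt' dt'))) => // x.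
  by rewrite /S'; ring.
have dH : cder (fun x => Q x * qform Q x - P x) (fun x => Q' x * qform Q x).
  by apply: cder_ext (cderB (cderM dQ dS) dP) => // x /=; ring.
rewrite /ci (cintegral_deriv ler01 dH); last first.
  by have := kern_ccont aQ aQ => ?; rewrite /qform; prove_ccont.
rewrite Q10 /P /qform /kern !(fth0, fth'0, fph0, fph'0) //.
have d := fundamental_det aQ 1; set m11 := fth Q 1 in d *; set m12 := fph Q 1 in d *.
set m21 := fth' Q 1 in d *; set m22 := fph' Q 1 in d *.
transitivity ((Q 0 * m12 + m21) * ((m11 * m22 - m21 * m12) - 1)); first by ring.
by rewrite d subrr mulr0.
Qed.

Lemma potential_deriv_orthogonal a b mu :
  ci (fun x => potential (- a) b x * qform (hill_coef a b mu) x) = 0.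
Proof.
have aQ := hill_coef_admissible a b mu.
pose k : R[i] := 0 +i* (2 * pi).
have k0 : k != 0.
  by rewrite eq_complex /= negb_and orbC gt_eqF // mulr_gt0 // pi_gt0.
have dQ : cder (hill_coef a b mu) (fun x => k * potential (- a) b x).
  by apply: cder_ext (cderB (potential_cder a b) (cder_cst mu)) => // x; rewrite subr0.
have cp := potential_ccont (- a) b.
have := qform_deriv_orthogonal aQ dQ (ccontZ k cp) _.
rewrite {1}/hill_coef -{1}(add0r 1) potential_period => /(_ erefl).
under eq_ci do rewrite -mulrA.
rewrite ciZ; last by have := kern_ccont aQ aQ => ?; rewrite /qform; prove_ccont.
by move/eqP; rewrite mulf_eq0 (negbTE k0) => /eqP.
Qed.

(* The derivative of the potential along this flow is a multiple of its derivative in x, which is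
   orthogonal to P = qform: with Q = hill_coef, P is periodic and P''' = 4 Q P' + 2 Q' P. *)
Lemma tr_rescale a b mu (tau : R) :
  tr (hill_coef ((expR (- tau))%:C * a) ((expR tau)%:C * b) mu) = tr (hill_coef a b mu).
Proof.
pose A (t : R) := (expR (- t))%:C * a; pose B (t : R) := (expR t)%:C * b.
pose G (t : R) := tr (hill_coef (A t) (B t) mu).
have dG : cder G (fun=> 0).
  apply: cder_quadratic => t.
  pose c := cmod (A t) + cmod (B t); pose K := 2 * c + cmod mu.
  exists (1 / 2), (12 * growth K ^+ 4 * (2 * c) ^+ 2 + 2 * c * (4 * growth K ^+ 3)).
  split; first by lra.
  move=> h hh.
  have c0 : 0 <= c by rewrite addr_ge0.
  pose Q1 := hill_coef (A t) (B t) mu; pose Q2 := hill_coef (A (t + h)) (B (t + h)) mu.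
  have a1 : admissible Q1 := hill_coef_admissible _ _ _.
  have a2 : admissible Q2 := hill_coef_admissible _ _ _.
  have AE : A (t + h) = (expR (- h))%:C * A t.
    by rewrite /A opprD addrC expRD realCM mulrA.
  have BE : B (t + h) = (expR h)%:C * B t.
    by rewrite /B addrC expRD realCM mulrA.
  (* [Tt] is the derivative of the potential along the flow and [er] the second order remainder of
     the two exponentials; after orthogonality only [er] contributes at first order in the
     potential. *)
  pose Tt := potential (- A t) (B t).
  pose er x := (expR (- h) - 1 + h)%:C * (A t * expi (- (2 * pi * x)))
     + (expR h - 1 - h)%:C * (B t * expi (2 * pi * x)).
  have QE x : Q2 x - Q1 x = h%:C * Tt x + er x.
    rewrite /Q2 /Q1 /hill_coef AE BE /Tt /potential /er.
    by rewrite !(raddfB, raddfD) /=; ring.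
  have h2 := expR_quadratic hh.
  have h2' : `|expR (- h) - 1 + h| <= 2 * h ^+ 2.
    by have := @expR_quadratic _ (- h); rewrite normrN opprK sqrrN => /(_ hh).
  have erB x : cmod (er x) <= 2 * c * h ^+ 2.
    have m (u v : R) (w : R[i]) : cmod (u%:C * (w * expi v)) = `|u| * cmod w.
      by rewrite !cmodM cmod_real cmod_expi mulr1.
    apply: le_trans (cmodD _ _) _; rewrite !m.
    rewrite [leRHS](_ : _ = 2 * h ^+ 2 * cmod (A t) + 2 * h ^+ 2 * cmod (B t)); last first.
      by rewrite /c; ring.
    by apply: lerD; apply: ler_wpM2r.
  have TB x : cmod (Tt x) <= c by rewrite /c -(cmodN (A t)) cmod_potential_le.
  have hsq : h ^+ 2 <= `|h| * (1 / 2).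
    by rewrite -real_normK ?num_real // expr2 ler_wpM2l.
  have QB : bounded01 (fun x => Q2 x - Q1 x) (2 * c * `|h|).
    move=> x _ _; rewrite QE; apply: le_trans (cmodD _ _) _.
    rewrite cmodM cmod_real.
    have := ler_wpM2l (normr_ge0 h) (TB x); have := erB x.
    have : 2 * c * h ^+ 2 <= 2 * c * (`|h| * (1 / 2)) by rewrite ler_wpM2l // mulr_ge0.
    by move=> e1 e2 e3; lra.
  have Q1K : bounded01 Q1 K.
    by apply: hill_coef_bounded; rewrite /K -/c lerD2r; lra.
  have Q2K : bounded01 Q2 K.
    move=> x x0 x1; rewrite -(subrK (Q1 x) (Q2 x)); apply: le_trans (cmodD _ _) _.
    have := QB x x0 x1; have := hill_coef_bounded (lexx (cmod (A t) + cmod (B t) + cmod mu)) x0 x1.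
    rewrite -/c -/(Q1 x) /K.
    have : 2 * c * `|h| <= 2 * c * (1 / 2) by rewrite ler_wpM2l // mulr_ge0.
    move=> e1 e2 e3; lra.
  have := tr_expand a1 a2 Q1K Q2K QB; rewrite mulr0 subr0 -/(G t) -/(G (t + h)).
  have cT : ccont Tt := potential_ccont _ _.
  have ck : ccont (qform Q1) := kern_ccont a1 a1.
  have cer : ccont er.
    apply: (@ccont_ext _ (fun x => Q2 x - Q1 x - h%:C * Tt x)) => [x|].
      by rewrite QE addrC addKr.
    by have [[? _] [? _]] := (a1, a2); prove_ccont.
  have -> : ci (fun x => (Q2 x - Q1 x) * qform Q1 x) = ci (fun x => er x * qform Q1 x).
    under eq_ci do rewrite QE mulrDl -mulrA.
    rewrite ciD ?ciZ; [|prove_ccont..].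
    by rewrite potential_deriv_orthogonal mulr0 add0r.
  move=> e1.
  have e2 : cmod (ci (fun x => er x * qform Q1 x)) <= 2 * c * h ^+ 2 * (4 * growth K ^+ 3).
    apply: cmod_ci_le => [|x x0 x1]; first by prove_ccont.
    rewrite cmodM; apply: ler_pM => //; exact: kern_bound.
  rewrite -(subrK (ci (fun x => er x * qform Q1 x)) (G (t + h) - G t)).
  apply: le_trans (cmodD _ _) _; apply: le_trans (lerD e1 e2) _.
  by rewrite exprMn real_normK ?num_real //; lra.
have := cder_const dG tau; rewrite /G /A /B oppr0 expR0 !mul1r; exact.
Qed.

End Invariance.

(** * The discriminant on the real line: reality and lower bound *)

Section TraceValues.
Variable R : realType.
Implicit Types (a b mu : R[i]) (Q : R -> R[i]).

Lemma tr_lip Q1 Q2 (K d : R) : admissible Q1 -> admissible Q2 ->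
  bounded01 Q1 K -> bounded01 Q2 K -> bounded01 (fun x => Q2 x - Q1 x) d ->
  cmod (tr Q2 - tr Q1) <= d * (4 * growth K ^+ 3).
Proof.
move=> a1 a2 Q1K Q2K Qd; rewrite tr_diff //.
have [[c1 _] [c2 _]] := (a1, a2); have ck := kern_ccont a1 a2.
apply: cmod_ci_le => [|x x0 x1]; first by prove_ccont.
by rewrite cmodM; apply: ler_pM => //; [exact: Qd|exact: kern_bound].
Qed.

(** With one coefficient equal to zero the flow can shrink the other to zero while the trace stays
    constant; continuity of the trace in the potential gives the free value. *)
Lemma tr_degenerate a b mu : a = 0 \/ b = 0 ->
  tr (hill_coef a b mu) = tr (hill_coef 0 0 mu).
Proof.
move=> ab0; apply/eqP; rewrite -subr_eq0 -cmod_eq0 eq_le cmod_ge0 andbT.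
pose c := cmod a + cmod b; pose K := c + cmod mu.
apply: (@le0_geometric _ _ (c * (4 * growth K ^+ 3))) => n.
pose s : R := 2^-1 ^+ n.
have s0 : 0 < s by rewrite exprn_gt0 // invr_gt0.
have s1 : s <= 1 by rewrite exprn_ile1 // ?invr_ge0 // invf_le1 ?ltr0n // ler1n.
have [tau e] : exists tau : R,
    hill_coef ((expR (- tau))%:C * a) ((expR tau)%:C * b) mu = hill_coef (s%:C * a) (s%:C * b) mu.
  case: ab0 => ->.
  - by exists (ln s); rewrite !mulr0 lnK // posrE.
  - by exists (- ln s); rewrite !mulr0 opprK lnK // posrE.
rewrite -(tr_rescale _ _ _ tau) e.
have bnd x : cmod (potential (s%:C * a) (s%:C * b) x) <= s * c.
  apply: le_trans (cmod_potential_le _ _ _) _.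
  by rewrite !cmodM cmod_real ger0_norm ?(ltW s0) // -mulrDr.
have c0 : 0 <= c by rewrite addr_ge0.
have p00 x : hill_coef 0 0 mu x = - mu.
  by rewrite /hill_coef /potential !mul0r addr0 sub0r.
rewrite [leRHS](_ : _ = s * c * (4 * growth K ^+ 3)); last by rewrite /s; ring.
apply: tr_lip; try exact: hill_coef_admissible.
- by move=> x _ _; rewrite p00 cmodN /K lerDr.
- move=> x _ _; apply: le_trans (cmodB _ _) _; rewrite lerD2r; apply: le_trans (bnd x) _.
  by rewrite ler_piMl.
- by move=> x _ _; rewrite p00 /hill_coef opprK subrK.
Qed.

Lemma ode_conj Q (y p : R -> R[i]) : ode Q y p ->
  ode (fun x => (Q x)^*%C) (fun x => (y x)^*%C) (fun x => (p x)^*%C).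
Proof.
move=> [dy dp]; split; first exact: cderJ.
by apply: cder_ext (cderJ dp) => // x; rewrite conjcM.
Qed.

Lemma ode_shift Q (y p : R -> R[i]) (s : R) : ode Q y p ->
  ode (fun x => Q (x + s)) (fun x => y (x + s)) (fun x => p (x + s)).
Proof. by move=> [dy dp]; split; [exact: cder_shift dy|exact: cder_shift s dp]. Qed.

Lemma ode_ext Q1 Q2 (y p : R -> R[i]) : Q1 =1 Q2 -> ode Q1 y p -> ode Q2 y p.
Proof. by move=> /funext ->. Qed.

Lemma tr_real Q : admissible Q -> (forall x, (Q x)^*%C = Q x) -> (tr Q)^*%C = tr Q.
Proof.
move=> aQ QJ.
have [_ ep] := ode_rep aQ (ode_ext QJ (ode_conj (ode_fph aQ))) 1.
have [et _] := ode_rep aQ (ode_ext QJ (ode_conj (ode_fth aQ))) 1.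
rewrite /tr conjcD [X in X + _ = _]ep [X in _ + X = _]et.
rewrite fth0 // fth'0 // fph0 // fph'0 //.
by rewrite !conjc1 !conjc0 !mul1r !mul0r add0r addr0.
Qed.

(** [T] is the trace of N times its complex conjugate, where N has rows (p, q) and (r, s). The
    diagonal squares give at least 2|ps|, the cross terms at least -2|qr|, and det N = 1 gives |ps|
    >= |qr| - 1. *)
Lemma conj_trace_ge (p q r s : R[i]) : p * s - r * q = 1 ->
  let T := (p * p^*%C + q * r^*%C) + (r * q^*%C + s * s^*%C) in
  T^*%C = T /\ -2 <= Re T.
Proof.
move=> det T; split.
  by rewrite /T !(conjcD, conjcM) !conjcK; ring.
rewrite /T !cReD !mulcJ /=.
have e1 : cmod (p * s) ^+ 2 = cmod p ^+ 2 * cmod s ^+ 2 by rewrite cmodM exprMn.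
have e2 : Re (q * r^*%C) + Re (r * q^*%C) = 2 * Re (r * q^*%C).
  rewrite (_ : q * r^*%C = (r * q^*%C)^*%C); last by rewrite conjcM conjcK mulrC.
  by rewrite cReJ; ring.
have e3 : - (cmod r * cmod q) <= Re (r * q^*%C).
  by have := ler_Re_cmod (r * q^*%C); rewrite cmodM cmodJ ler_norml => /andP[].
have e4 : cmod (r * q) - 1 <= cmod (p * s).
  rewrite (_ : p * s = r * q - (- 1)); last by rewrite opprK -det; ring.
  by have := cmod_sub_le (r * q) (-1); rewrite cmodN cmod1.
have e5 := sqr_ge0 (cmod p - cmod s).
rewrite !cmodM in e4.
by rewrite sqrrB in e5; lra.
Qed.

(** A shift by half a period conjugates the equation, so the conjugate of the monodromy matrix is N
    times its conjugate, with N the fundamental matrix at 1/2. *)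
Lemma tr_half_conj Q : admissible Q -> (forall x, Q (x + 1 / 2) = (Q x)^*%C) ->
  (tr Q)^*%C = tr Q /\ -2 <= Re (tr Q).
Proof.
move=> aQ Qh.
have QJ x : (Q (x + 1 / 2))^*%C = Q x by rewrite Qh conjcK.
pose h : R := 1 / 2.
have rep y p : ode Q y p ->
    (y 1)^*%C = (y h)^*%C * fth Q h + (p h)^*%C * fph Q h /\
    (p 1)^*%C = (y h)^*%C * fth' Q h + (p h)^*%C * fph' Q h.
  move=> oy; have := ode_rep aQ (ode_ext QJ (ode_conj (ode_shift h oy))) h.
  by rewrite add0r (_ : h + h = 1) // /h; field.
have [et _] := rep _ _ (ode_fth aQ); have [_ ep] := rep _ _ (ode_fph aQ).
have det := fundamental_det aQ h.
have [e1 e2] := conj_trace_ge det.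
set T := (X in X^*%C = X) in e1 *.
have tJ : (tr Q)^*%C = T.
  by rewrite /tr conjcD [X in X + _ = _]ep [X in _ + X = _]et /T; ring.
have tE : tr Q = T by rewrite -[LHS]conjcK tJ e1.
by rewrite tE.
Qed.

Lemma potential_half a b (x : R) : potential a b (x + 1 / 2) = - potential a b x.
Proof.
rewrite /potential.
rewrite (_ : - (2 * pi * (x + 1 / 2)) = - (2 * pi * x) + - pi); last by field.
rewrite (_ : 2 * pi * (x + 1 / 2) = 2 * pi * x + pi); last by field.
rewrite (expiD (- (2 * pi * x))) (expiD (2 * pi * x)) (expiN pi) expi_pi.
have -> : (-1 : R[i])^*%C = -1 by apply: complex_ext => /=; rewrite ?oppr0.
by ring.
Qed.

Lemma potential_conj a b (x : R) : (potential a b x)^*%C = potential b^*%C a^*%C x.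
Proof. by rewrite /potential conjcD !conjcM -!expiN opprK addrC. Qed.

Lemma ab_conj a b : a * b \is Num.real -> cmod a = cmod b -> b != 0 ->
  (0 <= Re (a * b) -> b = a^*%C) /\ (Re (a * b) <= 0 -> b = - a^*%C).
Proof.
move=> abr nab b0.
have a0 : a != 0 by rewrite -cmod_eq0 nab cmod_eq0.
have abE : a * b = (Re (a * b))%:C by rewrite RRe_real.
have nE : `|Re (a * b)| = cmod a ^+ 2.
  by rewrite -cmod_real -abE cmodM nab expr2.
split => s.
- apply: (mulfI a0); rewrite mulcJ abE -nE ger0_norm //.
- apply: (mulfI a0); rewrite mulrN mulcJ abE -nE ler0_norm // rmorphN opprK //.
Qed.

Lemma discriminant_real a b (l : R) : a * b \is Num.real ->
  (discriminant a b l%:C)^*%C = discriminant a b l%:C /\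
  (Re (a * b) <= 0 -> -2 <= Re (discriminant a b l%:C)).
Proof.
move=> abr; rewrite discriminantE.
have [ab0|ab0] := eqVneq (a * b) 0.
  have -> : tr (hill_coef a b l%:C) = tr (hill_coef 0 0 l%:C).
    by apply: tr_degenerate; move/eqP: ab0; rewrite mulf_eq0 => /orP[] /eqP ->; [left|right].
  have [|e1 e2] := tr_half_conj (hill_coef_admissible 0 0 l%:C) _; last by split.
  by move=> x; rewrite /hill_coef /potential !mul0r addr0 sub0r conjcN conjc_real.
have [a0 b0] : a != 0 /\ b != 0 by apply/andP; rewrite -negb_or -mulf_eq0.
have pa : 0 < cmod a by rewrite cmod_gt0.
have pb : 0 < cmod b by rewrite cmod_gt0.
(* At this time of the flow the moduli of the two coefficients agree, while their product is
   unchanged. *)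
pose tau := ln (cmod a / cmod b) / 2.
have et : expR tau ^+ 2 = cmod a / cmod b.
  rewrite expr2 -expRD /tau (_ : _ + _ = ln (cmod a / cmod b)); last by field.
  by rewrite lnK // posrE divr_gt0.
pose a' := (expR (- tau))%:C * a; pose b' := (expR tau)%:C * b.
have ab' : a' * b' = a * b.
  rewrite /a' /b' mulrACA -realCM -expRD addNr expR0 mul1r //.
have n' : cmod a' = cmod b'.
  rewrite /a' /b' !cmodM !cmod_real !gtr0_norm ?expR_gt0 // expRN.
  have e0 : expR tau != 0 by rewrite gt_eqF // expR_gt0.
  apply: (mulfI e0); rewrite mulrA mulfV // mul1r mulrA -expr2 et.
  by rewrite divfK // gt_eqF.
have b'0 : b' != 0.
  by rewrite -cmod_gt0 -n' cmodM mulr_gt0 // cmod_gt0 eq_complex /= negb_and gt_eqF ?expR_gt0.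
have abr' : a' * b' \is Num.real by rewrite ab'.
have [hp hn] := ab_conj abr' n' b'0; rewrite ab' in hp hn.
rewrite -(tr_rescale _ _ _ tau) -/a' -/b'.
have aQ := hill_coef_admissible a' b' l%:C.
have [s|s] := leP 0 (Re (a * b)); last first.
  have bE := hn (ltW s).
  have [|e1 e2] := tr_half_conj aQ _; last by split.
  move=> x; rewrite /hill_coef potential_half conjcB conjc_real potential_conj bE.
  by rewrite /potential conjcN conjcK; ring.
have bE := hp s; split.
  apply: tr_real => // x.
  by rewrite /hill_coef conjcB conjc_real potential_conj bE conjcK.
move=> s'; exfalso; move/eqP: ab0; apply.
by rewrite -(RRe_real abr) (_ : Re (a * b) = 0) //; apply/eqP; rewrite eq_le s'.
Qed.

End TraceValues.

(** * Asymptotics of the discriminant at high energy *)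

Section Asymptotics.
Variable R : realType.
Implicit Types (a b : R[i]).

(** The energy |p|^2 + w^2 |y|^2 of the free oscillator changes only through [q]: its logarithmic
    derivative is at most c/w <= 1/2, and exp(-1/2) >= 1/2 accounts for the factor 2. Unlike the
    Gronwall bound this stays useful as w grows. *)
Lemma energy_bound (q y p : R -> R[i]) (c w : R) : 0 < w -> 0 <= c -> 2 * c <= w ->
  (forall x, cmod (q x) <= c) -> ode (fun x => q x - (w ^+ 2)%:C) y p ->
  forall x, 0 <= x -> x <= 1 ->
  cmod (p x) ^+ 2 + w ^+ 2 * cmod (y x) ^+ 2 <= 2 * (cmod (p 0) ^+ 2 + w ^+ 2 * cmod (y 0) ^+ 2).
Proof.
move=> w0 c0 cw qc [dy dp] x x0 x1.
pose E (t : R) := cmod (p t) ^+ 2 + w ^+ 2 * cmod (y t) ^+ 2.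
pose E' (t : R) := 2 * Re ((p t)^*%C * (q t * y t)).
have dE (t : R) : is_derive t (1 : R) E (E' t).
  have dw : is_derive t (1 : R) (fun=> w ^+ 2) 0 by exact: is_derive_cst.
  have H := is_derive_addr (is_derive_cmod_sqr t dp) (is_derive_mulr dw (is_derive_cmod_sqr t dy)).
  by apply: (is_derive_eq H); rewrite /E' !cReImE /=; ring.
pose k := c / w.
have k0 : 0 <= k by rewrite divr_ge0 // ltW.
have k1 : k <= 1 / 2 by rewrite ler_pdivrMr //; lra.
have E'le (t : R) : E' t <= k * E t.
  have a1 := Re_le_cmod (p t) (q t * y t); rewrite cmodM in a1.
  have a2 : cmod (p t) * (cmod (q t) * cmod (y t)) <= cmod (p t) * (c * cmod (y t)).
    by rewrite ler_wpM2l // ler_wpM2r.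
  have a3 : 2 * (cmod (p t) * (c * cmod (y t))) = k * (2 * cmod (p t) * (w * cmod (y t))).
    by rewrite /k; field; rewrite gt_eqF.
  have a4 : k * (2 * cmod (p t) * (w * cmod (y t))) <= k * E t.
    apply: ler_wpM2l => //; have := sqr_ge0 (cmod (p t) - w * cmod (y t)).
    by rewrite sqrrB exprMn /E; lra.
  by rewrite /E'; lra.
pose G (t : R) := expR (- k * t) * E t.
have dG (t : R) : is_derive t (1 : R) G (- k * expR (- k * t) * E t + expR (- k * t) * E' t).
  exact: is_derive_mulr (is_derive_expRZ _ _) (dE t).
have d0 (t : R) : is_derive t (1 : R) (fun=> 0 : R) 0 by exact: is_derive_cst.
have := le_increment x0 dG d0.
have /[swap] /[apply] : forall t : R, 0 < t -> t < x ->
    - k * expR (- k * t) * E t + expR (- k * t) * E' t <= 0.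
  move=> t _ _; have := ler_wpM2l (ltW (expR_gt0 (- k * t))) (E'le t); lra.
rewrite /G mulr0 expR0 mul1r subrr => h.
have E0 (t : R) : 0 <= E t by apply: addr_ge0; [|apply: mulr_ge0]; exact: sqr_ge0.
have e1 : 1 / 2 <= expR (- k * x).
  have := expR_ge1Dx (- k * x); have : k * x <= 1 / 2 * 1 by apply: ler_pM.
  by rewrite mulNr; lra.
have := ler_wpM2r (E0 x) e1; rewrite -/(E x) -/(E 0); lra.
Qed.

Lemma free_solution (w : R) : 0 < w ->
  let Q := hill_coef 0 0 (w ^+ 2)%:C in
  forall x, [/\ fth Q x = (cos (w * x))%:C, fth' Q x = (- w * sin (w * x))%:C,
    fph Q x = (w^-1 * sin (w * x))%:C & fph' Q x = (cos (w * x))%:C].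
Proof.
move=> w0 Q x; have wn : w != 0 by rewrite gt_eqF.
have aQ : admissible Q := hill_coef_admissible _ _ _.
have QE t : Q t = (- w ^+ 2)%:C.
  by rewrite /Q /hill_coef /potential !mul0r addr0 sub0r rmorphN.
have dc (t : R) : is_derive t (1 : R) (fun t => cos (w * t)) (- w * sin (w * t)).
  have := @is_derive_affine_comp R cos _ w 0 t (is_derive_cos _).
  by under eq_fun do rewrite addr0; rewrite addr0 mulrN mulNr.
have ds (t : R) : is_derive t (1 : R) (fun t => sin (w * t)) (w * cos (w * t)).
  have := @is_derive_affine_comp R sin _ w 0 t (is_derive_sin _).
  by under eq_fun do rewrite addr0; rewrite addr0.
have dZ (k : R) (f f' : R -> R) : (forall t : R, is_derive t (1 : R) f (f' t)) ->
    cder (fun t => (k * f t)%:C) (fun t => (k * f' t)%:C).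
  move=> df; apply: cder_ext (cderZ k%:C (cder_real df)) => t; exact: esym (realCM _ _).
have ot : ode Q (fun t => (cos (w * t))%:C) (fun t => (- w * sin (w * t))%:C).
  split; first exact: cder_real.
  by apply: cder_ext (dZ _ _ _ ds) => // t; rewrite QE -realCM; congr (_%:C); ring.
have op : ode Q (fun t => (w^-1 * sin (w * t))%:C) (fun t => (cos (w * t))%:C).
  split; first by apply: cder_ext (dZ _ _ _ ds) => // t; rewrite mulKf.
  by apply: cder_ext (cder_real dc) => // t; rewrite QE -realCM; congr (_%:C); field.
have [e1 e2] := ode_rep aQ ot x; have [e3 e4] := ode_rep aQ op x.
move: e1 e2 e3 e4; rewrite !mulr0 cos0 sin0 !mulr0 !mul1r !mul0r !addr0 !add0r => -> -> -> ->.
by split.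
Qed.

(** [tr_diff] against the free equation. In each of the four products of the kernel the factors w
    and 1/w combine to at most 2/w, which gives 8. *)
Lemma discriminant_asymptotics a b (w : R) : 0 < w -> 2 * (cmod a + cmod b) <= w ->
  cmod (discriminant a b (w ^+ 2)%:C - (2 * cos w)%:C) <= 8 * (cmod a + cmod b) / w.
Proof.
move=> w0 cw; set c := cmod a + cmod b in cw *.
have c0 : 0 <= c by rewrite addr_ge0.
have wn : w != 0 by rewrite gt_eqF.
pose Q0 := hill_coef 0 0 (w ^+ 2)%:C : R -> R[i]; pose Q := hill_coef a b (w ^+ 2)%:C.
have a0 : admissible Q0 := hill_coef_admissible _ _ _.
have aQ : admissible Q := hill_coef_admissible _ _ _.
have fs := free_solution w0.
have trQ0 : tr Q0 = (2 * cos w)%:C.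
  have [f1 f2 f3 f4] := fs 1.
  rewrite /tr f1 f4 mulr1 -rmorphD; congr (_%:C); ring.
rewrite discriminantE -/Q -trQ0 tr_diff //.
have [[c1 _] [c2 _]] := (aQ, a0); have ck := kern_ccont a0 aQ.
have iw : 0 < w^-1 by rewrite invr_gt0.
apply: cmod_ci_le => [|x x0 x1]; first by prove_ccont.
rewrite (_ : Q x - Q0 x = potential a b x); last first.
  by rewrite /Q /Q0 /hill_coef {2}/potential !mul0r; ring.
rewrite cmodM [leRHS](_ : _ = c * (8 * w^-1)); last by ring.
apply: ler_pM => //; first exact: cmod_potential_le.
have sqle (u v : R) : 0 <= u -> 0 <= v -> u ^+ 2 <= v ^+ 2 -> u <= v.
  by move=> u0 v0; rewrite ler_pXn2r ?nnegrE.
have tb : cmod (fth Q x) <= 2.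
  have := energy_bound w0 c0 cw (cmod_potential_le a b) (ode_fth aQ) x0 x1.
  rewrite fth0 // fth'0 // cmod0 cmod1 expr0n add0r expr1n mulr1 => h.
  apply: sqle => //; rewrite -(ler_pM2l (exprn_gt0 2 w0)).
  have := sqr_ge0 (cmod (fth' Q x)); have := sqr_ge0 w; lra.
have pb : cmod (fph Q x) <= 2 * w^-1.
  have := energy_bound w0 c0 cw (cmod_potential_le a b) (ode_fph aQ) x0 x1.
  rewrite fph0 // fph'0 // cmod0 cmod1 expr0n expr1n mulr0 addr0 mulr1 => h.
  apply: sqle => //; first by rewrite mulr_ge0 // ltW.
  rewrite -(ler_pM2l (exprn_gt0 2 w0)) [leRHS](_ : _ = 4); last by field.
  have := sqr_ge0 (cmod (fph' Q x)); lra.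
have [F1 F2 F3 F4] := fs x; have [G1 G2 G3 G4] := fs 1.
have absM (u v B C : R) : `|u| <= B -> `|v| <= C -> `|u * v| <= B * C.
  by move=> hu hv; rewrite normrM; exact: ler_pM.
have cosb t : `|cos t : R| <= 1 by rewrite ler_norml cos_geN1 cos_le1.
have sinb t : `|sin t : R| <= 1 by rewrite ler_norml sin_geN1 sin_le1.
have b1 : cmod (fth Q0 x) <= 1 by rewrite F1 cmod_real.
have b3 : cmod (fph Q0 x) <= w^-1.
  by rewrite F3 cmod_real -[leRHS]mulr1 absM // ger0_norm // ltW.
have d1 : cmod (fth Q0 1) <= 1 by rewrite G1 cmod_real.
have d4 : cmod (fph' Q0 1) <= 1 by rewrite G4 cmod_real.
have d3 : cmod (fph Q0 1) <= w^-1.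
  by rewrite G3 cmod_real -[leRHS]mulr1 absM // ger0_norm // ltW.
have d2 : cmod (fth' Q0 1) <= w.
  by rewrite G2 cmod_real -[leRHS]mulr1 absM // normrN ger0_norm // ltW.
have m3 (u v z : R[i]) (A B C : R) : cmod u <= A -> cmod v <= B -> cmod z <= C ->
    cmod (u * (v * z)) <= A * (B * C).
  move=> hu hv hz; rewrite !cmodM; apply: ler_pM => //; first by rewrite mulr_ge0.
  exact: ler_pM.
apply: le_trans (cmodD _ _) _; apply: le_trans (lerD (cmodB _ _) (lexx _)) _.
apply: le_trans (lerD (lerD (cmodB _ _) (lexx _)) (lexx _)) _.
have h1 := m3 _ _ _ _ _ _ d4 b1 pb; have h2 := m3 _ _ _ _ _ _ d2 b3 pb.
have h3 := m3 _ _ _ _ _ _ d1 b3 tb; have h4 := m3 _ _ _ _ _ _ d3 b1 tb.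
rewrite [w * _]mulrA mulfV // in h2.
lra.
Qed.

End Asymptotics.

(** * Absolutely continuous and square integrable functions *)

Section AbsolutelyContinuous.
Variable R : realType.
Local Notation leb := (@lebesgue_measure R).
Implicit Types (D : set R) (c d x y : R) (f g h p w v z : R -> R[i]).

Lemma integrable_sub D (a b : R) (f : R -> R) : `[a, b] `<=` D ->
  measurable (D : set (measurableTypeR R)) ->
  leb.-integrable D (EFin \o f) -> leb.-integrable `[a, b] (EFin \o f).
Proof. by move=> s mD; exact: integrableS. Qed.

Lemma subset_itvcc (a b a' b' : R) : a' <= a -> b <= b' -> `[a, b] `<=` `[a', b'].
Proof.
by move=> h1 h2 t /=; rewrite !in_itv /= => /andP[h3 h4]; rewrite (le_trans h1) ?(le_trans h4).
Qed.

Lemma Rintegral_split (f : R -> R) (a m b : R) : a <= m -> m <= b ->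
  leb.-integrable `[a, b] (EFin \o f) ->
  \int[leb]_(t in `[a, b]) f t = \int[leb]_(t in `[a, m]) f t + \int[leb]_(t in `[m, b]) f t.
Proof.
move=> am mb fi.
have := @Rintegral_itvB R f (BLeft a) (BRight b) m fi.
rewrite !bnd_simp => /(_ am mb).
rewrite Rintegral_itv_obnd_cbnd; last first.
  apply: integrableS fi => // t /=; rewrite !in_itv /= => /andP[mt tb].
  by rewrite tb (le_trans am (ltW mt)).
by move=> <-; ring.
Qed.

Definition cmeas D f := measurable_fun D (Re \o f) /\ measurable_fun D (Im \o f).

(** Comparable to the modulus, but its integrability is read off from the two parts. *)
Definition csum f x : R := `|Re (f x)| + `|Im (f x)|.

Lemma csum_ge0 f x : 0 <= csum f x. Proof. by rewrite addr_ge0. Qed.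

Lemma cmod_le_csum f x : cmod (f x) <= csum f x. Proof. exact: cmod_le_ReIm. Qed.

Lemma csum_integrable D f : measurable (D : set (measurableTypeR R)) ->
  cintegrable D f -> leb.-integrable D (EFin \o csum f).
Proof.
move=> mD [f1 f2].
have := integrableD mD (integrable_abse f1) (integrable_abse f2).
by congr integrable.
Qed.

Lemma cintegrable_meas D f : cintegrable D f -> cmeas D f.
Proof.
by move=> [/measurable_int /measurable_EFinP f1 /measurable_int /measurable_EFinP f2].
Qed.

Lemma cintegrable_bound D f (u : R -> R) : measurable (D : set (measurableTypeR R)) ->
  cmeas D f -> leb.-integrable D (EFin \o u) ->
  (forall x, D x -> cmod (f x) <= u x) -> cintegrable D f.
Proof.
move=> mD [f1 f2] iu fu; split.
- apply: (le_integrable mD _ _ iu); first exact/measurable_EFinP.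
  move=> x Dx; rewrite /= lee_fin; apply: le_trans (ler_Re_cmod _) _.
  by apply: le_trans (fu x Dx) (ler_norm _).
- apply: (le_integrable mD _ _ iu); first exact/measurable_EFinP.
  move=> x Dx; rewrite /= lee_fin; apply: le_trans (ler_Im_cmod _) _.
  by apply: le_trans (fu x Dx) (ler_norm _).
Qed.

Lemma cmeasD D f g : cmeas D f -> cmeas D g -> cmeas D (fun x => f x + g x).
Proof.
move=> [f1 f2] [g1 g2]; split.
- rewrite (_ : Re \o _ = (Re \o f) \+ (Re \o g)); last by apply/funext => t; rewrite /= cReD.
  exact: measurable_funD.
- rewrite (_ : Im \o _ = (Im \o f) \+ (Im \o g)); last by apply/funext => t; rewrite /= cImD.
  exact: measurable_funD.
Qed.

Lemma cmeasM D f g : cmeas D f -> cmeas D g -> cmeas D (fun x => f x * g x).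
Proof.
move=> [f1 f2] [g1 g2]; split.
- rewrite (_ : Re \o _ = ((Re \o f) \* (Re \o g)) \- ((Im \o f) \* (Im \o g))); last first.
    by apply/funext => t; rewrite /= cReM.
  by apply: measurable_funB; exact: measurable_funM.
- rewrite (_ : Im \o _ = ((Re \o f) \* (Im \o g)) \+ ((Im \o f) \* (Re \o g))); last first.
    by apply/funext => t; rewrite /= cImM.
  by apply: measurable_funD; exact: measurable_funM.
Qed.

Lemma cmeas_cst D (k : R[i]) : cmeas D (fun=> k).
Proof. by split; exact: measurable_cst. Qed.

Lemma cmeasZ D (k : R[i]) f : cmeas D f -> cmeas D (fun x => k * f x).
Proof. exact/cmeasM/cmeas_cst. Qed.

Lemma cmeasN D f : cmeas D f -> cmeas D (fun x => - f x).
Proof.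
move=> /(cmeasZ (-1)); rewrite (_ : (fun x => _ * _) = fun x => - f x) //.
by apply/funext => t; rewrite mulN1r.
Qed.

Lemma cmeasB D f g : cmeas D f -> cmeas D g -> cmeas D (fun x => f x - g x).
Proof. by move=> mf mg; exact: cmeasD mf (cmeasN mg). Qed.

Lemma cmeasJ D f : cmeas D f -> cmeas D (fun x => (f x)^*%C).
Proof.
move=> [f1 f2]; split.
- by rewrite (_ : Re \o _ = Re \o f) //; apply/funext => t; rewrite /= cReJ.
- rewrite (_ : Im \o _ = \- (Im \o f)); last by apply/funext => t; rewrite /= cImJ.
  exact: measurableT_comp.
Qed.

Lemma cmeas_sub D D' f : D' `<=` D -> measurable (D : set (measurableTypeR R)) ->
  cmeas D f -> cmeas D' f.
Proof. by move=> s mD [f1 f2]; split; exact: measurable_funS mD s _. Qed.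

Lemma ccont_meas D f : measurable (D : set (measurableTypeR R)) -> ccont f -> cmeas D f.
Proof.
move=> mD [f1 f2].
by split; apply: (@measurable_funS _ _ _ _ setT) => //; exact: continuous_measurable_fun.
Qed.

Lemma cintegral_split f (a m b : R) : a <= m -> m <= b -> cintegrable `[a, b] f ->
  cintegral `[a, b] f = cintegral `[a, m] f + cintegral `[m, b] f.
Proof.
move=> am mb [f1 f2]; apply: complex_ext; rewrite /= ?cReD ?cImD /=.
- exact: Rintegral_split.
- exact: Rintegral_split.
Qed.

Lemma cintegrable_sub D f (a b : R) : `[a, b] `<=` D ->
  measurable (D : set (measurableTypeR R)) -> cintegrable D f -> cintegrable `[a, b] f.
Proof. by move=> s mD [f1 f2]; split; exact: integrable_sub s mD _. Qed.

Definition cmass g x y : R := \int[leb]_(t in `[x, y]) csum g t.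

Lemma cmass_ge0 g x y : 0 <= cmass g x y.
Proof. by apply: Rintegral_ge0 => t _; exact: csum_ge0. Qed.

Section ByParts.
Variables (c d : R) (p g : R -> R[i]).
Hypotheses (cd : c <= d) (ac : abs_cont `[c, d] p g).

Lemma abs_cont_integrable : cintegrable `[c, d] g. Proof. by case: (ac cd). Qed.

Local Notation mass := (cmass g).

Lemma csum_integrable_sub x y : c <= x -> y <= d -> leb.-integrable `[x, y] (EFin \o csum g).
Proof.
move=> cx yd; apply: csum_integrable => //.
by apply: cintegrable_sub abs_cont_integrable => //; exact: subset_itvcc.
Qed.

Lemma cmassD x m y : c <= x -> x <= m -> m <= y -> y <= d -> mass x y = mass x m + mass m y.
Proof. by move=> cx xm my yd; apply: Rintegral_split => //; exact: csum_integrable_sub. Qed.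

Lemma abs_contE x y : c <= x -> x <= y -> y <= d ->
  cintegrable `[x, y] g /\ p y - p x = cintegral `[x, y] g.
Proof. by move=> cx xy yd; apply: ac => //; exact: subset_itvcc. Qed.

Lemma abs_cont_le_cmass x y : c <= x -> x <= y -> y <= d -> cmod (p y - p x) <= mass x y.
Proof.
move=> cx xy yd; have [gi' ->] := abs_contE cx xy yd.
apply: cmod_cintegral_le => //; first exact: csum_integrable_sub.
by move=> t _; exact: cmod_le_csum.
Qed.

Lemma abs_cont_bounded : exists B, forall x, c <= x -> x <= d -> cmod (p x) <= B.
Proof.
exists (cmod (p c) + mass c d) => x cx xd.
rewrite -(subrK (p c) (p x)) addrC; apply: le_trans (cmodD _ _) _.
rewrite lerD2l; apply: le_trans (abs_cont_le_cmass (lexx _) cx xd) _.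
by rewrite (cmassD (lexx c) cx xd (lexx d)) lerDl cmass_ge0.
Qed.

Lemma abs_cont_within : {within `[c, d], continuous (Re \o p)} /\
  {within `[c, d], continuous (Im \o p)}.
Proof.
have [g1 g2] := abs_cont_integrable.
have cP (u : R -> R) (k : R) : leb.-integrable `[c, d] (EFin \o u) ->
    {within `[c, d], continuous (fun x => k + parameterized_integral leb c x u)}.
  move=> iu x; apply: cvgD; first exact: cvg_cst.
  exact: parameterized_integral_continuous.
split.
- apply: (@subspace_eq_continuous _ _ _ (fun x => Re (p c) + parameterized_integral leb c x (Re \o g)) _ _ (cP _ _ g1)).
  move=> x; rewrite inE /= in_itv /= => /andP[cx xd].
  have [_ e] := abs_contE (lexx c) cx xd.
  have e' : parameterized_integral leb c x (Re \o g) = Re (p x) - Re (p c) by rewrite -cReB e.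
  by rewrite e' /=; ring.
- apply: (@subspace_eq_continuous _ _ _ (fun x => Im (p c) + parameterized_integral leb c x (Im \o g)) _ _ (cP _ _ g2)).
  move=> x; rewrite inE /= in_itv /= => /andP[cx xd].
  have [_ e] := abs_contE (lexx c) cx xd.
  have e' : parameterized_integral leb c x (Im \o g) = Im (p x) - Im (p c) by rewrite -cImB e.
  by rewrite e' /=; ring.
Qed.

Lemma abs_cont_meas : cmeas `[c, d] p.
Proof.
by have [c1 c2] := abs_cont_within; split; exact: subspace_continuous_measurable_fun.
Qed.

End ByParts.

Lemma cintegrable_mulr D f w (B : R) : measurable (D : set (measurableTypeR R)) ->
  cintegrable D f -> cmeas D w -> (forall x, D x -> cmod (w x) <= B) ->
  cintegrable D (fun x => f x * w x).
Proof.
move=> mD fi wm wB.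
apply: (@cintegrable_bound _ _ (fun x => B * csum f x)) => //.
- by apply: cmeasM => //; exact: cintegrable_meas.
- rewrite (_ : EFin \o _ = (fun x => B%:E * (EFin \o csum f) x)%E) //.
  exact/integrableZl/csum_integrable.
- move=> x Dx; rewrite cmodM mulrC; apply: ler_pM => //; first exact: wB.
  exact: cmod_le_csum.
Qed.

(** The defect [Delta] of the formula is additive over adjacent intervals, and since [w] is
    Lipschitz it is bounded by length times mass, a product of two additive quantities; bisection
    sends such a quantity to zero. *)
Lemma abs_cont_by_parts (c d : R) p g w v (C : R) : c <= d ->
  abs_cont `[c, d] p g -> abs_cont `[c, d] w v ->
  (forall x, c <= x -> x <= d -> cmod (v x) <= C) ->
  [/\ cintegrable `[c, d] (fun x => g x * w x), cintegrable `[c, d] (fun x => p x * v x) &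
    cintegral `[c, d] (fun x => g x * w x) + cintegral `[c, d] (fun x => p x * v x) =
    p d * w d - p c * w c].
Proof.
move=> cd acp acw vC.
have gi := abs_cont_integrable cd acp; have vi := abs_cont_integrable cd acw.
have [Bp pB] := abs_cont_bounded cd acp; have [Bw wB] := abs_cont_bounded cd acw.
have mp := abs_cont_meas cd acp; have mw := abs_cont_meas cd acw.
have itvE x : `[c, d]%classic x -> c <= x /\ x <= d.
  by rewrite /= in_itv /= => /andP.
have gwi : cintegrable `[c, d] (fun x => g x * w x).
  by apply: (@cintegrable_mulr _ _ _ Bw) => // x /itvE[]; exact: wB.
have pvi : cintegrable `[c, d] (fun x => p x * v x).
  rewrite (_ : (fun x => _) = fun x => v x * p x); last by apply/funext => t; rewrite mulrC.
  by apply: (@cintegrable_mulr _ _ _ Bp) => // x /itvE[]; exact: pB.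
split => //.
pose G t := g t * w t + p t * v t.
have Gi : cintegrable `[c, d] G by exact: cintegrableD.
have Gi' x y : c <= x -> y <= d -> cintegrable `[x, y] G.
  by move=> cx yd; apply: cintegrable_sub Gi => //; exact: subset_itvcc.
have gi' x y : c <= x -> y <= d -> cintegrable `[x, y] g.
  by move=> cx yd; apply: cintegrable_sub gi => //; exact: subset_itvcc.
have vi' x y : c <= x -> y <= d -> cintegrable `[x, y] v.
  by move=> cx yd; apply: cintegrable_sub vi => //; exact: subset_itvcc.
rewrite -cintegralD //; apply/eqP; rewrite -subr_eq0; apply/eqP.
pose Delta x y := cintegral `[x, y] G - (p y * w y - p x * w x).
rewrite -[LHS]/(Delta c d).
have C0 : 0 <= C by apply: le_trans (vC c (lexx _) cd).
(* halving the interval halves the bound, since [y - x] and the mass are both additive *)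
have bound n : forall x y, c <= x -> x <= y -> y <= d ->
    cmod (Delta x y) <= 2 * C * (y - x) * cmass g x y * 2^-1 ^+ n.
  elim: n => [|n IH] x y cx xy yd; last first.
    pose m := (x + y) / 2.
    have xm : x <= m by rewrite /m; lra.
    have my : m <= y by rewrite /m; lra.
    have -> : Delta x y = Delta x m + Delta m y.
      by rewrite /Delta (cintegral_split xm my (Gi' _ _ cx yd)); ring.
    apply: le_trans (cmodD _ _) _.
    have h1 := IH x m cx xm (le_trans my yd); have h2 := IH m y (le_trans cx xm) my yd.
    apply: le_trans (lerD h1 h2) _.
    rewrite (cmassD cd acp cx xm my yd) exprS.
    have -> : m - x = (y - x) / 2 by rewrite /m; field.
    have -> : y - m = (y - x) / 2 by rewrite /m; field.
    rewrite le_eqVlt; apply/orP; left; apply/eqP.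
    by move: (2^-1 ^+ n) => t; field.
  rewrite expr0 mulr1.
  have cy : c <= y := le_trans cx xy; have xd : x <= d := le_trans xy yd.
  have [_ pE] := abs_contE acp cx xy yd; have [_ wE] := abs_contE acw cx xy yd.
  (* Subtracting an end point value from each undifferentiated factor makes both terms small: one
     factor is then O(y - x), the other bounded by the mass of [g]. *)
  have DE : Delta x y = cintegral `[x, y] (fun t => g t * (w t - w y) + (p t - p x) * v t).
    rewrite (@eq_cintegral _ _ _ (fun t => G t - (w y * g t + p x * v t))); last first.
      by move=> t _; rewrite /G; ring.
    have i1 := cintegrableZ (w y) (measurable_itv _) (gi' x y cx yd).
    have i2 := cintegrableZ (p x) (measurable_itv _) (vi' x y cx yd).
    have e12 : cintegral `[x, y] (fun t => w y * g t + p x * v t) =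
        w y * (p y - p x) + p x * (w y - w x).
      by rewrite pE wE cintegralD // !cintegralZ //; [exact: vi'|exact: gi'].
    by rewrite cintegralB //; [rewrite e12 /Delta; ring|exact: Gi'|exact: cintegrableD].
  pose N := cmass g x y.
  have Ni := csum_integrable_sub cd acp cx yd.
  have mwB t : x <= t -> t <= y -> cmod (w t - w y) <= C * (y - x).
    move=> xt ty; rewrite cmodBC.
    have [wi ->] := abs_contE acw (le_trans cx xt) ty yd.
    have := @cmod_cintegral_le R `[t, y] v (fun=> C) _ wi _ _.
    rewrite Rintegral_cst //= lebesgue_measure_itv /= lte_fin => h.
    apply: le_trans (h _ _ _) _ => //.
    - exact/integrable_continuous/cst_continuous.
    - move=> s /=; rewrite in_itv /= => /andP[ts sy].
      by apply: vC; [exact: le_trans cx (le_trans xt ts)|exact: le_trans sy yd].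
    - by rewrite ler_wpM2l //; case: ifP => //= _; lra.
  have mpB t : x <= t -> t <= y -> cmod (p t - p x) <= N.
    move=> xt ty; apply: le_trans (abs_cont_le_cmass cd acp cx xt (le_trans ty yd)) _.
    by rewrite /N (cmassD cd acp cx xt ty yd) lerDl cmass_ge0.
  have [ui ue] := integrable_lincomb (C * (y - x)) (C * N) (measurable_itv `[x, y]) Ni
    (@integrable_continuous R _ x y (@cst_continuous _ _ (1 : R))).
  rewrite DE; apply: le_trans (cmod_cintegral_le (u := _) _ _ ui _) _ => //.
  - apply: cintegrableD => //.
    + apply: (@cintegrable_mulr _ _ _ (C * (y - x))) => //; first exact: gi'.
        apply: cmeasB (cmeas_cst _ _); apply: cmeas_sub mw => //; exact: subset_itvcc.
      by move=> t /=; rewrite in_itv /= => /andP[]; exact: mwB.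
    + rewrite (_ : (fun t => _) = fun t => v t * (p t - p x)); last by apply/funext => t; rewrite mulrC.
      apply: (@cintegrable_mulr _ _ _ N) => //; first exact: vi'.
        apply: cmeasB (cmeas_cst _ _); apply: cmeas_sub mp => //; exact: subset_itvcc.
      by move=> t /=; rewrite in_itv /= => /andP[]; exact: mpB.
  - move=> t /=; rewrite in_itv /= => /andP[xt ty].
    apply: le_trans (cmodD _ _) _; rewrite !cmodM mulr1 mulrC; apply: lerD.
    + by apply: ler_pM => //; [exact: mwB|exact: cmod_le_csum].
    + rewrite mulrC; apply: ler_pM => //; last exact: mpB.
      by apply: vC; [exact: le_trans cx xt|exact: le_trans ty yd].
  - rewrite ue Rintegral_cst //= lebesgue_measure_itv /= lte_fin -/N.
    rewrite -[X in _ + _ * X](_ : y - x = _); last first.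
      rewrite mul1r; case: ifP => //= /negbT; rewrite -leNgt => yx.
      by rewrite (_ : y = x) ?subrr //; apply/eqP; rewrite eq_le yx.
    by rewrite -/(cmass g x y) -/N; lra.
apply/eqP; rewrite -cmod_eq0 eq_le cmod_ge0 andbT.
by apply: le0_geometric => n; exact: bound.
Qed.

Lemma cder_abs_cont D f p : cder f p -> ccont p -> abs_cont D f p.
Proof.
move=> dy cp a b ab _; split; first exact: ccont_cintegrable.
by rewrite (cintegral_deriv ab dy).
Qed.

Lemma ccont_bounded f (c d : R) : ccont f ->
  exists B, forall x, c <= x -> x <= d -> cmod (f x) <= B.
Proof.
move=> [f1 f2].
have bd (u : R -> R) : continuous u -> exists B, forall x, c <= x -> x <= d -> `|u x| <= B.
  move=> cu; have [dc|cd] := ltP d c.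
    by exists 0 => x cx xd; have := le_trans cx xd; rewrite leNgt dc.
  have cn : {within `[c, d], continuous (fun x => `|u x|)}.
    apply: continuous_subspaceT => x; apply: continuous_comp; first exact: cu.
    exact: norm_continuous.
  have [m _ hm] := EVT_max cd cn.
  by exists `|u m| => x cx xd; apply: hm; rewrite in_itv /= cx.
have [B1 h1] := bd _ f1; have [B2 h2] := bd _ f2.
exists (B1 + B2) => x cx xd; apply: le_trans (cmod_le_ReIm _) _.
by apply: lerD; [exact: h1|exact: h2].
Qed.

End AbsolutelyContinuous.

(** * Pointwise Cauchy data from integral norms *)

Section LocalEstimate.
Variable R : realType.
Implicit Types (u p g f h y z : R -> R[i]) (D : set R).

Lemma abs_cont_by_parts2 (c d : R) u p g (w w' w'' : R -> R[i]) : c <= d ->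
  abs_cont `[c, d] u p -> abs_cont `[c, d] p g ->
  cder w w' -> cder w' w'' -> ccont w'' ->
  [/\ cintegrable `[c, d] (fun x => g x * w x), cintegrable `[c, d] (fun x => u x * w'' x) &
  cintegral `[c, d] (fun x => g x * w x) - cintegral `[c, d] (fun x => u x * w'' x) =
  (p d * w d - u d * w' d) - (p c * w c - u c * w' c)].
Proof.
move=> cd au ap dw dw' cw''.
have [B wB] := ccont_bounded c d (cder_ccont dw').
have [B' wB'] := ccont_bounded c d cw''.
have aw : abs_cont `[c, d] w w' := cder_abs_cont dw (cder_ccont dw').
have aw' : abs_cont `[c, d] w' w'' := cder_abs_cont dw' cw''.
have [i1 i2 e1] := abs_cont_by_parts cd ap aw wB.
have [i3 i4 e2] := abs_cont_by_parts cd au aw' wB'.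
split => //; set s1 := cintegral _ _ in e1 *; set s2 := cintegral _ _ in e1 e2.
set s3 := cintegral _ _ in e2 *.
have -> : s1 - s3 = (s1 + s2) - (s2 + s3) by ring.
by rewrite e1 e2; ring.
Qed.

Lemma cmod_cintegral_mul_le (c d : R) g w (B : R) : cintegrable `[c, d] g ->
  cintegrable `[c, d] (fun x => g x * w x) ->
  (forall x, c <= x -> x <= d -> cmod (w x) <= B) ->
  cmod (cintegral `[c, d] (fun x => g x * w x)) <= B * cmass g c d.
Proof.
move=> gi gwi wB; have ci := csum_integrable (measurable_itv _) gi.
rewrite /cmass -RintegralZl //; apply: cmod_cintegral_le => //.
- rewrite (_ : EFin \o _ = (fun x => B%:E * (EFin \o csum g) x)%E) //; exact: integrableZl.
- move=> x /=; rewrite in_itv /= => /andP[cx xd].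
  rewrite cmodM mulrC; apply: ler_pM => //; [exact: wB|exact: cmod_le_csum].
Qed.

Lemma cubic_cder (a1 a2 a3 a0 : R) :
  let w := fun x : R => (a0 + a1 * x + a2 * x ^+ 2 + a3 * x ^+ 3)%:C in
  let w' := fun x : R => (a1 + 2 * a2 * x + 3 * a3 * x ^+ 2)%:C in
  let w'' := fun x : R => (2 * a2 + 6 * a3 * x)%:C in
  [/\ cder w w', cder w' w'' & cder w'' (fun=> (6 * a3)%:C)].
Proof.
move=> w w' w''.
have dM (k : R) (f f' : R -> R) : (forall x : R, is_derive x (1 : R) f (f' x)) ->
    forall x : R, is_derive x (1 : R) (fun x => k * f x) (k * f' x).
  move=> df x; have dk : is_derive x (1 : R) (fun=> k) 0 by exact: is_derive_cst.
  by apply: (is_derive_eq (is_derive_mulr dk (df x))); rewrite mul0r add0r.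
have dX (x : R) : is_derive x (1 : R) id 1 by exact: is_derive_id.
have d2 (x : R) : is_derive x (1 : R) (fun x => x ^+ 2) (2 * x).
  apply: (is_derive_eq (is_derive_mulr (dX x) (dX x))); ring.
have d3 (x : R) : is_derive x (1 : R) (fun x => x ^+ 3) (3 * x ^+ 2).
  apply: (is_derive_eq (is_derive_mulr (dX x) (d2 x))); ring.
have dc (k x : R) : is_derive x (1 : R) (fun=> k) 0 by exact: is_derive_cst.
have d'' : cder w'' (fun=> (6 * a3)%:C).
  apply: cder_real => x.
  apply: (is_derive_eq (is_derive_addr (dc (2 * a2) x) (dM (6 * a3) _ _ dX x))); ring.
split; last exact: d''.
- apply: cder_real => x.
  apply: (is_derive_eq (is_derive_addr (is_derive_addr (is_derive_addr (dc a0 x) (dM a1 _ _ dX x))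
    (dM a2 _ _ d2 x)) (dM a3 _ _ d3 x))); ring.
- apply: cder_real => x.
  apply: (is_derive_eq (is_derive_addr (is_derive_addr (dc a1 x) (dM (2 * a2) _ _ dX x))
    (dM (3 * a3) _ _ d2 x))); ring.
Qed.

(* Integration against the Hermite cubics that vanish to second order at the right end point
   isolates the Cauchy data at the left end point. *)
Lemma cauchy_data_le (c : R) u p g :
  abs_cont `[c, c + 1] u p -> abs_cont `[c, c + 1] p g ->
  cmod (u c) <= 6 * (cmass u c (c + 1) + cmass g c (c + 1)) /\
  cmod (p c) <= 6 * (cmass u c (c + 1) + cmass g c (c + 1)).
Proof.
move=> au ap; have cc1 : c <= c + 1 by lra.
have gi := abs_cont_integrable cc1 ap.
have ui : cintegrable `[c, c + 1] u.
  have [B uB] := abs_cont_bounded cc1 au.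
  apply: (@cintegrable_bound _ _ _ (fun=> B)) => //; first exact: abs_cont_meas cc1 au.
    exact/integrable_continuous/cst_continuous.
  by move=> x /=; rewrite in_itv /= => /andP[]; exact: uB.
have key (a1 a2 a3 a0 : R) :
    a0 + a1 + a2 + a3 = 0 -> a1 + 2 * a2 + 3 * a3 = 0 ->
    (forall s : R, 0 <= s -> s <= 1 -> `|a0 + a1 * s + a2 * s ^+ 2 + a3 * s ^+ 3| <= 6) ->
    (forall s : R, 0 <= s -> s <= 1 -> `|2 * a2 + 6 * a3 * s| <= 6) ->
    cmod (p c * a0%:C - u c * a1%:C) <= 6 * (cmass u c (c + 1) + cmass g c (c + 1)).
  move=> e0 e1 b0 b2.
  have [d0 d1 c2] := cubic_cder a1 a2 a3 a0.
  have sh (f f' : R -> R[i]) : cder f f' -> cder (fun x => f (x - c)) (fun x => f' (x - c)).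
    by move=> df; exact: (@cder_shift _ f f' (- c)).
  have c2' := cder_ccont (sh _ _ c2).
  have [i1 i2 e] := abs_cont_by_parts2 cc1 au ap (sh _ _ d0) (sh _ _ d1) c2'.
  rewrite (_ : c + 1 - c = 1) in e; last by ring.
  have z0 : (0 : R)%:C = 0 :> R[i] by [].
  rewrite subrr !expr1n !mulr1 e0 e1 !expr0n /= z0 !mulr0 !addr0 subr0 sub0r in e.
  rewrite -cmodN -e; apply: le_trans (cmodB _ _) _; rewrite mulrDr addrC.
  apply: lerD; apply: cmod_cintegral_mul_le => // x cx xc; rewrite cmod_real.
  - by apply: b2; lra.
  - by apply: b0; lra.
have sq (s : R) : 0 <= s -> s <= 1 -> [/\ 0 <= s ^+ 2, s ^+ 2 <= 1, 0 <= s ^+ 3 & s ^+ 3 <= 1].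
  by move=> s0 s1; rewrite !exprn_ge0 // !exprn_ile1.
split.
- rewrite -cmodN (_ : - u c = p c * (0 : R)%:C - u c * (1 : R)%:C); last first.
    by rewrite (_ : (0 : R)%:C = 0) // mulr0 sub0r mulr1.
  (* The cubic s (1 - s)^2: value 0 and slope 1 at the left end, so only [u c] survives. *)
  apply: (@key 1 (-2) 1 0).
  + by lra.
  + by lra.
  + by move=> s s0 s1; have [? ? ? ?] := sq s s0 s1; rewrite ler_norml; lra.
  + by move=> s s0 s1; rewrite ler_norml; lra.
- rewrite (_ : p c = p c * (1 : R)%:C - u c * (0 : R)%:C); last first.
    by rewrite (_ : (0 : R)%:C = 0) // mulr0 subr0 mulr1.
  (* The cubic 1 - 3 s^2 + 2 s^3: value 1 and slope 0 at the left end, so only [p c] survives. Its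
     second derivative is the one that attains the bound 6. *)
  apply: (@key 0 (-3) 2 1).
  + by lra.
  + by lra.
  + by move=> s s0 s1; have [? ? ? ?] := sq s s0 s1; rewrite ler_norml; lra.
  + by move=> s s0 s1; rewrite ler_norml; lra.
Qed.

End LocalEstimate.

(** * Square integrable functions and the norm of a solution *)

Section SquareIntegrable.
Variable R : realType.
Local Notation leb := (@lebesgue_measure R).
Implicit Types (u p g f h y z : R -> R[i]) (D : set R).

Definition sqmod f (x : R) : R := cmod (f x) ^+ 2.

Lemma L2P D f : measurable (D : set (measurableTypeR R)) ->
  L2 D f <-> cmeas D f /\ leb.-integrable D (EFin \o sqmod f).
Proof.
move=> mD.
have ms : cmeas D f -> measurable_fun D (sqmod f).
  move=> [f1 f2]; rewrite (_ : sqmod f = ((Re \o f) \* (Re \o f)) \+ ((Im \o f) \* (Im \o f))).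
    by apply: measurable_funD; exact: measurable_funM.
  by apply/funext => x; rewrite /sqmod cmod_sqr !expr2.
have ae : (\int[leb]_(x in D) `|(EFin \o sqmod f) x| = \int[leb]_(x in D) (sqmod f x)%:E)%E.
  by apply: eq_integral => x _; rewrite /= ger0_norm // sqr_ge0.
split.
- move=> [f1 f2 fi]; split => //; apply/integrableP; split.
    by apply/measurable_EFinP; apply: ms.
  by rewrite ae.
- move=> [[f1 f2] /integrableP[_ fi]]; split => //.
  by rewrite -[X in (X < _)%E]ae.
Qed.

Lemma L2_mulJ D f g : measurable (D : set (measurableTypeR R)) -> L2 D f -> L2 D g ->
  cintegrable D (fun x => f x * (g x)^*%C).
Proof.
move=> mD /(L2P _ mD)[mf fi] /(L2P _ mD)[mg gi].
have [ui _] := integrable_lincomb (1 / 2) (1 / 2) mD fi gi.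
apply: (cintegrable_bound mD _ ui); first by apply: cmeasM => //; exact: cmeasJ.
move=> x _; rewrite cmodM cmodJ /sqmod.
by have := sqr_ge0 (cmod (f x) - cmod (g x)); rewrite sqrrB; lra.
Qed.

Lemma inner_self D f : measurable (D : set (measurableTypeR R)) ->
  inner D f f = (\int[leb]_(x in D) sqmod f x)%:C.
Proof.
move=> mD; apply: complex_ext => /=.
- by apply: eq_Rintegral => x _; rewrite /= mulcJ.
- rewrite -(Rintegral_set0 leb (Im \o f)) /Rintegral integral_set0.
  by rewrite integral0_eq // => x _; rewrite /= mulcJ.
Qed.

Lemma L2_ccont f (c d : R) : ccont f -> L2 `[c, d] f.
Proof.
move=> cf; apply/L2P => //; split; first exact: ccont_meas.
rewrite (_ : sqmod f = Re \o (fun x => f x * (f x)^*%C)); last first.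
  by apply/funext => x; rewrite /= mulcJ.
have cff : ccont (fun x => f x * (f x)^*%C) by prove_ccont.
by have [] := ccont_cintegrable c d cff.
Qed.

Definition sqnorm f : R := \int[leb]_(x in `[0, 1]) sqmod f x.

Lemma sqnorm_ge0 f : 0 <= sqnorm f.
Proof. by apply: Rintegral_ge0 => x _; exact: sqr_ge0. Qed.

Lemma sqmod_integrable f (c d : R) : ccont f -> leb.-integrable `[c, d] (EFin \o sqmod f).
Proof. by move=> /(L2_ccont c d) /L2P []. Qed.

(** Cauchy-Schwarz by integrating the nonnegative expression 2|f|^2 - 2 m (|Re f| + |Im f|) + m^2 at
    the mean [m]. *)
Lemma cmass_sqr_le f : ccont f -> cmass f 0 1 ^+ 2 <= 2 * sqnorm f.
Proof.
move=> cf; set m := cmass f 0 1.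
have si := sqmod_integrable 0 1 cf.
have ci := csum_integrable (measurable_itv `[0, 1]) (ccont_cintegrable 0 1 cf).
have i1 : leb.-integrable `[(0 : R), 1] (EFin \o (fun=> 1 : R)).
  exact/integrable_continuous/cst_continuous.
have [j1 e1] := integrable_lincomb 2 (- 2 * m) (measurable_itv _) si ci.
have [j2 e2] := integrable_lincomb 1 (m ^+ 2) (measurable_itv _) j1 i1.
have : 0 <= \int[leb]_(x in `[0, 1]) (1 * (2 * sqmod f x + - 2 * m * csum f x) + m ^+ 2 * 1).
  apply: Rintegral_ge0 => x _; rewrite /sqmod cmod_sqr /csum.
  rewrite -(real_normK (num_real (Re (f x)))) -(real_normK (num_real (Im (f x)))).
  move: (`|Re _|) (`|Im _|) => s t.
  have h1 := sqr_ge0 (s + t - m); have h2 := sqr_ge0 (s - t); rewrite !expr2 in h1 h2 *.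
  lra.
rewrite e2 e1 Rintegral_cst //= lebesgue_measure_itv /= lte_fin ltr01 /=.
rewrite -/(cmass f 0 1) -/m -/(sqnorm f) !expr2; lra.
Qed.

(** A solution with small norm has small Cauchy data, with a constant depending only on the bound
    [K], hence uniformly on bounded sets of energies. 144 arises as two squares of 6 and a factor 2
    from [cmass_sqr_le]. *)
Lemma cauchy_data_sqnorm_le (Q y p : R -> R[i]) (K : R) : bounded01 Q K -> ccont Q -> ode Q y p ->
  cmod (y 0) ^+ 2 + cmod (p 0) ^+ 2 <= 144 * (1 + 2 * K) ^+ 2 * sqnorm y.
Proof.
move=> QK cQ oy; have [cy cp] := ode_ccont oy; have [dy dp] := oy.
have cQy := ccontM cQ cy; have K0 := bounded01_ge0 QK.
have [h1 h2] := cauchy_data_le (cder_abs_cont (D := `[0, 0 + 1]) dy cp)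
  (cder_abs_cont (D := `[0, 0 + 1]) dp cQy).
rewrite add0r in h1 h2.
have mQ : cmass (fun x => Q x * y x) 0 1 <= 2 * K * cmass y 0 1.
  have ci := csum_integrable (measurable_itv `[0, 1]) (ccont_cintegrable 0 1 cy).
  rewrite /cmass -RintegralZl //; apply: le_Rintegral => //.
  + exact: csum_integrable (ccont_cintegrable 0 1 cQy).
  + rewrite (_ : EFin \o _ = (fun x => (2 * K)%:E * (EFin \o csum y) x)%E) //; exact: integrableZl.
  move=> x /=; rewrite in_itv /= => /andP[x0 x1].
  have e1 : csum (fun x => Q x * y x) x <= 2 * cmod (Q x * y x).
    by rewrite /csum mulr_natl mulr2n; apply: lerD; [exact: ler_Re_cmod|exact: ler_Im_cmod].
  apply: le_trans e1 _; rewrite cmodM -mulrA ler_wpM2l //.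
  by apply: ler_pM => //; [exact: QK|exact: cmod_le_csum].
have m0 := cmass_ge0 y 0 1; have := cmass_sqr_le cy.
set m := cmass y 0 1 in h1 h2 mQ m0 * => mle.
pose B := 6 * (1 + 2 * K) * m.
have B0 : 0 <= B by rewrite /B !mulr_ge0 //; lra.
have sq (s : R) : 0 <= s -> s <= B -> s ^+ 2 <= B ^+ 2.
  by move=> s0 sB; rewrite ler_pXn2r ?nnegrE.
have b1 : cmod (y 0) <= B by rewrite /B; lra.
have b2 : cmod (p 0) <= B by rewrite /B; lra.
apply: le_trans (lerD (sq _ (cmod_ge0 _) b1) (sq _ (cmod_ge0 _) b2)) _.
have -> : B ^+ 2 + B ^+ 2 = 72 * (1 + 2 * K) ^+ 2 * m ^+ 2 by rewrite /B; ring.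
rewrite [leRHS](_ : _ = 72 * (1 + 2 * K) ^+ 2 * (2 * sqnorm y)); last by ring.
by rewrite ler_wpM2l // mulr_ge0 // sqr_ge0.
Qed.

End SquareIntegrable.

(** * Spectrality at simple eigenvalues *)

Section Eigenfunctions.
Variable R : realType.
Local Notation leb := (@lebesgue_measure R).
Implicit Types (a b m : R[i]) (u p g f h y z r : R -> R[i]) (D : set R) (t : R).

Lemma ae_mono (P P' : R -> Prop) : (forall x, P x -> P' x) ->
  {ae leb, forall x, P x} -> {ae leb, forall x, P' x}.
Proof. by move=> PP; apply: filterS => //; exact: (ae_filter_ringOfSetsType leb). Qed.

Lemma ae_mono2 (P P' P'' : R -> Prop) : (forall x, P x -> P' x -> P'' x) ->
  {ae leb, forall x, P x} -> {ae leb, forall x, P' x} -> {ae leb, forall x, P'' x}.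
Proof. by move=> PP; apply: filterS2 => //; exact: (ae_filter_ringOfSetsType leb). Qed.

Lemma aeeq_refl D f : aeeq D f f.
Proof. exact: aeW. Qed.

Lemma ae_eq_cintegral D f g : measurable (D : set (measurableTypeR R)) ->
  cmeas D f -> cmeas D g -> aeeq D f g -> cintegral D f = cintegral D g.
Proof.
move=> mD [f1 f2] [g1 g2] fg; rewrite /cintegral /Rintegral; congr (fine _ +i* fine _).
- apply: ae_eq_integral => //; try exact/measurable_EFinP.
  by apply: ae_mono fg => x e Dx /=; rewrite e.
- apply: ae_eq_integral => //; try exact/measurable_EFinP.
  by apply: ae_mono fg => x e Dx /=; rewrite e.
Qed.

Lemma Hill_t_eigenfunction a b t m y p : ode (hill_coef a b m) y p ->
  y 1 = expi t * y 0 -> p 1 = expi t * p 0 -> Hill_t a b t y (fun x => m * y x).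
Proof.
move=> oy b1 b2; have [cy cp] := ode_ccont oy; have [dy dp] := oy.
have [cQ _] := hill_coef_admissible a b m.
have cQy := ccontM cQ cy.
split; [exact: L2_ccont|apply: L2_ccont; exact: ccontZ|].
exists y, p, (fun x => hill_coef a b m x * y x); split => //.
- exact: aeeq_refl.
- exact: cder_abs_cont.
- exact: cder_abs_cont.
- by apply: aeW => x _; rewrite /hill_coef; ring.
Qed.

(** Conjugating a Floquet solution with the reciprocal multiplier gives an eigenfunction of the
    adjoint, whose potential is the conjugate one. In the integration by parts the multipliers
    cancel, so the boundary terms at 0 and 1 are equal. *)
Lemma adjoint_eigenfunction a b t m z r : ode (hill_coef a b m) z r ->
  z 1 = expi (- t) * z 0 -> r 1 = expi (- t) * r 0 ->
  adjoint `[0, 1] (Hill_t a b t) (fun x => (z x)^*%C) (fun x => m^*%C * (z x)^*%C).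
Proof.
move=> oz b1 b2; have [cz cr] := ode_ccont oz; have [dz dr] := oz.
have [cQ _] := hill_coef_admissible a b m.
have cQz := ccontM cQ cz; have czJ := ccontJ cz.
split; [exact: L2_ccont|apply: L2_ccont; exact: ccontZ|].
move=> Y F [LY LF [u [p [g [eY au ap eF [bu bp]]]]]].
have mD : measurable (`[0, 1]%classic : set (measurableTypeR R)) by [].
have [mY _] := (L2P Y mD).1 LY; have [mF _] := (L2P F mD).1 LF.
have gi := abs_cont_integrable ler01 ap; have mg := cintegrable_meas gi.
have mu' := abs_cont_meas ler01 au.
have mz := ccont_meas mD cz; have mq := ccont_meas mD (potential_ccont a b).
have [i1 i2 e] := abs_cont_by_parts2 ler01 au ap dz dr cQz.
rewrite /inner.
have -> : cintegral `[0, 1] (fun x => F x * ((z x)^*%C)^*%C) =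
    cintegral `[0, 1] (fun x => u x * (m * z x)).
  rewrite (@ae_eq_cintegral _ _ (fun x => u x * (m * z x) -
      (g x * z x - u x * (hill_coef a b m x * z x)))) //.
  - have i3 : cintegrable `[0, 1] (fun x => u x * (m * z x)).
      have [B uB] := abs_cont_bounded ler01 au.
      rewrite (_ : (fun x => _) = fun x => (m * z x) * u x); last by apply/funext => x; rewrite mulrC.
      apply: (@cintegrable_mulr _ _ _ _ B) => //; first exact/ccont_cintegrable/ccontZ.
      by move=> x /=; rewrite in_itv /= => /andP[]; exact: uB.
    rewrite cintegralB //; last exact: cintegrableB.
    rewrite cintegralB // e b1 b2 bu bp.
    rewrite (_ : _ - _ = (1 - expi (- t) * expi t) * (p 0 * z 0 - u 0 * r 0) +
      cintegral `[0, 1] (fun x => u x * (m * z x))); last by ring.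
    by rewrite expiNK subrr mul0r add0r.
  - by apply: cmeasM => //; apply: cmeasJ; exact: cmeasJ.
  - have mQ := ccont_meas mD cQ.
    apply: cmeasB; first by apply: cmeasM => //; exact: cmeasZ.
    by apply: cmeasB; [exact: cmeasM|apply: cmeasM => //; exact: cmeasM].
  - apply: ae_mono eF => x ex Dx; rewrite ex // conjcK /hill_coef; ring.
rewrite (@ae_eq_cintegral _ _ (fun x => u x * (m * z x))) //.
- by apply: cmeasM => //; apply: cmeasJ; apply: cmeasZ; exact: cmeasJ.
- by apply: cmeasM => //; exact: cmeasZ.
- by apply: ae_mono eY => x ex Dx; rewrite ex // conjcM !conjcK.
Qed.

Lemma ode_scale Q y p (k : R[i]) : ode Q y p -> ode Q (fun x => k * y x) (fun x => k * p x).
Proof.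
move=> [dy dp]; split; first exact: cderZ.
by apply: cder_ext (cderZ k dp) => // x; ring.
Qed.

Lemma inner_normalize y : ccont y -> 0 < sqnorm y ->
  inner `[0, 1] (fun x => ((Num.sqrt (sqnorm y))^-1)%:C * y x)
    (fun x => ((Num.sqrt (sqnorm y))^-1)%:C * y x) = 1.
Proof.
move=> cy N0; rewrite inner_self //.
have -> : \int[leb]_(x in `[0, 1]) sqmod (fun x => ((Num.sqrt (sqnorm y))^-1)%:C * y x) x =
    \int[leb]_(x in `[0, 1]) ((sqnorm y)^-1 * sqmod y x).
  apply: eq_Rintegral => x _; rewrite /sqmod cmodM cmod_real exprMn real_normK ?num_real //.
  by rewrite exprVn sqr_sqrtr // ltW.
by rewrite RintegralZl // ?mulVf ?gt_eqF //; exact: sqmod_integrable.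
Qed.

(* The normalized eigenfunctions are multiples of y and of the conjugate of z, hence
   |d|^2 = |ci (y z)|^2 / (sqnorm y * sqnorm z). *)
Lemma spectral_lower_bound a b lam : eigenvalue_numbering a b lam -> spectral_operator a b lam ->
  exists2 c : R, 0 < c & forall t m y p z r, t \in `]-pi, pi] -> multiplicity a b t m 1 ->
    ode (hill_coef a b m) y p -> ode (hill_coef a b m) z r ->
    y 1 = expi t * y 0 -> p 1 = expi t * p 0 ->
    z 1 = expi (- t) * z 0 -> r 1 = expi (- t) * r 0 ->
    0 < sqnorm y -> 0 < sqnorm z ->
    sqnorm y * sqnorm z <= c ^+ 2 * cmod (ci (fun x => y x * z x)) ^+ 2.
Proof.
move=> [hn _ _] [c c0 H]; exists c => // t m y p z r tI m1 oy oz by1 bp1 bz1 br1 Ny Nz.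
(* A root of order 1 is carried by exactly one index, and [t] is not exceptional for that index. *)
have [n lamn] : exists n, lam n t = m.
  by have /eq_cardSP[n e _] := (hn t tI m 1%N).1 m1; exists n.
have nex : ~ exceptional a b lam n t.
  by move=> [_]; rewrite lamn; exact.
have [cy cp] := ode_ccont oy; have [cz cr] := ode_ccont oz; have czJ := ccontJ cz.
pose ky : R := (Num.sqrt (sqnorm y))^-1; pose kz : R := (Num.sqrt (sqnorm z))^-1.
have NzJ : sqnorm (fun x => (z x)^*%C) = sqnorm z.
  by apply: eq_Rintegral => x _; rewrite /sqmod cmodJ.
have nPsi : normalized_eigenfunction `[0, 1] (Hill_t a b t) (lam n t) (fun x => ky%:C * y x).
  rewrite lamn; split; last exact: inner_normalize.
  apply: Hill_t_eigenfunction (ode_scale ky%:C oy) _ _.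
  - by rewrite by1; ring.
  - by rewrite bp1; ring.
have nPsis : normalized_eigenfunction `[0, 1] (adjoint `[0, 1] (Hill_t a b t)) ((lam n t)^*%C)
    (fun x => kz%:C * (z x)^*%C).
  rewrite lamn; split; last first.
    by have := inner_normalize czJ; rewrite NzJ; exact.
  have E x : kz%:C * (z x)^*%C = (kz%:C * z x)^*%C by rewrite conjcM conjc_real.
  rewrite (funext E).
  have -> : (fun x => m^*%C * (kz%:C * (z x)^*%C)) = fun x => m^*%C * (kz%:C * z x)^*%C.
    by apply/funext => x; rewrite E.
  apply: (@adjoint_eigenfunction a b t m (fun x => kz%:C * z x) (fun x => kz%:C * r x)).
  - exact: ode_scale.
  - by rewrite bz1; ring.
  - by rewrite br1; ring.
have := H n t tI nex _ _ nPsi nPsis.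
have -> : inner `[0, 1] (fun x => ky%:C * y x) (fun x => kz%:C * (z x)^*%C) =
    (ky * kz)%:C * ci (fun x => y x * z x).
  rewrite -ciZ; last by prove_ccont.
  by apply: eq_ci => x; rewrite conjcM conjcK conjc_real realCM; ring.
set I := ci _ => -[d0 dc].
have kp : 0 < ky * kz by rewrite mulr_gt0 // invr_gt0 sqrtr_gt0.
have dp : 0 < cmod ((ky * kz)%:C * I) by rewrite cmod_gt0; apply/eqP.
rewrite cmodM cmod_real gtr0_norm // in dc dp.
have h : 1 <= (c * cmod I * (ky * kz)) ^+ 2.
  have : 1 <= c * cmod I * (ky * kz).
    have := ltW dc; rewrite -div1r ler_pdivrMr //; lra.
  by move=> h; rewrite exprn_ege1.
have kk : (ky * kz) ^+ 2 = (sqnorm y * sqnorm z)^-1.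
  by rewrite exprMn !exprVn !sqr_sqrtr ?(ltW Ny) ?(ltW Nz) // invfM.
by rewrite exprMn kk ler_pdivlMr ?mul1r ?mulr_gt0 // exprMn in h.
Qed.

End Eigenfunctions.

(** * Floquet solutions and the distance of the monodromy matrix from the scalars *)

Section Floquet.
Variable R : realType.
Implicit Types (Q y p z r : R -> R[i]) (a b : R[i]).

(** (m12, k - m11) is an eigenvector unless m12 = 0; the matrix is then triangular and its second
    column or, because k <> k', the vector (k - m22, m21) serves. *)
Lemma trace_eigenvector (m11 m12 m21 m22 k k' : R[i]) :
  m11 * m22 - m21 * m12 = 1 -> k * k' = 1 -> k + k' = m22 + m11 -> k != k' ->
  exists v1 v2, [/\ m11 * v1 + m12 * v2 = k * v1, m21 * v1 + m22 * v2 = k * v2 &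
    (v1 != 0) || (v2 != 0)].
Proof.
move=> det kk kt kn.
have [m12_0|m12_0] := eqVneq m12 0; last first.
  exists m12, (k - m11); split; [by ring| |by rewrite m12_0].
  have -> : m21 * m12 = m11 * m22 - k * k' by rewrite kk -det; ring.
  have -> : k' = m22 + m11 - k by rewrite -kt; ring.
  by ring.
have [km|km] := eqVneq k m11; last first.
  exists 0, 1; rewrite m12_0 !mulr0 !mulr1 !add0r oner_neq0 orbT; split => //.
  have : (k - m11) * (k - m22) = 0.
    transitivity (k * k - k * (m22 + m11) + (m11 * m22 - m21 * m12)).
      by rewrite m12_0; ring.
    by rewrite -kt det -kk; ring.
  by move/eqP; rewrite mulf_eq0 !subr_eq0 (negbTE km) => /eqP.
have m22E : m22 = k' by apply: (addIr m11); rewrite -kt km addrC.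
exists (k - m22), m21; split; last by rewrite subr_eq0 m22E kn.
- by rewrite m12_0 km; ring.
- by ring.
Qed.

(** With [D] the determinant of the two eigenvectors, D times each off-scalar entry of M is k' - k
    times a product of their coordinates. The identities also hold for k = k', where they force D =
    0 or M scalar. *)
Lemma eigenvector_products (m11 m12 m21 m22 k k' p1 p2 r1 r2 : R[i]) :
  m11 * p1 + m12 * p2 = k * p1 -> m21 * p1 + m22 * p2 = k * p2 ->
  m11 * r1 + m12 * r2 = k' * r1 -> m21 * r1 + m22 * r2 = k' * r2 ->
  let D := p1 * r2 - p2 * r1 in
  [/\ D * m12 = (k' - k) * (p1 * r1), D * - m21 = (k' - k) * (p2 * r2) &
      D * (m22 - m11) = (k' - k) * (p1 * r2 + p2 * r1)].
Proof.
move=> e1 e2 e3 e4 D; split.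
- transitivity (p1 * (m11 * r1 + m12 * r2) - (m11 * p1 + m12 * p2) * r1); first by rewrite /D; ring.
  by rewrite e1 e3; ring.
- transitivity (p2 * (m21 * r1 + m22 * r2) - (m21 * p1 + m22 * p2) * r2); first by rewrite /D; ring.
  by rewrite e2 e4; ring.
- transitivity ((p1 * (m21 * r1 + m22 * r2) - r1 * (m21 * p1 + m22 * p2)) -
    ((m11 * p1 + m12 * p2) * r2 - p2 * (m11 * r1 + m12 * r2))); first by rewrite /D; ring.
  by rewrite e1 e2 e3 e4; ring.
Qed.

(** Applied when the determinant of the eigenvectors is assumed to vanish: all symmetric products of
    coordinates would then be zero, so one of the vectors would be zero. *)
Lemma eigenvectors_independent (k k' p1 p2 r1 r2 : R[i]) : k != k' ->
  (p1 != 0) || (p2 != 0) -> (r1 != 0) || (r2 != 0) ->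
  (k' - k) * (p1 * r1) = 0 -> (k' - k) * (p2 * r2) = 0 -> (k' - k) * (p1 * r2 + p2 * r1) = 0 ->
  False.
Proof.
move=> kn pn rn h1 h2 h3.
have kn' : k' - k != 0 by rewrite subr_eq0 eq_sym.
have canc (w : R[i]) : (k' - k) * w = 0 -> w = 0.
  by move/eqP; rewrite mulf_eq0 (negbTE kn') => /eqP.
have [p10|p10] := eqVneq p1 0.
  rewrite p10 eqxx /= in pn; rewrite p10 mul0r add0r in h3.
  move/canc/eqP: h2; rewrite mulf_eq0 (negbTE pn) /= => /eqP r20.
  move/canc/eqP: h3; rewrite mulf_eq0 (negbTE pn) /= => /eqP r10.
  by rewrite r10 r20 eqxx in rn.
move/canc/eqP: h1; rewrite mulf_eq0 (negbTE p10) /= => /eqP r10.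
rewrite r10 mulr0 addr0 in h3.
move/canc/eqP: h3; rewrite mulf_eq0 (negbTE p10) /= => /eqP r20.
by rewrite r10 r20 eqxx in rn.
Qed.

(* D is the Wronskian of y and z, so qform is proportional to the product of two Floquet solutions. *)
Lemma qform_expand Q y z p r : admissible Q -> ode Q y p -> ode Q z r -> forall k : R[i],
  let D := y 0 * r 0 - p 0 * z 0 in
  D * fph Q 1 = k * (y 0 * z 0) -> D * - fth' Q 1 = k * (p 0 * r 0) ->
  D * (fph' Q 1 - fth Q 1) = k * (y 0 * r 0 + p 0 * z 0) ->
  forall x, D * qform Q x = k * (y x * z x).
Proof.
move=> aQ oy oz k D e1 e2 e3 x.
have [-> _] := ode_rep aQ oy x; have [-> _] := ode_rep aQ oz x.
set th := fth Q x; set ph := fph Q x.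
have -> : D * qform Q x = (D * fph Q 1) * (th * th) + (D * (fph' Q 1 - fth Q 1)) * (th * ph)
   + (D * - fth' Q 1) * (ph * ph) by rewrite /qform /kern -/th -/ph; ring.
by rewrite e1 e2 e3; ring.
Qed.

(** A distance of the monodromy matrix from the scalar matrices; its entries are also the
    coefficients of [qform]. *)
Definition offscalar Q : R := cmod (fph Q 1) + cmod (fth' Q 1) + cmod (fph' Q 1 - fth Q 1).

Lemma cmod_mul_le_sum (u v s t : R[i]) :
  (cmod u * cmod v) ^+ 2 <= (cmod s ^+ 2 + cmod u ^+ 2) * (cmod t ^+ 2 + cmod v ^+ 2).
Proof.
rewrite exprMn; apply: ler_pM; rewrite ?sqr_ge0 // lerDr sqr_ge0 //.
Qed.

(** Both D F' = -(k' - k) I, with I the integral of y z, and D times the off-scalar entries = (k' -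
    k) times products of Cauchy data hold for the Floquet solutions. D and k' - k, which degenerate
    at band edges, cancel in the quotient; spectrality bounds the norms by I, and the norms bound
    the Cauchy data. So [C] is uniform over the energies up to [L]. *)
Lemma spectral_offscalar_bound a b lam (L : R) :
  eigenvalue_numbering a b lam -> spectral_operator a b lam ->
  exists C : R, forall l : R, `|l| <= L ->
    (discriminant a b l%:C)^*%C = discriminant a b l%:C ->
    -2 < Re (discriminant a b l%:C) -> Re (discriminant a b l%:C) < 2 ->
    Fdot a b l%:C <> 0 ->
    offscalar (hill_coef a b l%:C) <= C * cmod (Fdot a b l%:C).
Proof.
move=> hn hs; have [c c0 H] := spectral_lower_bound hn hs.
pose K := cmod a + cmod b + L; pose G := 144 * (1 + 2 * K) ^+ 2.
exists (4 * (c * G)) => l lL FJ F1 F2 Fd.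
pose Q := hill_coef a b l%:C.
have aQ : admissible Q := hill_coef_admissible _ _ _.
have QK : bounded01 Q K by apply: hill_coef_bounded; rewrite /K cmod_real lerD2l.
have G0 : 0 <= G by rewrite /G mulr_ge0 // sqr_ge0.
set F := discriminant a b l%:C in FJ F1 F2.
have FE : F = (Re F)%:C.
  apply: ReE_real; have := congr1 (@complex.Im R) FJ; rewrite cImJ; lra.
pose t := acos (Re F / 2).
have ct : cos t = Re F / 2 by rewrite acosK // in_itv /=; lra.
have t0 : 0 < t by apply: acos_gt0; lra.
have tpi : t < pi by apply: acos_ltpi; lra.
have tI : t \in `]-pi, pi].
  by rewrite in_itv /= (ltW tpi) andbT (lt_trans _ t0) // oppr_lt0 pi_gt0.
have st : 0 < sin t by apply: sin_gt0_pi; rewrite t0 tpi.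
have m1 : multiplicity a b t l%:C 1.
  by apply/multiplicity1P; split => //; rewrite -/F ct FE; congr (_%:C); field.
pose k := expi t; pose k' := expi (- t).
have kk : k * k' = 1 by rewrite /k /k' mulrC expiNK.
have kt : k + k' = fph' Q 1 + fth Q 1.
  rewrite -[RHS]/(tr Q) -discriminantE -/F FE /k /k' expiN.
  apply: complex_ext => /=; last by rewrite subrr.
  by rewrite ct; field.
have kn : k != k'.
  apply/eqP => /(congr1 (@complex.Im R)); rewrite /k /k' expiN cImJ /=.
  move: st; lra.
have det := fundamental_det aQ 1.
have kk' : k' * k = 1 by rewrite mulrC.
have kt' : k' + k = fph' Q 1 + fth Q 1 by rewrite addrC.
have kn' : k' != k by rewrite eq_sym.
have [p1 [p2 [ep1 ep2 pn]]] := trace_eigenvector det kk kt kn.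
have [r1 [r2 [er1 er2 rn]]] := trace_eigenvector det kk' kt' kn'.
have [w1 w2 w3] := eigenvector_products ep1 ep2 er1 er2.
pose y x := p1 * fth Q x + p2 * fph Q x; pose py x := p1 * fth' Q x + p2 * fph' Q x.
pose z x := r1 * fth Q x + r2 * fph Q x; pose pz x := r1 * fth' Q x + r2 * fph' Q x.
have oy : ode Q y py := ode_lincomb p1 p2 (ode_fth aQ) (ode_fph aQ).
have oz : ode Q z pz := ode_lincomb r1 r2 (ode_fth aQ) (ode_fph aQ).
have y0 : y 0 = p1 by rewrite /y fth0 // fph0 //; ring.
have py0 : py 0 = p2 by rewrite /py fth'0 // fph'0 //; ring.
have z0 : z 0 = r1 by rewrite /z fth0 // fph0 //; ring.
have pz0 : pz 0 = r2 by rewrite /pz fth'0 // fph'0 //; ring.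
have by1 : y 1 = expi t * y 0 by rewrite y0 -ep1 /y; ring.
have bp1 : py 1 = expi t * py 0 by rewrite py0 -ep2 /py; ring.
have bz1 : z 1 = expi (- t) * z 0 by rewrite z0 -er1 /z; ring.
have bq1 : pz 1 = expi (- t) * pz 0 by rewrite pz0 -er2 /pz; ring.
have Ny := cauchy_data_sqnorm_le QK aQ.1 oy; have Nz := cauchy_data_sqnorm_le QK aQ.1 oz.
rewrite y0 py0 -/G in Ny; rewrite z0 pz0 -/G in Nz.
have pos (u v : R[i]) (N : R) : 0 <= N -> (u != 0) || (v != 0) ->
    cmod u ^+ 2 + cmod v ^+ 2 <= G * N -> 0 < N.
  move=> N0 uv h; rewrite lt_def N0 andbT; apply/negP => /eqP N00.
  rewrite N00 mulr0 in h; have u0 := sqr_ge0 (cmod u); have v0 := sqr_ge0 (cmod v).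
  have : (cmod u ^+ 2 == 0) && (cmod v ^+ 2 == 0) by apply/andP; split; apply/eqP; lra.
  by rewrite !expf_eq0 /= !cmod_eq0 => /andP[/eqP e /eqP e']; rewrite e e' eqxx in uv.
have := H t l%:C y py z pz tI m1 oy oz by1 bp1 bz1 bq1
  (pos _ _ _ (sqnorm_ge0 _) pn Ny) (pos _ _ _ (sqnorm_ge0 _) rn Nz).
set I := ci _ => HI.
set D := p1 * r2 - p2 * r1 in w1 w2 w3.
have D0 : D != 0.
  apply/eqP => D0; rewrite D0 !mul0r in w1 w2 w3.
  exact: (eigenvectors_independent kn pn rn (esym w1) (esym w2) (esym w3)).
have cq : ccont (qform Q) := kern_ccont aQ aQ.
have [[cy _] [cz _]] := (ode_ccont oy, ode_ccont oz).
have DI : D * - Fdot a b l%:C = (k' - k) * I.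
  rewrite /Fdot opprK -!ciZ //; last by prove_ccont.
  apply: eq_ci => x; have := @qform_expand Q y z py pz aQ oy oz (k' - k).
  by rewrite y0 z0 py0 pz0; apply.
have DIc : cmod D * cmod (Fdot a b l%:C) = cmod (k' - k) * cmod I.
  by rewrite -(cmodN (Fdot a b l%:C)) -(cmodM D) DI cmodM.
have kp : 0 < cmod (k' - k) by rewrite cmod_gt0 subr_eq0.
have Dp : 0 < cmod D by rewrite cmod_gt0.
have G1 : (cmod p1 ^+ 2 + cmod p2 ^+ 2) * (cmod r1 ^+ 2 + cmod r2 ^+ 2) <=
    (c * G * cmod I) ^+ 2.
  apply: le_trans (ler_pM _ _ Ny Nz) _; try by rewrite addr_ge0 ?sqr_ge0.
  rewrite [leLHS](_ : _ = G ^+ 2 * (sqnorm y * sqnorm z)); last by ring.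
  rewrite [leRHS](_ : _ = G ^+ 2 * (c ^+ 2 * cmod I ^+ 2)); last by ring.
  by rewrite ler_wpM2l // sqr_ge0.
have B0 : 0 <= c * G * cmod I by apply: mulr_ge0 => //; apply: mulr_ge0 => //; exact: ltW.
have le_of_sum (s u s' u' : R[i]) :
    (cmod s ^+ 2 + cmod u ^+ 2) * (cmod s' ^+ 2 + cmod u' ^+ 2) <= (c * G * cmod I) ^+ 2 ->
    cmod u * cmod u' <= c * G * cmod I.
  have u0 : 0 <= cmod u * cmod u' by rewrite mulr_ge0.
  by move=> h; rewrite -(@ler_pXn2r _ 2) ?nnegrE //; exact: le_trans (cmod_mul_le_sum _ _ _ _) h.
have coef (X w : R[i]) (j : R) : D * X = (k' - k) * w -> cmod w <= j * (c * G * cmod I) ->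
    cmod X <= j * (c * G) * cmod (Fdot a b l%:C).
  move=> eX hw; rewrite -(ler_pM2l Dp) -cmodM eX cmodM.
  rewrite (_ : cmod D * _ = j * (c * G) * (cmod D * cmod (Fdot a b l%:C))); last by ring.
  rewrite DIc (_ : j * _ * _ = cmod (k' - k) * (j * (c * G * cmod I))); last by ring.
  by rewrite ler_wpM2l.
have a1 : cmod p1 * cmod r1 <= c * G * cmod I.
  by apply: (le_of_sum p2 p1 r2 r1); rewrite addrC (addrC (cmod r2 ^+ 2)).
have a2 : cmod p2 * cmod r2 <= c * G * cmod I by exact: (le_of_sum p1 p2 r1 r2).
have a3 : cmod p1 * cmod r2 <= c * G * cmod I by apply: (le_of_sum p2 p1 r1 r2); rewrite addrC.
have a4 : cmod p2 * cmod r1 <= c * G * cmod I.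
  by apply: (le_of_sum p1 p2 r2 r1); rewrite (addrC (cmod r2 ^+ 2)).
have c1 := coef _ _ 1 w1; have c2 := coef _ _ 1 w2; have c3 := coef _ _ 2 w3.
rewrite !mul1r cmodM in c1 c2; rewrite cmodN cmodM in c2.
have {}c1 := c1 a1; have {}c2 := c2 a2.
have {}c3 : cmod (fph' Q 1 - fth Q 1) <= 2 * (c * G) * cmod (Fdot a b l%:C).
  apply: c3; apply: le_trans (cmodD _ _) _; rewrite !cmodM; lra.
rewrite /offscalar -/Q; lra.
Qed.

Lemma spectral_scalar a b lam (l0 : R) :
  eigenvalue_numbering a b lam -> spectral_operator a b lam ->
  (forall l : R, (discriminant a b l%:C)^*%C = discriminant a b l%:C) ->
  Fdot a b l0%:C = 0 ->
  (forall d, 0 < d -> exists l : R, [/\ `|l - l0| < d, -2 < Re (discriminant a b l%:C),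
     Re (discriminant a b l%:C) < 2 & Fdot a b l%:C <> 0]) ->
  let Q := hill_coef a b l0%:C in [/\ fph Q 1 = 0, fth' Q 1 = 0 & fph' Q 1 = fth Q 1].
Proof.
move=> hn hs FJ F0 near0 Q.
have [C hC] := spectral_offscalar_bound (`|l0| + 1) hn hs.
pose K := cmod a + cmod b + (`|l0| + 1); pose g := growth K.
have K0 : 0 <= K by rewrite !addr_ge0.
have g1 : 1 <= g := growth_ge1 K0.
have C0 : 0 <= `|C| by [].
(* At distance d from [l0] the off-scalar part moves by at most 4 g^2 d, and F', which vanishes at
   [l0], is at most 12 g^4 d. *)
pose B := 4 * g ^+ 2 + `|C| * (12 * g ^+ 4).
have B0 : 0 < B.
  rewrite ltr_wpDr // ?mulr_ge0 ?exprn_ge0 // ?(le_trans ler01) //.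
  by rewrite mulr_gt0 // exprn_gt0 // (lt_le_trans ltr01).
have small (d : R) : 0 < d -> d <= 1 -> offscalar Q <= B * d.
  move=> d0 d1; have [l [ld F1 F2 Fd]] := near0 d d0.
  have lL : `|l| <= `|l0| + 1.
    by have := ler_normD (l - l0) l0; rewrite subrK; move: ld d1; clear => *; lra.
  have h := hC l lL (FJ l) F1 F2 Fd.
  pose Ql := hill_coef a b l%:C.
  have aQ : admissible Q := hill_coef_admissible _ _ _.
  have aQl : admissible Ql := hill_coef_admissible _ _ _.
  have QK : bounded01 Q K.
    by apply: hill_coef_bounded; rewrite /K cmod_real lerD2l lerDl.
  have QlK : bounded01 Ql K by apply: hill_coef_bounded; rewrite /K cmod_real lerD2l.
  have Qd : bounded01 (fun x => Ql x - Q x) d.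
    move=> x _ _; rewrite (_ : _ - _ = (l0 - l)%:C); last by rewrite /Ql /Q /hill_coef rmorphB; ring.
    by rewrite cmod_real distrC ltW.
  have [e1 e2 e3 e4] := fund_lip aQ aQl QK QlK Qd ler01 (lexx 1).
  have tri (u v : R[i]) : cmod u <= cmod v + cmod (v - u).
    by rewrite -{1}(subKr v u); exact: cmodB.
  have h1 := tri (fph Q 1) (fph Ql 1); have h2 := tri (fth' Q 1) (fth' Ql 1).
  have h3 := tri (fph' Q 1 - fth Q 1) (fph' Ql 1 - fth Ql 1).
  have h4 : cmod (fph' Ql 1 - fth Ql 1 - (fph' Q 1 - fth Q 1)) <=
      cmod (fph' Ql 1 - fph' Q 1) + cmod (fth Ql 1 - fth Q 1).
    rewrite (_ : _ - _ = (fph' Ql 1 - fph' Q 1) - (fth Ql 1 - fth Q 1)); last by ring.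
    exact: cmodB.
  have hF : cmod (Fdot a b l%:C) <= 12 * g ^+ 4 * d.
    rewrite -[Fdot a b l%:C]subr0 -F0 /Fdot -/Q -/Ql.
    have cq : ccont (qform Q) := kern_ccont aQ aQ.
    have cql : ccont (qform Ql) := kern_ccont aQl aQl.
    rewrite opprK addrC -(ciB cq cql); apply: cmod_ci_le => [|x x0 x1].
      exact: ccontB cq cql.
    have [_] := kern_lip aQ aQl QK QlK Qd x0 x1.
    by rewrite cmodBC.
  have hCF : C * cmod (Fdot a b l%:C) <= `|C| * (12 * g ^+ 4 * d).
    apply: le_trans (ler_wpM2r (cmod_ge0 _) (ler_norm C)) _; exact: ler_wpM2l.
  rewrite /offscalar -/Ql in h *.
  rewrite -/g in e1 e2 e3 e4; rewrite /B; lra.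
have off0 : offscalar Q <= 0.
  apply/ler_addgt0Pr => e e0; rewrite add0r.
  have [eB|/ltW eB] := leP (e / B) 1.
    have := small (e / B) (divr_gt0 e0 B0) eB.
    by rewrite mulrCA mulfV ?mulr1 // gt_eqF.
  apply: le_trans (small 1 ltr01 (lexx _)) _; rewrite mulr1.
  by rewrite ler_pdivlMr // mul1r in eB.
have n1 := cmod_ge0 (fph Q 1); have n2 := cmod_ge0 (fth' Q 1).
have n3 := cmod_ge0 (fph' Q 1 - fth Q 1); rewrite /offscalar in off0.
split; apply/eqP.
- by rewrite -cmod_eq0; apply/eqP; lra.
- by rewrite -cmod_eq0; apply/eqP; lra.
- by rewrite -subr_eq0 -cmod_eq0; apply/eqP; lra.
Qed.

End Floquet.

(** * Fourier coefficients of antiperiodic solutions *)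

Section HillSequences.
Variable R : realType.
Implicit Types (a b : R[i]) (c d e : int -> R[i]) (k : int) (l r : R).

Definition kappa k : R := (2 * k + 1)%:~R * pi.

(* The recurrence of the coefficients of an antiperiodic solution in the basis expi (kappa k * x). *)
Definition hill_seq a b l c := forall k,
  (kappa k ^+ 2 - l)%:C * c k + a * c (k + 1) + b * c (k - 1) = 0.

Lemma kappaN k : kappa (- k - 1) = - kappa k.
Proof. by rewrite /kappa -mulNr -rmorphN; congr (_%:~R * _); ring. Qed.

Lemma pi_ge1 : 1 <= pi :> R.
Proof. by apply: le_trans (pi_ge2 R); rewrite ler1n. Qed.

Lemma kappa_sqr_ge (n : nat) : n%:R <= kappa n ^+ 2.
Proof.
have p1 := pi_ge1.
have h : n%:R <= (2 * n%:R + 1 :> R) ^+ 2.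
  have n0 : 0 <= n%:R :> R by []. 
  by rewrite sqrrD expr1n mulr1; have := sqr_ge0 (2 * n%:R : R); lra.
rewrite /kappa exprMn (_ : (2 * n%:Z + 1)%:~R = 2 * n%:R + 1 :> R); last first.
  by rewrite rmorphD rmorphM.
apply: le_trans h _; rewrite ler_peMr ?sqr_ge0 //.
by rewrite exprn_ege1.
Qed.

(** If both neighbours are at most B r^-j then the middle term is at most B r^-(j+1). Each
    improvement consumes one index at the left end, so after n - N of them the bound is geometric in
    n. *)
Lemma two_sided_recurrence_decay (x : nat -> R) (B r : R) (N : nat) : 1 <= r ->
  (forall n, x n <= B) -> (forall n, 0 <= x n) ->
  (forall n, (N <= n)%N -> 2 * r * x n.+1 <= x n.+2 + x n) ->
  forall n, x n <= B * r ^+ N * r^-1 ^+ n.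
Proof.
move=> r1 xB x0 rec.
have r0 : 0 < r by apply: lt_le_trans r1.
have B0 : 0 <= B := le_trans (x0 0%N) (xB 0%N).
have step j : forall n, (N + j <= n)%N -> x n <= B * r^-1 ^+ j.
  elim: j => [|j IH] n; first by rewrite expr0 mulr1.
  case: n => [|n]; first by rewrite addnS.
  rewrite addnS ltnS => jn.
  have h1 := IH n jn; have h2 := IH n.+2 (leq_trans jn (leqW (leqnSn n))).
  have h3 := rec n (leq_trans (leq_addr j N) jn).
  rewrite exprS mulrCA mulrC ler_pdivlMr //; lra.
move=> n; have [Nn|nN] := leqP N n.
  have := step (n - N)%N n; rewrite subnKC // => /(_ (leqnn _)) h.
  apply: le_trans h _; rewrite -{2}(subnKC Nn) exprD -!mulrA ler_wpM2l //.
  by rewrite mulrA -exprMn mulfV ?gt_eqF // expr1n mul1r.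
apply: le_trans (xB n) _; rewrite -mulrA ler_peMr //.
rewrite -(subnK (ltnW nN)) exprD -mulrA -exprMn mulfV ?gt_eqF // expr1n mulr1.
exact: exprn_ege1.
Qed.

Definition rapidly_decreasing (x : nat -> R[i]) := forall r, 1 <= r ->
  exists2 C : R, 0 <= C & forall n, cmod (x n) <= C * r^-1 ^+ n.

(** The diagonal factor grows quadratically while the off-diagonal ones are constant, so any ratio
    [r] is eventually available. When both coefficients vanish the division by [A] is impossible,
    but then the sequence has finite support. *)
Lemma hill_seq_decay a b l c (B : R) : hill_seq a b l c -> (forall k, cmod (c k) <= B) ->
  rapidly_decreasing (fun n => c n) /\ rapidly_decreasing (fun n => c (- n%:Z)).
Proof.
move=> hc cB; pose A := cmod a + cmod b.
have A0 : 0 <= A by rewrite addr_ge0.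
have B0 : 0 <= B := le_trans (cmod_ge0 _) (cB 0).
have rec k r : 1 <= r -> 2 * r * A <= kappa k ^+ 2 - l ->
    2 * r * A * cmod (c k) <= A * (cmod (c (k + 1)) + cmod (c (k - 1))).
  move=> r1 rk.
  have e : cmod ((kappa k ^+ 2 - l)%:C * c k) <= A * (cmod (c (k + 1)) + cmod (c (k - 1))).
    have -> : (kappa k ^+ 2 - l)%:C * c k = - (a * c (k + 1) + b * c (k - 1)).
      by have := hc k; rewrite -addrA => /eqP; rewrite addr_eq0 => /eqP.
    rewrite cmodN; apply: le_trans (cmodD _ _) _; rewrite !cmodM.
    have h1 := mulr_ge0 (cmod_ge0 b) (cmod_ge0 (c (k + 1))).
    have h2 := mulr_ge0 (cmod_ge0 a) (cmod_ge0 (c (k - 1))).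
    by rewrite /A; lra.
  apply: le_trans e; rewrite cmodM cmod_real ler_wpM2r //.
  exact: le_trans rk (ler_norm _).
have [A00|An0] := eqVneq A 0.
  have [a0 b0] : a = 0 /\ b = 0.
    have := cmod_ge0 a; have := cmod_ge0 b; rewrite /A in A00 => h1 h2.
    by split; apply/eqP; rewrite -cmod_eq0; apply/eqP; lra.
  have zero k : `|l| < kappa k ^+ 2 -> c k = 0.
    move=> lk; have := hc k; rewrite a0 b0 !mul0r !addr0 => /eqP.
    rewrite mulf_eq0 => /orP[/eqP/(congr1 (@complex.Re R)) /= h|/eqP //].
    by exfalso; have := ler_norm l; lra.
  pose N := Num.bound `|l|.
  have lN : `|l| < N%:R by apply: archi_boundP.
  have fin (x : nat -> R[i]) : (forall n, cmod (x n) <= B) -> (forall n, (N < n)%N -> x n = 0) ->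
      rapidly_decreasing x.
    move=> xB xN r r1; exists (B * r ^+ N); first by rewrite mulr_ge0 // exprn_ge0 //; lra.
    have r0 : 0 < r by lra.
    move=> n; have [Nn|nN] := ltnP N n.
      by rewrite xN // cmod0 !mulr_ge0 ?exprn_ge0 ?invr_ge0 // ltW.
    apply: le_trans (xB n) _; rewrite -mulrA ler_peMr //.
    rewrite -(subnK nN) exprD -mulrA -exprMn mulfV ?gt_eqF // expr1n mulr1.
    exact: exprn_ege1.
  split; apply: fin => // n Nn; apply: zero; apply: lt_le_trans lN _.
  - by apply: le_trans (kappa_sqr_ge n); rewrite ler_nat ltnW.
  - case: n Nn => // n Nn; rewrite (_ : - n.+1%:Z = - n%:Z - 1); last by rewrite -addn1 PoszD; ring.
    by rewrite kappaN sqrrN; apply: le_trans (kappa_sqr_ge n); rewrite ler_nat.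
have Ap : 0 < A by rewrite lt_def An0.
have main (x : nat -> R[i]) : (forall n, cmod (x n) <= B) ->
    (forall n r, 1 <= r -> 2 * r * A <= n%:R - l ->
       2 * r * A * cmod (x n.+1) <= A * (cmod (x n.+2) + cmod (x n))) -> rapidly_decreasing x.
  move=> xB xrec r r1; pose N := Num.bound (2 * r * A + `|l|).
  have r0 : 0 < r by lra.
  have hN : 2 * r * A + `|l| < N%:R.
    by apply: archi_boundP; rewrite addr_ge0 // !mulr_ge0 // ltW.
  exists (B * r ^+ N); first by rewrite mulr_ge0 // exprn_ge0 // ltW.
  apply: (@two_sided_recurrence_decay (fun n => cmod (x n))) => // n Nn.
  rewrite -(ler_pM2l Ap) mulrA (mulrC A) ; apply: xrec => //.
  have : N%:R <= n%:R :> R by rewrite ler_nat.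
  have := ler_norm l; lra.
split; apply: main => // n r r1 hn.
- have := rec n.+1 r r1; rewrite (_ : n.+1%:Z + 1 = n.+2); last by rewrite -[n.+2]addn1 PoszD.
  rewrite (_ : n.+1%:Z - 1 = n); last by rewrite -addn1 PoszD addrK.
  apply; apply: le_trans hn _; rewrite lerD2r; apply: le_trans (kappa_sqr_ge n.+1).
  by rewrite ler_nat.
- have := rec (- n.+1%:Z) r r1; rewrite (_ : - n.+1%:Z + 1 = - n%:Z); last by rewrite -addn1 PoszD; ring.
  rewrite (_ : - n.+1%:Z - 1 = - n.+2%:Z); last by rewrite -[n.+2]addn1 PoszD; ring.
  rewrite (addrC (cmod (c (- n%:Z)))); apply; apply: le_trans hn _; rewrite lerD2r.
  rewrite (_ : - n.+1%:Z = - n%:Z - 1); last by rewrite -addn1 PoszD; ring.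
  by rewrite kappaN sqrrN kappa_sqr_ge.
Qed.

Lemma int_two_sided_ind (P : int -> Prop) : P 0 -> (forall k, P k -> P (k + 1)) ->
  (forall k, P k -> P (k - 1)) -> forall k, P k.
Proof.
move=> P0 Pp Pm; case=> n.
- by elim: n => // n IH; rewrite -addn1 PoszD; exact: Pp.
- elim: n => [|n IH]; first exact: (Pm 0).
  by rewrite (_ : Negz n.+1 = Negz n - 1) ?NegzE; [exact: Pm|rewrite -[n.+2]addn1 PoszD; ring].
Qed.

Lemma hill_seq_zero a b l c k0 : a != 0 -> b != 0 -> hill_seq a b l c ->
  c k0 = 0 -> c (k0 + 1) = 0 -> forall k, c k = 0.
Proof.
move=> a0 b0 hc c0 c1.
suff H k : c (k0 + k) = 0 /\ c (k0 + k + 1) = 0.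
  by move=> k; have [] := H (k - k0); rewrite addrC subrK.
elim/int_two_sided_ind: k => [|k [h1 h2]|k [h1 h2]]; first by rewrite addr0.
- rewrite addrA; split => //; have := hc (k0 + k + 1); rewrite h2 mulr0 add0r addrK h1 mulr0 addr0.
  by move/eqP; rewrite mulf_eq0 (negbTE a0) => /eqP.
- rewrite addrA subrK; split => //; have := hc (k0 + k); rewrite h1 h2 !mulr0 !add0r.
  by move/eqP; rewrite mulf_eq0 (negbTE b0) => /eqP.
Qed.

(* The Casoratian W satisfies a W k = b W (k - 1), hence is geometric, yet decays faster than that. *)
Lemma casoratian_zero a b l c d : a != 0 -> b != 0 -> hill_seq a b l c -> hill_seq a b l d ->
  rapidly_decreasing (fun n => c n) -> rapidly_decreasing (fun n => d n) ->
  forall k, c k * d (k + 1) = c (k + 1) * d k.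
Proof.
move=> a0 b0 hc hd cdec ddec.
pose W k := c k * d (k + 1) - c (k + 1) * d k.
have rec k : a * W k = b * W (k - 1).
  rewrite /W subrK.
  have -> : a * (c k * d (k + 1) - c (k + 1) * d k) =
    c k * (- (a * d (k + 1)) * -1) - (a * c (k + 1)) * d k by ring.
  have ec : a * c (k + 1) = - (kappa k ^+ 2 - l)%:C * c k - b * c (k - 1).
    by apply/eqP; rewrite -subr_eq0 -(hc k); apply/eqP; ring.
  have ed : a * d (k + 1) = - (kappa k ^+ 2 - l)%:C * d k - b * d (k - 1).
    by apply/eqP; rewrite -subr_eq0 -(hd k); apply/eqP; ring.
  by rewrite ec ed; ring.
have W0 : W 0 = 0.
  have Wn (n : nat) : W 0 = (a / b) ^+ n * W n.
    elim: n => [|n IH]; first by rewrite expr0 mul1r.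
    have := rec n.+1; rewrite (_ : n.+1%:Z - 1 = n); last by rewrite -addn1 PoszD addrK.
    move=> e; rewrite IH exprSr -mulrA; congr (_ * _).
    by rewrite mulrAC e mulrC mulrA mulVf // mul1r.
  (* [W 0] is (a/b)^n times [W n]; this rate of decay beats the growth q^n and leaves 2^-n. *)
  pose q := cmod (a / b); pose r := 2 * (q + 1).
  have q0 : 0 <= q by exact: cmod_ge0.
  have r1 : 1 <= r by rewrite /r; lra.
  have r0 : 0 < r by lra.
  have [C1 C10 h1] := cdec r r1; have [C2 C20 h2] := ddec r r1.
  apply/eqP; rewrite -cmod_eq0 eq_le cmod_ge0 andbT.
  apply: (@le0_geometric _ _ (2 * (C1 * C2))) => n.
  have ri : 0 <= r^-1 by rewrite invr_ge0 ltW.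
  have ri1 : r^-1 <= 1 by rewrite invf_le1.
  have hn : cmod (W n) <= 2 * (C1 * C2) * r^-1 ^+ n.
    have p0 : 0 <= r^-1 ^+ n by rewrite exprn_ge0.
    have p1 : r^-1 ^+ n <= 1 by rewrite exprn_ile1.
    have pS : r^-1 ^+ n.+1 <= 1 by rewrite exprn_ile1.
    have pSn : r^-1 ^+ n.+1 <= r^-1 ^+ n by rewrite exprS ler_piMl.
    have CC : 0 <= C1 * C2 by rewrite mulr_ge0.
    have key s t : 0 <= s -> t <= 1 -> C1 * s * (C2 * t) <= C1 * C2 * s.
      move=> s0 t1; rewrite (_ : _ * _ = C1 * C2 * s * t); last by ring.
      by rewrite ler_piMr // mulr_ge0.
    have key2 s t : 0 <= s -> t <= 1 -> C1 * t * (C2 * s) <= C1 * C2 * s.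
      move=> s0 t1; rewrite (_ : _ * _ = C1 * C2 * s * t); last by ring.
      by rewrite ler_piMr // mulr_ge0.
    have b1 : cmod (c n * d (n%:Z + 1)) <= C1 * C2 * r^-1 ^+ n.
      rewrite cmodM (_ : n%:Z + 1 = n.+1); last by rewrite -[n.+1]addn1 PoszD.
      apply: le_trans (ler_pM _ _ (h1 n) (h2 n.+1)) _ => //.
      exact: key.
    have b2 : cmod (c (n%:Z + 1) * d n) <= C1 * C2 * r^-1 ^+ n.
      rewrite cmodM (_ : n%:Z + 1 = n.+1); last by rewrite -[n.+1]addn1 PoszD.
      apply: le_trans (ler_pM _ _ (h1 n.+1) (h2 n)) _ => //.
      by have := key2 _ _ p0 pS.
    by apply: le_trans (cmodB _ _) _; lra.
  rewrite (Wn n) cmodM cmodX -/q.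
  apply: le_trans (ler_wpM2l (exprn_ge0 n q0) hn) _.
  rewrite mulrCA -exprMn ler_wpM2l ?mulr_ge0 //.
  apply: lerXn2r; rewrite ?nnegrE ?(mulr_ge0 q0 ri) ?invr_ge0 //.
  by rewrite ler_pdivrMr // /r; lra.
have Wk k : W k = 0.
  elim/int_two_sided_ind: k => // k h.
  - have := rec (k + 1); rewrite addrK h mulr0 => /eqP.
    by rewrite mulf_eq0 (negbTE a0) => /eqP.
  - have := rec k; rewrite h mulr0 => /esym/eqP.
    by rewrite mulf_eq0 (negbTE b0) => /eqP.
by move=> k; apply/eqP; rewrite -subr_eq0; apply/eqP; exact: Wk.
Qed.

(** The combination [e] vanishes at [k0] by construction and at the next index because the
    Casoratian is zero; two consecutive zeros propagate. *)
Lemma hill_seq_proportional a b l c d : a != 0 -> b != 0 -> hill_seq a b l c -> hill_seq a b l d ->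
  (forall k, c k * d (k + 1) = c (k + 1) * d k) -> forall k0 k, c k0 * d k = d k0 * c k.
Proof.
move=> a0 b0 hc hd W k0 k; apply/eqP; rewrite -subr_eq0; apply/eqP.
pose e k := c k0 * d k - d k0 * c k.
apply: (@hill_seq_zero a b l e k0) => //.
- move=> j; rewrite /e.
  transitivity (c k0 * ((kappa j ^+ 2 - l)%:C * d j + a * d (j + 1) + b * d (j - 1)) -
     d k0 * ((kappa j ^+ 2 - l)%:C * c j + a * c (j + 1) + b * c (j - 1))); first by ring.
  by rewrite hc hd; ring.
- by rewrite /e; ring.
- by rewrite /e W; ring.
Qed.

(** The reflection k -> -k - 1 preserves the squared frequencies and exchanges the roles of [a] and
    [b]; the gauge factor (b/a)^k exchanges them back. *)
Lemma hill_seq_reflect a b l c : a != 0 -> b != 0 -> hill_seq a b l c ->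
  hill_seq a b l (fun k => c (- k - 1) * (b / a) ^ k).
Proof.
move=> a0 b0 hc k; set t := b / a.
have t0 : t != 0 by rewrite mulf_neq0 // invr_eq0.
have := hc (- k - 1); rewrite kappaN sqrrN subrK => e.
rewrite (_ : - (k + 1) - 1 = - k - 1 - 1); last by ring.
rewrite (_ : - (k - 1) - 1 = - k); last by ring.
rewrite !expfzDr // expr1z exprN1.
have ta : t * a = b by rewrite /t divfK.
have tb : b / t = a by rewrite /t invf_div mulrCA mulfV // mulr1.
transitivity (t ^ k * ((kappa k ^+ 2 - l)%:C * c (- k - 1) + (t * a) * c (- k - 1 - 1) + (b / t) * c (- k))).
  by ring.
rewrite ta tb (_ : _ + _ = (kappa k ^+ 2 - l)%:C * c (- k - 1) + a * c (- k) + b * c (- k - 1 - 1)); last by ring.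
by rewrite e mulr0.
Qed.

End HillSequences.

(** * Fourier coefficients against antiperiodic exponentials *)

Section FourierCoefficients.
Variable R : realType.
Local Notation leb := (@lebesgue_measure R).
Implicit Types (a b : R[i]) (f y p w : R -> R[i]) (k : int) (l x : R).

Lemma kappaS k : kappa R (k + 1) = kappa R k + 2 * pi.
Proof.
rewrite /kappa (_ : 2 * (k + 1) + 1 = 2 * k + 1 + 2); last by ring.
by rewrite rmorphD mulrDl rmorph_nat.
Qed.

Lemma kappaP k : kappa R (k - 1) = kappa R k - 2 * pi.
Proof. by rewrite -{2}(subrK 1 k) kappaS addrK. Qed.

Definition fcoef y k : R[i] := ci (fun x => y x * expi (- kappa R k * x)).

Lemma expi_ccont (w : R) : ccont (fun x => expi (w * x)).
Proof. exact: cder_ccont (cder_expi w). Qed.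

Lemma expi_kappa k : expi (kappa R k) = -1.
Proof.
elim/int_two_sided_ind: k => [|k IH|k IH].
- by rewrite /kappa mulr0 add0r mul1r expi_pi.
- by rewrite kappaS expi_period.
- by rewrite -IH -[LHS]expi_period kappaP subrK.
Qed.

Lemma expiNk k : expi (- kappa R k) = -1.
Proof.
rewrite expiN expi_kappa; by apply: complex_ext => /=; rewrite ?oppr0.
Qed.

Lemma fcoefD f y k : ccont f -> ccont y ->
  fcoef (fun x => f x + y x) k = fcoef f k + fcoef y k.
Proof.
move=> cf cy; have ce := expi_ccont (- kappa R k); rewrite /fcoef -ciD; [|prove_ccont..].
by apply: eq_ci => x; rewrite mulrDl.
Qed.

Lemma fcoefZ (s : R[i]) y k : ccont y -> fcoef (fun x => s * y x) k = s * fcoef y k.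
Proof.
move=> cy; have ce := expi_ccont (- kappa R k); rewrite /fcoef -ciZ; last by prove_ccont.
by apply: eq_ci => x; rewrite mulrA.
Qed.

Lemma fcoef_le y k (B : R) : ccont y -> (forall x, 0 <= x -> x <= 1 -> cmod (y x) <= B) ->
  cmod (fcoef y k) <= B.
Proof.
move=> cy yB; have ce := expi_ccont (- kappa R k).
apply: cmod_ci_le => [|x x0 x1]; first by prove_ccont.
by rewrite cmodM cmod_expi mulr1 yB.
Qed.

(** Two integrations by parts: the solution and the exponential both change sign over the period, so
    the boundary terms at 0 and 1 are equal. The two exponentials in the potential shift the index
    by one. *)
Lemma fcoef_hill_seq a b l y p : ode (hill_coef a b l%:C) y p -> y 1 = - y 0 -> p 1 = - p 0 ->
  hill_seq a b l (fcoef y).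
Proof.
move=> oy y1 p1 k; have [cy cp] := ode_ccont oy; have [dy dp] := oy.
have [cQ _] := hill_coef_admissible a b l%:C; have cQy := ccontM cQ cy.
pose K := - kappa R k; pose w x := expi (K * x); pose z := 0 +i* K : R[i].
have zz : z * z = - (kappa R k ^+ 2)%:C.
  by apply: complex_ext; rewrite /= /K; ring.
have dw : cder w (fun x => z * w x) := cder_expi K.
have dw' : cder (fun x => z * w x) (fun x => z * (z * w x)) := cderZ z dw.
have cw : ccont w := expi_ccont K.
have cw'' : ccont (fun x => z * (z * w x)) by do 2 apply: ccontZ.
have w0 : w 0 = 1 by rewrite /w mulr0 expi0.
have w1 : w 1 = -1 by rewrite /w mulr1 expiNk.
have [_ _ e] := abs_cont_by_parts2 ler01 (cder_abs_cont (D := `[0, 1]) dy cp)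
  (cder_abs_cont (D := `[0, 1]) dp cQy) dw dw' cw''.
have pos (j : int) : ci (fun x => (y x * expi (- kappa R j * x))) = fcoef y j by [].
have eE : ci (fun x => hill_coef a b l%:C x * y x * w x) =
    a * fcoef y (k + 1) + b * fcoef y (k - 1) - l%:C * fcoef y k.
  have ck1 := expi_ccont (- kappa R (k + 1)); have ck2 := expi_ccont (- kappa R (k - 1)).
  rewrite -!fcoefZ // /fcoef -ciD; [|prove_ccont..]; rewrite -ciB; [|prove_ccont..].
  apply: eq_ci => x; rewrite /hill_coef /potential kappaS kappaP.
  have -> : - (kappa R k + 2 * pi) * x = - (2 * pi * x) + K * x by rewrite /K; ring.
  have -> : - (kappa R k - 2 * pi) * x = 2 * pi * x + K * x by rewrite /K; ring.
  by rewrite (expiD (- (2 * pi * x))) (expiD (2 * pi * x)) -/(w x); ring.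
have eE2 : ci (fun x => y x * (z * (z * w x))) = - (kappa R k ^+ 2)%:C * fcoef y k.
  rewrite -zz -fcoefZ //; apply: eq_ci => x; rewrite -/(w x); ring.
have : ci (fun x => hill_coef a b l%:C x * y x * w x) - ci (fun x => y x * (z * (z * w x))) = 0.
  by rewrite /ci e y1 p1 w0 w1; ring.
rewrite eE eE2 => h; rewrite rmorphB /= -[RHS]h; ring.
Qed.

(** Multiplication by the cosine shifts the index by 1 and -1, so vanishing of all coefficients
    survives multiplication by any power of the raised cosine. *)
Lemma kernel_annihilates f (x0 : R) : ccont f -> (forall k, fcoef f k = 0) ->
  forall n k, fcoef (fun x => f x * (1 + (cos (2 * pi * (x - x0)))%:C) ^+ n) k = 0.
Proof.
move=> cf f0.
pose u (s : R) x := expi (s * x).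
have KE x : (cos (2 * pi * (x - x0)))%:C =
    (1 / 2) * (expi (- (2 * pi * x0)) * expi (2 * pi * x)) +
    (1 / 2) * (expi (2 * pi * x0) * expi (- (2 * pi) * x)).
  rewrite -!expiD (_ : - (2 * pi * x0) + 2 * pi * x = 2 * pi * (x - x0)); last by ring.
  rewrite (_ : 2 * pi * x0 + - (2 * pi) * x = - (2 * pi * (x - x0))); last by ring.
  rewrite expiN; move: (2 * pi * (x - x0)) => t.
  rewrite (_ : 1 / 2 = (1 / 2 : R)%:C :> R[i]); last by rewrite fmorph_div /= rmorph1 rmorphMn.
  by apply: complex_ext; rewrite /=; field.
have ck : ccont (fun x => (cos (2 * pi * (x - x0)))%:C).
  apply: (ccont_ext (fun x => esym (KE x))).
  have c1 := expi_ccont (2 * pi); have c2 := expi_ccont (- (2 * pi)); prove_ccont.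
have cn n : ccont (fun x => f x * (1 + (cos (2 * pi * (x - x0)))%:C) ^+ n).
  elim: n => [|n IH]; first by apply: ccont_ext cf => x; rewrite expr0 mulr1.
  apply: (@ccont_ext _ (fun x => (f x * (1 + (cos (2 * pi * (x - x0)))%:C) ^+ n) *
     (1 + (cos (2 * pi * (x - x0)))%:C))) => [x|]; first by rewrite exprSr mulrA.
  by apply: ccontM => //; apply: ccontD => //; exact: ccont_cst.
elim=> [|n IH] k.
  by rewrite -(f0 k); apply: eq_ci => x; rewrite expr0 mulr1.
pose g x := f x * (1 + (cos (2 * pi * (x - x0)))%:C) ^+ n.
have cg : ccont g := cn n.
transitivity (fcoef g k + ((1 / 2) * expi (- (2 * pi * x0))) * fcoef g (k - 1) +
    ((1 / 2) * expi (2 * pi * x0)) * fcoef g (k + 1)); last by rewrite !IH; ring.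
have c1 := expi_ccont (- kappa R (k + 1)); have c2 := expi_ccont (- kappa R (k - 1)).
have c3 := expi_ccont (- kappa R k).
rewrite -!fcoefZ // /fcoef -ciD; [|prove_ccont..]; rewrite -ciD; [|prove_ccont..].
apply: eq_ci => x; rewrite exprSr mulrA -/(g x) KE kappaS kappaP.
have -> : - (kappa R k + 2 * pi) * x = - (2 * pi) * x + - kappa R k * x by ring.
have -> : - (kappa R k - 2 * pi) * x = 2 * pi * x + - kappa R k * x by ring.
by rewrite (expiD (- (2 * pi) * x)) (expiD (2 * pi * x)); ring.
Qed.

Lemma cos_le_cos (s t : R) : 0 <= s -> s <= t -> t <= pi -> cos t <= cos s.
Proof.
move=> s0; rewrite le_eqVlt => /predU1P[-> //|st] tpi; apply: ltW.
by rewrite ltr_cos ?in_itv /= ?s0 ?tpi ?(le_trans s0 (ltW st)) ?(le_trans (ltW st)).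
Qed.

Lemma cos_normr (t : R) : cos `|t| = cos t.
Proof. by case: (ger0P t) => // _; rewrite cosN. Qed.

Lemma Rintegral_ge_cst (g : R -> R) (c d m : R) : c <= d -> continuous g ->
  (forall x, c <= x -> x <= d -> m <= g x) -> m * (d - c) <= \int[leb]_(x in `[c, d]) g x.
Proof.
move=> cd cg gm.
have -> : m * (d - c) = \int[leb]_(x in `[c, d]) (fun=> m) x.
  rewrite Rintegral_cst //= lebesgue_measure_itv /= lte_fin; congr (_ * _).
  by case: ifP => //= /negbT; rewrite -leNgt => dc; lra.
apply: le_Rintegral => //; first exact/integrable_continuous/cst_continuous.
  exact: integrable_continuous.
by move=> x /=; rewrite in_itv /= => /andP[]; exact: gm.
Qed.

(** On [0, 1] the kernel has its peak at [x0] alone as long as [x0] keeps distance [d] from both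
    ends; for |x - x0| > 1/2 the value is that at the reflected distance 1 - |x - x0|, still at
    least d. *)
Lemma raised_cosine_peak x0 (d : R) : 0 < d -> d <= x0 -> d <= 1 - x0 ->
  exists A B : R, [/\ 0 <= A, A < B,
    forall x, `|x - x0| <= d / 2 -> B <= 1 + cos (2 * pi * (x - x0)) &
    forall x, 0 <= x -> x <= 1 -> d <= `|x - x0| -> 1 + cos (2 * pi * (x - x0)) <= A].
Proof.
move=> d0 dx0 dx1; have d2 : d <= 1 - d by lra.
have xdP x : 0 <= x -> x <= 1 -> `|x - x0| <= 1 - d.
  by move=> x_0 x_1; rewrite ler_norml; apply/andP; split; lra.
have dh : 0 < d / 2 by rewrite divr_gt0.
have p2 : 0 < 2 * pi :> R by rewrite mulr_gt0 // pi_gt0.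
have absE x : `|2 * pi * (x - x0)| = 2 * pi * `|x - x0|.
  by rewrite normrM ger0_norm // ltW.
have ph : 2 * pi * (1 - 1 / 2) = pi :> R by move: (@pi R) => p; field.
have half (s : R) : s <= 1 / 2 -> 2 * pi * s <= pi.
  move=> s2; have s3 : s <= 1 - 1 / 2 by lra.
  have := ler_wpM2l (ltW p2) s3; by rewrite ph.
exists (1 + cos (2 * pi * d)), (1 + cos (2 * pi * (d / 2))); split.
- by rewrite -lerBlDl sub0r cos_geN1.
- rewrite ltrD2l ltr_cos ?in_itv /= ?mulr_ge0 ?half ?(ltW p2) ?(ltW d0) ?(ltW dh) //; try lra.
  by rewrite ltr_pM2l //; lra.
- move=> x xd; rewrite lerD2l -[leRHS]cos_normr absE; apply: cos_le_cos.
  + by rewrite mulr_ge0 // ltW.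
  + by rewrite ler_pM2l.
  + by apply: half; lra.
- move=> x x_0 x_1 dx; rewrite lerD2l -[leLHS]cos_normr absE.
  have [xs|xl] := leP `|x - x0| (1 / 2).
    by apply: cos_le_cos; [rewrite mulr_ge0 // ltW|rewrite ler_pM2l|exact: half].
  have -> : cos (2 * pi * `|x - x0|) = cos (2 * pi * (1 - `|x - x0|)).
    rewrite -[RHS]cosN [in LHS](_ : 2 * pi * `|x - x0| = - (2 * pi * (1 - `|x - x0|)) + pi + pi).
      by rewrite !cosDpi opprK.
    by move: (@pi R) => p; ring.
  apply: cos_le_cos; [by rewrite mulr_ge0 // ltW| |by apply: half; lra].
  by rewrite ler_pM2l //; have := xdP x x_0 x_1; lra.
Qed.

(** The central window of length [d] contributes at least h0 d B^n, all else at least -H A^n. Since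
    A < B the first term wins for large n and the integral cannot vanish. *)
Lemma concentrating_kernel (h K : R -> R) (x0 d h0 H A B : R) :
  continuous h -> continuous K -> 0 < d -> d <= x0 -> d <= 1 - x0 -> 0 < h0 ->
  (forall x, `|x - x0| <= d -> h0 <= h x) -> (forall x, 0 <= x -> x <= 1 -> `|h x| <= H) ->
  (forall x, 0 <= K x) -> 0 <= A -> A < B -> (forall x, `|x - x0| <= d / 2 -> B <= K x) ->
  (forall x, 0 <= x -> x <= 1 -> d <= `|x - x0| -> K x <= A) ->
  (forall n, \int[leb]_(x in `[0, 1]) (h x * K x ^+ n) = 0) -> False.
Proof.
move=> ch cK d0 dx0 dx1 h0p hd hH K0 A0 AB Kin Kout int0.
have B0 : 0 < B by exact: le_lt_trans AB.
have H0 : 0 <= H by apply: le_trans (hH 0 (lexx _) ler01).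
have cKn n : continuous (fun x => h x * K x ^+ n).
  move=> x; apply: cvgM; first exact: ch.
  by apply: (@continuous_comp _ _ _ K (fun t => t ^+ n)); [exact: cK|exact: exprn_continuous].
have low n x : 0 <= x -> x <= 1 -> - (H * A ^+ n) <= h x * K x ^+ n.
  move=> x_0 x_1; have HA : 0 <= H * A ^+ n by rewrite mulr_ge0 // exprn_ge0.
  have [xd|xd] := leP `|x - x0| d.
    apply: (@le_trans _ _ 0); first by rewrite oppr_le0.
    by rewrite mulr_ge0 ?exprn_ge0 // (le_trans (ltW h0p)) // hd.
  have : `|h x * K x ^+ n| <= H * A ^+ n.
    rewrite normrM; apply: ler_pM => //; first exact: hH.
    rewrite ger0_norm ?exprn_ge0 //; apply: lerXn2r; rewrite ?nnegrE //.
    exact: Kout (ltW xd).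
  by rewrite ler_norml => /andP[].
have main n : h0 * d * B ^+ n <= H * A ^+ n.
  have m1 : 0 <= x0 - d / 2 by lra.
  have m2 : x0 - d / 2 <= x0 + d / 2 by lra.
  have m3 : x0 + d / 2 <= 1 by lra.
  have := int0 n.
  rewrite (Rintegral_split m1 (le_trans m2 m3) (integrable_continuous _ _ (cKn n))).
  rewrite (Rintegral_split m2 m3 (integrable_continuous _ _ (cKn n))).
  have i1 := @Rintegral_ge_cst (fun x => h x * K x ^+ n) 0 (x0 - d / 2) (- (H * A ^+ n)) m1 (cKn n).
  have i3 := @Rintegral_ge_cst (fun x => h x * K x ^+ n) (x0 + d / 2) 1 (- (H * A ^+ n)) m3 (cKn n).
  have i2 := @Rintegral_ge_cst (fun x => h x * K x ^+ n) (x0 - d / 2) (x0 + d / 2) (h0 * B ^+ n) m2 (cKn n).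
  have {}i1 := i1 (fun x q1 q2 => low n x q1 (le_trans q2 (le_trans m2 m3))).
  have {}i3 := i3 (fun x q1 q2 => low n x (le_trans (le_trans m1 m2) q1) q2).
  have {}i2 : h0 * B ^+ n * (x0 + d / 2 - (x0 - d / 2)) <=
      \int[leb]_(x in `[x0 - d / 2, x0 + d / 2]) (h x * K x ^+ n).
    apply: i2 => x xl xr.
    have xd : `|x - x0| <= d / 2 by rewrite ler_norml; apply/andP; split; lra.
    apply: ler_pM; [exact: ltW|by rewrite exprn_ge0 // ltW| |].
      by apply: hd; lra.
    by apply: lerXn2r; rewrite ?nnegrE ?(ltW B0) //; exact: Kin.
  have HA : 0 <= H * A ^+ n by rewrite mulr_ge0 // exprn_ge0.
  have HAx : H * A ^+ n * d >= 0 by rewrite mulr_ge0 // ltW.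
  move: i1 i2 i3; move: (\int[leb]_(x in _) _) (\int[leb]_(x in _) _) (\int[leb]_(x in _) _).
  move: (H * A ^+ n) (B ^+ n) HA HAx => U V U0 Ud I1 I2 I3 j1 j2 j3 jz.
  move: j1 j2 j3 jz U0 Ud; clear => *; lra.
have AB1 : 0 <= A / B < 1.
  by rewrite divr_ge0 ?(ltW B0) //= ltr_pdivrMr // mul1r.
have lim : (H * (A / B) ^+ n) @[n --> \oo] --> (0 : R).
  rewrite -(mulr0 H); apply: cvgMr; apply: cvg_expr.
  by case/andP: AB1 => q0 q1; rewrite ger0_norm.
have hp : 0 < h0 * d by rewrite mulr_gt0.
move/cvgr_lt: lim => /(_ _ hp) [N _ /(_ N (leqnn N)) /=].
rewrite ltNge => /negP; apply.
rewrite expr_div_n mulrA ler_pdivlMr ?exprn_gt0 //; exact: main.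
Qed.

(** Powers of the raised cosine concentrate at [x0]; orthogonality to all of them contradicts a
    nonzero value there. The kernel needs room on both sides, so the end points are left to
    continuity. *)
Lemma fourier_uniqueness f : ccont f -> (forall k, fcoef f k = 0) ->
  forall x, 0 < x -> x < 1 -> f x = 0.
Proof.
move=> cf f0 x0 x00 x01; apply/eqP; apply/negPn/negP => fx0.
(* The factor exp(-i pi x) is the exponential of index 0, so the integrals of [g] against the
   kernels are coefficients of index 0; the constant factor makes [g x0] equal to |f x0|^2. *)
pose g x := (f x0 * expi (- pi * x0))^*%C * (f x * expi (- pi * x)).
have cg : ccont g by have c1 := expi_ccont (- pi); rewrite /g; prove_ccont.
pose h0 := cmod (f x0) ^+ 2.
have h0p : 0 < h0 by rewrite exprn_gt0 // cmod_gt0.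
have gx0 : Re (g x0) = h0.
  by rewrite /g mulrC mulcJ /= cmodM cmod_expi mulr1.
have [H hH] := ccont_bounded 0 1 cg.
pose h x := Re (g x); have ch : continuous h by case: cg.
have hx0 : h x0 = h0 by exact: gx0.
pose Kr x : R := 1 + cos (2 * pi * (x - x0)).
have KrC x : (1 + (cos (2 * pi * (x - x0)))%:C) = (Kr x)%:C by rewrite rmorphD rmorph1.
have Kr0 x : 0 <= Kr x by rewrite /Kr; have := cos_geN1 (2 * pi * (x - x0)); lra.
have cKr : continuous Kr.
  move=> x; apply: cvgD; first exact: cvg_cst.
  apply: (@continuous_comp _ _ _ (fun x => 2 * pi * (x - x0)) cos); last exact: continuous_cos.
  by apply: cvgM; [exact: cvg_cst|apply: cvgB; [exact: cvg_id|exact: cvg_cst]].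
have int0 n : \int[leb]_(x in `[0, 1]) (h x * Kr x ^+ n) = 0.
  have e := kernel_annihilates x0 cf f0 n 0.
  have cfk : ccont (fun x => f x * (1 + (cos (2 * pi * (x - x0)))%:C) ^+ n * expi (- kappa R 0 * x)).
    have cK : ccont (fun x => (1 + (cos (2 * pi * (x - x0)))%:C) ^+ n).
      rewrite (_ : (fun x => _) = fun x => (Kr x ^+ n)%:C); last first.
        by apply/funext => x; rewrite KrC rmorphXn.
      split; last exact: cst_continuous.
      move=> x; apply: (@continuous_comp _ _ _ Kr (fun t => t ^+ n)); [exact: cKr|exact: exprn_continuous].
    have ce := expi_ccont (- kappa R 0); prove_ccont.
  have : ci (fun x => (f x0 * expi (- pi * x0))^*%C *
     (f x * (1 + (cos (2 * pi * (x - x0)))%:C) ^+ n * expi (- kappa R 0 * x))) = 0.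
    by rewrite ciZ // -/(fcoef _ 0) e mulr0.
  move=> /(congr1 (@complex.Re R)) /= e2; rewrite -[RHS]e2; apply: eq_Rintegral => x _ /=.
  rewrite KrC -rmorphXn (_ : - kappa R 0 = - pi); last by rewrite /kappa mulr0 add0r mul1r.
  rewrite (_ : _ * _ = g x * (Kr x ^+ n)%:C); last by rewrite /g; ring.
  by rewrite cReM /= mulr0 subr0.
have h02 : 0 < h0 / 2 by rewrite divr_gt0.
have hlt : h0 / 2 < h x0 by rewrite hx0 ltr_pdivrMr // ltr_pMr // ltr1n.
have : \forall x \near x0, h0 / 2 < h x by exact: (cvgr_gt (h x0) (ch x0)).
move=> /nbhs_ballP [e /= e0 he].
pose d := Order.min (e / 2) (Order.min x0 (1 - x0)).
have [m1 m2 m3] : [/\ d <= e / 2, d <= x0 & d <= 1 - x0] by rewrite !ge_min !lexx !orbT.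
have d0 : 0 < d by rewrite !lt_min divr_gt0 // x00 subr_gt0.
have [A [B [A0 AB Kin Kout]]] := raised_cosine_peak d0 m2 m3.
apply: (concentrating_kernel ch cKr d0 m2 m3 h02 _ _ Kr0 A0 AB Kin Kout int0).
  move=> x xd; apply/ltW/he; rewrite /ball /= distrC.
  by apply: le_lt_trans xd (le_lt_trans m1 _); rewrite ltr_pdivrMr // ltr_pMr // ltr1n.
by move=> x x_0 x_1; apply: le_trans (ler_Re_cmod _) _; exact: hH.
Qed.

End FourierCoefficients.

(** * Monodromy -1 cannot occur *)

Section Ince.
Variable R : realType.
Local Notation leb := (@lebesgue_measure R).
Implicit Types (a b : R[i]) (f y p w : R -> R[i]) (k : int) (l x : R).

Lemma ccont_zero_closure f : ccont f -> (forall x, 0 < x -> x < 1 -> f x = 0) ->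
  forall x, 0 <= x -> x <= 1 -> f x = 0.
Proof.
have key (u : R -> R) : continuous u -> (forall x, 0 < x -> x < 1 -> u x = 0) ->
    forall x, 0 <= x -> x <= 1 -> u x = 0.
  move=> cu u0 x x0 x1; apply/eqP; apply/negPn/negP => ux.
  have uxp : 0 < `|u x| by rewrite normr_gt0.
  have /cvgrPdist_lt /(_ _ uxp) /nbhs_ballP [e /= e0 he] := cu x.
  pose s := Order.min (1 / 2) (e / 2).
  have s0 : 0 < s by rewrite lt_min; apply/andP; split; lra.
  have s1 : s <= 1 / 2 by rewrite ge_min lexx.
  have s2 : s <= e / 2 by rewrite ge_min lexx orbT.
  pose z := x + s * (1 / 2 - x).
  have zp : 0 < z by rewrite /z; nra.
  have z1 : z < 1 by rewrite /z; nra.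
  have : ball x e z.
    rewrite /ball /= /z opprD addNKr normrN normrM (gtr0_norm s0).
    have : `|1 / 2 - x| <= 1 by rewrite ler_norml; apply/andP; split; lra.
    by move=> h; apply: le_lt_trans (ler_wpM2l (ltW s0) h) _; lra.
  by move=> /he /=; rewrite (u0 z zp z1) subr0 ltxx.
move=> [c1 c2] f0 x x0 x1; apply: complex_ext => /=.
- by apply: (key (Re \o f)) => // t t0 t1; rewrite /= f0.
- by apply: (key (Im \o f)) => // t t0 t1; rewrite /= f0.
Qed.

Lemma sqnorm_eq0 f : (forall x, 0 <= x -> x <= 1 -> f x = 0) -> sqnorm f = 0.
Proof.
move=> f0; rewrite /sqnorm (@eq_Rintegral _ _ _ _ _ (fun=> 0)); last first.
  by move=> x /set_mem /=; rewrite in_itv /= => /andP[x0 x1]; rewrite /sqmod f0 // cmod0 expr0n.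
by rewrite Rintegral_cst // mul0r.
Qed.

Section AntiperiodicMonodromy.
Variables (a b : R[i]) (l : R).
Let Q := hill_coef a b l%:C.
Hypotheses (ph1 : fph Q 1 = 0) (th'1 : fth' Q 1 = 0) (th1 : fth Q 1 = -1) (ph'1 : fph' Q 1 = -1).

Let aQ : admissible Q := hill_coef_admissible a b l%:C.

Lemma fcoef_fth_hill_seq : hill_seq a b l (fcoef (fth Q)) /\ hill_seq a b l (fcoef (fph Q)).
Proof.
split.
- by apply: (fcoef_hill_seq (ode_fth aQ)); rewrite ?fth0 ?fth'0 ?th1 ?th'1 ?oppr0.
- by apply: (fcoef_hill_seq (ode_fph aQ)); rewrite ?fph0 ?fph'0 ?ph1 ?ph'1 ?oppr0.
Qed.

(** A combination with vanishing coefficients vanishes on [0, 1] by uniqueness, so its Cauchy data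
    (s, t) vanish. This makes the passage to coefficients injective on the solution space. *)
Lemma fcoef_combination_eq0 (s t : R[i]) :
  (forall k, s * fcoef (fth Q) k + t * fcoef (fph Q) k = 0) -> s = 0 /\ t = 0.
Proof.
move=> h; have [ct ct' cp cp'] := fund_ccont aQ.
pose y x := s * fth Q x + t * fph Q x; pose p x := s * fth' Q x + t * fph' Q x.
have oy : ode Q y p := ode_lincomb s t (ode_fth aQ) (ode_fph aQ).
have [cy _] := ode_ccont oy.
have y0 k : fcoef y k = 0.
  by rewrite fcoefD ?fcoefZ //; exact: ccontZ.
have N0 := sqnorm_eq0 (ccont_zero_closure cy (fourier_uniqueness cy y0)).
have [cQ _] := aQ.
have := cauchy_data_sqnorm_le (hill_coef_bounded (lexx (cmod a + cmod b + cmod l%:C))) cQ oy.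
rewrite N0 mulr0 /y /p fth0 // fph0 // fth'0 // fph'0 // !mulr0 !mulr1 addr0 add0r => hh.
have h1 := sqr_ge0 (cmod s); have h2 := sqr_ge0 (cmod t).
have sq0 (u : R[i]) : cmod u ^+ 2 = 0 -> u = 0.
  by move/eqP; rewrite expf_eq0 /= cmod_eq0 => /eqP.
by split; apply: sq0; lra.
Qed.

(** If M = -1, both fundamental solutions are antiperiodic, and proportional coefficient sequences
    would make them linearly dependent. *)
Lemma antiperiodic_monodromy_nonscalar : a != 0 -> b != 0 -> False.
Proof.
move=> a0 b0; have [ct ct' cp cp'] := fund_ccont aQ.
have [hc hd] := fcoef_fth_hill_seq.
have [B1 hB1] := ccont_bounded 0 1 ct; have [B2 hB2] := ccont_bounded 0 1 cp.
have [d1 _] := hill_seq_decay hc (fun k => fcoef_le k ct hB1).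
have [d2 _] := hill_seq_decay hd (fun k => fcoef_le k cp hB2).
have W := casoratian_zero a0 b0 hc hd d1 d2.
have prop := hill_seq_proportional a0 b0 hc hd W.
set c := fcoef (fth Q) in prop; set d := fcoef (fph Q) in prop.
have E k0 : c k0 = 0 /\ d k0 = 0.
  have [|e1 e2] := @fcoef_combination_eq0 (d k0) (- c k0).
    by move=> k; rewrite -/c -/d mulNr prop subrr.
  by split => //; apply/eqP; rewrite -oppr_eq0 e2.
have [|/eqP] := @fcoef_combination_eq0 1 0; last by rewrite oner_eq0.
by move=> k; have [+ _] := E k; rewrite /c => ->; rewrite mulr0 mul0r addr0.
Qed.

(** At l = pi^2 the diagonal factor vanishes exactly for k = 0 and k = -1. With one of [a], [b] zero
    the recurrence has two terms, so a single coefficient, at 0 if a = 0 and at -1 if b = 0,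
    determines the sequence: antiperiodic solutions form a space of dimension at most one, against
    two for M = -1. *)
Lemma antiperiodic_monodromy_nonscalar0 : l = pi ^+ 2 -> (a != 0 \/ b != 0) -> a = 0 \/ b = 0 -> False.
Proof.
move=> lE ab ab0; have [hc hd] := fcoef_fth_hill_seq.
set c := fcoef (fth Q) in hc; set d := fcoef (fph Q) in hd.
have nz k : k != 0 -> k != -1 -> (kappa R k ^+ 2 - l)%:C != 0.
  move=> k0 k1; apply/eqP => /(congr1 (@complex.Re R)) /=.
  have -> : kappa R k ^+ 2 - l = (4 * k * (k + 1))%:~R * pi ^+ 2.
    rewrite lE /kappa exprMn -rmorphXn -{2}[pi ^+ 2]mul1r -mulrBl; congr (_ * _).
    by rewrite -(rmorph1 (intmul (1 : R))) -rmorphB; congr (_%:~R); ring.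
  move/eqP; rewrite mulf_eq0 intr_eq0 => /orP[|]; last by rewrite expf_eq0 /= gt_eqF // pi_gt0.
  by rewrite !mulf_eq0 (negbTE k0) /= addr_eq0 => /eqP kE; move: k1; rewrite kE.
(* with one coefficient killed, the two-term recurrence propagates zero in both directions *)
have kill (k0 : int) : (a = 0 /\ k0 = 0) \/ (b = 0 /\ k0 = -1) ->
    forall s t, s * c k0 + t * d k0 = 0 -> forall k, s * c k + t * d k = 0.
  move=> cases s t e0 k.
  pose e k := s * c k + t * d k.
  have he : hill_seq a b l e.
    move=> j; rewrite /e.
    transitivity (s * ((kappa R j ^+ 2 - l)%:C * c j + a * c (j + 1) + b * c (j - 1)) +
     t * ((kappa R j ^+ 2 - l)%:C * d j + a * d (j + 1) + b * d (j - 1))); first by ring.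
    by rewrite hc hd; ring.
  rewrite -/(e k); case: cases => -[z0 k0E]; rewrite k0E in e0.
  - have b0 : b != 0 by case: ab => //; rewrite z0 eqxx.
    have up (n : nat) : e n = 0.
      elim: n => [//|n IH]; have := he n.+1; rewrite z0 mul0r addr0.
      rewrite (_ : n.+1%:Z - 1 = n); last by rewrite -addn1 PoszD addrK.
      by rewrite IH mulr0 addr0 => /eqP; rewrite mulf_eq0 (negbTE (nz n.+1 _ _)) // => /eqP.
    have dn (n : nat) : e (- n%:Z) = 0.
      elim: n => [|n IH]; first by rewrite oppr0.
      have := he (- n%:Z); rewrite z0 mul0r addr0 IH mulr0 add0r.
      rewrite (_ : - n%:Z - 1 = - n.+1%:Z); last by rewrite -[n.+1]addn1 PoszD opprD.
      by move/eqP; rewrite mulf_eq0 (negbTE b0) => /eqP.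
    by case: k => n; [exact: up|rewrite NegzE; exact: dn].
  - have a0 : a != 0 by case: ab => //; rewrite z0 eqxx.
    have up (n : nat) : e (n%:Z - 1) = 0.
      elim: n => [|n IH]; first by rewrite sub0r.
      have := he (n%:Z - 1); rewrite z0 mul0r addr0 IH mulr0 add0r.
      rewrite subrK (_ : n.+1%:Z - 1 = n); last by rewrite -addn1 PoszD addrK.
      by move/eqP; rewrite mulf_eq0 (negbTE a0) => /eqP.
    have dn (n : nat) : e (- n.+1%:Z) = 0.
      elim: n => [//|n IH]; have := he (- n.+2%:Z); rewrite z0 mul0r addr0.
      rewrite (_ : - n.+2%:Z + 1 = - n.+1%:Z); last by rewrite -[n.+2]addn1 PoszD; ring.
      rewrite IH mulr0 addr0 => /eqP; rewrite mulf_eq0 (negbTE (nz _ _ _)) //=.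
      by move/eqP.
    by case: k => n; [rewrite -[n%:Z](addrK 1) -PoszD; exact: up|rewrite NegzE; exact: dn].
have [k0 hk0] : exists k0 : int, (a = 0 /\ k0 = 0) \/ (b = 0 /\ k0 = -1).
  by case: ab0 => z; [exists 0; left|exists (-1); right].
have e0 : d k0 * c k0 + - c k0 * d k0 = 0 by rewrite mulNr mulrC subrr.
have [d0 c0] := fcoef_combination_eq0 (kill k0 hk0 _ _ e0).
have [|/eqP] := @fcoef_combination_eq0 1 0; last by rewrite oner_eq0.
apply: (kill k0 hk0); move/eqP: c0; rewrite oppr_eq0 => /eqP ->.
by rewrite mulr0 mul0r addr0.
Qed.

End AntiperiodicMonodromy.

End Ince.

(** * The norm of an antiperiodic eigenfunction at high energy *)

Section WeightedSums.
Variable R : realType.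

(** With v = u/2 the right side minus 2 is the square of e^v - e^-v, which is at least v for v >= 0
    by 1 + v <= e^v. The constant 1/4 is not sharp. *)
Lemma cosh_ge (u : R) : 2 + u ^+ 2 / 4 <= expR u + expR (- u).
Proof.
have main (v : R) : 0 <= v -> 2 + v ^+ 2 <= expR (2 * v) + expR (- (2 * v)).
  move=> v0; have h1 := expR_ge1Dx v; have e0 := expR_gt0 (- v); have e1 := expR_gt0 v.
  have e : expR v * expR (- v) = 1 by rewrite -expRD subrr expR0.
  have h2 : (1 + v) * expR (- v) <= 1 by rewrite -[leRHS]e ler_wpM2r // ltW.
  have h3 : v <= expR v - expR (- v).
    have : (1 + v) * v <= (1 + v) * (expR v - expR (- v)); last by rewrite ler_pM2l //; lra.
    rewrite mulrBr.
    have : (1 + v) * (1 + v) <= (1 + v) * expR v by rewrite ler_wpM2l //; lra.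
    lra.
  have -> : 2 * v = v + v by ring.
  rewrite opprD !expRD.
  have h4 : v ^+ 2 <= (expR v - expR (- v)) ^+ 2 by rewrite ler_pXn2r ?nnegrE //; lra.
  rewrite expr2 in h4; rewrite expr2; nra.
have h4 : u ^+ 2 / 4 = (u / 2) ^+ 2 by rewrite expr_div_n; congr (_ / _); ring.
have [u0|/ltW u0] := leP 0 u.
  have h0 : 0 <= u / 2 by lra.
  by have := main _ h0; rewrite (_ : 2 * (u / 2) = u); [rewrite h4|field].
have h0 : 0 <= - (u / 2) by lra.
have := main _ h0; rewrite sqrrN (_ : 2 * - (u / 2) = - u); last by field.
by rewrite opprK h4 addrC (addrC (expR _)).
Qed.

(** Here [x j] stands for |c(j)|, [t j * x j] for |c(-j-1)|, and [sg j] for their product. The sum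
    of squares is [sg j] times t + 1/t, which exceeds 2 by [kp * K j] at least; and [K j] may be
    traded for [l] because the recurrence keeps the [sg]-average of |K j - l| of order [A]. For j =
    0 the lower neighbour c(-1) has modulus s |c(0)|. *)
Lemma weighted_sum_bound (x : nat -> R) (s A l : R) :
  let K (j : nat) := ((2 * j%:R + 1) * pi) ^+ 2 in
  let t j := s ^+ (2 * j + 1) in
  let sg j := t j * x j ^+ 2 in
  let kp := ln s ^+ 2 / (4 * pi ^+ 2) in
  0 < s -> 0 <= A -> (forall j, 0 <= x j) ->
  (forall j, `|K j - l| * x j <= A * s * x j.+1 + A / s * (if j is i.+1 then x i else s * x 0%N)) ->
  forall N, (2 + kp * (l - 3 * A)) * \sum_(j < N.+1) sg j - kp * A * sg N.+1 <=
    \sum_(j < N.+1) (x j ^+ 2 + (t j * x j) ^+ 2).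
Proof.
move=> K t sg kp s0 A0 x0 rec N.
have p0 : 0 < pi ^+ 2 :> R by rewrite exprn_gt0 // pi_gt0.
have t0 j : 0 < t j by rewrite exprn_gt0.
have sg0 j : 0 <= sg j by rewrite mulr_ge0 ?sqr_ge0 // ltW.
have kp0 : 0 <= kp by rewrite divr_ge0 ?sqr_ge0 // mulr_ge0 // ltW.
have tS j : t j.+1 = s ^+ 2 * t j by rewrite /t mulnS -addnA exprD.
pose sp j := if j is i.+1 then sg i else sg 0%N.
(* The recurrence multiplied by [t j * x j]; the weight [t] is adapted to it, so each cross term is
   a mean of neighbouring [sg] by the inequality 2uv <= u^2 + v^2. *)
have energy j : `|K j - l| * sg j <= A * (sg j + (sg j.+1 + sp j) / 2).
  have := ler_wpM2r (mulr_ge0 (ltW (t0 j)) (x0 j)) (rec j).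
  rewrite (_ : _ * x j * (t j * x j) = `|K j - l| * sg j); last by rewrite /sg; ring.
  move=> /le_trans; apply.
  have h1 : s * x j.+1 * (t j * x j) <= (sg j + sg j.+1) / 2.
    have : 0 <= t j * (x j - s * x j.+1) ^+ 2 by rewrite mulr_ge0 ?sqr_ge0 // ltW.
    rewrite sqrrB /sg tS exprMn; lra.
  have h2 : s^-1 * (if j is i.+1 then x i else s * x 0%N) * (t j * x j) <= (sg j + sp j) / 2.
    case: j {h1} => [|i].
      by rewrite /sp mulKf ?gt_eqF // /sg; lra.
    have : 0 <= t i * (x i - s * x i.+1) ^+ 2 by rewrite mulr_ge0 ?sqr_ge0 // ltW.
    rewrite /sp /sg !tS sqrrB exprMn.
    have -> : s^-1 * x i * (s ^+ 2 * t i * x i.+1) = s * x i * t i * x i.+1.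
      by field; rewrite gt_eqF.
    lra.
  have := ler_wpM2l A0 h1; have := ler_wpM2l A0 h2.
  move: (if j is i.+1 then x i else s * x 0%N) => xm; move: (sg j) (sg j.+1) (sp j) => u v w.
  lra.
(* Writing [t j] as the exponential of (2j + 1) ln s, [cosh_ge] gives t + 1/t >= 2 + kp K j; the
   constant [kp] is chosen for this identity. *)
have term j : 2 * sg j + kp * (l * sg j - `|K j - l| * sg j) <= x j ^+ 2 + (t j * x j) ^+ 2.
  have e1 : x j ^+ 2 = (t j)^-1 * sg j by rewrite /sg mulrA mulVf ?mul1r // gt_eqF.
  have e2 : (t j * x j) ^+ 2 = t j * sg j by rewrite /sg; ring.
  rewrite {1}e1 e2 -mulrDl addrC.
  have tE : t j = expR ((2 * j%:R + 1) * ln s).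
    rewrite -[t j]lnK ?posrE // /t lnXn //; congr expR.
    by rewrite -[LHS]mulr_natl natrD natrM.
  have := cosh_ge ((2 * j%:R + 1) * ln s); rewrite expRN -tE => hc.
  have hK : kp * K j = ((2 * j%:R + 1) * ln s) ^+ 2 / 4.
    rewrite /kp /K; have := pi_gt0 R; move: pi => q q0.
    by field; rewrite gt_eqF.
  have hl : kp * (l - `|K j - l|) <= kp * K j.
    by apply: ler_wpM2l => //; have := ler_norm (- (K j - l)); rewrite normrN; lra.
  have : 2 + kp * (l - `|K j - l|) <= t j + (t j)^-1 by lra.
  by move/(ler_wpM2r (sg0 j)); lra.
have sumE : \sum_(j < N.+1) `|K j - l| * sg j <= A * (3 * \sum_(j < N.+1) sg j + sg N.+1).
  apply: le_trans (ler_sum _ (fun (j : 'I_N.+1) _ => energy j)) _.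
  rewrite -mulr_sumr ler_wpM2l // big_split /= -mulr_suml big_split /=.
  have s1 : \sum_(j < N.+1) sg j.+1 <= \sum_(j < N.+1) sg j + sg N.+1.
    rewrite -(big_ord_recr N.+1 (fun j => sg j)) /= [leRHS]big_ord_recl /=.
    by rewrite lerDr.
  have s2 : \sum_(j < N.+1) sp j <= sg 0%N + \sum_(j < N.+1) sg j.
    rewrite big_ord_recl /= lerD2l.
    by rewrite [leRHS]big_ord_recr /= lerDl.
  have s3 : sg 0%N <= \sum_(j < N.+1) sg j.
    by rewrite big_ord_recl lerDl sumr_ge0.
  have := sg0 N.+1; have := sg0 0%N; lra.
apply: le_trans _ (ler_sum _ (fun (j : 'I_N.+1) _ => term j)).
rewrite big_split /= -!mulr_sumr sumrB -mulr_sumr.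
have := ler_wpM2l kp0 sumE; lra.
Qed.

End WeightedSums.

Section FourierExpansion.
Variable R : realType.
Local Notation leb := (@lebesgue_measure R).
Implicit Types (a b : R[i]) (f g y p w : R -> R[i]) (k : int) (l x : R).

Definition fexp k x : R[i] := expi (kappa R k * x).

Lemma fexp_ccont k : ccont (fexp k). Proof. exact: expi_ccont. Qed.

Lemma kappa_inj k k' : kappa R k = kappa R k' -> k = k'.
Proof.
have pn : pi != 0 :> R by rewrite gt_eqF // pi_gt0.
move=> /(mulIf pn) /eqP; rewrite eqr_int => /eqP /addIr e; exact: (mulfI _ e).
Qed.

Lemma fcoef_fexp k k' : fcoef (fexp k) k' = (k == k')%:R.
Proof.
have [->|kk] := eqVneq k k'.
  rewrite /fcoef (@eq_ci _ _ (fun x => 1)).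
    by have := cintegral_deriv ler01 (cder_real (fun x => is_derive_id x (1 : R))) (ccont_cst _);
       rewrite subr0.
  by move=> x; rewrite /fexp mulNr expiN mulcJ cmod_expi expr1n.
pose w := kappa R k - kappa R k'; pose z : R[i] := 0 +i* w.
have w0 : w != 0 by rewrite subr_eq0; apply: contra kk => /eqP /kappa_inj ->.
have z0 : z != 0 by rewrite eq_complex /= negb_and w0 orbT.
have e : fcoef (fexp k) k' = ci (fun x => expi (w * x)).
  by apply: eq_ci => x; rewrite /fexp -expiD; congr expi; rewrite /w; ring.
apply: (mulfI z0); rewrite mulr0 e -ciZ; last exact: expi_ccont.
rewrite /ci (cintegral_deriv ler01 (cder_expi w)); last by apply: ccontZ; exact: expi_ccont.
by rewrite mulr1 mulr0 expi0 /w expiD expiN !expi_kappa; apply: complex_ext => /=; ring.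
Qed.

(** [Negz j] is -j - 1, so each summand pairs the opposite frequencies (2j + 1) pi and -(2j + 1)
    pi. *)
Definition fsum (c : int -> R[i]) (N : nat) x : R[i] :=
  \sum_(j < N) (c (Posz j) * fexp (Posz j) x + c (Negz j) * fexp (Negz j) x).

Lemma fsumS c N x : fsum c N.+1 x =
  fsum c N x + (c (Posz N) * fexp (Posz N) x + c (Negz N) * fexp (Negz N) x).
Proof. by rewrite /fsum big_ord_recr. Qed.

Lemma fsum_ccont c N : ccont (fsum c N).
Proof.
elim: N => [|N IH].
  by apply: ccont_ext (ccont_cst 0) => x; rewrite /fsum big_ord0.
apply: ccont_ext (fun x => esym (fsumS c N x)) _.
have c1 := fexp_ccont (Posz N); have c2 := fexp_ccont (Negz N); prove_ccont.
Qed.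

(** Without conjugation a frequency meets its opposite, so the coefficient at j is paired with the
    one at -j - 1; with conjugation it is paired with itself. The comparison of these two sums is
    the source of the decay of d. *)
Lemma ci_mul_fsum g c N : ccont g -> ci (fun x => g x * fsum c N x) =
  \sum_(j < N) (c (Posz j) * fcoef g (Negz j) + c (Negz j) * fcoef g (Posz j)).
Proof.
move=> cg; elim: N => [|N IH].
  rewrite big_ord0 (@eq_ci _ _ (fun x => 0 * g x)) ?ciZ ?mul0r //.
  by move=> x; rewrite /fsum big_ord0 mulr0 mul0r.
rewrite big_ord_recr /= -IH.
have c1 := fexp_ccont (Posz N); have c2 := fexp_ccont (Negz N); have c3 := fsum_ccont c N.
have kN : kappa R (Negz N) = - kappa R (Posz N).
  by rewrite -kappaN; congr kappa; rewrite NegzE -addn1 PoszD; ring.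
have e1 : fcoef g (Negz N) = ci (fun x => g x * fexp (Posz N) x).
  by apply: eq_ci => x; rewrite kN opprK.
have e2 : fcoef g (Posz N) = ci (fun x => g x * fexp (Negz N) x).
  by apply: eq_ci => x; rewrite /fexp kN.
rewrite e1 e2 -!ciZ; [|prove_ccont..].
rewrite -ciD; [|prove_ccont..]; rewrite -ciD; [|prove_ccont..].
by apply: eq_ci => x; rewrite fsumS; ring.
Qed.

Lemma ci_mul_fsumJ g c N : ccont g -> ci (fun x => g x * (fsum c N x)^*%C) =
  \sum_(j < N) ((c (Posz j))^*%C * fcoef g (Posz j) + (c (Negz j))^*%C * fcoef g (Negz j)).
Proof.
move=> cg; elim: N => [|N IH].
  rewrite big_ord0 (@eq_ci _ _ (fun x => 0 * g x)) ?ciZ ?mul0r //.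
  by move=> x; rewrite /fsum big_ord0 conjc0 mulr0 mul0r.
rewrite big_ord_recr /= -IH.
have c1 := fexp_ccont (Posz N); have c2 := fexp_ccont (Negz N); have c3 := fsum_ccont c N.
have e k : fcoef g k = ci (fun x => g x * (fexp k x)^*%C).
  by apply: eq_ci => x; rewrite /fexp -expiN mulNr.
rewrite !e -!ciZ; [|prove_ccont..].
rewrite -ciD; [|prove_ccont..]; rewrite -ciD; [|prove_ccont..].
by apply: eq_ci => x; rewrite fsumS !(conjcD, conjcM); ring.
Qed.

Definition pair_index (k : int) : nat := match k with Posz j => j | Negz j => j end.

Lemma fcoef_fsum c N k : fcoef (fsum c N) k = if (pair_index k < N)%N then c k else 0.
Proof.
elim: N => [|N IH].
  rewrite /fcoef (@eq_ci _ _ (fun x => 0 * fexp 0 x)) ?ciZ ?mul0r //; first exact: fexp_ccont.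
  by move=> x; rewrite /fsum big_ord0 !mul0r.
have c1 := fexp_ccont (Posz N); have c2 := fexp_ccont (Negz N); have c3 := fsum_ccont c N.
have -> : fcoef (fsum c N.+1) k =
    fcoef (fun x => fsum c N x + (c (Posz N) * fexp (Posz N) x + c (Negz N) * fexp (Negz N) x)) k.
  by apply: eq_ci => x; rewrite fsumS.
rewrite fcoefD //; last by prove_ccont.
rewrite fcoefD; [|prove_ccont..]; rewrite !fcoefZ // !fcoef_fexp IH ltnS [in RHS]leq_eqVlt.
case: k {IH} => j /=.
- have -> : (Posz N == Posz j) = (j == N) by rewrite eq_sym.
  by have [->|_] := eqVneq j N; rewrite ?ltnn /= ?mulr1 ?mulr0 ?add0r ?addr0.
- have -> : (Negz N == Negz j) = (j == N) by rewrite eq_sym.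
  by have [->|_] := eqVneq j N; rewrite ?ltnn /= ?mulr1 ?mulr0 ?add0r ?addr0.
Qed.

Lemma cmod_fexp k x : cmod (fexp k x) = 1. Proof. exact: cmod_expi. Qed.

(** Geometric decay makes the partial sums converge uniformly to a continuous [g]; it has the
    coefficients of [f], so uniqueness identifies the two on [0, 1]. *)
Lemma fsum_approximates f (C : R) : ccont f -> (forall n : nat, cmod (fcoef f (Posz n)) <= C * 2^-1 ^+ n) ->
  (forall n : nat, cmod (fcoef f (Negz n)) <= C * 2^-1 ^+ n) ->
  forall n x, 0 <= x -> x <= 1 -> cmod (fsum (fcoef f) n x - f x) <= 8 * C * 2^-1 ^+ n.
Proof.
move=> cf cp cn; set c := fcoef f in cp cn *.
have /choice [g gP] : forall x, exists v, forall n, cmod (fsum c n x - v) <= 4 * (2 * C) * 2^-1 ^+ n.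
  move=> x; apply: cgeometric_limit => n; rewrite fsumS addrAC subrr add0r.
  apply: le_trans (cmodD _ _) _; rewrite !cmodM !cmod_fexp !mulr1.
  by apply: le_trans (lerD (cp n) (cn n)) _; lra.
have cg : ccont g.
  apply: (@ccont_uniform_limit _ _ (fsum c) (fun=> 4 * (2 * C))).
  - exact: fsum_ccont.
  - exact: cst_continuous.
  - by move=> n x; rewrite mulrC.
have c0 k : fcoef (fun x => f x - g x) k = 0.
  have ck := fexp_ccont k.
  apply/eqP; rewrite -cmod_eq0 eq_le cmod_ge0 andbT.
  apply: (@le0_geometric _ _ (4 * (2 * C))) => n.
  (* Long enough for the partial sum to contain the frequency k, and for its distance to [g] to be
     of order 2^-n. *)
  pose m := (n + (pair_index k).+1)%N.
  have -> : fcoef (fun x => f x - g x) k = fcoef (fun x => fsum c m x - g x) k.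
    have e (h : R -> R[i]) : ccont h -> fcoef (fun x => h x - g x) k = fcoef h k - fcoef g k.
      move=> ch; rewrite -mulN1r -fcoefZ // -fcoefD //; last exact: ccontZ.
      by apply: eq_ci => x; rewrite mulN1r.
    rewrite !e //; last exact: fsum_ccont.
    by rewrite fcoef_fsum /m addnS ltnS leq_addl.
  apply: fcoef_le => [|x _ _]; first by apply: ccontB => //; exact: fsum_ccont.
  apply: le_trans (gP x m) _.
  have C0 : 0 <= 4 * (2 * C).
    have := le_trans (cmod_ge0 _) (gP 0 0%N); by rewrite expr0 mulr1.
  rewrite ler_wpM2l // /m exprD ler_piMr ?exprn_ge0 ?invr_ge0 //.
  by rewrite exprn_ile1 ?invr_ge0 // invf_le1 ?ltr0n // ler1n.
have fg := ccont_zero_closure (ccontB cf cg) (fourier_uniqueness (ccontB cf cg) c0).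
move=> n x x0 x1; have /eqP := fg x x0 x1; rewrite subr_eq0 => /eqP ->.
by apply: le_trans (gP x n) _; lra.
Qed.

End FourierExpansion.

Section NormBound.
Variable R : realType.
Implicit Types (a b : R[i]) (y p : R -> R[i]) (k : int) (l : R).

Lemma cmod_exprz (z : R[i]) k : cmod (z ^ k) = cmod z ^ k.
Proof. by case: k => n; rewrite ?NegzE /= ?cmodV cmodX. Qed.

Lemma NegzB (j : nat) : Negz j = - Posz j - 1.
Proof. by rewrite NegzE -addn1 PoszD opprD. Qed.

(** Decay faster than every geometric rate absorbs the factor |t|^n: the rate r (|t| + 1) is asked
    of the original sequence. *)
Lemma rapidly_decreasing_reflect (c : int -> R[i]) (t : R[i]) :
  rapidly_decreasing (fun n => c (- n%:Z)) ->
  rapidly_decreasing (fun n => c (- n%:Z - 1) * t ^ (n%:Z)).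
Proof.
move=> d r r1; pose q := cmod t; pose r' := r * (q + 1).
have q0 : 0 <= q by exact: cmod_ge0.
have r0 : 0 < r by lra.
have r'1 : 1 <= r'.
  by rewrite /r' -[leLHS]mulr1; apply: ler_pM => //; lra.
have r'0 : 0 < r' by lra.
have [C C0 hC] := d r' r'1; exists C => // n.
rewrite cmodM cmod_exprz -/q.
have h : cmod (c (- n%:Z - 1)) <= C * r'^-1 ^+ n.
  have := hC n.+1; rewrite (_ : - n.+1%:Z = - n%:Z - 1); last by rewrite -addn1 PoszD opprD.
  move=> /le_trans; apply; rewrite ler_wpM2l // exprS ler_piMl ?exprn_ge0 ?invr_ge0 ?(ltW r'0) //.
  by rewrite invf_le1.
apply: le_trans (ler_wpM2r (exprn_ge0 n q0) h) _.
rewrite -mulrA -exprMn ler_wpM2l //.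
have ri : 0 <= r'^-1 by rewrite invr_ge0 ltW.
apply: lerXn2r; rewrite ?nnegrE ?(mulr_ge0 ri q0) ?invr_ge0 ?(ltW r0) //.
rewrite mulrC ler_pdivrMr // /r' mulrA mulVf ?gt_eqF // mul1r; lra.
Qed.

(** The sequence and its gauged reflection are proportional; comparing the indices j and -j - 1
    gives c(-j-1)^2 = c(j)^2 (a/b)^(2j+1), and s^2 = |a|/|b|. *)
Lemma reflected_modulus a b l (c : int -> R[i]) (s : R) : a != 0 -> b != 0 -> 0 < s ->
  s ^+ 2 * cmod b = cmod a -> hill_seq a b l c ->
  rapidly_decreasing (fun n => c n) -> rapidly_decreasing (fun n => c (- n%:Z)) ->
  forall j : nat, cmod (c (Negz j)) = s ^+ (2 * j + 1) * cmod (c (Posz j)).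
Proof.
move=> a0 b0 s0 sE hc d1 d2 j.
have hc' := hill_seq_reflect a0 b0 hc.
have W := casoratian_zero a0 b0 hc hc' d1 (rapidly_decreasing_reflect (b / a) d2).
have prop := hill_seq_proportional a0 b0 hc hc' W (Posz j) (Negz j).
have e : - Negz j - 1 = Posz j by rewrite NegzB; ring.
rewrite e -NegzB in prop.
have ap : 0 < cmod a by rewrite cmod_gt0.
have bp : 0 < cmod b by rewrite cmod_gt0.
have qE : cmod (b / a) = (s ^+ 2)^-1.
  by rewrite cmodM cmodV -sE; field; rewrite !gt_eqF.
have := congr1 (@cmod R) prop; rewrite !cmodM !cmod_exprz qE.
move: (cmod (c (Posz j))) (cmod (c (Negz j))) (cmod_ge0 (c (Posz j))) (cmod_ge0 (c (Negz j))).
move=> u v u0 v0 /= h.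
have sn : s != 0 by rewrite gt_eqF.
have sj : 0 < s ^+ j by rewrite exprn_gt0.
have : v ^+ 2 = (s ^+ (2 * j + 1) * u) ^+ 2.
  have e1 : (s ^+ 2)^-1 ^+ j = (s ^+ j)^-2.
    by rewrite exprVn -exprM mulnC exprM.
  have e2 : ((s ^+ 2)^-1 ^+ j.+1)^-1 = s ^+ 2 * (s ^+ j) ^+ 2.
    by rewrite -exprVn invrK exprS -!exprM (mulnC 2).
  have e3 : s ^+ (2 * j + 1) = (s ^+ j) ^+ 2 * s.
    by rewrite exprD expr1 -exprM mulnC.
  have {}h : u * (u * ((s ^+ 2)^-1 ^+ j.+1)^-1) = v * (s ^+ 2)^-1 ^+ j * v by exact: h.
  rewrite e1 e2 in h; rewrite e3.
  have h' : u * u * s ^+ 2 * (s ^+ j) ^+ 4 = v * v.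
    transitivity (u * (u * (s ^+ 2 * (s ^+ j) ^+ 2)) * (s ^+ j) ^+ 2); first by ring.
    by rewrite h; field; rewrite gt_eqF.
  by rewrite expr2 -h'; ring.
move/eqP; rewrite eqrXn2 // ?mulr_ge0 ?exprn_ge0 ?(ltW s0) //.
by move/eqP.
Qed.

(* With c the coefficients of y, the integral of y^2 pairs c j with c (-j-1) while that of |y|^2 sums
   squares; the two moduli differ by the factor s^(2j+1), and the recurrence keeps the weight near the
   large frequencies 2j+1 ~ sqrt l / pi. *)
Lemma fourier_norm_bound a b l y p (s A : R) : a != 0 -> b != 0 -> 0 < s ->
  s ^+ 2 * cmod b = cmod a -> A = cmod b * s ->
  ode (hill_coef a b l%:C) y p -> y 1 = - y 0 -> p 1 = - p 0 ->
  let be := 2 + ln s ^+ 2 / (4 * pi ^+ 2) * (l - 3 * A) in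
  0 <= be -> be / 2 * cmod (ci (fun x => y x * y x)) <= sqnorm y.
Proof.
move=> a0 b0 s0 sE AE oy y1 p1 be be0.
have [cy _] := ode_ccont oy; have hc := fcoef_hill_seq oy y1 p1.
have [B yB] := ccont_bounded 0 1 cy.
have B0 : 0 <= B := le_trans (cmod_ge0 _) (yB 0 (lexx _) ler01).
set c := fcoef y in hc.
have [d1 d2] := hill_seq_decay hc (fun k => fcoef_le k cy yB).
have [C1 C10 h1] := d1 2 (ler1n _ _ : 1 <= 2%:R); have [C2 C20 h2] := d2 2 (ler1n _ _ : 1 <= 2%:R).
pose C := C1 + C2.
have C0 : 0 <= C by rewrite addr_ge0.
have P0 n : 0 <= 2^-1 ^+ n :> R by rewrite exprn_ge0 // invr_ge0.
have PS n : 2^-1 ^+ n.+1 <= 2^-1 ^+ n :> R.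
  by rewrite exprS ler_piMl // invf_le1 ?ltr0n // ler1n.
have P1 n : 2^-1 ^+ n <= 1 :> R by rewrite exprn_ile1 ?invr_ge0 // invf_le1 ?ltr0n // ler1n.
have cP n : cmod (c (Posz n)) <= C * 2^-1 ^+ n.
  by apply: le_trans (h1 n) _; rewrite ler_wpM2r // /C; lra.
have cN n : cmod (c (Negz n)) <= C * 2^-1 ^+ n.
  rewrite NegzE; apply: le_trans (h2 n.+1) _; apply: ler_pM => //; rewrite /C; lra.
have appr := fsum_approximates cy cP cN.
have refl := reflected_modulus a0 b0 s0 sE hc d1 d2.
pose x j := cmod (c (Posz j)).
pose t j := s ^+ (2 * j + 1); pose sg j := t j * x j ^+ 2.
have A0 : 0 <= A by rewrite AE mulr_ge0 // ltW.
have sn : s != 0 by rewrite gt_eqF.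
(* [A] is the geometric mean of |a| and |b|: A s = |a| and A / s = |b|. At j = 0 the coefficient at
   -1 is replaced through [refl]. *)
have rec j : `|((2 * j%:R + 1) * pi) ^+ 2 - l| * x j <=
    A * s * x j.+1 + A / s * (if j is i.+1 then x i else s * x 0%N).
  have e : (kappa R (Posz j) ^+ 2 - l)%:C * c (Posz j) =
      - (a * c (Posz j + 1) + b * c (Posz j - 1)).
    by have := hc (Posz j); rewrite -addrA => /eqP; rewrite addr_eq0 => /eqP.
  have kE : kappa R (Posz j) = (2 * j%:R + 1) * pi.
    by rewrite /kappa rmorphD rmorphM.
  have : cmod ((kappa R (Posz j) ^+ 2 - l)%:C * c (Posz j)) <=
      cmod a * cmod (c (Posz j + 1)) + cmod b * cmod (c (Posz j - 1)).
    by rewrite e cmodN -!cmodM; exact: cmodD.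
  rewrite cmodM cmod_real kE => /le_trans; apply.
  rewrite (_ : A * s = cmod a); last by rewrite AE -sE; ring.
  rewrite (_ : A / s = cmod b); last by rewrite AE mulfK.
  rewrite (_ : Posz j + 1 = j.+1); last by rewrite -addn1 PoszD.
  rewrite lerD2l ler_wpM2l //; case: j {e kE} => [|i].
    by rewrite sub0r -[X in c X]/(Negz 0) refl muln0 add0n expr1.
  by rewrite (_ : i.+1%:Z - 1 = i) // -addn1 PoszD addrK.
have W := weighted_sum_bound s0 A0 (fun j => cmod_ge0 (c (Posz j))) rec.
pose kp := ln s ^+ 2 / (4 * pi ^+ 2).
have kp0 : 0 <= kp by rewrite divr_ge0 ?sqr_ge0 // mulr_ge0 // sqr_ge0.
have sgE j : sg j = cmod (c (Posz j)) * cmod (c (Negz j)) by rewrite refl /sg /t /x; ring.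
rewrite -subr_le0.
(* Collects the truncation errors: of the integral of y^2, of the boundary term [sg N.+1], and of
   the norm. Each is a constant times 2^-N. *)
pose D := be / 2 * (B * (8 * C)) + kp * A * (C * C) + B * (8 * C).
apply: (@le0_geometric _ _ D) => N.
have ap x' : 0 <= x' -> x' <= 1 -> cmod (fsum c N.+1 x' - y x') <= 8 * C * 2^-1 ^+ N.
  move=> x0 x1; apply: le_trans (appr N.+1 x' x0 x1) _; rewrite ler_wpM2l //.
  by rewrite mulr_ge0.
have cf := fsum_ccont c N.+1.
have E1 : cmod (ci (fun x => y x * y x)) <= 2 * \sum_(j < N.+1) sg j + B * (8 * C) * 2^-1 ^+ N.
  have e : cmod (ci (fun x => y x * fsum c N.+1 x)) <= 2 * \sum_(j < N.+1) sg j.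
    rewrite ci_mul_fsum // -/c mulr_sumr; elim: (N.+1) => [|n IH]; first by rewrite !big_ord0 cmod0.
    rewrite !big_ord_recr /=; apply: le_trans (cmodD _ _) _; apply: lerD => //.
    by apply: le_trans (cmodD _ _) _; rewrite !cmodM sgE; lra.
  have e' : cmod (ci (fun x => y x * y x) - ci (fun x => y x * fsum c N.+1 x)) <= B * (8 * C) * 2^-1 ^+ N.
    rewrite -ciB; [|prove_ccont..]; apply: cmod_ci_le => [|x' x0 x1]; first by prove_ccont.
    rewrite -mulrBr cmodM -mulrA; apply: ler_pM => //; first exact: yB.
    by rewrite cmodBC; exact: ap.
  rewrite -(subrK (ci (fun x => y x * fsum c N.+1 x)) (ci (fun x => y x * y x))).
  by apply: le_trans (cmodD _ _) _; lra.
have E2 : \sum_(j < N.+1) (x j ^+ 2 + (t j * x j) ^+ 2) <= sqnorm y + B * (8 * C) * 2^-1 ^+ N.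
  have e : ci (fun x => y x * (fsum c N.+1 x)^*%C) = (\sum_(j < N.+1) (x j ^+ 2 + (t j * x j) ^+ 2))%:C.
    rewrite ci_mul_fsumJ // -/c rmorph_sum; apply: eq_bigr => j _.
    have mJ (z : R[i]) : z^*%C * z = (cmod z ^+ 2)%:C by rewrite mulrC mulcJ.
    by rewrite !mJ /t -refl -rmorphD.
  have e2 : ci (fun x => y x * (y x)^*%C) = (sqnorm y)%:C by rewrite -inner_self.
  have e' : cmod (ci (fun x => y x * (fsum c N.+1 x)^*%C) - ci (fun x => y x * (y x)^*%C))
      <= B * (8 * C) * 2^-1 ^+ N.
    rewrite -ciB; [|prove_ccont..]; apply: cmod_ci_le => [|x' x0 x1]; first by prove_ccont.
    rewrite -mulrBr cmodM -mulrA; apply: ler_pM => //; first exact: yB.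
    by rewrite -conjcB cmodJ; exact: ap.
  rewrite e e2 -rmorphB cmod_real in e'.
  by have := le_trans (ler_norm _) e'; lra.
have E3 : sg N.+1 <= C * C * 2^-1 ^+ N.
  rewrite sgE -mulrA mulrCA mulrC.
  have q1 : cmod (c (Posz N.+1)) <= C * 2^-1 ^+ N.
    by apply: le_trans (cP _) _; rewrite ler_wpM2l.
  have q2 : cmod (c (Negz N.+1)) <= C.
    by apply: le_trans (cN _) _; rewrite ler_piMr.
  rewrite [leRHS](_ : _ = C * (C * 2^-1 ^+ N)); last by ring.
  by apply: ler_pM.
have := W N; rewrite -/kp -/be -/(sg _) => W'.
have i1 := ler_wpM2l be0 E1.
have i3 := ler_wpM2l (mulr_ge0 kp0 A0) E3.
rewrite /D; move: W' i1 i3 E2; rewrite -/x.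
rewrite (eq_bigr (fun j : 'I_N.+1 => sg j)) //.
move: (\sum_(j < N.+1) sg j) (\sum_(j < N.+1) _) (2^-1 ^+ N) => S1 S2 P.
lra.
Qed.

End NormBound.

(** * Failure of spectrality *)

Section RealDiscriminant.
Variable R : realType.
Implicit Types (f : R -> R) (a b : R[i]).

Lemma continuous_gt f (x v : R) : {for x, continuous f} -> v < f x ->
  exists2 d, 0 < d & forall y, `|y - x| < d -> v < f y.
Proof.
move=> cf vf.
have : \forall y \near x, v < f y by exact: (cvgr_gt (f x) cf).
move=> /nbhs_ballP[d /= d0 H]; exists d => // y yd; apply: H.
by rewrite /ball /= distrC.
Qed.

Lemma continuous_lt f (x v : R) : {for x, continuous f} -> f x < v ->
  exists2 d, 0 < d & forall y, `|y - x| < d -> f y < v.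
Proof.
move=> cf vf.
have : \forall y \near x, f y < v by exact: (cvgr_lt (f x) cf).
move=> /nbhs_ballP[d /= d0 H]; exists d => // y yd; apply: H.
by rewrite /ball /= distrC.
Qed.

(** The infimum of the set where f <= v; continuity places it in the set, and the intermediate value
    theorem makes the value there equal to [v]. *)
Lemma first_crossing f (c d v : R) : continuous f -> c <= d -> v < f c -> f d <= v ->
  exists x, [/\ c < x, x <= d, f x = v & forall y, c <= y -> y < x -> v < f y].
Proof.
move=> cf cd vc dv.
pose E := [set y | [/\ c <= y, y <= d & f y <= v]].
have En : E !=set0 by exists d; split.
have El : lbound E c by move=> y [].
have Hl : has_lbound E by exists c.
have ci := lb_le_inf En El.
have id : inf E <= d by apply: ge_inf => //; split.
have fi : f (inf E) <= v.
  rewrite leNgt; apply/negP => /(continuous_gt (cf _))[e e0 H].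
  have [y [cy yd fy] ye] := inf_adherent e0 (conj En Hl).
  have iy : inf E <= y by exact: ge_inf.
  have : v < f y by apply: H; rewrite ger0_norm ?subr_ge0 // ltrBlDl.
  by rewrite ltNge fy.
have before y : c <= y -> y < inf E -> v < f y.
  move=> cy yi; rewrite ltNge; apply/negP => fy.
  have : inf E <= y by apply: ge_inf => //; split => //; exact: le_trans (ltW yi) id.
  by rewrite leNgt yi.
have [x xI fx] : exists2 x, x \in `[c, inf E] & f x = v.
  apply: IVT => //; first exact: continuous_subspaceT.
  by rewrite ge_min fi orbT le_max (ltW vc).
move: xI; rewrite in_itv /= => /andP[cx xi].
have xE : x = inf E.
  apply/eqP; rewrite eq_le xi /=; apply: ge_inf => //; split => //; last by rewrite fx.
  exact: le_trans xi id.
exists x; split => //; [|exact: le_trans xi id|by rewrite xE].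
by rewrite lt_def cx andbT; apply/eqP => e; move: vc; rewrite -e fx ltxx.
Qed.

Lemma discriminant_cder a b :
  cder (fun l : R => discriminant a b l%:C) (fun l : R => Fdot a b l%:C).
Proof.
apply: cder_quadratic => l; pose K := cmod a + cmod b + (`|l| + 1).
exists 1, (12 * growth K ^+ 4); split => // h h1.
have hl : cmod a + cmod b + cmod l%:C <= K by rewrite /K cmod_real lerD2l lerDl.
have hh : cmod a + cmod b + cmod (l + h)%:C <= K.
  rewrite /K cmod_real lerD2l; apply: le_trans (ler_normD _ _) _; exact: lerD.
have := discriminant_expand hl hh.
have -> : (l + h)%:C - l%:C = h%:C :> R[i] by rewrite rmorphD; ring.
by rewrite cmod_real real_normK ?num_real.
Qed.

Variables (a b : R[i]).
Hypothesis hab : a * b \is Num.real.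

Definition rdisc (l : R) : R := Re (discriminant a b l%:C).

Lemma rdiscE (l : R) : discriminant a b l%:C = (rdisc l)%:C.
Proof.
apply: ReE_real; have := congr1 (@complex.Im R) (discriminant_real l hab).1.
rewrite cImJ; lra.
Qed.

Lemma rdisc_deriv (l : R) : is_derive l 1 rdisc (Re (Fdot a b l%:C)).
Proof. exact: (discriminant_cder a b l).1. Qed.

Lemma FdotE (l : R) : Fdot a b l%:C = (Re (Fdot a b l%:C))%:C.
Proof.
apply: ReE_real; have [_ d] := discriminant_cder a b l.
have e : @complex.Im R \o (fun l => discriminant a b l%:C) = cst 0.
  by apply/funext => x /=; rewrite rdiscE.
rewrite e in d; have := @derive_val _ _ _ _ _ _ _ d.
by rewrite derive_cst.
Qed.

Lemma rdisc_continuous : continuous rdisc.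
Proof. exact: deriv_continuous rdisc_deriv. Qed.

Lemma rdisc_min (u v l : R) : u < l -> l < v ->
  (forall x, u < x -> x < v -> rdisc l <= rdisc x) -> Fdot a b l%:C = 0.
Proof.
move=> ul lv H; rewrite FdotE.
have d : is_derive l 1 rdisc 0.
  apply: (@derive1_at_min _ rdisc u v); first by rewrite (ltW (lt_trans ul lv)).
  - by move=> t _; case: (rdisc_deriv t).
  - by rewrite in_itv /= ul lv.
  - by move=> t; rewrite in_itv /= => /andP[ut tv]; exact: H.
have e1 := @derive_val _ _ _ _ _ _ _ d; have e2 := @derive_val _ _ _ _ _ _ _ (rdisc_deriv l).
by rewrite -e2 e1.
Qed.

(** An energy that is no [lam n t] has multiplicity 0 at [t], so it is not a root; the roots are
    thus indexed by integers. *)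
Lemma eigenvalues_countable lam (t : R) : eigenvalue_numbering a b lam -> t \in `]-pi, pi] ->
  countable [set l : R | rdisc l = 2 * cos t].
Proof.
move=> [hn _ _] tI.
have sub : [set l : R | rdisc l = 2 * cos t] `<=` [set Re (lam n t) | n in setT].
  move=> l /= lE; apply: contrapT => no.
  have [_] : multiplicity a b t l%:C 0.
    apply/(hn t tI); rewrite II0 card_eq0; apply/eqP.
    apply/seteqP; split => // n /= ln; apply: no; exists n => //; by rewrite ln.
  by apply; rewrite /= rdiscE lE subrr.
apply: sub_countable (subset_card_le sub) _.
exact: sub_countable (card_image_le _ _) (countableP _).
Qed.

(** If F' vanished at every point of the interval where -2 < F < 2, it would vanish on the whole
    interval, since points with F = -2 are minima. F would then be constant there, and the set of
    roots for the corresponding [t] would have positive measure. *)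
Lemma rdisc_regular lam (u v : R) : eigenvalue_numbering a b lam -> u < v ->
  (forall l, u < l -> l < v -> -2 <= rdisc l /\ rdisc l < 2) ->
  exists l : R, [/\ u < l, l < v, -2 < rdisc l, rdisc l < 2 & Fdot a b l%:C <> 0].
Proof.
move=> hn uv H; apply: contrapT => no.
have F0 l : u < l -> l < v -> Fdot a b l%:C = 0.
  move=> ul lv; have [h1 h2] := H l ul lv.
  have [e|ne] := eqVneq (rdisc l) (-2).
    by apply: (rdisc_min ul lv) => x ux xv; rewrite e; have [] := H x ux xv.
  apply: contrapT => nz; apply: no; exists l; split => //.
  by rewrite lt_def ne.
pose m := (u + v) / 2.
have um : u < m by rewrite /m; lra. have mv : m < v by rewrite /m; lra.
pose df l := Re (Fdot a b l%:C).
have df0 l : u < l -> l < v -> df l = 0 by move=> ul lv; rewrite /df F0.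
have cst x : u < x -> x < v -> rdisc x = rdisc m.
  move=> ux xv.
  have seg c d : u < c -> d < v -> c <= d -> rdisc d = rdisc c.
    move=> uc dv cd.
    have [|e] := @MVT_segment _ rdisc df c d cd (fun x _ => rdisc_deriv x).
      exact/continuous_subspaceT/rdisc_continuous.
    rewrite in_itv /= => /andP[ce ed]; rewrite df0; [|lra|lra].
    by rewrite mul0r; lra.
  have [xm|/ltW mx] := leP x m; first by rewrite (seg x m).
  by rewrite (seg m x).
have [m1 m2] := H m um mv.
pose t := acos (rdisc m / 2).
have ct : cos t = rdisc m / 2 by rewrite acosK // in_itv /=; lra.
have t0 : 0 <= t by apply: acos_ge0; lra.
have tpi : t <= pi by apply: acos_lepi; lra.
have tI : t \in `]-pi, pi].
  by rewrite in_itv /= tpi andbT (lt_le_trans _ t0) // oppr_lt0 pi_gt0.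
have := eigenvalues_countable hn tI.
have sub : `]u, v[%classic `<=` [set l : R | rdisc l = 2 * cos t].
  move=> x /=; rewrite in_itv /= => /andP[ux xv]; rewrite (cst x) // ct; lra.
move=> /(sub_countable (subset_card_le sub)) /countable_lebesgue_measure0.
rewrite lebesgue_measure_itv /= lte_fin uv => /eqP.
by rewrite -EFinB eqe subr_eq0 gt_eqF.
Qed.

(** Being scalar with determinant 1, the monodromy matrix is 1 or -1, and the sign of the trace
    selects -1. *)
Lemma spectral_contradiction lam (l0 : R) :
  eigenvalue_numbering a b lam -> spectral_operator a b lam ->
  Fdot a b l0%:C = 0 -> rdisc l0 < 0 ->
  (forall d, 0 < d -> exists u v, [/\ u < v, l0 - d <= u, v <= l0 + d &
     forall l, u < l -> l < v -> -2 <= rdisc l /\ rdisc l < 2]) ->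
  let Q := hill_coef a b l0%:C in
  [/\ fph Q 1 = 0, fth' Q 1 = 0, fth Q 1 = -1 & fph' Q 1 = -1].
Proof.
move=> hn hs F0 neg near0 Q.
have [|||||p1 t1 pt] := @spectral_scalar _ a b lam l0 => //.
- by move=> l; have [] := discriminant_real l hab.
- move=> d d0; have [u [v [uv lu vl H]]] := near0 d d0.
  have [l [ul lv h1 h2 h3]] := rdisc_regular hn uv H.
  exists l; split; [|exact: h1|exact: h2|exact: h3].
  by rewrite ltr_norml; move: ul lv lu vl; clear => *; apply/andP; split; lra.
have aQ : admissible Q := hill_coef_admissible _ _ _.
have := fundamental_det aQ 1; rewrite -/Q in p1 t1 pt *.
rewrite p1 t1 pt mulr0 subr0 -expr2 => /eqP; rewrite sqrf_eq1 => /orP[] /eqP e //.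
move: neg; rewrite /rdisc discriminantE /tr -/Q pt e /=; lra.
Qed.

End RealDiscriminant.

(** * Band edges and the contradiction *)

Section Nonspectral.
Variable R : realType.
Implicit Types (a b : R[i]).

Lemma trace_antiperiodic (m11 m12 m21 m22 : R[i]) :
  m11 * m22 - m21 * m12 = 1 -> m22 + m11 = -2 ->
  exists v1 v2, [/\ m11 * v1 + m12 * v2 = - v1, m21 * v1 + m22 * v2 = - v2 &
    (v1 != 0) || (v2 != 0)].
Proof.
move=> det tr2.
have m22E : m22 = -2 - m11 by rewrite -tr2; ring.
have [|nz] := boolP ((m12 != 0) || (-1 - m11 != 0)).
  exists m12, (-1 - m11); split => //; first by ring.
  have -> : m21 * m12 = m11 * m22 - 1 by rewrite -det; ring.
  by rewrite m22E; ring.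
move: nz; rewrite negb_or !negbK => /andP[/eqP m12_0 /eqP m11_1].
have m11E : m11 = -1 by rewrite -[RHS]subr0 -m11_1; ring.
exists 0, 1; split; [by rewrite m12_0; ring|rewrite m22E m11E; ring|by rewrite oner_neq0 orbT].
Qed.

Lemma antiperiodic_solution a b (l : R) : discriminant a b l%:C = -2 ->
  exists y p, [/\ ode (hill_coef a b l%:C) y p, y 1 = - y 0, p 1 = - p 0 & 0 < sqnorm y].
Proof.
set Q := hill_coef a b l%:C; rewrite discriminantE => tr2.
have aQ : admissible Q := hill_coef_admissible _ _ _.
have QK : bounded01 Q (cmod a + cmod b + cmod l%:C) by exact: hill_coef_bounded.
have det := fundamental_det aQ 1.
have [v1 [v2 [e1 e2 vn]]] := trace_antiperiodic det tr2.
pose y x := v1 * fth Q x + v2 * fph Q x; pose p x := v1 * fth' Q x + v2 * fph' Q x.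
have oy : ode Q y p := ode_lincomb v1 v2 (ode_fth aQ) (ode_fph aQ).
have y0 : y 0 = v1 by rewrite /y fth0 // fph0 //; ring.
have p0 : p 0 = v2 by rewrite /p fth'0 // fph'0 //; ring.
exists y, p; split => //.
- by rewrite y0 -e1 /y; ring.
- by rewrite p0 -e2 /p; ring.
have := cauchy_data_sqnorm_le QK aQ.1 oy; rewrite y0 p0 => h.
rewrite lt_def sqnorm_ge0 andbT; apply/negP => /eqP N0; rewrite N0 mulr0 in h.
have u0 := sqr_ge0 (cmod v1); have w0 := sqr_ge0 (cmod v2).
have : (cmod v1 ^+ 2 == 0) && (cmod v2 ^+ 2 == 0) by apply/andP; split; apply/eqP; lra.
by rewrite !expf_eq0 /= !cmod_eq0 => /andP[/eqP e /eqP e']; rewrite e e' eqxx in vn.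
Qed.

Lemma cos_2pin (n : nat) : cos (pi *+ 2 *+ n) = 1 :> R.
Proof.
elim: n => [|n IH]; first by rewrite mulr0n cos0.
by rewrite mulrS cosD IH cos2pi sin2pi; ring.
Qed.

(** Energies w^2, (w + pi)^2, (w + 2 pi)^2 with w = 2 pi n, where 2 cos takes the values 2, -2, 2.
    The error 8 c / x is at most 1/2 once x >= 16 c. *)
Lemma rdisc_oscillation a b (L : R) : exists u m v : R,
  [/\ L <= u, u < m, m < v & [/\ 3 / 2 <= rdisc a b u, rdisc a b m <= - (3 / 2) & 3 / 2 <= rdisc a b v]].
Proof.
pose c := cmod a + cmod b; have c0 : 0 <= c by rewrite addr_ge0.
have pi1 := @pi_ge1 R.
have [n nP] : exists n : nat, 16 * c + `|L| + 1 <= n%:R.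
  by exists (Num.truncn (16 * c + `|L| + 1)).+1; rewrite ltW // truncnS_gt.
pose w := pi *+ 2 *+ n : R.
have wE : w = 2 * pi * n%:R by rewrite /w -[LHS]mulr_natr -[pi *+ 2]mulr_natl.
have L0 : 0 <= `|L| by []. have LL := ler_norm L.
have nw : n%:R <= w.
  rewrite wE -{1}[n%:R]mul1r ler_wpM2r //; lra.
have as_ (x : R) : w <= x -> `|rdisc a b (x ^+ 2) - 2 * cos x| <= 1 / 2.
  move=> wx; have x0 : 0 < x by lra.
  have h : 2 * (cmod a + cmod b) <= x by rewrite -/c; lra.
  have := discriminant_asymptotics x0 h; rewrite -/c => H.
  have := le_trans (ler_Re_cmod _) H; rewrite cReB /= => /le_trans; apply.
  rewrite ler_pdivrMr //; lra.
have sq (x y : R) : 0 <= x -> x < y -> x ^+ 2 < y ^+ 2 by move=> x0 xy; rewrite ltr_pXn2r ?nnegrE //; lra.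
have cw := cos_2pin n; rewrite -/w in cw.
have cw1 : cos (w + pi) = -1 by rewrite cosDpi cw.
have cw2 : cos (w + pi *+ 2) = 1 by rewrite cosD cos2pi sin2pi cw; ring.
exists (w ^+ 2), ((w + pi) ^+ 2), ((w + pi *+ 2) ^+ 2); split.
- apply: le_trans LL _; apply: (@le_trans _ _ w); first by lra.
  by rewrite expr2 ler_peMl; lra.
- apply: sq; lra.
- apply: sq; lra.
- split.
  + by have := as_ w (lexx _); rewrite cw ler_norml => /andP[]; lra.
  + by have := as_ (w + pi); rewrite cw1 ler_norml => /(_ ltac:(lra)) /andP[]; lra.
  + by have := as_ (w + pi *+ 2); rewrite cw2 ler_norml => /(_ ltac:(lra)) /andP[]; lra.
Qed.

Lemma rdisc_degenerate a b (w : R) : a = 0 \/ b = 0 -> 0 < w -> rdisc a b (w ^+ 2) = 2 * cos w.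
Proof.
move=> ab w0; have := @discriminant_asymptotics R 0 0 w w0.
rewrite cmod0 addr0 !mulr0 mul0r => /(_ (ltW w0)) h.
have : cmod (discriminant 0 0 (w ^+ 2)%:C - (2 * cos w)%:C : R[i]) == 0 by rewrite eq_le h cmod_ge0.
rewrite cmod_eq0 subr_eq0 => /eqP e.
by rewrite /rdisc discriminantE tr_degenerate // -discriminantE e.
Qed.

Definition band_adjacent (F : R -> R) (l : R) := forall d, 0 < d ->
  exists u v, [/\ u < v, l - d <= u, v <= l + d &
    forall y, u < y -> y < v -> -2 <= F y /\ F y < 2].

Lemma band_adjacent_right (F : R -> R) (l v : R) : continuous F -> F l < 2 -> l < v ->
  (forall y, l < y -> y < v -> -2 <= F y) -> band_adjacent F l.
Proof.
move=> cF Fl lv H d d0; have [e e0 He] := continuous_lt (cF l) Fl.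
pose r := Num.min d (Num.min e (v - l)).
have [rd re rv] : [/\ r <= d, r <= e & r <= v - l] by rewrite !ge_min !lexx !orbT.
have r0 : 0 < r by rewrite !lt_min d0 e0 subr_gt0.
exists l, (l + r); split; [lra..|move=> y ly yr].
by split; [apply: H; lra|apply: He; rewrite ltr_norml; lra].
Qed.

Lemma band_adjacent_left (F : R -> R) (l u : R) : continuous F -> F l < 2 -> u < l ->
  (forall y, u < y -> y < l -> -2 <= F y) -> band_adjacent F l.
Proof.
move=> cF Fl ul H d d0; have [e e0 He] := continuous_lt (cF l) Fl.
pose r := Num.min d (Num.min e (l - u)).
have [rd re rv] : [/\ r <= d, r <= e & r <= l - u] by rewrite !ge_min !lexx !orbT.
have r0 : 0 < r by rewrite !lt_min d0 e0 subr_gt0.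
exists (l - r), l; split; [lra..|move=> y ly yr].
by split; [apply: H; lra|apply: He; rewrite ltr_norml; lra].
Qed.

(** The minimum between the two large values either is at least -2, and then is itself the point, or
    lies below -2, and then the first crossing of -2 on the way down is taken, where the band lies
    to the left. In the second case F does go below -2, which excludes |a| = |b|. *)
Lemma band_edge (F : R -> R) (u m v : R) : continuous F -> u < m -> m < v ->
  3 / 2 <= F u -> F m <= - (3 / 2) -> 3 / 2 <= F v ->
  exists x, [/\ u <= x, F x < 0, band_adjacent F x &
    (exists u' v', [/\ u' < x, x < v' & forall y, u' < y -> y < v' -> F x <= F y]) \/
    (F x = -2 /\ exists l, F l < -2)].
Proof.
move=> cF um mv Fu Fm Fv.
have uv : u <= v by lra.
have [l + lmin] := @EVT_min _ F u v uv (continuous_subspaceT cF).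
rewrite in_itv /= => /andP[ul lv].
have Fl : F l <= - (3 / 2) by apply: le_trans Fm; apply: lmin; rewrite in_itv /=; lra.
have {}ul : u < l.
  by rewrite lt_def ul andbT; apply/eqP => e; move: Fl Fu; rewrite e; lra.
have {}lv : l < v.
  by rewrite lt_def lv andbT; apply/eqP => e; move: Fl Fv; rewrite e; lra.
have lmin' y : u < y -> y < v -> F l <= F y by move=> uy yv; apply: lmin; rewrite in_itv /=; lra.
have [Fl2|Fl2] := leP (-2) (F l).
  exists l; split; [exact: ltW|lra| |left; exists u, v; split => //].
  apply: (@band_adjacent_right _ _ v) => //; first lra.
  by move=> y ly yv; apply: le_trans Fl2 _; apply: lmin' => //; lra.
have Fu2 : -2 < F u by lra.
have [x [ux xl Fx before]] := first_crossing cF (ltW ul) Fu2 (ltW Fl2).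
exists x; split; [exact: ltW|lra| |right; split => //; exists l => //].
apply: (@band_adjacent_left _ _ u) => //; first lra.
by move=> y uy yx; apply/ltW/before => //; lra.
Qed.

(** At t = pi both multipliers are -1, so one solution f serves as y and as z. Spectrality gives N
    <= c I, with N its squared norm and I the modulus of the integral of f^2, while the Fourier
    estimate gives a lower bound of N by I with a factor growing with the energy. *)
Lemma simple_edge_not_spectral a b lam : a * b \is Num.real -> a != 0 -> b != 0 -> cmod a != cmod b ->
  eigenvalue_numbering a b lam -> spectral_operator a b lam ->
  exists L, forall l, L <= l -> rdisc a b l = -2 -> Fdot a b l%:C <> 0 -> False.
Proof.
move=> hab a0 b0 mods hn hs.
have ap : 0 < cmod a by rewrite cmod_gt0. have bp : 0 < cmod b by rewrite cmod_gt0.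
pose s := Num.sqrt (cmod a / cmod b).
have s0 : 0 < s by rewrite sqrtr_gt0 divr_gt0.
have sE : s ^+ 2 * cmod b = cmod a by rewrite sqr_sqrtr ?divfK ?gt_eqF // ltW // divr_gt0.
pose A := cmod b * s.
have [kp [kpE kp0]] : exists kp : R, kp = ln s ^+ 2 / (4 * pi ^+ 2) /\ 0 < kp.
  exists (ln s ^+ 2 / (4 * pi ^+ 2)); split => //.
  rewrite divr_gt0 ?exprn_even_gt0 ?mulr_gt0 ?exprn_gt0 ?pi_gt0 //=.
  apply: contra mods; rewrite ln_eq0 // => /eqP e; move: sE; rewrite e expr1n mul1r => ->.
  by rewrite eqxx.
have [c c0 Hc] := spectral_lower_bound hn hs.
(* From this energy on the factor in [fourier_norm_bound] is at least 1 + c, so (1 + c) I <= N <= c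
   I. *)
exists (3 * A + 2 * c / kp) => x Lx Fx Fd.
have [f [p [of_ f1 p1 Nf]]] : exists y p,
    [/\ ode (hill_coef a b x%:C) y p, y 1 = - y 0, p 1 = - p 0 & 0 < sqnorm y].
  by apply: antiperiodic_solution; rewrite rdiscE // Fx rmorphN rmorph_nat.
have := fourier_norm_bound a0 b0 s0 sE (erefl A) of_ f1 p1.
rewrite -kpE; set I := cmod (ci _) => /= N1.
have piI : (pi : R) \in `]-pi, pi] by rewrite in_itv /= lexx andbT gtrN // pi_gt0.
have m1 : multiplicity a b pi x%:C 1.
  by apply/multiplicity1P; split => //; rewrite rdiscE // Fx cospi mulrN1.
have e1 : expi (pi : R) = -1 := expi_pi R.
have e2 : expi (- pi : R) = -1 by rewrite expiN e1 conjcN conjc1.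
have := Hc pi x%:C f p f p piI m1 of_ of_; rewrite e1 e2 !mulN1r.
move=> /(_ f1 p1 f1 p1 Nf Nf); rewrite -/I => H.
have I0 : 0 <= I by rewrite cmod_ge0.
have {H} : sqnorm f <= c * I.
  by rewrite -(@ler_pXn2r _ 2) ?nnegrE ?mulr_ge0 ?(ltW Nf) ?(ltW c0) // exprMn expr2.
have : kp * (2 * c / kp) <= kp * (x - 3 * A) by rewrite ler_wpM2l ?(ltW kp0) // lerBrDl.
rewrite mulrCA mulfV ?gt_eqF // mulr1.
move: N1 Nf c0 I0; clear; move: (sqnorm f) I (kp * _) => N I k N1 N0 c0 I0 kc NI.
have h : 0 <= 2 + k by lra.
have : (1 + c) * I <= N by apply: le_trans (N1 h); apply: ler_wpM2r => //; lra.
move=> h2; have I00 : I = 0 by lra.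
by move: N0 NI; rewrite I00 mulr0; lra.
Qed.

Lemma spectral_conj a b lam : a * b \is Num.real ->
  eigenvalue_numbering a b lam -> spectral_operator a b lam -> b = a^*%C.
Proof.
move=> hab hn hs; apply: contrapT => nb.
have cF : continuous (rdisc a b) by exact: rdisc_continuous.
have scontra l := @spectral_contradiction R a b hab lam l hn hs.
have [ab0|] := boolP ((a == 0) || (b == 0)).
  have ab0' : a = 0 \/ b = 0 by case/orP: ab0 => /eqP; [left|right].
  have abn : a != 0 \/ b != 0.
    have [a0|] := eqVneq a 0; last by left.
    by right; apply/eqP => b0; apply: nb; rewrite a0 b0 conjc0.
  have Fpi : rdisc a b (pi ^+ 2) = -2 by rewrite rdisc_degenerate ?pi_gt0 // cospi mulrN1.
  have Fge l : -2 <= rdisc a b l.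
    apply: (discriminant_real l hab).2.
    by case: ab0' => ->; rewrite ?mul0r ?mulr0.
  have [|||h1 h2 h3 h4] := scontra (pi ^+ 2).
  - apply: (@rdisc_min _ _ _ hab (pi ^+ 2 - 1) (pi ^+ 2 + 1)).
    + by rewrite ltrBlDr ltrDl.
    + by rewrite ltrDl.
    + by move=> x _ _; rewrite Fpi.
  - by rewrite Fpi oppr_lt0.
  - apply: (@band_adjacent_right _ _ (pi ^+ 2 + 1)) => //; last by rewrite ltrDl.
    by rewrite Fpi -subr_gt0 opprK addr_gt0.
  exact: (antiperiodic_monodromy_nonscalar0 h1 h2 h3 h4 erefl abn ab0').
rewrite negb_or => /andP[a0 b0].
have nonscalar l : Fdot a b l%:C = 0 -> rdisc a b l < 0 -> band_adjacent (rdisc a b) l -> False.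
  move=> h1 h2 h3; have [k1 k2 k3 k4] := scontra l h1 h2 h3.
  exact: (antiperiodic_monodromy_nonscalar k1 k2 k3 k4 a0 b0).
(* For |a| = |b| the hypothesis F(l') < -2 is already absurd: either b is the conjugate of a, or the
   product is at most 0 and F >= -2. Otherwise the decay at simple edges applies. *)
have [L HL] : exists L, forall l, L <= l -> rdisc a b l = -2 -> (exists l', rdisc a b l' < -2) ->
    Fdot a b l%:C <> 0 -> False.
  have [e|mods] := eqVneq (cmod a) (cmod b).
    exists 0 => l _ _ [l' ll'] _; have [h _] := ab_conj hab e b0.
    have [ge|/ltW le] := leP 0 (Re (a * b)); first exact: nb (h ge).
    by have := (discriminant_real l' hab).2 le; rewrite -/(rdisc a b l') leNgt ll'.
  have [L HL] := simple_edge_not_spectral hab a0 b0 mods hn hs.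
  by exists L => l Ll e _; exact: HL.
have [u [m [v [Lu um mv [Fu Fm Fv]]]]] := rdisc_oscillation a b L.
have [x [ux Fx adj cases]] := band_edge cF um mv Fu Fm Fv.
have [Fd|Fd] := pselect (Fdot a b x%:C = 0); first exact: nonscalar Fd Fx adj.
case: cases => [[u' [v' [u'x xv' H]]]|[Fx2 ex]]; first exact/Fd/(rdisc_min hab u'x xv').
exact: HL (le_trans Lu ux) Fx2 ex Fd.
Qed.

End Nonspectral.

(** * Regularity of adjoint elements *)

Section LocalSupport.
Variable R : realType.
Local Notation leb := (@lebesgue_measure R).
Implicit Types (u p g k f h y z v r l : R -> R[i]) (D : set R) (c d x m : R).

Lemma mem_itvcc c d x : `[c, d]%classic x -> c <= x /\ x <= d.
Proof. by rewrite /= in_itv /= => /andP. Qed.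

Lemma aeeq_open_itv c d f :
  aeeq `[c, d] f (fun x => if (c < x) && (x < d) then f x else 0).
Proof.
apply: (@negligibleS _ _ _ leb [set c; d]).
  move=> x /=; apply: contra_notP => /not_orP[xc xd] /mem_itvcc[cx xd'].
  by rewrite !lt_def cx xd' (introN eqP xc) eq_sym (introN eqP xd).
apply/negligibleP; first exact: measurableU.
by apply: countable_lebesgue_measure0; exact: finite_set_countable.
Qed.

Lemma patch_supported (V : pointedType) (F : R -> V) D c d : `[c, d] `<=` D ->
  (forall x, ~ `[c, d]%classic x -> F x = point) -> F \_ D = F \_ `[c, d].
Proof.
move=> sub F0; apply/funext => x; rewrite !patchE.
case: ifPn => xD; case: ifPn => // xcd; first by rewrite F0 // => /mem_set; rewrite (negbTE xcd).
by move: xD; rewrite notin_setE => nD; case: nD; apply: sub; exact: set_mem.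
Qed.

Lemma cintegral_supported D c d f : `[c, d] `<=` D ->
  (forall x, ~ `[c, d]%classic x -> f x = 0) -> cintegral D f = cintegral `[c, d] f.
Proof.
move=> sub f0.
have key (F : R -> R) : (forall x, ~ `[c, d]%classic x -> F x = 0) ->
    \int[leb]_(x in D) F x = \int[leb]_(x in `[c, d]) F x.
  move=> F0; rewrite Rintegral_mkcond [RHS]Rintegral_mkcond; congr Rintegral.
  exact: patch_supported.
by rewrite /cintegral !key // => x /f0 /= ->.
Qed.

Lemma cmeas_supported D c d f : measurable (D : set (measurableTypeR R)) -> `[c, d] `<=` D ->
  (forall x, ~ `[c, d]%classic x -> f x = 0) -> cmeas `[c, d] f -> cmeas D f.
Proof.
move=> mD sub f0 [m1 m2]; have mI : measurable (`[c, d]%classic : set (measurableTypeR R)) by [].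
by split; apply/(measurable_restrictT _ mD); [rewrite (patch_supported (F := Re \o f) sub)|
  rewrite (patch_supported (F := Im \o f) sub)];
  [apply/(measurable_restrictT _ mI)|move=> x /f0 /= ->|apply/(measurable_restrictT _ mI)|move=> x /f0 /= ->].
Qed.

Lemma L2_supported D c d f : measurable (D : set (measurableTypeR R)) -> `[c, d] `<=` D ->
  (forall x, ~ `[c, d]%classic x -> f x = 0) -> L2 `[c, d] f -> L2 D f.
Proof.
move=> mD sub f0 /L2P[//|mf fi]; apply/L2P => //; split; first exact: cmeas_supported sub f0 mf.
apply/(integrable_mkcond _ mD); have /integrable_mkcond := fi; move=> /(_ (measurable_itv _)).
rewrite (patch_supported (F := EFin \o sqmod f) sub) // => x /f0 e.
by rewrite /= /sqmod e cmod0 expr0n.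
Qed.

Lemma L2_sub D c d f : measurable (D : set (measurableTypeR R)) -> `[c, d] `<=` D ->
  L2 D f -> L2 `[c, d] f.
Proof.
move=> mD sub /(L2P _ mD)[mf fi]; apply/L2P => //; split; first exact: cmeas_sub mf.
exact: integrable_sub fi.
Qed.

Lemma L2_cintegrable c d f : L2 `[c, d] f -> cintegrable `[c, d] f.
Proof.
move=> /L2P[//|mf fi].
have i1 : leb.-integrable `[c, d] (EFin \o fun=> 1 : R) by apply: integrable_continuous; exact: cst_continuous.
have [ui _] := integrable_lincomb 1 1 (measurable_itv _) i1 fi.
apply: (cintegrable_bound _ mf ui) => // x _; rewrite !mul1r /sqmod.
have := sqr_ge0 (cmod (f x) - 1); have := cmod_ge0 (f x); nra.
Qed.

Lemma L2D D f g : measurable (D : set (measurableTypeR R)) -> L2 D f -> L2 D g ->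
  L2 D (fun x => f x + g x).
Proof.
move=> mD /(L2P _ mD)[mf fi] /(L2P _ mD)[mg gi]; apply/L2P => //.
have ms : cmeas D (fun x => f x + g x) by exact: cmeasD.
split => //; have [ui _] := integrable_lincomb 2 2 mD fi gi.
have [i1 _] : cintegrable D (fun x => (sqmod (fun x => f x + g x) x)%:C).
  apply: (cintegrable_bound mD _ ui).
    have := cmeasM ms (cmeasJ ms); congr cmeas; apply/funext => x; exact: mulcJ.
  move=> x _; rewrite cmod_real ger0_norm ?sqr_ge0 // /sqmod.
  have := cmodD (f x) (g x); have := cmod_ge0 (f x + g x).
  have := sqr_ge0 (cmod (f x) - cmod (g x)).
  have := cmod_ge0 (f x); have := cmod_ge0 (g x); nra.
exact: i1.
Qed.

Lemma L2M_bounded D q f (B : R) : measurable (D : set (measurableTypeR R)) -> cmeas D q ->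
  (forall x, D x -> cmod (q x) <= B) -> L2 D f -> L2 D (fun x => q x * f x).
Proof.
move=> mD mq qB /(L2P _ mD)[mf fi]; apply/L2P => //.
have ms : cmeas D (fun x => q x * f x) by exact: cmeasM.
split => //; have [ui _] := integrable_lincomb (B ^+ 2) 0 mD fi fi.
have [i1 _] : cintegrable D (fun x => (sqmod (fun x => q x * f x) x)%:C).
  apply: (cintegrable_bound mD _ ui).
    have := cmeasM ms (cmeasJ ms); congr cmeas; apply/funext => x; exact: mulcJ.
  move=> x Dx; rewrite cmod_real ger0_norm ?sqr_ge0 // /sqmod mul0r addr0 cmodM exprMn.
  rewrite ler_wpM2r ?sqr_ge0 // ler_pXn2r ?nnegrE ?qB //.
  exact: le_trans (qB x Dx).
exact: i1.
Qed.

Lemma L2Z D (k : R[i]) f : measurable (D : set (measurableTypeR R)) -> L2 D f -> L2 D (fun x => k * f x).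
Proof. by move=> mD; apply: (L2M_bounded mD (cmeas_cst _ _) (B := cmod k)). Qed.

Lemma L2B D f g : measurable (D : set (measurableTypeR R)) -> L2 D f -> L2 D g ->
  L2 D (fun x => f x - g x).
Proof.
move=> mD Lf /(L2Z (-1) mD) /(L2D mD Lf); congr L2; apply/funext => x; ring.
Qed.

Lemma local_primitive k : (forall c d, c <= d -> cintegrable `[c, d] k) ->
  exists P, abs_cont setT P k.
Proof.
move=> ki.
exists (fun x => if 0 <= x then cintegral `[0, x] k else - cintegral `[x, 0] k).
move=> c d cd _; split; first exact: ki.
case: (leP 0 c) => c0; case: (leP 0 d) => d0.
- by rewrite (cintegral_split c0 cd (ki _ _ d0)); ring.
- by move: (le_lt_trans (le_trans c0 cd) d0); rewrite ltxx.
- by rewrite (cintegral_split (ltW c0) d0 (ki _ _ cd)); ring.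
- by rewrite (cintegral_split cd (ltW d0) (ki _ _ (ltW c0))); ring.
Qed.

Lemma abs_cont_sub D D' p g : D' `<=` D -> abs_cont D p g -> abs_cont D' p g.
Proof. by move=> sub ac c d cd h; apply: ac => //; exact: subset_trans sub. Qed.

Lemma aeeq_sub D D' f g : D' `<=` D -> aeeq D f g -> aeeq D' f g.
Proof. by move=> sub; apply: ae_mono => x e /sub. Qed.

Lemma aeeq_sym D f g : aeeq D f g -> aeeq D g f.
Proof. by apply: ae_mono => x e Dx; rewrite e. Qed.

Lemma aeeq_trans D f g h : aeeq D f g -> aeeq D g h -> aeeq D f h.
Proof. by apply: ae_mono2 => x e1 e2 Dx; rewrite e1 // e2. Qed.

Lemma abs_cont_aeeq D p g g' : abs_cont D p g ->
  aeeq D g g' -> (forall c d, c <= d -> `[c, d] `<=` D -> cintegrable `[c, d] g') ->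
  abs_cont D p g'.
Proof.
move=> ac e gi c d cd sub; split; first exact: gi.
have [i ->] := ac c d cd sub.
apply: ae_eq_cintegral => //; [exact: cintegrable_meas|exact/cintegrable_meas/gi|].
exact: aeeq_sub e.
Qed.

Lemma abs_contJ D p g : abs_cont D p g -> abs_cont D (fun x => (p x)^*%C) (fun x => (g x)^*%C).
Proof.
move=> ac c d cd sub; have [i e] := ac c d cd sub.
by split; [exact: cintegrableJ|rewrite cintegralJ // -e conjcB].
Qed.

Lemma abs_contD D p g p' g' : abs_cont D p g -> abs_cont D p' g' ->
  abs_cont D (fun x => p x + p' x) (fun x => g x + g' x).
Proof.
move=> ac ac' c d cd sub; have [i e] := ac c d cd sub; have [i' e'] := ac' c d cd sub.
split; first exact: cintegrableD.
by rewrite cintegralD // -e -e'; ring.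
Qed.

(** One integration by parts on each side; the first derivatives [p] and [r] occur in the same mixed
    integral, which cancels. *)
Lemma lagrange_identity c d u p k v r l : c <= d ->
  abs_cont `[c, d] u p -> abs_cont `[c, d] p k -> abs_cont `[c, d] v r -> abs_cont `[c, d] r l ->
  [/\ cintegrable `[c, d] (fun x => k x * (v x)^*%C), cintegrable `[c, d] (fun x => u x * (l x)^*%C) &
   cintegral `[c, d] (fun x => k x * (v x)^*%C) - cintegral `[c, d] (fun x => u x * (l x)^*%C) =
   (p d * (v d)^*%C - u d * (r d)^*%C) - (p c * (v c)^*%C - u c * (r c)^*%C)].
Proof.
move=> cd au ap av ar.
have [B1 b1] := abs_cont_bounded cd ap; have [B2 b2] := abs_cont_bounded cd ar.
have [|i1 i2 e1] := abs_cont_by_parts (C := B2) cd ap (abs_contJ av).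
  by move=> x cx xd; rewrite cmodJ b2.
have [i3 i4 e2] := abs_cont_by_parts cd (abs_contJ ar) au b1.
have E : (fun x => u x * (l x)^*%C) = fun x => (l x)^*%C * u x by apply/funext => x; rewrite mulrC.
have E' : (fun x => p x * (r x)^*%C) = fun x => (r x)^*%C * p x by apply/funext => x; rewrite mulrC.
split; [exact: i1|by rewrite E|rewrite E]; rewrite E' in e1.
transitivity ((cintegral `[c, d] (fun x => k x * (v x)^*%C) + cintegral `[c, d] (fun x => (r x)^*%C * p x))
  - (cintegral `[c, d] (fun x => (l x)^*%C * u x) + cintegral `[c, d] (fun x => (r x)^*%C * p x))); first by ring.
by rewrite e1 e2; ring.
Qed.

End LocalSupport.

(** * Test functions and weak solutions on an interval *)

Section Regularity.
Variable R : realType.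
Local Notation leb := (@lebesgue_measure R).
Implicit Types (u p g k f h y z v r l q w : R -> R[i]) (D : set R) (c d x m : R).

Lemma cintegral0 D : cintegral D (fun=> 0 : R[i]) = 0.
Proof.
have e : \int[leb]_(x in D) (0 : R) = 0 by rewrite /Rintegral integral0.
by apply: complex_ext; rewrite /cintegral /=; exact: e.
Qed.

Lemma cintegrable_supported c d f : (forall x, ~ `[c, d]%classic x -> f x = 0) ->
  cintegrable `[c, d] f -> cintegrable setT f.
Proof.
move=> f0 [i1 i2].
have key (F : R -> R) : (forall x, ~ `[c, d]%classic x -> F x = 0) ->
    leb.-integrable `[c, d] (EFin \o F) -> leb.-integrable setT (EFin \o F).
  move=> F0 Fi; have /integrable_mkcond := Fi; move=> /(_ (measurable_itv _)).
  by rewrite -(@patch_supported _ _ (EFin \o F) setT) ?patch_setT // => x /F0 /= ->.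
by split; apply: key => // x /f0 /= ->.
Qed.

Lemma abs_cont_cintegrable c d p g : c <= d -> abs_cont `[c, d] p g -> cintegrable `[c, d] p.
Proof.
move=> cd ac; have [B b] := abs_cont_bounded cd ac.
have ui : leb.-integrable `[c, d] (EFin \o fun=> B : R).
  by apply: integrable_continuous; exact: cst_continuous.
apply: (cintegrable_bound _ (abs_cont_meas cd ac) ui) => // x /mem_itvcc[cx xd].
exact: b.
Qed.

Lemma L2_abs_cont c d p g : c <= d -> abs_cont `[c, d] p g -> L2 `[c, d] p.
Proof.
move=> cd ac; have [B b] := abs_cont_bounded cd ac.
have L1 : L2 `[c, d] (fun=> 1 : R[i]) by apply: L2_ccont; exact: ccont_cst.
have := @L2M_bounded _ _ _ _ B (measurable_itv _) (abs_cont_meas cd ac) _ L1.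
under [X in L2 _ X]eq_fun do rewrite mulr1.
by apply => x /mem_itvcc[cx xd]; exact: b.
Qed.

Lemma primitive_supported c d g : c <= d -> cintegrable `[c, d] g ->
  (forall x, x <= c \/ d <= x -> g x = 0) -> cintegral `[c, d] g = 0 ->
  exists p, abs_cont setT p g /\ forall x, x <= c \/ d <= x -> p x = 0.
Proof.
move=> cd gi g0 int0.
have out x : ~ `[c, d]%classic x -> g x = 0.
  move=> xn; apply: g0; have [|xc] := leP x c; first by left.
  by right; rewrite leNgt; apply/negP => xd; apply: xn; rewrite /= in_itv /= !ltW.
have giT := cintegrable_supported out gi.
have [P aP] : exists P, abs_cont setT P g.
  by apply: local_primitive => s t st; apply: cintegrable_sub giT.
have zero s t : s <= t -> (t <= c \/ d <= s) -> P t - P s = 0.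
  move=> st h; have [_ ->] := aP s t st (@subsetT _ _).
  rewrite -[RHS](cintegral0 `[s, t]); apply: eq_cintegral => x /set_mem /mem_itvcc[sx xt].
  by apply: g0; case: h => h; [left; exact: le_trans h|right; exact: le_trans sx].
exists (fun x => P x - P c); split.
  move=> s t st sub; have [i e] := aP s t st sub.
  by split => //; rewrite -e; ring.
move=> x [xc|dx]; first by rewrite -opprB (zero x c) ?oppr0 //; left.
have [_ e] := aP c d cd (@subsetT _ _).
have dx0 : P x - P d = 0 by apply: zero => //; right.
by rewrite -(subrK (P d) (P x)) dx0 add0r e.
Qed.

Lemma cintegrable_mul_ccont c d f w : cintegrable `[c, d] f -> ccont w ->
  cintegrable `[c, d] (fun x => f x * w x).
Proof.
move=> fi cw; have [B b] := ccont_bounded c d cw.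
apply: (@cintegrable_mulr _ _ _ _ B) => //; first exact: ccont_meas.
by move=> x /mem_itvcc[]; exact: b.
Qed.

Lemma affine_cder m : cder (fun x : R => (x - m)%:C) (fun=> 1%:C).
Proof.
apply: cder_real => x.
by apply: (is_derive_eq (is_derive_subr (is_derive_id x 1) (is_derive_cst m x 1))); rewrite subr0.
Qed.

Lemma ccont_affine m : ccont (fun x : R => (x - m)%:C).
Proof. exact: cder_ccont (affine_cder m). Qed.

(** [g] is the second derivative of a function supported in [c, d] once it is orthogonal to affine
    functions: the first moment condition closes up [p], the second, integrated by parts, closes up
    [y]. *)
Lemma test_function c d m g : c <= d -> cintegrable `[c, d] g ->
  (forall x, x <= c \/ d <= x -> g x = 0) ->
  cintegral `[c, d] g = 0 -> cintegral `[c, d] (fun x => g x * (x - m)%:C) = 0 ->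
  exists y p, [/\ abs_cont setT y p, abs_cont setT p g &
    forall x, x <= c \/ d <= x -> y x = 0 /\ p x = 0].
Proof.
move=> cd gi g0 i0 i1; have [p [ap p0]] := primitive_supported cd gi g0 i0.
have ap' := abs_cont_sub (@subsetT _ `[c, d]) ap.
have d1 := affine_cder m.
have aw := cder_abs_cont (D := `[c, d]) d1 (ccont_cst _).
have [|_ _ e] := abs_cont_by_parts (C := 1) cd ap' aw.
  by move=> x _ _; rewrite cmod1.
have [|y [ay y0]] := primitive_supported cd (abs_cont_cintegrable cd ap') p0.
  have [pc pd] : p c = 0 /\ p d = 0 by split; apply: p0; [left|right].
  move: e; rewrite i1 add0r pc pd !mul0r subr0 => <-.
  by apply: eq_cintegral => x _; rewrite mulr1.
by exists y, p; split => // x h; rewrite y0 // p0.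
Qed.

(** Centring at the midpoint makes 1 and x - m orthogonal, so projections onto affine functions need
    no linear system. *)
Lemma affine_moments c d : c < d -> let m := (c + d) / 2 in
  [/\ cintegral `[c, d] (fun=> 1 : R[i]) = (d - c)%:C,
      cintegral `[c, d] (fun x => (x - m)%:C) = 0 &
      cintegral `[c, d] (fun x => (x - m)%:C * (x - m)%:C) = ((d - c) ^+ 3 / 12)%:C].
Proof.
move=> cd m; have cd' := ltW cd; split.
- have [d1 d2 _] := @cubic_cder R 1 0 0 0.
  have e := cintegral_deriv cd' d1 (cder_ccont d2).
  rewrite (@eq_cintegral _ _ _ (fun x => (1 + 2 * 0 * x + 3 * 0 * x ^+ 2)%:C)).
    by rewrite e -rmorphB; congr (_%:C); ring.
  by move=> x _; rewrite (_ : 1 + _ + _ = 1 :> R) //; ring.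
- have [d1 d2 _] := cubic_cder (- m) (1 / 2) 0 0.
  have e := cintegral_deriv cd' d1 (cder_ccont d2).
  rewrite (@eq_cintegral _ _ _ (fun x => (- m + 2 * (1 / 2) * x + 3 * 0 * x ^+ 2)%:C)).
    by rewrite e -rmorphB -[RHS](rmorph0 (real_complex R)); congr (_%:C); rewrite /m; field.
  by move=> x _; congr (_%:C); field.
- have [d1 d2 _] := cubic_cder (m ^+ 2) (- m) (1 / 3) 0.
  have e := cintegral_deriv cd' d1 (cder_ccont d2).
  rewrite (@eq_cintegral _ _ _ (fun x => (m ^+ 2 + 2 * - m * x + 3 * (1 / 3) * x ^+ 2)%:C)).
    by rewrite e -rmorphB; congr (_%:C); rewrite /m; field.
  by move=> x _; rewrite -realCM; congr (_%:C); field.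
Qed.

Lemma affine_projection c d w : c < d -> cintegrable `[c, d] w -> let m := (c + d) / 2 in
  exists A B, let r := fun x => w x - (A + B * (x - m)%:C) in
    cintegral `[c, d] r = 0 /\ cintegral `[c, d] (fun x => r x * (x - m)%:C) = 0.
Proof.
move=> cd wi m; have [e1 e2 e3] := affine_moments cd; rewrite -/m in e2 e3.
have mI := measurable_itv `[c, d].
have ca := ccont_affine m.
have i1 : cintegrable `[c, d] (fun=> 1 : R[i]) by apply: ccont_cintegrable; exact: ccont_cst.
have i2 : cintegrable `[c, d] (fun x => (x - m)%:C) by exact: ccont_cintegrable.
have i3 : cintegrable `[c, d] (fun x => (x - m)%:C * (x - m)%:C).
  by apply: ccont_cintegrable; exact: ccontM.
have i4 := cintegrable_mul_ccont wi ca.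
have L0 : (d - c)%:C != 0 :> R[i].
  by rewrite -cmod_eq0 cmod_real normr_eq0 subr_eq0 gt_eqF.
have L3 : ((d - c) ^+ 3 / 12)%:C != 0 :> R[i].
  rewrite -cmod_eq0 cmod_real normr_eq0 mulf_neq0 ?invr_neq0 ?pnatr_eq0 //.
  by rewrite expf_neq0 // subr_eq0 gt_eqF.
exists (cintegral `[c, d] w / (d - c)%:C).
exists (cintegral `[c, d] (fun x => w x * (x - m)%:C) / ((d - c) ^+ 3 / 12)%:C) => r.
set A := _ / _ in r *; set B := _ / _ in r *.
split.
- rewrite (@eq_cintegral _ _ _ (fun x => w x - (A * 1 + B * (x - m)%:C))); last first.
    by move=> x _; rewrite /r mulr1.
  rewrite cintegralB //; last by apply: cintegrableD => //; exact: cintegrableZ.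
  rewrite cintegralD //; [|exact: cintegrableZ..].
  by rewrite !cintegralZ // e1 e2 /A divfK // mulr0 addr0 subrr.
- rewrite (@eq_cintegral _ _ _ (fun x => w x * (x - m)%:C - (A * (x - m)%:C + B * ((x - m)%:C * (x - m)%:C)))); last first.
    by move=> x _; rewrite /r; ring.
  rewrite cintegralB //; last by apply: cintegrableD => //; exact: cintegrableZ.
  rewrite cintegralD //; [|exact: cintegrableZ..].
  by rewrite !cintegralZ // e2 e3 /B divfK // mulr0 add0r subrr.
Qed.

Lemma inner_self_eq0 D g : measurable (D : set (measurableTypeR R)) -> L2 D g ->
  inner D g g = 0 -> aeeq D g (fun=> 0).
Proof.
move=> mD /(L2P _ mD)[mg gi]; rewrite inner_self // => /(congr1 (@complex.Re R)) /= e.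
have ms := measurable_int _ gi.
have : (\int[leb]_(x in D) `|(EFin \o sqmod g) x| = 0)%E.
  under eq_integral do rewrite /= ger0_norm ?sqr_ge0 //.
  have := integrable_fin_num mD gi => fn.
  by rewrite -(fineK fn); congr EFin.
move/(ae_eq_integral_abs _ mD ms); apply: ae_mono => x h Dx.
have [/eqP] := h Dx; rewrite /sqmod expf_eq0 /= cmod_eq0 => /eqP //.
Qed.

End Regularity.

Section AdjointRegularity.
Variable R : realType.
Local Notation leb := (@lebesgue_measure R).
Implicit Types (u p g k f h y z v r l q w : R -> R[i]) (D : set R) (c d x m : R).
Implicit Types (bc : (R -> R[i]) -> (R -> R[i]) -> Prop).

Lemma L2_ccontM c d q f : ccont q -> L2 `[c, d] f -> L2 `[c, d] (fun x => q x * f x).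
Proof.
move=> cq Lf; have [B b] := ccont_bounded c d cq.
apply: (@L2M_bounded _ _ _ _ B) => //; first exact: ccont_meas.
by move=> x /mem_itvcc[]; exact: b.
Qed.

Lemma generated_canonical D q bc y f : measurable (D : set (measurableTypeR R)) -> ccont q ->
  generated D q bc y f <-> [/\ L2 D y, L2 D f & exists u p,
    [/\ aeeq D y u, abs_cont D u p, abs_cont D p (fun x => q x * y x - f x) & bc u p]].
Proof.
move=> mD cq; split.
- move=> [Ly Lf [u [p [g [eu au ap ef b]]]]]; split => //; exists u, p; split => //.
  apply: abs_cont_aeeq ap _ _.
    by apply: ae_mono2 eu ef => x e1 e2 Dx; rewrite e1 // e2 //; ring.
  move=> c d cd sub; apply: L2_cintegrable.
  by apply: L2B => //; [apply: L2_ccontM => //|]; exact: L2_sub sub _.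
- move=> [Ly Lf [u [p [eu au ap b]]]]; split => //.
  exists u, p, (fun x => q x * y x - f x); split => //.
  by apply: ae_mono eu => x e Dx; rewrite e //; ring.
Qed.

Lemma cmeas_open_indic c d : cmeas `[c, d] (fun x : R => (\1_(`]c, d[%classic : set R) x)%:C).
Proof.
split; last exact: measurable_cst.
by apply: measurable_funTS; exact: measurable_indic.
Qed.

(** Since [Z] solves the adjoint equation with right side built from z and h, the difference z - Z
    is orthogonal to second derivatives of all test functions. Its residual [r] modulo affine
    functions is such a second derivative, hence orthogonal to itself. Only boundary conditions that
    hold for functions vanishing at and outside the end points enter. *)
Lemma adjoint_regular D q bc c d z h Z P : measurable (D : set (measurableTypeR R)) ->
  c < d -> `[c, d] `<=` D -> ccont q ->
  (forall y p, (forall x, x <= c \/ d <= x -> y x = 0 /\ p x = 0) -> bc y p) ->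
  adjoint D (generated D q bc) z h ->
  abs_cont `[c, d] Z P -> abs_cont `[c, d] P (fun x => (q x)^*%C * z x - h x) ->
  exists A B, aeeq `[c, d] z (fun x => Z x + (A + B * (x - (c + d) / 2)%:C)).
Proof.
move=> mD cd sub cq bc0 [LzD LhD H] aZ aP; set m := (c + d) / 2.
have cd' := ltW cd; have mI := measurable_itv `[c, d].
have Lz := L2_sub mD sub LzD; have Lh := L2_sub mD sub LhD.
pose w x := z x - Z x.
have Lw : L2 `[c, d] w by apply: L2B => //; exact: L2_abs_cont aZ.
have [A [B [r0 r1]]] := affine_projection cd (L2_cintegrable Lw); rewrite -/m in r0 r1.
set r := fun x => w x - _ in r0 r1; exists A, B.
have ca : ccont (fun x => A + B * (x - m)%:C) by apply: ccontD; [exact: ccont_cst|exact/ccontZ/ccont_affine].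
have Lr : L2 `[c, d] r by apply: L2B => //; exact: L2_ccont.
(* Cutting off outside the open interval gives exact vanishing at the end points, as [test_function]
   requires, and alters [r] on a null set of [c, d] only. *)
pose g x := (\1_(`]c, d[%classic : set R) x)%:C * r x.
have Lg : L2 `[c, d] g.
  apply: (@L2M_bounded _ _ _ _ 1) => //; first exact: cmeas_open_indic.
  by move=> x _; rewrite cmod_real indicE; case: (_ \in _); rewrite ?normr1 ?normr0.
have gr : aeeq `[c, d] r g.
  apply: aeeq_trans (aeeq_open_itv c d r) _; apply: aeW => x _; rewrite /g indicE.
  by rewrite mem_setE /= in_itv /=; case: ifP => _; rewrite ?mul1r ?mul0r.
have g_out x : x <= c \/ d <= x -> g x = 0.
  move=> h'; rewrite /g indicE mem_setE /= in_itv /=.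
  by case: h' => h'; rewrite !ltNge h' ?andbF mul0r.
have gi := L2_cintegrable Lg; have ri := L2_cintegrable Lr.
have g0 : cintegral `[c, d] g = 0.
  by rewrite -r0; apply: ae_eq_cintegral (aeeq_sym gr) => //; exact: cintegrable_meas.
have cam := ccont_affine m.
have g1 : cintegral `[c, d] (fun x => g x * (x - m)%:C) = 0.
  rewrite -r1; apply: ae_eq_cintegral => //; try exact/cintegrable_meas/cintegrable_mul_ccont.
  by apply: ae_mono gr => x e Dx; rewrite -[g x]e.
have [y [p [ay ap yp0]]] := test_function cd' gi g_out g0 g1.
have ay' := abs_cont_sub (@subsetT _ `[c, d]) ay.
have ap' := abs_cont_sub (@subsetT _ `[c, d]) ap.
pose f x := - g x + q x * y x.
have outI x : ~ `[c, d]%classic x -> x <= c \/ d <= x.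
  move=> xn; have [|xc] := leP x c; first by left.
  by right; rewrite leNgt; apply/negP => xd; apply: xn; rewrite /= in_itv /= !ltW.
have y_out x : ~ `[c, d]%classic x -> y x = 0 by move=> /outI /yp0[].
have f_out x : ~ `[c, d]%classic x -> f x = 0.
  by move=> xn; rewrite /f y_out // g_out ?oppr0 ?mulr0 ?addr0 //; exact: outI.
have Ly : L2 `[c, d] y by exact: L2_abs_cont ay'.
have Lqy := L2_ccontM cq Ly.
have Lf : L2 `[c, d] f.
  have := L2B mI Lqy Lg; congr L2; apply/funext => x; rewrite /f; ring.
have Gyf : generated D q bc y f.
  split; [exact: L2_supported Ly|exact: L2_supported Lf|].
  exists y, p, g; split; [exact: aeeq_refl|exact: abs_cont_sub ay|exact: abs_cont_sub ap| |exact: bc0].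
  exact: aeeq_refl.
have := H y f Gyf; rewrite /inner.
rewrite (cintegral_supported sub) => [|x /f_out ->]; last by rewrite mul0r.
rewrite [RHS](cintegral_supported sub) => [fz|x /y_out ->]; last by rewrite mul0r.
have [i1 i2] := lagrange_identity cd' ay' ap' aZ aP.
have [[yc pc] [yd pd]] : (y c = 0 /\ p c = 0) /\ (y d = 0 /\ p d = 0).
  by split; apply: yp0; [left|right].
rewrite yc pc yd pd !mul0r !subr0 => /eqP; rewrite subr_eq0 => /eqP e.
have jgz := L2_mulJ mI Lg Lz; have jfz := L2_mulJ mI Lf Lz; have jyh := L2_mulJ mI Ly Lh.
have e2 : cintegral `[c, d] (fun x => y x * ((q x)^*%C * z x - h x)^*%C) =
    cintegral `[c, d] (fun x => g x * (z x)^*%C).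
  rewrite (@eq_cintegral _ _ _ (fun x => g x * (z x)^*%C + (f x * (z x)^*%C - y x * (h x)^*%C))).
    rewrite cintegralD //; last exact: cintegrableB.
    by rewrite cintegralB // fz subrr addr0.
  by move=> x _; rewrite conjcB conjcM conjcK /f; ring.
have gg : inner `[c, d] g g = 0.
  have j1 := cintegrable_mul_ccont gi cam.
  have k1 := cintegrableB mI jgz i1.
  have k2 := cintegrableZ A^*%C mI gi; have k3 := cintegrableZ B^*%C mI j1.
  have k4 := cintegrableD mI k2 k3.
  rewrite /inner (ae_eq_cintegral mI (cintegrable_meas (L2_mulJ mI Lg Lg))
    (cintegrable_meas (cintegrableB mI k1 k4))).
    rewrite (cintegralB mI k1 k4) (cintegralB mI jgz i1) (cintegralD mI k2 k3).
    by rewrite (cintegralZ _ mI gi) (cintegralZ _ mI j1) g0 g1 !mulr0 addr0 subr0 e e2 subrr.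
  apply: ae_mono gr => x e' Dx; rewrite -[X in _ * (X)^*%C]e' // /r /w !conjcB conjcD conjcM conjc_real.
  ring.
have g_0 := inner_self_eq0 mI Lg gg.
apply: ae_mono2 gr g_0 => x e1 e0 Dx.
have : r x = 0 by rewrite e1 // e0.
by rewrite /r /w => /eqP; rewrite subr_eq0 subr_eq => /eqP ->; ring.
Qed.

End AdjointRegularity.

(** * Fibre operators with real potential *)

Section SelfAdjointFibres.
Variable R : realType.
Local Notation leb := (@lebesgue_measure R).
Implicit Types (u p g k f h y z v r q w Q : R -> R[i]) (D : set R) (c d x t : R) (a b l : R[i]).

Lemma inner_ae D f f' g g' : measurable (D : set (measurableTypeR R)) ->
  cmeas D f -> cmeas D f' -> cmeas D g -> cmeas D g' -> aeeq D f f' -> aeeq D g g' ->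
  inner D f g = inner D f' g'.
Proof.
move=> mD mf mf' mg mg' e e'; apply: ae_eq_cintegral => //; try by apply: cmeasM => //; exact: cmeasJ.
by apply: ae_mono2 e e' => x e1 e2 Dx; rewrite e1 // e2.
Qed.

Lemma abs_cont_cst D (k : R[i]) : abs_cont D (fun=> k) (fun=> 0).
Proof. exact: (cder_abs_cont (cder_cst k) (ccont_cst 0)). Qed.

Lemma abs_cont_affine D A (B : R[i]) (m : R) : abs_cont D (fun x => A + B * (x - m)%:C) (fun=> B).
Proof.
apply: (cder_abs_cont _ (ccont_cst B)).
have d1 := affine_cder m.
by apply: cder_ext (cderD (cder_cst A) (cderZ B d1)) => x //; rewrite mulr1 add0r.
Qed.

Lemma abs_cont_ext D p g g' : abs_cont D p g -> g =1 g' -> abs_cont D p g'.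
Proof. by move=> ac /funext <-. Qed.

(** [k] is cut off outside the interval so that its primitives exist on the whole line. *)
Lemma double_primitive c d k : c <= d -> cintegrable `[c, d] k ->
  exists Z P, abs_cont `[c, d] Z P /\ abs_cont `[c, d] P k.
Proof.
move=> cd ki; pose k' x := if x \in `[c, d] then k x else 0.
have out x : ~ `[c, d]%classic x -> k' x = 0 by move=> h; rewrite /k'; case: ifP => // /h.
have eI (i : interval R) : [set` i] `<=` `[c, d] -> {in [set` i], k' =1 k}.
  by move=> sub x /set_mem /sub h; rewrite /k' ifT.
have k'i : cintegrable `[c, d] k'.
  have [i1 i2] := ki; split.
  - by apply: eq_integrable i1 => // x xI /=; rewrite (eI `[c, d]).
  - by apply: eq_integrable i2 => // x xI /=; rewrite (eI `[c, d]).
have giT := cintegrable_supported out k'i.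
have [P aP] : exists P, abs_cont setT P k'.
  by apply: local_primitive => s t st; apply: cintegrable_sub giT.
have aP' : abs_cont `[c, d] P k.
  move=> s t st sub; have [_ ->] := aP s t st (@subsetT _ _).
  by split; [exact: cintegrable_sub ki|apply: eq_cintegral; exact: eI].
have [Z aZ] : exists Z, abs_cont setT Z P.
  by apply: local_primitive => s t st; apply: abs_cont_cintegrable st (abs_cont_sub _ aP).
by exists Z, P; split => //; exact: abs_cont_sub aZ.
Qed.

(** The Wronskians with the classical fundamental solutions are still constant, by integration by
    parts, so a solution in the almost everywhere sense is the classical one. *)
Lemma abs_cont_ode_rep Q u p k : admissible Q -> abs_cont `[0, 1] u p -> abs_cont `[0, 1] p k ->
  aeeq `[0, 1] k (fun x => Q x * u x) -> forall x, 0 <= x -> x <= 1 ->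
  u x = u 0 * fth Q x + p 0 * fph Q x /\ p x = u 0 * fth' Q x + p 0 * fph' Q x.
Proof.
move=> aQ au ap ek x x0 x1.
have sub : `[0, x] `<=` `[0, 1] by exact: subset_itvcc.
have au' := abs_cont_sub sub au; have ap' := abs_cont_sub sub ap; have cQ := aQ.1.
have key w w' : ode Q w w' -> p x * w x - u x * w' x = p 0 * w 0 - u 0 * w' 0.
  move=> ow; have [cw cw'] := ode_ccont ow; have [dw dw'] := ow.
  have cQw := ccontM cQ cw.
  have [i1 i2] := abs_cont_by_parts2 x0 au' ap' dw dw' cQw.
  rewrite (_ : cintegral _ _ = cintegral `[0, x] (fun x => u x * (Q x * w x))); last first.
    apply: ae_eq_cintegral => //; [exact: cintegrable_meas|exact: cintegrable_meas|].
    by apply: ae_mono (aeeq_sub sub ek) => s e Ds; rewrite e //; ring.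
  by rewrite subrr => /esym /eqP; rewrite subr_eq0 => /eqP.
have k1 := key _ _ (ode_fth aQ); have k2 := key _ _ (ode_fph aQ).
rewrite fth0 // fth'0 // mulr1 mulr0 subr0 in k1.
rewrite fph0 // fph'0 // mulr1 mulr0 sub0r in k2.
have det := fundamental_det aQ x.
split.
- transitivity (u x * (fth Q x * fph' Q x - fth' Q x * fph Q x)); first by rewrite det mulr1.
  rewrite -k1 -[u 0]opprK -k2; ring.
- transitivity (p x * (fth Q x * fph' Q x - fth' Q x * fph Q x)); first by rewrite det mulr1.
  rewrite -k1 -[u 0]opprK -k2; ring.
Qed.

(** Hermite cubics realize arbitrary Cauchy data at 0 together with the quasi-periodic data at 1;
    these are the test elements that detect the adjoint boundary conditions. *)
Lemma quasi_periodic_cubic (E y0 p0 : R[i]) : exists y p g,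
  [/\ cder y p, cder p g, ccont g & [/\ y 0 = y0, p 0 = p0, y 1 = E * y0 & p 1 = E * p0]].
Proof.
have [d1 e1 f1] := @cubic_cder R 0 3 (-2) 0; have [d2 e2 f2] := @cubic_cder R 1 (-2) 1 0.
have [d3 e3 f3] := @cubic_cder R 0 (-1) 1 0.
have dy := cderD (cderD (cder_cst y0) (cderZ (y0 * (E - 1)) d1))
  (cderD (cderZ p0 d2) (cderZ (p0 * E) d3)).
have dp := cderD (cderD (cder_cst 0) (cderZ (y0 * (E - 1)) e1))
  (cderD (cderZ p0 e2) (cderZ (p0 * E) e3)).
have dg := cderD (cderD (cder_cst 0) (cderZ (y0 * (E - 1)) f1))
  (cderD (cderZ p0 f2) (cderZ (p0 * E) f3)).
eexists _, _, _; split; [exact: dy|exact: dp|exact: cder_ccont dg|].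
by split; apply: complex_ext; rewrite !cReImE /=; ring.
Qed.

(** Interior regularity gives a representative [v] with derivative [r]; the remaining boundary form
    vanishes for all data y0, p0 of domain elements, and the choices (0, 1) and (1, 0) give the two
    conditions. *)
Lemma adjoint_Hill_t a b t z h : adjoint `[0, 1] (Hill_t a b t) z h ->
  exists v r, [/\ aeeq `[0, 1] z v, abs_cont `[0, 1] v r,
    abs_cont `[0, 1] r (fun x => (potential a b x)^*%C * z x - h x),
    v 1 = expi t * v 0 & r 1 = expi t * r 0].
Proof.
move=> H; set q := potential a b; have cq : ccont q := potential_ccont a b.
have mI := measurable_itv (`[0, 1] : interval R); have sub := @subset_refl _ (`[0, 1]%classic : set R).
have [Lz Lh pair] := H.
have Lk : L2 `[0, 1] (fun x => (q x)^*%C * z x - h x).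
  by apply: L2B => //; apply: L2_ccontM => //; exact: ccontJ.
have [Z [P [aZ aP]]] := double_primitive ler01 (L2_cintegrable Lk).
have [|A [B zE]] := adjoint_regular mI ltr01 sub cq _ H aZ aP.
  move=> y p yp0; have [[y0 p0] [y1 p1]] : (y 0 = 0 /\ p 0 = 0) /\ (y 1 = 0 /\ p 1 = 0).
    by split; apply: yp0; [left|right].
  by rewrite y0 p0 y1 p1 !mulr0.
have av := abs_contD aZ (abs_cont_affine (D := `[0, 1]) A B ((0 + 1) / 2)).
set v := fun x => Z x + _ in zE av.
have ar := abs_cont_ext (abs_contD aP (abs_cont_cst (D := `[0, 1]) B)) (fun x => addr0 _).
set r := fun x => P x + B in av ar.
exists v, r; suff bcs (y0 p0 : R[i]) :
    p0 * (expi t * (v 1)^*%C - (v 0)^*%C) - y0 * (expi t * (r 1)^*%C - (r 0)^*%C) = 0.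
  have flip (s s' : R[i]) : expi t * s^*%C - s'^*%C = 0 -> s = expi t * s'.
    move=> /eqP; rewrite subr_eq0 => /eqP /(congr1 (fun s0 : R[i] => expi t * s0^*%C)).
    rewrite conjcK conjcM conjcK mulrA => <-.
    by rewrite -expiN [expi t * _]mulrC expiNK mul1r.
  split => //; apply: flip; first by have := bcs 0 1; rewrite mul1r mul0r subr0.
  by have /eqP := bcs 1 0; rewrite mul1r mul0r sub0r oppr_eq0 => /eqP.
have [y [p [g [dy dp cg [y0E p0E y1E p1E]]]]] := quasi_periodic_cubic (expi t) y0 p0.
have [cy cp] := (cder_ccont dy, cder_ccont dp); have cqy := ccontM cq cy.
have ay := cder_abs_cont (D := `[0, 1]) dy cp; have ap := cder_abs_cont (D := `[0, 1]) dp cg.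
pose f x := - g x + q x * y x.
have cf : ccont f by apply: ccontD => //; exact: ccontN.
have Gyf : Hill_t a b t y f.
  split; [exact: L2_ccont|exact: L2_ccont|].
  exists y, p, g; split => //; [exact: aeeq_refl|exact: aeeq_refl|].
  by rewrite y0E p0E y1E p1E.
have e := pair y f Gyf; rewrite /inner in e.
have [i1 i2] := lagrange_identity ler01 ay ap av ar.
have Ly := L2_ccont 0 1 cy; have Lf := L2_ccont 0 1 cf; have Lg := L2_ccont 0 1 cg.
have jgz := L2_mulJ mI Lg Lz; have jfz := L2_mulJ mI Lf Lz; have jyh := L2_mulJ mI Ly Lh.
have -> : cintegral `[0, 1] (fun x => y x * ((q x)^*%C * z x - h x)^*%C) =
    cintegral `[0, 1] (fun x => g x * (z x)^*%C).
  rewrite (@eq_cintegral _ _ _ (fun x => g x * (z x)^*%C + (f x * (z x)^*%C - y x * (h x)^*%C))).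
    rewrite cintegralD //; last exact: cintegrableB.
    by rewrite cintegralB // e subrr addr0.
  by move=> x _; rewrite conjcB conjcM conjcK /f; ring.
rewrite (_ : cintegral _ _ = cintegral `[0, 1] (fun x => g x * (z x)^*%C)); last first.
  apply: ae_eq_cintegral => //; [exact: cintegrable_meas|exact: cintegrable_meas|].
  by apply: ae_mono zE => x e' Dx; rewrite [z x]e'.
rewrite subrr y0E p0E y1E p1E => ->; ring.
Qed.

Lemma real_eigenvalue a b t l y p : (forall x, (potential a b x)^*%C = potential a b x) ->
  ode (hill_coef a b l) y p -> y 1 = expi t * y 0 -> p 1 = expi t * p 0 ->
  0 < sqnorm y -> l^*%C = l.
Proof.
move=> qJ oy y1 p1 Ny; have [cy cp] := ode_ccont oy; have [dy dp] := oy.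
have [cQ _] := hill_coef_admissible a b l; have cQy := ccontM cQ cy.
have ay := cder_abs_cont (D := `[0, 1]) dy cp; have ap := cder_abs_cont (D := `[0, 1]) dp cQy.
have [i1 i2] := lagrange_identity ler01 ay ap ay ap.
rewrite -cintegralB // (@eq_cintegral _ _ _ (fun x => (l^*%C - l) * (y x * (y x)^*%C))); last first.
  by move=> x _; rewrite conjcM /hill_coef conjcB qJ; ring.
rewrite cintegralZ //; last by apply/ccont_cintegrable/ccontM => //; exact: ccontJ.
rewrite (_ : cintegral _ _ = (sqnorm y)%:C); last exact: inner_self.
rewrite y1 p1 !conjcM.
have -> : expi t * p 0 * ((expi t)^*%C * (y 0)^*%C) - expi t * y 0 * ((expi t)^*%C * (p 0)^*%C) -
   (p 0 * (y 0)^*%C - y 0 * (p 0)^*%C) =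
   (expi (- t) * expi t - 1) * (p 0 * (y 0)^*%C - y 0 * (p 0)^*%C) by rewrite expiN; ring.
rewrite expiNK subrr mul0r => /eqP; rewrite mulf_eq0 subr_eq0 => /orP[/eqP //|].
by rewrite -cmod_eq0 cmod_real normr_eq0 gt_eqF.
Qed.

(** [qform] vanishes identically when M is scalar; so at a simple eigenvalue M is not scalar and the
    eigenspace is a line. *)
Lemma scalar_offdiag_Fdot a b l : let Q := hill_coef a b l in
  fph Q 1 = 0 -> fth' Q 1 = 0 -> fph' Q 1 = fth Q 1 -> Fdot a b l = 0.
Proof.
move=> Q e1 e2 e3; rewrite /Fdot -/Q.
rewrite (_ : qform Q = fun=> 0); last by apply/funext => x; rewrite /qform /kern e1 e2 e3; ring.
by rewrite /ci cintegral0 oppr0.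
Qed.

Lemma spectral_of_conj a b lam : (forall x, (potential a b x)^*%C = potential a b x) ->
  eigenvalue_numbering a b lam -> spectral_operator a b lam.
Proof.
(* |d| = 1 will be shown; the inequality is strict, so the constant has to exceed 1. *)
move=> qJ _; exists 2 => // n t tI nex Psi Psis [GPsi nPsi] [GPsis nPsis].
have m1 : multiplicity a b t (lam n t) 1 by apply: contrapT => h; apply: nex.
move: m1 GPsi GPsis; set l := lam n t => /multiplicity1P[_ Fd] GPsi GPsis.
have mI := measurable_itv (`[0, 1] : interval R).
pose Q := hill_coef a b l; have aQ : admissible Q := hill_coef_admissible _ _ _.
have cq := potential_ccont a b.
have [LP _ [u [p [eu au ap [bu bp]]]]] := (generated_canonical _ _ _ mI cq).1 GPsi.
have {}ap : abs_cont `[0, 1] p (fun x => Q x * Psi x).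
  by apply: abs_cont_ext ap _ => x; rewrite /Q /hill_coef; ring.
have rep := abs_cont_ode_rep aQ au ap _.
have {}rep := rep (ae_mono (fun x e Dx => congr1 (fun s => Q x * s) (e Dx)) eu).
pose U x := u 0 * fth Q x + p 0 * fph Q x; pose U' x := u 0 * fth' Q x + p 0 * fph' Q x.
have oU : ode Q U U' := ode_lincomb (u 0) (p 0) (ode_fth aQ) (ode_fph aQ).
have [cU _] := ode_ccont oU; have mU := ccont_meas mI cU.
have ePU : aeeq `[0, 1] Psi U.
  by apply: ae_mono eu => x e Dx; rewrite e //; have [] := mem_itvcc Dx; move=> x0 x1; have [] := rep x x0 x1.
have U0 : U 0 = u 0 by rewrite /U fth0 // fph0 //; ring.
have U'0 : U' 0 = p 0 by rewrite /U' fth'0 // fph'0 //; ring.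
have U1 : U 1 = expi t * U 0 by rewrite U0 -bu; have [-> _] := rep 1 ler01 (lexx _).
have U'1 : U' 1 = expi t * U' 0 by rewrite U'0 -bp; have [_ ->] := rep 1 ler01 (lexx _).
have [mPsi _] := (L2P Psi mI).1 LP.
have UU : inner `[0, 1] U U = 1 by rewrite -nPsi; apply: inner_ae => //; exact: aeeq_sym.
have NU : sqnorm U = 1 by have := UU; rewrite inner_self // => /(congr1 (@complex.Re R)).
have lJ : l^*%C = l by apply: (real_eigenvalue qJ oU U1 U'1); rewrite NU.
have [v [r [ev av ar bv br]]] := adjoint_Hill_t GPsis.
have [LPs _ _] := GPsis; have [mPsis _] := (L2P Psis mI).1 LPs.
have {}ar : abs_cont `[0, 1] r (fun x => Q x * Psis x).
  by apply: abs_cont_ext ar _ => x; rewrite /Q /hill_coef qJ lJ; ring.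
have reps := abs_cont_ode_rep aQ av ar _.
have {}reps := reps (ae_mono (fun x e Dx => congr1 (fun s => Q x * s) (e Dx)) ev).
have [v1 r1] := reps 1 ler01 (lexx _); have [u1 p1] := rep 1 ler01 (lexx _).
have nz : (u 0 != 0) || (p 0 != 0).
  rewrite -negb_and; apply/negP => /andP[/eqP e0 /eqP e0'].
  have : inner `[0, 1] U U = 0.
    rewrite /inner -[RHS](cintegral0 `[0, 1]); apply: eq_cintegral => x _.
    by rewrite /U e0 e0'; ring.
  by rewrite UU => /eqP; rewrite oner_eq0.
(* Both vectors of Cauchy data are eigenvectors of M for the same multiplier, since l is real. If
   they were independent M would be scalar and F' would vanish. *)
have det0 : u 0 * r 0 - p 0 * v 0 = 0.
  have [|||| w1 w2 w3] := @eigenvector_products R (fth Q 1) (fph Q 1) (fth' Q 1) (fph' Q 1)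
      (expi t) (expi t) (u 0) (p 0) (v 0) (r 0).
  - by rewrite -bu u1; ring.
  - by rewrite -bp p1; ring.
  - by rewrite -bv v1; ring.
  - by rewrite -br r1; ring.
  rewrite subrr !mul0r in w1 w2 w3; apply/eqP/negPn/negP => D0; apply: Fd.
  have canc (s : R[i]) : (u 0 * r 0 - p 0 * v 0) * s = 0 -> s = 0.
    by move/eqP; rewrite mulf_eq0 (negbTE D0) => /eqP.
  apply: scalar_offdiag_Fdot; rewrite -/Q; [exact: canc|by apply: oppr_inj; rewrite oppr0; exact: canc|].
  by apply/eqP; rewrite -subr_eq0; apply/eqP; exact: canc.
have [ka [kv kr]] : exists ka, v 0 = ka * u 0 /\ r 0 = ka * p 0.
  have [u0|u0] := eqVneq (u 0) 0.
    rewrite u0 eqxx /= in nz; exists (r 0 / p 0); rewrite divfK // u0 mulr0; split => //.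
    by move/eqP: det0; rewrite u0 mul0r sub0r oppr_eq0 mulf_eq0 (negbTE nz) => /eqP.
  exists (v 0 / u 0); rewrite divfK //; split => //.
  apply: (mulfI u0); move/eqP: det0; rewrite subr_eq0 => /eqP ->.
  by field.
have ePs : aeeq `[0, 1] Psis (fun x => ka * U x).
  apply: ae_mono ev => x e Dx; rewrite e //; have [x0 x1] := mem_itvcc Dx.
  by have [-> _] := reps x x0 x1; rewrite kv kr /U; ring.
have mkU := cmeasZ ka mU; have ckU := ccontZ ka cU.
have iUU : cintegrable `[0, 1] (fun x => U x * (U x)^*%C).
  by apply/ccont_cintegrable/ccontM => //; exact: ccontJ.
have d1 : inner `[0, 1] Psi Psis = ka^*%C.
  rewrite (inner_ae mI mPsi mU mPsis mkU ePU ePs) /inner.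
  rewrite (@eq_cintegral _ _ _ (fun x => ka^*%C * (U x * (U x)^*%C))).
    by rewrite cintegralZ // [cintegral _ _]UU mulr1.
  by move=> x _; rewrite conjcM; ring.
have kk : cmod ka = 1.
  have := nPsis; rewrite (inner_ae mI mPsis mkU mPsis mkU ePs ePs) /inner.
  rewrite (@eq_cintegral _ _ _ (fun x => (ka * ka^*%C) * (U x * (U x)^*%C))).
    rewrite cintegralZ // [cintegral _ _]UU mulr1 mulcJ => /(congr1 (@complex.Re R)) /= /eqP.
    rewrite sqrf_eq1 => /orP[/eqP //|/eqP e]; have := cmod_ge0 ka; rewrite e; lra.
  by move=> x _; rewrite conjcM; ring.
move=> d; rewrite /d d1 cmodJ kk invr1; split; last by rewrite ltr1n.
by move=> e; move/eqP: kk; rewrite -cmodJ e cmod0 eq_sym oner_eq0.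
Qed.

End SelfAdjointFibres.

(** * The operator on the line *)

Section WholeLine.
Variable R : realType.
Local Notation leb := (@lebesgue_measure R).
Implicit Types (u p g k f h y z v r q w : R -> R[i]) (D : set R) (c d x m e : R) (a b : R[i]).

(** Dominated convergence along sets that leave every point eventually; used for unit intervals
    moving to infinity and for complements of growing intervals. *)
Lemma vanishing_integral (f : R -> R) (A : nat -> set R) :
  leb.-integrable setT (EFin \o f) -> (forall n, measurable (A n : set (measurableTypeR R))) ->
  (forall x, exists N, forall n, (N <= n)%N -> ~ A n x) ->
  forall e, 0 < e -> exists N, forall n, (N <= n)%N -> `|\int[leb]_(x in A n) f x| <= e.
Proof.
move=> fi mA out e e0.
have mf := measurable_int _ fi.
have cv : (\int[leb]_(x in setT) ((EFin \o f) \_ (A n)) x)%E @[n --> \oo] -->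
    (\int[leb]_(x in setT) (cst 0%E : R -> \bar R) x)%E.
  apply: (@dominated_cvg _ _ _ leb setT measurableT _ _ (fun x => `|(f x)%:E|%E)).
  - move=> n; apply/(measurable_restrictT _ (mA n)).
    exact: measurable_funS mf.
  - move=> x _; have [N HN] := out x; apply: cvg_near_cst; exists N => // n /= Nn.
    by rewrite patchE memNset //; exact: HN.
  - by move=> x _.
  - exact: integrable_abse.
  - by move=> n x _; rewrite patchE; case: ifP => _ //=; rewrite normr0 lee_fin.
rewrite integral0 in cv.
have fin n : (\int[leb]_(x in setT) ((EFin \o f) \_ (A n)) x)%E = (\int[leb]_(x in A n) f x)%:E.
  rewrite -integral_mkcond /Rintegral fineK //; apply: integrable_fin_num => //.
  exact: integrableS fi.
have {}cv : (fun n => \int[leb]_(x in A n) f x) @ \oo --> (0 : R).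
  rewrite (funext fin) in cv; exact: (fine_cvg cv).
have /cvgrPdist_le /(_ e e0)[N _ H] := cv.
by exists N => n Nn; have := H n Nn; rewrite sub0r normrN.
Unshelve. all: by end_near. Qed.

(** Pointwise |Re y| + |Im y| <= 2|y| <= e + |y|^2 / e, integrated over an interval of length
    one. *)
Lemma cmass_L2_le y c e : 0 < e -> L2 `[c, c + 1] y ->
  cmass y c (c + 1) <= e + e^-1 * \int[leb]_(x in `[c, c + 1]) sqmod y x.
Proof.
move=> e0 /[dup] /L2_cintegrable yi /L2P[//|_ si].
have i1 : leb.-integrable `[c, c + 1] (EFin \o fun=> 1 : R) by apply: integrable_continuous; exact: cst_continuous.
have [ui ue] := integrable_lincomb e e^-1 (measurable_itv _) i1 si.
have e1 : \int[leb]_(x in `[c, c + 1]) (1 : R) = 1.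
  rewrite Rintegral_cst //= lebesgue_measure_itv /= lte_fin ltrDl ltr01 /= mul1r; ring.
rewrite [in RHS]e1 [in RHS]mulr1 in ue; rewrite -ue.
apply: le_Rintegral => //; first exact: csum_integrable.
move=> x _; rewrite mulr1.
have h1 := ler_Re_cmod (y x); have h2 := ler_Im_cmod (y x).
have h3 : 2 * cmod (y x) <= e + e^-1 * sqmod y x.
  have : 0 <= e^-1 * (e - cmod (y x)) ^+ 2 by rewrite mulr_ge0 ?sqr_ge0 // invr_ge0 ltW.
  rewrite (_ : e^-1 * _ = e + e^-1 * sqmod y x - 2 * cmod (y x)); first by rewrite subr_ge0.
  by rewrite /sqmod; field; rewrite gt_eqF.
by rewrite /csum; lra.
Qed.

Lemma L2_cmass_tail y e : L2 setT y -> 0 < e -> exists N, forall n, (N <= n)%N ->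
  cmass y n%:R (n%:R + 1) <= e /\ cmass y (- n%:R) (- n%:R + 1) <= e.
Proof.
move=> Ly e0; have [_ si] := (L2P y measurableT).1 Ly.
have e2 : 0 < e / 2 by rewrite divr_gt0.
have key (c : nat -> R) : (forall x, exists N, forall n, (N <= n)%N -> ~ `[c n, c n + 1]%classic x) ->
    exists N, forall n, (N <= n)%N -> cmass y (c n) (c n + 1) <= e.
  move=> out; have [||N HN] := @vanishing_integral (sqmod y) (fun n => `[c n, c n + 1]%classic) si _ out ((e / 2) ^+ 2).
  - by move=> n.
  - by rewrite exprn_gt0.
  exists N => n Nn; apply: le_trans (cmass_L2_le e2 (L2_sub measurableT (@subsetT _ _) Ly)) _.
  have := le_trans (ler_norm _) (HN n Nn) => h.
  have : (e / 2)^-1 * (e / 2) ^+ 2 = e / 2 by rewrite expr2 mulKf // gt_eqF.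
  have := ler_wpM2l (ltW (_ : 0 < (e / 2)^-1)) h; rewrite invr_gt0 => /(_ e2); lra.
have arch x : exists N, forall n, (N <= n)%N -> x < n%:R.
  exists (Num.truncn `|x|).+1 => n Nn; apply: le_lt_trans (ler_norm x) _.
  by apply: lt_le_trans (truncnS_gt _) _; rewrite ler_nat.
have [|N1 H1] := key (fun n => n%:R).
  move=> x; have [N HN] := arch x; exists N => n Nn /mem_itvcc[h _].
  by have := HN n Nn; rewrite ltNge h.
have [|N2 H2] := key (fun n => - n%:R).
  move=> x; have [N HN] := arch (- x + 1); exists N => n Nn /mem_itvcc[_ h].
  by have := HN n Nn; lra.
exists (maxn N1 N2) => n; rewrite geq_max => /andP[n1 n2]; split; [exact: H1|exact: H2].
Qed.

Lemma cmass_ae c d f g : cmeas `[c, d] f -> cmeas `[c, d] g -> aeeq `[c, d] f g -> cmass f c d = cmass g c d.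
Proof.
move=> mf mg e; rewrite /cmass /Rintegral; congr fine; apply: ae_eq_integral => //.
- apply/measurable_EFinP; case: mf => mf1 mf2.
  by apply: measurable_funD; apply: measurableT_comp.
- apply/measurable_EFinP; case: mg => mg1 mg2.
  by apply: measurable_funD; apply: measurableT_comp.
- by apply: ae_mono e => x h Dx; rewrite /= /csum h.
Qed.

(** [cauchy_data_le] bounds u and its derivative at a point by the masses of y and of the second
    derivative over an adjacent unit interval, and both masses tend to zero at infinity. *)
Lemma cauchy_data_tail y u p k e : aeeq setT y u -> abs_cont setT u p -> abs_cont setT p k ->
  L2 setT y -> L2 setT k -> 0 < e -> exists N, forall n, (N <= n)%N ->
  [/\ cmod (u n%:R) <= e, cmod (p n%:R) <= e, cmod (u (- n%:R)) <= e & cmod (p (- n%:R)) <= e].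
Proof.
move=> yu au ap Ly Lk e0; have e12 : 0 < e / 12 by rewrite divr_gt0.
have [N1 H1] := L2_cmass_tail Ly e12; have [N2 H2] := L2_cmass_tail Lk e12.
exists (maxn N1 N2) => n; rewrite geq_max => /andP[n1 n2].
have key c : cmass y c (c + 1) <= e / 12 -> cmass k c (c + 1) <= e / 12 ->
    cmod (u c) <= e /\ cmod (p c) <= e.
  have cc : c <= c + 1 by rewrite lerDl.
  have au' := abs_cont_sub (@subsetT _ `[c, c + 1]) au.
  have ap' := abs_cont_sub (@subsetT _ `[c, c + 1]) ap.
  rewrite (_ : cmass y c (c + 1) = cmass u c (c + 1)).
    move=> h1 h2; have [q1 q2] := cauchy_data_le au' ap'; split; lra.
  apply: cmass_ae; last exact: aeeq_sub yu.
  - by have /(L2P y measurableT)[my _] := Ly; exact: cmeas_sub my.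
  - exact: abs_cont_meas au'.
have [h1 h1'] := H1 n n1; have [h2 h2'] := H2 n n2.
by have [? ?] := key _ h1 h2; have [? ?] := key _ h1' h2'.
Qed.

Lemma cintegral_tail f e : cintegrable setT f -> 0 < e -> exists N, forall n, (N <= n)%N ->
  cmod (cintegral setT f - cintegral `[- n%:R, n%:R] f) <= e.
Proof.
move=> [f1 f2] e0; have e2 : 0 < e / 2 by rewrite divr_gt0.
pose A (n : nat) : set R := ~` `[- n%:R, n%:R].
have mA n : measurable (A n : set (measurableTypeR R)) by exact: measurableC.
have out x : exists N, forall n, (N <= n)%N -> ~ A n x.
  exists (Num.truncn `|x|).+1 => n Nn; apply; rewrite /= in_itv /= -ler_norml.
  by apply: ltW; apply: lt_le_trans (truncnS_gt _) _; rewrite ler_nat.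
have split_ (F : R -> R) n : leb.-integrable setT (EFin \o F) ->
    \int[leb]_(x in setT) F x - \int[leb]_(x in `[- n%:R, n%:R]) F x = \int[leb]_(x in A n) F x.
  move=> Fi; rewrite (_ : setT = `[- n%:R, n%:R] `|` A n); last by rewrite setUv.
  rewrite Rintegral_setU ?setUv //; last by apply/disj_setPS; rewrite setICr.
  by rewrite addrC addKr.
have [N1 H1] := vanishing_integral f1 mA out e2; have [N2 H2] := vanishing_integral f2 mA out e2.
exists (maxn N1 N2) => n; rewrite geq_max => /andP[n1 n2].
apply: le_trans (cmod_le_ReIm _) _; rewrite cReB cImB /= !split_ //.
by have := H1 n n1; have := H2 n n2; lra.
Qed.

End WholeLine.

(** * Self-adjointness on the line and cut-off functions *)

Section HillOnTheLine.
Variable R : realType.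
Local Notation leb := (@lebesgue_measure R).
Implicit Types (u p g k f h y z v r q : R -> R[i]) (D : set R) (c d x m e : R) (a b : R[i]).

Lemma affine_ae_eq0 c d (A B : R[i]) : c < d ->
  aeeq `[c, d] (fun x => A + B * (x - (c + d) / 2)%:C) (fun=> 0) -> A = 0 /\ B = 0.
Proof.
move=> cd e0; set m := (c + d) / 2 in e0.
have [e1 e2 e3] := affine_moments cd; rewrite -/m in e2 e3.
have mI := measurable_itv `[c, d]; have ca := ccont_affine m.
have i1 : cintegrable `[c, d] (fun=> 1 : R[i]) by apply: ccont_cintegrable; exact: ccont_cst.
have i2 : cintegrable `[c, d] (fun x => (x - m)%:C) by exact: ccont_cintegrable.
have i3 : cintegrable `[c, d] (fun x => (x - m)%:C * (x - m)%:C).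
  by apply: ccont_cintegrable; exact: ccontM.
have cAB : ccont (fun x => A + B * (x - m)%:C) by apply: ccontD; [exact: ccont_cst|exact: ccontZ].
have L0 : (d - c)%:C != 0 :> R[i].
  by rewrite -cmod_eq0 cmod_real normr_eq0 subr_eq0 gt_eqF.
have L3 : ((d - c) ^+ 3 / 12)%:C != 0 :> R[i].
  rewrite -cmod_eq0 cmod_real normr_eq0 mulf_neq0 ?invr_neq0 ?pnatr_eq0 //.
  by rewrite expf_neq0 // subr_eq0 gt_eqF.
have A0 : A = 0.
  have : cintegral `[c, d] (fun x => A + B * (x - m)%:C) = 0.
    rewrite -(cintegral0 `[c, d]); apply: ae_eq_cintegral => //; first exact: ccont_meas.
    exact: cmeas_cst.
  rewrite (@eq_cintegral _ _ _ (fun x => A * 1 + B * (x - m)%:C)); last by move=> x _; rewrite mulr1.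
  rewrite cintegralD //; [|exact: cintegrableZ..]; rewrite !cintegralZ // e1 e2 mulr0 addr0.
  by move/eqP; rewrite mulf_eq0 (negbTE L0) orbF => /eqP.
split => //.
have : cintegral `[c, d] (fun x => (A + B * (x - m)%:C) * (x - m)%:C) = 0.
  rewrite -(cintegral0 `[c, d]); apply: ae_eq_cintegral => //.
  - by apply: ccont_meas => //; exact: ccontM.
  - exact: cmeas_cst.
  - by apply: ae_mono e0 => x e' Dx; rewrite e' // mul0r.
rewrite (@eq_cintegral _ _ _ (fun x => B * ((x - m)%:C * (x - m)%:C))); last first.
  by move=> x _; rewrite A0; ring.
by rewrite cintegralZ // e3 => /eqP; rewrite mulf_eq0 (negbTE L3) orbF => /eqP.
Qed.

(** On [-n, n] the Lagrange identity leaves boundary terms, which tend to zero together with the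
    tails of the integrals. *)
Lemma Hill_symmetric a b y f z h : (forall x, (potential a b x)^*%C = potential a b x) ->
  Hill a b y f -> Hill a b z h -> inner setT f z = inner setT y h.
Proof.
move=> qJ; set q := potential a b; have cq : ccont q := potential_ccont a b.
have mT : measurable (setT : set (measurableTypeR R)) by [].
move=> /(generated_canonical _ _ _ mT cq)[Ly Lf [u [p [yu au ap _]]]].
move=> /(generated_canonical _ _ _ mT cq)[Lz Lh [v [r [zv av ar _]]]].
have Lq w : L2 setT w -> L2 setT (fun x => q x * w x).
  move=> Lw; apply: (L2M_bounded mT (ccont_meas mT cq) _ Lw) => x _.
  exact: cmod_potential_le.
have Lk := L2B mT (Lq _ Ly) Lf; have Ll := L2B mT (Lq _ Lz) Lh.
set k := fun x => q x * y x - f x in ap Lk; set l := fun x => q x * z x - h x in ar Ll.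
have jfz := L2_mulJ mT Lf Lz; have jyh := L2_mulJ mT Ly Lh.
apply/eqP; rewrite -subr_eq0 -cmod_eq0 eq_le cmod_ge0 andbT.
apply/ler_addgt0Pr => e e0; rewrite add0r.
(* Five errors are added: the tail and four boundary products. The bound by 1 makes a product of two
   small factors at most [e']. *)
pose e' := Num.min 1 (e / 5).
have e'0 : 0 < e' by rewrite lt_min ltr01 divr_gt0.
have [e'1 e'e] : e' <= 1 /\ e' <= e / 5 by rewrite !ge_min !lexx orbT.
have [N1 H1] := cauchy_data_tail yu au ap Ly Lk e'0.
have [N2 H2] := cauchy_data_tail zv av ar Lz Ll e'0.
have FI : cintegrable setT (fun x => f x * (z x)^*%C - y x * (h x)^*%C) by exact: cintegrableB.
have [N3 H3] := cintegral_tail FI e'0.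
pose n := maxn N1 (maxn N2 N3).
have [b1 b2 b3 b4] := H1 n (leq_maxl _ _).
have [c1 c2 c3 c4] := H2 n (leq_trans (leq_maxl _ _) (leq_maxr _ _)).
have tail := H3 n (leq_trans (leq_maxr _ _) (leq_maxr _ _)).
rewrite /inner -cintegralB //.
have nn : - n%:R <= n%:R :> R by rewrite (@le_trans _ _ 0) // oppr_le0.
set I := `[- n%:R, n%:R] in tail *; have sI : [set` I] `<=` setT by exact: subsetT.
have [i1 i2 eL] := lagrange_identity nn (abs_cont_sub sI au) (abs_cont_sub sI ap)
  (abs_cont_sub sI av) (abs_cont_sub sI ar).
have sub_int F : cintegrable setT F -> cintegrable [set` I] F by exact: cintegrable_sub.
have Fb : cintegral [set` I] (fun x => f x * (z x)^*%C - y x * (h x)^*%C) =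
    - (cintegral [set` I] (fun x => k x * (v x)^*%C) - cintegral [set` I] (fun x => u x * (l x)^*%C)).
  rewrite -cintegralB // -cintegralN; [|by []|exact: cintegrableB].
  apply: ae_eq_cintegral => //; try apply: cintegrable_meas; first exact: sub_int.
  - by apply: cintegrableN => //; exact: cintegrableB.
  - apply: ae_mono2 (aeeq_sub sI yu) (aeeq_sub sI zv) => x ey ez Dx.
    by rewrite -(ey Dx) -(ez Dx) /k /l conjcB conjcM qJ -/q; ring.
have small (s s' : R[i]) : cmod s <= e' -> cmod s' <= e' -> cmod (s * s'^*%C) <= e'.
  move=> h1 h2; rewrite cmodM cmodJ -[leRHS]mulr1; apply: ler_pM => //.
  exact: le_trans e'1.
rewrite -[X in cmod X](subrK (cintegral [set` I] (fun x => f x * (z x)^*%C - y x * (h x)^*%C))).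
apply: le_trans (cmodD _ _) _; rewrite [in X in _ + X]Fb eL cmodN.
have q1 := cmodB (p n%:R * (v n%:R)^*%C - u n%:R * (r n%:R)^*%C) (p (- n%:R) * (v (- n%:R))^*%C - u (- n%:R) * (r (- n%:R))^*%C).
have q2 := cmodB (p n%:R * (v n%:R)^*%C) (u n%:R * (r n%:R)^*%C).
have q3 := cmodB (p (- n%:R) * (v (- n%:R))^*%C) (u (- n%:R) * (r (- n%:R))^*%C).
have := small _ _ b2 c1; have := small _ _ b1 c2; have := small _ _ b4 c3; have := small _ _ b3 c4.
lra.
Qed.

(** Local regularity on each symmetric interval gives z = Z plus an affine function; the intervals
    have midpoint 0, so the affine parts can be compared on [-1, 1] and agree, which yields one
    representative on the line. *)
Lemma Hill_adjoint_regular a b z h : (forall x, (potential a b x)^*%C = potential a b x) ->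
  adjoint setT (Hill a b) z h -> Hill a b z h.
Proof.
move=> qJ H; have [Lz Lh _] := H.
set q := potential a b in qJ *; have cq : ccont q := potential_ccont a b.
have mT : measurable (setT : set (measurableTypeR R)) by [].
pose k x := q x * z x - h x.
have ki c d : cintegrable `[c, d] k.
  apply: L2_cintegrable; have s := @subsetT _ (`[c, d]%classic : set R).
  by apply: L2B => //; [apply: L2_ccontM => //|]; exact: L2_sub Lz || exact: L2_sub Lh.
have [P aP] : exists P, abs_cont setT P k by apply: local_primitive.
have [Z aZ] : exists Z, abs_cont setT Z P.
  by apply: local_primitive => s t st; apply: abs_cont_cintegrable st (abs_cont_sub _ aP).
have reg n : exists AB : R[i] * R[i],
    aeeq `[- n.+1%:R, n.+1%:R] z (fun x => Z x + (AB.1 + AB.2 * x%:C)).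
  have lt_n : - n.+1%:R < n.+1%:R :> R by rewrite (@lt_trans _ _ 0) // oppr_lt0.
  have s := @subsetT _ (`[- n.+1%:R, n.+1%:R]%classic : set R).
  have aP' : abs_cont `[- n.+1%:R, n.+1%:R] P (fun x => (q x)^*%C * z x - h x).
    by apply: abs_cont_ext (abs_cont_sub s aP) _ => x; rewrite qJ.
  have [//|A [B e]] := adjoint_regular mT lt_n s cq _ H (abs_cont_sub s aZ) aP'.
  exists (A, B); apply: ae_mono e => x e Dx; rewrite e //=.
  by rewrite addNr mul0r subr0.
have [[A B] /= e0] := reg 0%N.
have all n : aeeq `[- n.+1%:R, n.+1%:R] z (fun x => Z x + (A + B * x%:C)).
  have [[A' B'] /= e1] := reg n.
  have s1 : `[-1, 1] `<=` `[- n.+1%:R, n.+1%:R : R].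
    by apply: subset_itvcc; rewrite ?lerN2 ler1n.
  have lt11 : -1 < 1 :> R by rewrite (@lt_trans _ _ 0) ?oppr_lt0.
  have ae0 : aeeq `[-1, 1] (fun x => A - A' + (B - B') * (x - (-1 + 1) / 2)%:C) (fun=> 0).
    apply: ae_mono2 e0 (aeeq_sub s1 e1) => x h1 h2 Dx.
    have := h1 Dx; rewrite (h2 Dx) => /addrI /eqP.
    rewrite addNr mul0r subr0 -subr_eq0 => /eqP h3.
    by rewrite -[RHS]oppr0 -h3; ring.
  have [/eqP dA /eqP dB] := affine_ae_eq0 lt11 ae0.
  rewrite !subr_eq0 in dA dB; rewrite (eqP dA) (eqP dB); exact: e1.
apply/(generated_canonical _ _ _ mT cq); split => //.
exists (fun x => Z x + (A + B * (x - 0)%:C)), (fun x => P x + B); split => //.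
- apply: ae_mono (ae_foralln all) => x hx _; rewrite subr0.
  apply: (hx (Num.truncn `|x|)); rewrite /= in_itv /= -ler_norml.
  by apply: ltW; exact: truncnS_gt.
- exact: abs_contD aZ (abs_cont_affine A B 0).
- exact: abs_cont_ext (abs_contD aP (abs_cont_cst B)) (fun x => addr0 _).
Qed.

Lemma Hill_self_adjoint a b : (forall x, (potential a b x)^*%C = potential a b x) ->
  self_adjoint setT (Hill a b).
Proof.
move=> qJ y f; split; last exact: Hill_adjoint_regular.
move=> Gy; have [Ly Lf _] := Gy; split => // z h Gz.
exact: Hill_symmetric.
Qed.

(* The cube makes products of such cut-offs twice continuously differentiable. *)
Definition cube_pos x := Num.max x 0 ^+ 3.

Lemma cube_pos_deriv x : is_derive x 1 cube_pos (3 * Num.max x 0 ^+ 2).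
Proof.
apply: (@is_derive_quadratic _ _ _ _ (3 * `|x| + 4) 1) => // e e1.
rewrite /cube_pos; set s := Num.max x 0; set t := Num.max (x + e) 0.
have e1' : `|e| ^+ 2 = e ^+ 2 by rewrite real_normK ?num_real.
have e2 : `|e| ^+ 3 <= e ^+ 2 by rewrite exprS e1' ler_piMl ?sqr_ge0.
have [x0|x0] := leP x 0; have [y0|y0] := leP (x + e) 0.
- rewrite /s /t !max_r // !expr0n /= !mulr0 !subr0 normr0.
  by rewrite mulr_ge0 ?sqr_ge0 // addr_ge0 // mulr_ge0.
- rewrite /s (max_r x0) /t (max_l (ltW y0)) !expr0n /= !mulr0 !subr0.
  rewrite ger0_norm ?exprn_ge0 ?(ltW y0) //.
  apply: (@le_trans _ _ (`|e| ^+ 3)).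
    rewrite ler_pXn2r ?nnegrE ?(ltW y0) // (le_trans _ (ler_norm e)) //; lra.
  apply: le_trans e2 _; rewrite -[leLHS]mul1r ler_wpM2r ?sqr_ge0 //.
  have := normr_ge0 x; lra.
- rewrite /s (max_l (ltW x0)) /t (max_r y0) expr0n /= sub0r.
  rewrite (gtr0_norm x0) (_ : - _ - _ = - (x ^+ 3 + 3 * (e * x ^+ 2))); last by ring.
  have xe : x <= - e by lra.
  have h1 : x ^+ 2 <= e ^+ 2 by rewrite -[e ^+ 2]sqrrN ler_pXn2r // ?nnegrE; lra.
  have e3 : `|e| <= 1 by [].
  rewrite normrN; apply: le_trans (ler_normD _ _) _.
  have -> : `|x ^+ 3| = x * x ^+ 2 by rewrite ger0_norm ?exprn_ge0 ?(ltW x0) // exprS.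
  have -> : `|3 * (e * x ^+ 2)| = 3 * (`|e| * x ^+ 2).
    by rewrite (normrM 3) (normrM e) (ger0_norm (sqr_ge0 x)) (ger0_norm (ler0n _ 3)).
  have h2 : x * x ^+ 2 <= x * e ^+ 2 by rewrite ler_wpM2l // (ltW x0).
  have h3 : `|e| * x ^+ 2 <= 1 * e ^+ 2 by apply: ler_pM => //; exact: sqr_ge0.
  have h4 : 0 <= x * e ^+ 2 by rewrite mulr_ge0 ?sqr_ge0 // (ltW x0).
  have := sqr_ge0 e; lra.
- rewrite /s /t (max_l (ltW x0)) (max_l (ltW y0)) (gtr0_norm x0).
  rewrite (_ : _ - _ = (3 * x + e) * e ^+ 2); last by ring.
  rewrite normrM (ger0_norm (sqr_ge0 e)) ler_wpM2r ?sqr_ge0 //.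
  by apply: le_trans (ler_normD _ _) _; rewrite ger0_norm; lra.
Qed.

Lemma sqr_pos_deriv x : is_derive x 1 (fun x => Num.max x 0 ^+ 2) (2 * Num.max x 0).
Proof.
apply: (@is_derive_quadratic _ _ _ _ 1 1) => // e e1 /=; rewrite mul1r.
set s := Num.max x 0; set t := Num.max (x + e) 0.
have [x0|x0] := leP x 0; have [y0|y0] := leP (x + e) 0.
- by rewrite /s /t !max_r // !expr0n /= !mulr0 !subr0 normr0 sqr_ge0.
- rewrite /s /t (max_r x0) (max_l (ltW y0)) !expr0n /= !mulr0 !subr0 ger0_norm ?sqr_ge0 //.
  by rewrite ler_pXn2r // ?nnegrE; lra.
- rewrite /s /t (max_l (ltW x0)) (max_r y0) expr0n /= sub0r ler_norml.
  by apply/andP; split; nra.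
- rewrite /s /t (max_l (ltW x0)) (max_l (ltW y0)) (_ : _ - _ = e ^+ 2); last by ring.
  by rewrite ger0_norm ?sqr_ge0.
Qed.

(** The product of the cubes of the positive parts of x - c and d - x. At distance at least e from
    both ends each cube is at least e^3. *)
Lemma bump_exists c d : exists w w' w'' : R -> R,
  [/\ cder (fun x => (w x)%:C) (fun x => (w' x)%:C), cder (fun x => (w' x)%:C) (fun x => (w'' x)%:C),
      ccont (fun x => (w'' x)%:C),
      forall x, x <= c \/ d <= x -> w x = 0 /\ w'' x = 0 &
      forall x e, 0 <= e -> c + e <= x -> x <= d - e -> e ^+ 6 <= w x].
Proof.
pose l x := 1 * x + - c; pose r x := -1 * x + d.
pose s x := Num.max x 0.
have c3l x : is_derive x 1 (fun x => cube_pos (l x)) (3 * s (l x) ^+ 2).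
  by apply: (is_derive_eq (is_derive_affine_comp (cube_pos_deriv (l x)))); rewrite mul1r.
have c3r x : is_derive x 1 (fun x => cube_pos (r x)) (- (3 * s (r x) ^+ 2)).
  by apply: (is_derive_eq (is_derive_affine_comp (cube_pos_deriv (r x)))); rewrite mulN1r.
have c2l x : is_derive x 1 (fun x => s (l x) ^+ 2) (2 * s (l x)).
  by apply: (is_derive_eq (is_derive_affine_comp (sqr_pos_deriv (l x)))); rewrite mul1r.
have c2r x : is_derive x 1 (fun x => s (r x) ^+ 2) (- (2 * s (r x))).
  by apply: (is_derive_eq (is_derive_affine_comp (sqr_pos_deriv (r x)))); rewrite mulN1r.
pose w x := cube_pos (l x) * cube_pos (r x).
pose w' x := 3 * (s (l x) ^+ 2 * cube_pos (r x) - cube_pos (l x) * s (r x) ^+ 2).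
pose w'' x := 3 * (2 * s (l x) * cube_pos (r x) - 6 * (s (l x) ^+ 2 * s (r x) ^+ 2) +
  2 * cube_pos (l x) * s (r x)).
have sc : continuous s by move=> x; apply: continuous_max; [exact: cvg_id|exact: cvg_cst].
have lc : continuous l by move=> x; apply: cvgD; [apply: cvgM; [exact: cvg_cst|exact: cvg_id]|exact: cvg_cst].
have rc : continuous r by move=> x; apply: cvgD; [apply: cvgM; [exact: cvg_cst|exact: cvg_id]|exact: cvg_cst].
have slc : continuous (fun x => s (l x)) by move=> x; apply: (continuous_comp (lc x) (sc _)).
have src : continuous (fun x => s (r x)) by move=> x; apply: (continuous_comp (rc x) (sc _)).
exists w, w', w''; split.
- apply: cder_real => x; apply: (is_derive_eq (is_derive_mulr (c3l x) (c3r x))).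
  by rewrite /w'; ring.
- apply: cder_real => x.
  have d3 : is_derive x 1 (fun=> 3 : R) 0 by exact: is_derive_cst.
  apply: (is_derive_eq (is_derive_mulr d3 (is_derive_subr (is_derive_mulr (c2l x) (c3r x))
    (is_derive_mulr (c3l x) (c2r x))))).
  by rewrite /w''; ring.
- split; last exact: cst_continuous.
  have cM (F G : R -> R) : continuous F -> continuous G -> continuous (fun x => F x * G x).
    by move=> cF cG x; exact: continuousM (cF x) (cG x).
  have cD (F G : R -> R) : continuous F -> continuous G -> continuous (fun x => F x + G x).
    by move=> cF cG x; exact: continuousD (cF x) (cG x).
  have cN (F : R -> R) : continuous F -> continuous (fun x => - F x).
    by move=> cF x; exact: continuousN (cF x).
  have cc (K : R) : continuous (fun _ : R => K) by exact: cst_continuous.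
  have c2l' := cM _ _ slc slc; have c2r' := cM _ _ src src.
  have c3l' := cM _ _ slc c2l'; have c3r' := cM _ _ src c2r'.
  by apply: (cM) => //; apply: (cD); [apply: (cD); [|apply: (cN)]|]; repeat apply: (cM) => //.
- move=> x xcd; have [e|e] : s (l x) = 0 \/ s (r x) = 0.
  + by case: xcd => h; [left|right]; rewrite /s max_r // /l /r; lra.
  + by rewrite /w /w'' /cube_pos -/(s _) e !expr0n /=; split; ring.
  + by rewrite /w /w'' /cube_pos -/(s (r x)) e !expr0n /=; split; ring.
- move=> x e e0 h1 h2; rewrite (_ : e ^+ 6 = e ^+ 3 * e ^+ 3); last by ring.
  have sl : e <= s (l x) by rewrite le_max /l; apply/orP; left; lra.
  have sr : e <= s (r x) by rewrite le_max /r; apply/orP; left; lra.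
  by apply: ler_pM; rewrite ?exprn_ge0 // lerXn2r ?nnegrE // (le_trans e0).
Qed.

End HillOnTheLine.

(** * Reality of the potential from self-adjointness, and the theorem *)

Section Converse.
Variable R : realType.
Local Notation leb := (@lebesgue_measure R).
Implicit Types (a b : R[i]) (c d x : R).

Lemma Rintegral_gt0 (g : R -> R) c d m e : continuous g -> 0 < e -> c + 2 * e < d -> 0 < m ->
  (forall x, c <= x -> x <= d -> 0 <= g x) ->
  (forall x, c + e <= x -> x <= d - e -> m <= g x) ->
  0 < \int[leb]_(x in `[c, d]) g x.
Proof.
move=> cg e0 cd m0 g0 gm.
have [h1 h2 h3] : [/\ c <= c + e, c + e <= d - e & d - e <= d] by split; lra.
have gi s t := integrable_continuous s t cg.
rewrite (Rintegral_split h1 (le_trans h2 h3)) // (Rintegral_split h2 h3) //.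
have i1 := @Rintegral_ge_cst _ g c (c + e) 0 h1 cg (fun x p q => g0 x p (le_trans q (le_trans h2 h3))).
have i3 := @Rintegral_ge_cst _ g (d - e) d 0 h3 cg (fun x p q => g0 x (le_trans h1 (le_trans h2 p)) q).
have i2 := @Rintegral_ge_cst _ g (c + e) (d - e) m h2 cg gm.
have : 0 < m * (d - e - (c + e)) by rewrite mulr_gt0 //; lra.
lra.
Qed.

(** For a real element w of the domain, self-adjointness makes (H w, w) real, and its imaginary part
    is the integral of Im q times w^2. *)
Lemma self_adjoint_orthogonal a b c d (w w' w'' : R -> R) : c <= d ->
  cder (fun x => (w x)%:C) (fun x => (w' x)%:C) -> cder (fun x => (w' x)%:C) (fun x => (w'' x)%:C) ->
  ccont (fun x => (w'' x)%:C) -> (forall x, x <= c \/ d <= x -> w x = 0 /\ w'' x = 0) ->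
  self_adjoint setT (Hill a b) ->
  \int[leb]_(x in `[c, d]) (Im (potential a b x) * w x ^+ 2) = 0.
Proof.
move=> cd dw dw' cw'' out H; set q := potential a b; have cq : ccont q := potential_ccont a b.
pose y x := (w x)%:C : R[i]; pose f x := - (w'' x)%:C + q x * y x.
have cy : ccont y := cder_ccont dw; have cf : ccont f.
  by apply: ccontD; [exact: ccontN|exact: ccontM].
have outI x : ~ `[c, d]%classic x -> x <= c \/ d <= x.
  move=> xn; have [|xc] := leP x c; first by left.
  by right; rewrite leNgt; apply/negP => xd; apply: xn; rewrite /= in_itv /= !ltW.
have y_out x : ~ `[c, d]%classic x -> y x = 0 by move=> /outI /out[e _]; rewrite /y e.
have f_out x : ~ `[c, d]%classic x -> f x = 0.
  by move=> xn; rewrite /f y_out // mulr0 addr0; have /out[_ ->] := outI x xn; rewrite oppr0.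
have sT := @subsetT _ (`[c, d]%classic : set R).
have mT : measurable (setT : set (measurableTypeR R)) by [].
have Gy : Hill a b y f.
  split; [apply: (L2_supported mT sT y_out); exact: L2_ccont|apply: (L2_supported mT sT f_out); exact: L2_ccont|].
  exists y, (fun x => (w' x)%:C), (fun x => (w'' x)%:C); split => //.
  - exact: aeeq_refl.
  - exact: cder_abs_cont dw (cder_ccont dw').
  - exact: cder_abs_cont dw' cw''.
  - exact: aeeq_refl.
have [_ _ /(_ y f Gy)] := (H y f).1 Gy.
rewrite /inner (cintegral_supported sT) => [|x /f_out ->]; last by rewrite mul0r.
rewrite [RHS](cintegral_supported sT) => [|x /y_out ->]; last by rewrite mul0r.
rewrite (@eq_cintegral _ _ (fun x => y x * (f x)^*%C) (fun x => (f x * (y x)^*%C)^*%C)); last first.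
  by move=> x _; rewrite conjcM conjcK mulrC.
rewrite cintegralJ //; last by apply/ccont_cintegrable/ccontM => //; exact: ccontJ.
move=> /(congr1 (@complex.Im R)); rewrite cImJ => e.
have {e} : Im (cintegral `[c, d] (fun x => f x * (y x)^*%C)) = 0 by lra.
rewrite /cintegral /= => <-; apply: eq_Rintegral => x _.
by rewrite /f /y -/q /=; move: (q x) => -[s t] /=; ring.
Qed.

(** Where Im q is nonzero it keeps its sign nearby, and a bump concentrated there makes the
    orthogonality integral nonzero; [s] is that sign. *)
Lemma potential_real_of_self_adjoint a b : self_adjoint setT (Hill a b) ->
  forall x, Im (potential a b x) = 0.
Proof.
move=> H x0; apply/eqP/negPn/negP => nz.
pose g x := Im (potential a b x); have [_ cg] : ccont (potential a b) := potential_ccont a b.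
have [s [sE sg]] : exists s : R, s ^+ 2 = 1 /\ 0 < s * g x0.
  have [g0|g0] := leP (g x0) 0; last by exists 1; rewrite expr1n mul1r.
  by exists (-1); rewrite sqrrN expr1n mulN1r oppr_gt0 lt_neqAle nz.
have csg : continuous (fun x => s * g x).
  by move=> x; apply: continuousM (cg x); exact: cst_continuous.
pose m := s * g x0 / 2; have m0 : 0 < m by rewrite divr_gt0.
have mlt : m < s * g x0 by rewrite ltr_pdivrMr // ltr_pMr // ltr1n.
have [r r0 Hr] := continuous_gt (csg x0) mlt.
pose c := x0 - r / 2; pose d := x0 + r / 2.
have cd : c <= d by rewrite /c /d; lra.
have [w [w' [w'' [dw dw' cw out low]]]] := bump_exists c d.
have := self_adjoint_orthogonal cd dw dw' cw out H.
have cw2 : continuous w by have [] := cder_ccont dw.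
have cG : continuous (fun x => g x * w x ^+ 2).
  by move=> x; apply: continuousM (cg x) _; exact: continuousM (cw2 x) (cw2 x).
have : 0 < \int[leb]_(x in `[c, d]) (s * (g x * w x ^+ 2)).
  pose e := r / 8; have e0 : 0 < e by rewrite divr_gt0.
  have gm x : c <= x -> x <= d -> m <= s * g x.
    by move=> cx xd; apply/ltW/Hr; rewrite ltr_norml; rewrite /c /d in cx xd; lra.
  apply: (@Rintegral_gt0 _ _ _ (m * (e ^+ 6) ^+ 2) e).
  - by move=> x; apply: continuousM (cG x); exact: cst_continuous.
  - by [].
  - rewrite /c /d /e; lra.
  - by rewrite mulr_gt0 // !exprn_gt0.
  - move=> x cx xd; rewrite mulrA mulr_ge0 ?sqr_ge0 //.
    exact: le_trans (ltW m0) (gm _ cx xd).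
  - move=> x cx xd; rewrite mulrA; apply: ler_pM; rewrite ?(ltW m0) ?sqr_ge0 //.
    + by apply: gm; lra.
    + by rewrite lerXn2r ?nnegrE ?exprn_ge0 ?(ltW e0) ?low ?(ltW e0) // (le_trans _ (low x e _ cx xd)) ?exprn_ge0 ?(ltW e0).
rewrite RintegralZl //; last exact: integrable_continuous.
by move=> + e; rewrite e mulr0 ltxx.
Qed.

(** Two points suffice: x = 0 gives Im (a + b) = 0 and x = 1/4 gives Re (b - a) = 0. *)
Lemma potential_realP a b : (forall x, Im (potential a b x) = 0) <-> b = a^*%C.
Proof.
split=> [H|-> x].
- have h0 := H 0; have h1 := H (1 / 4).
  have q0 : potential a b 0 = a + b.
    by rewrite /potential mulr0 oppr0 expi0 !mulr1.
  have ei : expi (pi / 2) = 'i :> R[i] by rewrite /expi cos_pihalf sin_pihalf.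
  have q1 : potential a b (1 / 4) = (b - a) * 'i.
    rewrite /potential (_ : 2 * pi * (1 / 4) = pi / 2); last by move: (@pi R) => p; field.
    by rewrite expiN ei; apply: complex_ext; rewrite !cReImE /=; ring.
  rewrite q0 cImD in h0; rewrite q1 in h1.
  have h2 : Re b - Re a = 0 by rewrite -h1; case: (a) (b) => [? ?] [? ?] /=; ring.
  apply: complex_ext; rewrite ?cReJ ?cImJ; lra.
- have := potential_conj a a^*%C x; rewrite conjcK => /(congr1 (@complex.Im R)); rewrite cImJ; lra.
Qed.

End Converse.

Theorem corollary1 (R : realType) (a b : R[i]) (lam : int -> R -> R[i])
    (hab : a * b \is Num.real) (hlam : eigenvalue_numbering a b lam) :
  spectral_operator a b lam <-> self_adjoint setT (Hill a b).
Proof.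
have qJ : b = a^*%C -> forall x, (potential a b x)^*%C = potential a b x.
  by move=> -> x; rewrite potential_conj conjcK.
split=> [hs|/potential_real_of_self_adjoint/potential_realP ba].
- exact/Hill_self_adjoint/qJ/(spectral_conj hab hlam hs).
- exact: spectral_of_conj (qJ ba) hlam.
Qed.
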